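(* For $x=(x_1,x_2)$ sufficiently close to $(0,0)$ (so close that the pull-back under $\imath_{10}$ of $Q=\{t\in\mathbb C^4\mid t_1t_2t_3t_4-t_3t_4x_1-t_1t_2x_2=0\}$ does not meet any component of the chain $\mathrm{reg}(\square_1\times\triangle_2)$ described in the context), the function $$F_{10}(x)=x_1^{1-b_1}F\left(\begin{matrix}a_1-b_1+1,&a_2-b_1+1,&a_3-b_1+1\\2-b_1,&b_2-b_1+1,&1\\ b_3,&b_4,&1\end{matrix};x\right)$$ is expressed as $F_{10}(x)=C_{10}\int_{\Delta_{10}}u(t,x)\,dt$, where $dt=dt_1\wedge dt_3\wedge dt_2\wedge dt_4$, $$u(t,x)=\Bigl(\prod_{j=1}^4t_j^{-b_j}\Bigr)(1-t_1-t_3)^{b_1+b_3-a_1-2}(1-t_2-t_4)^{b_2+b_4-a_2-2}\Bigl(1-\frac{x_1}{t_1t_2}-\frac{x_2}{t_3t_4}\Bigr)^{-a_3},$$ $$C_{10}=\frac{\Gamma(b_1-a_1)\Gamma(b_1-a_2)\Gamma(b_1-a_3)}{\Gamma(b_1+b_3-a_1-1)\Gamma(b_2+b_4-a_2-1)\Gamma(1-a_3)}\cdot\frac1{\Gamma(b_1-1)\Gamma(b_1-b_2)\Gamma(1-b_3)\Gamma(1-b_4)},$$ and $\Delta_{10}$ is the image of $-\mathrm{reg}(\square_1\times\triangle_2)$ under the map $\imath_{10}:(s_1,s_2,s_3,s_4)\mapsto(t_1,t_2,t_3,t_4)=\bigl(\frac{x_1}{s_1s_2},s_2,s_3,s_4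\bigr)$.
   Context: With $(\alpha,n)=\alpha(\alpha+1)\cdots(\alpha+n-1)$, $$F\left(\begin{matrix}a_1,a_2,a_3\\ b_1,b_2,1\\ b_3,b_4,1\end{matrix};x\right)=\sum_{n_1,n_2\ge0}\frac{\prod_{i=1}^3(a_i,n_1+n_2)}{(b_1,n_1)(b_2,n_1)(1,n_1)(b_3,n_2)(b_4,n_2)(1,n_2)}x_1^{n_1}x_2^{n_2}.$$ The parameters are such that the regularization is defined and $C_{10}$ is finite: $b_1,b_3,b_4,a_3,b_1-b_2,b_1+b_3-a_1,b_2+b_4-a_2\notin\mathbb Z$ and $b_1-a_i\notin\{0,-1,-2,\dots\}$ $(i=1,2,3)$. $\square_1=\{(s_1,s_3)\in\mathbb R^2\mid0<s_1<1,0<s_3<1\}$, $\triangle_2=\{(s_2,s_4)\in\mathbb R^2\mid s_2>0,s_4>0,1-s_2-s_4>0\}$. For an open polygon $P$ of this kind and a weight $w$ (product of powers, with non-integral exponents, of the linear forms defining the edges), the regularization $\mathrm{reg}(P)$ is the compact twisted cycle supported in a small neighborhood of $\overline P$, loaded with branches of $w$, homologous as a locally finite twisted chain to $P$ loaded with the standard branch of $w$ (all linear forms positive on $P$); explicitly $\sigma+\sum_i\frac{S_i\times\sigma_i}{c_i-1}+\sum\frac{S_i\times S_j}{(c_i-1)(c_j-1)}$ (last sum over vertices), $c_i=e^{2\pi\sqrt{-1}p_i}$ for the exponent $p_i$ on the $i$-th edge, $\sigma$ the shrunken polygon, $\sigma_i$ its edges, $S_i$ small positive circles around the edge lines. $\mathrm{reg}(\square_1\times\triangle_2)=\mathrm{reg}(\square_1)\times\mathrm{reg}(\triangle_2)$,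 oriented by $ds=ds_1\wedge ds_3\wedge ds_2\wedge ds_4$, is taken with weights $s_1^{b_1-2}(1-s_1)^{-a_3}s_3^{-b_3}(1-s_3)^{b_1+b_3-a_1-2}$ on $\square_1$ and $s_2^{b_1-b_2-1}s_4^{-b_4}(1-s_2-s_4)^{b_2+b_4-a_2-2}$ on $\triangle_2$. The branch of $u$ on $\Delta_{10}$ is such that $\imath_{10}^*(u\,dt)$ equals $-x_1^{1-b_1}$ times the product of these weights times $\bigl(1-\frac{x_1}{(1-s_3)s_1s_2}\bigr)^{b_1+b_3-a_1-2}\bigl(1-\frac{x_2}{(1-s_1)s_3s_4}\bigr)^{-a_3}ds$, with principal branches of the last two factors ($x$ small) and the same branch of $x_1^{1-b_1}$ as in $F_{10}$. *)

(* Defs.v *)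
From Stdlib Require Import Reals ZArith List.
From Coquelicot Require Import Coquelicot.
Import ListNotations.
Open Scope C_scope.

Definition Cexp (z : C) : C := (exp (Re z) * cos (Im z), exp (Re z) * sin (Im z))%R.

(* Principal logarithm off the cut (-oo,0]: the half-angle formula
   tan (arg z / 2) = Im z / (|z| + Re z) gives arg z in (-PI,PI).
   It is only applied off the cut below. *)
Definition Clog (z : C) : C := (ln (Cmod z), 2 * atan (Im z / (Cmod z + Re z)))%R.

Definition CLim (u : nat -> C) : C :=
  (real (Lim_seq (fun n => Re (u n))), real (Lim_seq (fun n => Im (u n)))).

Definition CSeries (u : nat -> C) : C :=
  (Series (fun n => Re (u n)), Series (fun n => Im (u n))).

Definition CDerive (f : R -> C) (r : R) : C :=
  (Derive (fun h => Re (f h)) r, Derive (fun h => Im (f h)) r).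

Definition Csum (l : list C) : C := fold_right Cplus 0 l.

Definition not_int (z : C) : Prop := forall k : Z, z <> RtoC (IZR k).

Definition not_nonpos_int (z : C) : Prop := forall n : nat, z <> - RtoC (INR n).

Fixpoint poch (z : C) (n : nat) : C :=
  match n with
  | O => 1
  | S m => poch z m * (z + RtoC (INR m))
  end.

(* Gauss' product Gamma(z) = lim n! n^z / (z (z+1) ... (z+n)); meaningful off
   the poles 0,-1,-2,... *)
Definition CGamma (z : C) : C :=
  CLim (fun n => RtoC (INR (fact n)) * Cexp (z * RtoC (ln (INR n))) / poch z (S n)).

(* The series converges absolutely near the origin, so the order of summation
   does not matter there. *)
Definition hypF (a1 a2 a3 b1 b2 b3 b4 x1 x2 : C) : C :=
  CSeries (fun n1 => CSeries (fun n2 =>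
    poch a1 (n1 + n2) * poch a2 (n1 + n2) * poch a3 (n1 + n2)
    / (poch b1 n1 * poch b2 n1 * poch 1 n1 * poch b3 n2 * poch b4 n2 * poch 1 n2)
    * Cpow x1 n1 * Cpow x2 n2)).

(* [lx] is the logarithm of x_1 that selects the branch of x_1^(1-b_1). *)
Definition F10 (a1 a2 a3 b1 b2 b3 b4 lx x1 x2 : C) : C :=
  Cexp ((1 - b1) * lx)
  * hypF (a1 - b1 + 1) (a2 - b1 + 1) (a3 - b1 + 1) (2 - b1) (b2 - b1 + 1) b3 b4 x1 x2.

Definition C10 (a1 a2 a3 b1 b2 b3 b4 : C) : C :=
  CGamma (b1 - a1) * CGamma (b1 - a2) * CGamma (b1 - a3)
  / (CGamma (b1 + b3 - a1 - 1) * CGamma (b2 + b4 - a2 - 1) * CGamma (1 - a3))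
  * (1 / (CGamma (b1 - 1) * CGamma (b1 - b2) * CGamma (1 - b3) * CGamma (1 - b4))).

(* A loaded singular 2-cube [0,1]^2 -> C^2, for a polygon with edges
   l_0, l_1, ... in counterclockwise order, l_0 and l_1 being the coordinates.
   It is given by the values [form i] of all the l_i along the cell; the load is
   given by continuous logarithms [lg i] of the l_i, so that the branch of
   prod l_i^(p_i) on the cell is exp (sum p_i lg_i). *)
Record cell := Cell { form : nat -> R -> R -> C; lg : nat -> R -> R -> C }.

(* The circle l = e exp(2 pi i p), p in [0,1], based at l = e, with the
   logarithm of l continued from the real value ln e. *)
Definition circ (e p : R) : C := RtoC e * Cexp (0, 2 * PI * p)%R.
Definition circlog (e p : R) : C := (ln e, 2 * PI * p)%R.

Definition load_none (f : nat -> R -> R -> C) : cell :=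
  Cell f (fun i p q => Clog (f i p q)).

Definition load_edge (e : R) (f : nat -> R -> R -> C) : cell :=
  Cell f (fun i p q => match i with O => circlog e p | _ => Clog (f i p q) end).

Definition load_vertex (e : R) (f : nat -> R -> R -> C) : cell :=
  Cell f (fun i p q => match i with
                       | O => circlog e p
                       | S O => circlog e q
                       | _ => Clog (f i p q)
                       end).

(* Moves the cyclic numbering by i, so that edge 0 becomes edge i. *)
Definition rot (N i : nat) (K : cell) : cell :=
  Cell (fun j => form K ((j + N - i) mod N)) (fun j => lg K ((j + N - i) mod N)).

(* sigma + sum S_i x sigma_i / (c_i - 1)
         + sum S_i x S_(i+1) / ((c_i - 1)(c_(i+1) - 1)).
   [sigma] is the shrunken polygon, [edge] is S_0 x sigma_0 and [vertex] is
   S_0 x S_1.  All orientations are those of the parameters (p,q), where sigma_i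
   runs in the direction of increasing l_(i+1), that is, opposite to the
   boundary of sigma; this makes the chain a twisted cycle. *)
Definition reg (N : nat) (w : nat -> C) (sigma edge vertex : cell) : list (C * cell) :=
  let c := fun i => Cexp ((0, 2 * PI)%R * w (i mod N)) in
  (RtoC 1, sigma)
  :: map (fun i => (1 / (c i - 1), rot N i edge)) (seq 0 N)
  ++ map (fun i => (1 / ((c i - 1) * (c (S i) - 1)), rot N i vertex)) (seq 0 N).

(* Edges of the square: s1, s3, 1-s1, 1-s3. *)
Definition square_forms (z0 z1 : R -> R -> C) (i : nat) (p q : R) : C :=
  match i with
  | 0%nat => z0 p q
  | 1%nat => z1 p q
  | 2%nat => 1 - z0 p q
  | _ => 1 - z1 p q
  end.

Definition reg_square (e : R) (w : nat -> C) : list (C * cell) :=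
  let side (r : R) := RtoC (e + (1 - 2 * e) * r) in
  reg 4 w
    (load_none (square_forms (fun p q => side p) (fun p q => side q)))
    (load_edge e (square_forms (fun p q => circ e p) (fun p q => side q)))
    (load_vertex e (square_forms (fun p q => circ e p) (fun p q => circ e q))).

(* Edges of the triangle: s2, s4, 1-s2-s4. *)
Definition triangle_forms (z0 z1 : R -> R -> C) (i : nat) (p q : R) : C :=
  match i with
  | 0%nat => z0 p q
  | 1%nat => z1 p q
  | _ => 1 - z0 p q - z1 p q
  end.

(* The edge cell is fibered so that, over its two ends, l_1 = e and l_2 = e
   respectively: there it is glued to the tori S_0 x S_1 and S_2 x S_0. *)
Definition reg_triangle (e : R) (w : nat -> C) : list (C * cell) :=
  reg 3 w
    (load_none (triangle_forms
       (fun p q => RtoC (e + (1 - 3 * e) * p))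
       (fun p q => RtoC (e + (1 - 3 * e) * (1 - p) * q))))
    (load_edge e (triangle_forms
       (fun p q => circ e p)
       (fun p q => RtoC e + RtoC q * (1 - 2 * RtoC e - circ e p))))
    (load_vertex e (triangle_forms (fun p q => circ e p) (fun p q => circ e q))).

Definition square_weight (a1 a3 b1 b3 : C) (i : nat) : C :=
  match i with
  | 0%nat => b1 - 2
  | 1%nat => - b3
  | 2%nat => - a3
  | _ => b1 + b3 - a1 - 2
  end.

Definition triangle_weight (a2 b1 b2 b4 : C) (i : nat) : C :=
  match i with
  | 0%nat => b1 - b2 - 1
  | 1%nat => - b4
  | _ => b2 + b4 - a2 - 2
  end.

(* Product cells carry the parameters p, q of the square factor, with
   coordinates (s1,s3), followed by r, s of the triangle factor, with
   coordinates (s2,s4): this is the orientation ds1 ds3 ds2 ds4. *)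
Definition chain_prod (A B : list (C * cell)) : list (C * (cell * cell)) :=
  flat_map (fun X => map (fun Y => (fst X * fst Y, (snd X, snd Y))) B) A.

Definition reg_prod (e : R) (a1 a2 a3 b1 b2 b3 b4 : C) : list (C * (cell * cell)) :=
  chain_prod (reg_square e (square_weight a1 a3 b1 b3))
             (reg_triangle e (triangle_weight a2 b1 b2 b4)).

Definition chain_opp {T : Type} (A : list (C * T)) : list (C * T) :=
  map (fun X => (- fst X, snd X)) A.

Definition fun4 := R -> R -> R -> R -> C.

Definition s1 (K : cell * cell) : fun4 := fun p q r s => form (fst K) 0 p q.
Definition s3 (K : cell * cell) : fun4 := fun p q r s => form (fst K) 1 p q.
Definition s2 (K : cell * cell) : fun4 := fun p q r s => form (snd K) 0 r s.
Definition s4 (K : cell * cell) : fun4 := fun p q r s => form (snd K) 1 r s.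

(* A singular 4-cube in t-space, loaded with a branch of u: continuous
   logarithms of the factors t_j, 1-t1-t3, 1-t2-t4, 1-x1/(t1 t2)-x2/(t3 t4). *)
Record tcell := TCell {
  t1 : fun4; t2 : fun4; t3 : fun4; t4 : fun4;
  lg_t1 : fun4; lg_t2 : fun4; lg_t3 : fun4; lg_t4 : fun4;
  lg_13 : fun4; lg_24 : fun4; lg_Q : fun4 }.

(* Image of a product cell under iota_10, with the induced load.  With
   t = iota_10 (s) one has
     1 - t1 - t3                   = (1-s3) (1 - x1/((1-s3) s1 s2)),
     1 - x1/(t1 t2) - x2/(t3 t4)   = (1-s1) (1 - x2/((1-s1) s3 s4)),
     iota_10^* (dt1 dt3 dt2 dt4)   = - x1 s1^(-2) s2^(-1) ds1 ds3 ds2 ds4,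
   so that the pull-back of u dt is - x1^(1-b1) times the weights on the square
   and the triangle times the principal powers of the two last factors. *)
Definition iota_cell (lx x1 x2 : C) (K : cell * cell) : tcell :=
  TCell
    (fun p q r s => x1 / (s1 K p q r s * s2 K p q r s))
    (s2 K) (s3 K) (s4 K)
    (fun p q r s => lx - lg (fst K) 0 p q - lg (snd K) 0 r s)
    (fun p q r s => lg (snd K) 0 r s)
    (fun p q r s => lg (fst K) 1 p q)
    (fun p q r s => lg (snd K) 1 r s)
    (fun p q r s => lg (fst K) 3 p q
       + Clog (1 - x1 / ((1 - s3 K p q r s) * s1 K p q r s * s2 K p q r s)))
    (fun p q r s => lg (snd K) 2 r s)
    (fun p q r s => lg (fst K) 2 p q
       + Clog (1 - x2 / ((1 - s1 K p q r s) * s3 K p q r s * s4 K p q r s))).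

Definition iota_chain (lx x1 x2 : C) (A : list (C * (cell * cell))) : list (C * tcell) :=
  map (fun X => (fst X, iota_cell lx x1 x2 (snd X))) A.

Definition Delta10 (e : R) (a1 a2 a3 b1 b2 b3 b4 lx x1 x2 : C) : list (C * tcell) :=
  iota_chain lx x1 x2 (chain_opp (reg_prod e a1 a2 a3 b1 b2 b3 b4)).

Definition u_branch (a1 a2 a3 b1 b2 b3 b4 : C) (T : tcell) : fun4 := fun p q r s =>
  Cexp (- b1 * lg_t1 T p q r s - b2 * lg_t2 T p q r s
        - b3 * lg_t3 T p q r s - b4 * lg_t4 T p q r s
        + (b1 + b3 - a1 - 2) * lg_13 T p q r s
        + (b2 + b4 - a2 - 2) * lg_24 T p q r s
        - a3 * lg_Q T p q r s).

Definition partial (f : fun4) (k : nat) : fun4 := fun p q r s =>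
  match k with
  | 0%nat => CDerive (fun h => f h q r s) p
  | 1%nat => CDerive (fun h => f p h r s) q
  | 2%nat => CDerive (fun h => f p q h s) r
  | _ => CDerive (fun h => f p q r h) s
  end.

(* Determinant by expansion along the first row. *)
Fixpoint Cdet (n : nat) (M : nat -> nat -> C) : C :=
  match n with
  | O => 1
  | S m => Csum (map (fun j =>
             Cpow (- (1)) j * M 0%nat j
             * Cdet m (fun i k => M (S i) (if Nat.ltb k j then k else S k)))
           (seq 0 (S m)))
  end.

(* The coefficient of dt1 dt3 dt2 dt4 pulled back to the parameter cube. *)
Definition jacobian (T : tcell) : fun4 := fun p q r s =>
  Cdet 4 (fun i k =>
    partial (match i with
             | 0%nat => t1 T
             | 1%nat => t3 T
             | 2%nat => t2 T
             | _ => t4 T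
             end) k p q r s).

Definition CRInt (f : R -> C) (a b : R) : C := RInt (V := C_R_CompleteNormedModule) f a b.

Definition cube_int (f : fun4) : C :=
  CRInt (fun p => CRInt (fun q => CRInt (fun r => CRInt (fun s =>
    f p q r s) 0 1) 0 1) 0 1) 0 1.

Definition int_u_dt (a1 a2 a3 b1 b2 b3 b4 : C) (A : list (C * tcell)) : C :=
  Csum (map (fun X => fst X * cube_int (fun p q r s =>
    u_branch a1 a2 a3 b1 b2 b3 b4 (snd X) p q r s * jacobian (snd X) p q r s)) A).

Definition Qpoly (x1 x2 t1 t2 t3 t4 : C) : C :=
  t1 * t2 * t3 * t4 - t3 * t4 * x1 - t1 * t2 * x2.

(* x is so close to the origin that no point of the closed bidisc of radii
   |x1|, |x2| (with y1 <> 0, where iota_10 is nondegenerate) has a pull-back of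
   Q meeting a component of the chain.  The divisor 1 - t1 - t3 = 0, the other
   singular locus of u that moves with x under the pull-back, is to be avoided
   as well for u to have a branch on the chain. *)
Definition close_to_0 (A : list (C * (cell * cell))) (x1 x2 : C) : Prop :=
  forall y1 y2 : C, y1 <> 0 -> (Cmod y1 <= Cmod x1)%R -> (Cmod y2 <= Cmod x2)%R ->
  forall (c : C) (K : cell * cell), In (c, K) A ->
  forall p q r s : R,
    (0 <= p <= 1)%R -> (0 <= q <= 1)%R -> (0 <= r <= 1)%R -> (0 <= s <= 1)%R ->
    let u1 := y1 / (s1 K p q r s * s2 K p q r s) in
    Qpoly y1 y2 u1 (s2 K p q r s) (s3 K p q r s) (s4 K p q r s) <> 0
    /\ 1 - u1 - s3 K p q r s <> 0.

(* Main.v *)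
(* On each product cell the factors (1 - x1/((1-s3) s1 s2))^g, g = b1+b3-a1-2, and
   (1 - x2/((1-s1) s3 s4))^(-a3) are expanded in binomial series, uniformly
   convergent by compactness; the coefficient of x1^n x2^m is again a product of
   weights, with exponents shifted by integers, so the same twisted cycle serves.
   It splits as a regularized interval in s1, one in s3, and a regularized
   triangle in (s2,s4).  These satisfy the Beta and Dirichlet formulas with
   Gammas: Stokes gives the recurrences that allow one to raise the exponents
   until the circles can be shrunk to the edges, where the cycle becomes the
   ordinary convergent integral.  The same recurrences turn the shifts by n, m
   into the Pochhammer symbols of the hypergeometric series. *)

Require Import Defs.
From Stdlib Require Import Reals ZArith List Lra Lia Classical ClassicalEpsilon.
From Coquelicot Require Import Coquelicot.
Open Scope C_scope.

(** * Complex exponential, logarithm and derivatives along curves *)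

(** Two obstacles shape the proof. Gamma is given only as Gauss' limit, so its convergence, its lack
    of zeros, the functional equation and the Beta formula are all derived from the product: for an
    integral exponent n the Beta integral is, up to a power of n, a term of that product, and the
    general case follows asymptotically. And all integrals are iterated Riemann integrals: improper
    ones are avoided by asking for exponents of real part at least 1, where x^a, extended by 0, is
    continuous on the line. The recurrences lead there from any nonintegral exponent w_i, since a
    step divides only by w_i + 1. Homology is replaced by explicit boundary terms: Green's formula
    on the parameter square of a cell produces segments and arcs, which cancel in the weighted sum
    by an identity of rational functions in the c_i. When the circles shrink, edge and vertex cells
    become strips and corners which, with the shrunken triangle, tile the full one. Moving y inside
    the bidisc of [close_to_0] yields the strict inequality, and compactness the uniform ratio below
    1, that the binomial series require. *)

Lemma C_ext (z w : C) : Re z = Re w -> Im z = Im w -> z = w.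
Proof. destruct z, w; simpl; congruence. Qed.

Lemma continuous_C {U : UniformSpace} (f : U -> C) (x : U) :
  continuous (fun u => Re (f u)) x -> continuous (fun u => Im (f u)) x ->
  continuous (f : U -> C_UniformSpace) x.
Proof.
  intros H1 H2.
  apply continuous_ext with (fun u => (Re (f u), Im (f u))).
  { intros u. now destruct (f u). }
  apply (continuous_comp_2 (fun u => Re (f u)) (fun u => Im (f u)) (fun a b => (a, b)) x H1 H2).
  apply continuous_ext with (fun z : R * R => z).
  { now intros []. }
  apply continuous_id.
Qed.

Lemma continuous_Re {U : UniformSpace} (f : U -> C) (x : U) :
  continuous (f : U -> C_UniformSpace) x -> continuous (fun u => Re (f u)) x.
Proof.
  intros H. apply (continuous_comp (V := prod_UniformSpace R_UniformSpace R_UniformSpace) f fst x H).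
  destruct (f x). apply continuous_fst.
Qed.

Lemma continuous_Im {U : UniformSpace} (f : U -> C) (x : U) :
  continuous (f : U -> C_UniformSpace) x -> continuous (fun u => Im (f u)) x.
Proof.
  intros H. apply (continuous_comp (V := prod_UniformSpace R_UniformSpace R_UniformSpace) f snd x H).
  destruct (f x). apply continuous_snd.
Qed.

Lemma continuous_Cplus {U : UniformSpace} (f g : U -> C) (x : U) :
  continuous (f : U -> C_UniformSpace) x -> continuous (g : U -> C_UniformSpace) x ->
  continuous ((fun u => f u + g u) : U -> C_UniformSpace) x.
Proof.
  intros Hf Hg; apply continuous_C; cbn.
  - apply (continuous_plus (V := R_NormedModule) (fun u => Re (f u)) (fun u => Re (g u)));
      now apply continuous_Re.
  - apply (continuous_plus (V := R_NormedModule) (fun u => Im (f u)) (fun u => Im (g u)));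
      now apply continuous_Im.
Qed.

Lemma continuous_Copp {U : UniformSpace} (f : U -> C) (x : U) :
  continuous (f : U -> C_UniformSpace) x ->
  continuous ((fun u => - f u) : U -> C_UniformSpace) x.
Proof.
  intros Hf; apply continuous_C; cbn.
  - apply (continuous_opp (V := R_NormedModule) (fun u => Re (f u))); now apply continuous_Re.
  - apply (continuous_opp (V := R_NormedModule) (fun u => Im (f u))); now apply continuous_Im.
Qed.

Lemma continuous_Cminus {U : UniformSpace} (f g : U -> C) (x : U) :
  continuous (f : U -> C_UniformSpace) x -> continuous (g : U -> C_UniformSpace) x ->
  continuous ((fun u => f u - g u) : U -> C_UniformSpace) x.
Proof.
  intros Hf Hg. apply continuous_Cplus; auto. now apply continuous_Copp.
Qed.

Lemma continuous_Rm {U : UniformSpace} (f g : U -> R) (x : U) :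
  continuous f x -> continuous g x -> continuous (fun u => (f u * g u)%R) x.
Proof. intros. now apply (continuous_mult (K := R_AbsRing) f g). Qed.

Lemma continuous_Rp {U : UniformSpace} (f g : U -> R) (x : U) :
  continuous f x -> continuous g x -> continuous (fun u => (f u + g u)%R) x.
Proof. intros. now apply (continuous_plus (V := R_NormedModule) f g). Qed.

Lemma continuous_Ro {U : UniformSpace} (f : U -> R) (x : U) :
  continuous f x -> continuous (fun u => (- f u)%R) x.
Proof. intros. now apply (continuous_opp (V := R_NormedModule) f). Qed.

Lemma continuous_Rmi {U : UniformSpace} (f g : U -> R) (x : U) :
  continuous f x -> continuous g x -> continuous (fun u => (f u - g u)%R) x.
Proof. intros. now apply (continuous_minus (V := R_NormedModule) f g). Qed.

Lemma continuous_Cmult {U : UniformSpace} (f g : U -> C) (x : U) :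
  continuous (f : U -> C_UniformSpace) x -> continuous (g : U -> C_UniformSpace) x ->
  continuous ((fun u => f u * g u) : U -> C_UniformSpace) x.
Proof.
  intros Hf Hg.
  pose proof (continuous_Re _ _ Hf). pose proof (continuous_Im _ _ Hf).
  pose proof (continuous_Re _ _ Hg). pose proof (continuous_Im _ _ Hg).
  apply continuous_C; cbn.
  - now apply continuous_Rmi; apply continuous_Rm.
  - now apply continuous_Rp; apply continuous_Rm.
Qed.

Lemma continuous_RtoC {U : UniformSpace} (f : U -> R) (x : U) :
  continuous f x -> continuous ((fun u => RtoC (f u)) : U -> C_UniformSpace) x.
Proof. intros H; apply continuous_C; cbn; auto. apply continuous_const. Qed.

Lemma continuous_Cmod {U : UniformSpace} (f : U -> C) (x : U) :
  continuous (f : U -> C_UniformSpace) x -> continuous (fun u => Cmod (f u)) x.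
Proof.
  intros H. unfold Cmod.
  apply (continuous_comp (fun u => (fst (f u) ^ 2 + snd (f u) ^ 2)%R) sqrt).
  - pose proof (continuous_Re _ _ H). pose proof (continuous_Im _ _ H).
    simpl. apply continuous_Rp; repeat apply continuous_Rm; auto; apply continuous_const.
  - apply continuous_sqrt.
Qed.

Lemma Cmod_sqr (z : C) : (Cmod z * Cmod z = Re z * Re z + Im z * Im z)%R.
Proof.
  unfold Cmod. rewrite sqrt_sqrt; unfold Re, Im; nra.
Qed.

Lemma Cinv_parts (z : C) :
  / z = (Re z / (Cmod z * Cmod z), - Im z / (Cmod z * Cmod z))%R.
Proof.
  rewrite Cmod_sqr. unfold Cinv, Re, Im. destruct z as [a b]; simpl.
  now rewrite !Rmult_1_r.
Qed.

Lemma continuous_Rinv_at {U : UniformSpace} (f : U -> R) (x : U) :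
  f x <> 0%R -> continuous f x -> continuous (fun u => (/ f u)%R) x.
Proof. intros H0 H. apply (continuous_comp f Rinv); auto. now apply continuous_Rinv. Qed.

Lemma continuous_Cinv {U : UniformSpace} (f : U -> C) (x : U) :
  f x <> 0 -> continuous (f : U -> C_UniformSpace) x ->
  continuous ((fun u => / f u) : U -> C_UniformSpace) x.
Proof.
  intros H0 H.
  assert (Hm : (Cmod (f x) * Cmod (f x) <> 0)%R).
  { apply Cmod_gt_0 in H0. nra. }
  pose proof (continuous_Re _ _ H). pose proof (continuous_Im _ _ H).
  pose proof (continuous_Cmod _ _ H).
  apply continuous_ext with (fun u => (Re (f u) / (Cmod (f u) * Cmod (f u)), - Im (f u) / (Cmod (f u) * Cmod (f u)))%R).
  { intros u. now rewrite Cinv_parts. }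
  apply continuous_C; cbn; unfold Rdiv; apply continuous_Rm; auto.
  - apply (continuous_Rinv_at (fun u => (Cmod (f u) * Cmod (f u))%R)); auto. now apply continuous_Rm.
  - now apply continuous_Ro.
  - apply (continuous_Rinv_at (fun u => (Cmod (f u) * Cmod (f u))%R)); auto. now apply continuous_Rm.
Qed.

Lemma continuous_Cdiv {U : UniformSpace} (f g : U -> C) (x : U) :
  g x <> 0 -> continuous (f : U -> C_UniformSpace) x -> continuous (g : U -> C_UniformSpace) x ->
  continuous ((fun u => f u / g u) : U -> C_UniformSpace) x.
Proof. intros. apply continuous_Cmult; auto. now apply continuous_Cinv. Qed.

Lemma continuous_Cexp {U : UniformSpace} (f : U -> C) (x : U) :
  continuous (f : U -> C_UniformSpace) x ->
  continuous ((fun u => Cexp (f u)) : U -> C_UniformSpace) x.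
Proof.
  intros H.
  pose proof (continuous_Re _ _ H). pose proof (continuous_Im _ _ H).
  apply continuous_C; cbn; apply continuous_Rm.
  - apply (continuous_comp (fun u => Re (f u)) exp); auto. apply continuous_exp.
  - apply (continuous_comp (fun u => Im (f u)) cos); auto. apply continuous_cos.
  - apply (continuous_comp (fun u => Re (f u)) exp); auto. apply continuous_exp.
  - apply (continuous_comp (fun u => Im (f u)) sin); auto. apply continuous_sin.
Qed.

(** The complement of the cut (-oo,0]: |z| + Re z is the denominator in [Clog] and vanishes exactly
    on the cut. *)
Definition offcut (z : C) : Prop := (0 < Cmod z + Re z)%R.

Lemma offcut_neq0 (z : C) : offcut z -> z <> 0.
Proof. intros H ->. unfold offcut in H. rewrite Cmod_0 in H. simpl in H. lra. Qed.

Lemma offcut_Re (z : C) : (0 < Re z)%R -> offcut z.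
Proof. unfold offcut. pose proof (Cmod_ge_0 z). lra. Qed.

Lemma continuous_Clog {U : UniformSpace} (f : U -> C) (x : U) :
  offcut (f x) -> continuous (f : U -> C_UniformSpace) x ->
  continuous ((fun u => Clog (f u)) : U -> C_UniformSpace) x.
Proof.
  intros H0 H.
  pose proof (continuous_Re _ _ H). pose proof (continuous_Im _ _ H).
  pose proof (continuous_Cmod _ _ H).
  pose proof (offcut_neq0 _ H0) as Hn. apply Cmod_gt_0 in Hn.
  apply continuous_C; cbn.
  - apply (continuous_comp (fun u => Cmod (f u)) ln); auto. now apply continuous_ln.
  - apply continuous_Rm. apply continuous_const.
    apply (continuous_comp (fun u => Im (f u) / (Cmod (f u) + Re (f u)))%R atan).
    + apply continuous_Rm; auto.
      apply (continuous_Rinv_at (fun u => Cmod (f u) + Re (f u))%R).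
      unfold offcut in H0. lra. now apply continuous_Rp.
    + apply continuous_atan.
Qed.

(** Only derivatives along real curves occur; holomorphic dependence is also tested along curves, so
    no complex derivative is introduced. *)
Definition Cderiv (f : R -> C) (t : R) (l : C) : Prop :=
  is_derive (fun h => Re (f h)) t (Re l) /\ is_derive (fun h => Im (f h)) t (Im l).

Lemma Cderiv_CDerive f t l : Cderiv f t l -> CDerive f t = l.
Proof.
  intros [H1 H2]. apply C_ext; [apply (is_derive_unique _ _ _ H1) | apply (is_derive_unique _ _ _ H2)].
Qed.

Lemma Cderiv_eq f t l l' : Cderiv f t l -> l = l' -> Cderiv f t l'.
Proof. now intros H <-. Qed.

Lemma Cderiv_ext f g t l : (forall h, f h = g h) -> Cderiv f t l -> Cderiv g t l.
Proof.
  intros E [H1 H2]; split.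
  - apply is_derive_ext with (fun h => Re (f h)); auto. intros; now rewrite E.
  - apply is_derive_ext with (fun h => Im (f h)); auto. intros; now rewrite E.
Qed.

Lemma Cderiv_ext_loc f g t l : locally t (fun h => f h = g h) -> Cderiv f t l -> Cderiv g t l.
Proof.
  intros E [H1 H2]; split.
  - apply is_derive_ext_loc with (fun h => Re (f h)); auto.
    revert E. apply filter_imp. intros h Hh. now rewrite Hh.
  - apply is_derive_ext_loc with (fun h => Im (f h)); auto.
    revert E. apply filter_imp. intros h Hh. now rewrite Hh.
Qed.

Lemma Cderiv_const (c : C) t : Cderiv (fun _ => c) t 0.
Proof. split; cbn; apply is_derive_Reals; apply derivable_pt_lim_const. Qed.

Lemma Cderiv_RtoC (f : R -> R) t l : is_derive f t l -> Cderiv (fun h => RtoC (f h)) t (RtoC l).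
Proof. intros H; split; cbn; auto. apply is_derive_Reals; apply derivable_pt_lim_const. Qed.

Lemma Cderiv_plus f g t a b :
  Cderiv f t a -> Cderiv g t b -> Cderiv (fun h => f h + g h) t (a + b).
Proof.
  intros [H1 H2] [H3 H4]; split; cbn.
  - now apply (is_derive_plus (V := R_NormedModule) (fun h => Re (f h)) (fun h => Re (g h))).
  - now apply (is_derive_plus (V := R_NormedModule) (fun h => Im (f h)) (fun h => Im (g h))).
Qed.

Lemma Cderiv_opp f t a : Cderiv f t a -> Cderiv (fun h => - f h) t (- a).
Proof.
  intros [H1 H2]; split; cbn.
  - now apply (is_derive_opp (V := R_NormedModule) (fun h => Re (f h))).
  - now apply (is_derive_opp (V := R_NormedModule) (fun h => Im (f h))).
Qed.

Lemma Cderiv_minus f g t a b :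
  Cderiv f t a -> Cderiv g t b -> Cderiv (fun h => f h - g h) t (a - b).
Proof. intros. apply Cderiv_plus; auto. now apply Cderiv_opp. Qed.

Lemma Rderiv_mult (f g : R -> R) t a b :
  is_derive f t a -> is_derive g t b ->
  is_derive (fun h => (f h * g h)%R) t (a * g t + f t * b)%R.
Proof.
  intros H1 H2. apply is_derive_Reals in H1, H2. apply is_derive_Reals.
  now apply (derivable_pt_lim_mult f g).
Qed.

Lemma Rderiv_eq (f : R -> R) t a b : is_derive f t a -> a = b -> is_derive f t b.
Proof. now intros H <-. Qed.

Lemma Cderiv_mult f g t a b :
  Cderiv f t a -> Cderiv g t b -> Cderiv (fun h => f h * g h) t (a * g t + f t * b).
Proof.
  intros [H1 H2] [H3 H4]; split; cbn -[Rmult].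
  - replace (_ + _)%R with ((Re a * Re (g t) + Re (f t) * Re b) - (Im a * Im (g t) + Im (f t) * Im b))%R
      by (unfold Re, Im; ring).
    apply (is_derive_minus (V := R_NormedModule) (fun h => Re (f h) * Re (g h))%R (fun h => Im (f h) * Im (g h))%R);
      now apply Rderiv_mult.
  - replace (_ + _)%R with ((Re a * Im (g t) + Re (f t) * Im b) + (Im a * Re (g t) + Im (f t) * Re b))%R
      by (unfold Re, Im; ring).
    apply (is_derive_plus (V := R_NormedModule) (fun h => Re (f h) * Im (g h))%R (fun h => Im (f h) * Re (g h))%R);
      now apply Rderiv_mult.
Qed.

Lemma Rderiv_comp (f g : R -> R) t a b :
  is_derive f t a -> is_derive g (f t) b -> is_derive (fun h => g (f h)) t (b * a)%R.
Proof.
  intros H1 H2. apply is_derive_Reals in H1, H2. apply is_derive_Reals.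
  now apply (derivable_pt_lim_comp f g).
Qed.

Lemma Cderiv_Cexp f t a :
  Cderiv f t a -> Cderiv (fun h => Cexp (f h)) t (Cexp (f t) * a).
Proof.
  intros [H1 H2].
  assert (E : is_derive (fun h => exp (Re (f h))) t (exp (Re (f t)) * Re a)%R).
  { apply Rderiv_comp; auto. apply is_derive_Reals, derivable_pt_lim_exp. }
  assert (Cc : is_derive (fun h => cos (Im (f h))) t (- sin (Im (f t)) * Im a)%R).
  { apply (Rderiv_comp _ cos); auto. apply is_derive_Reals, derivable_pt_lim_cos. }
  assert (S : is_derive (fun h => sin (Im (f h))) t (cos (Im (f t)) * Im a)%R).
  { apply (Rderiv_comp _ sin); auto. apply is_derive_Reals, derivable_pt_lim_sin. }
  split; (eapply Rderiv_eq; [apply Rderiv_mult; [apply E|]|]).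
  - apply Cc.
  - unfold Cmult, Cexp, Re, Im; cbn; ring.
  - apply S.
  - unfold Cmult, Cexp, Re, Im; cbn; ring.
Qed.

Lemma Cderiv_continuous f t a : Cderiv f t a -> continuous (f : R -> C_UniformSpace) t.
Proof.
  intros [H1 H2]. apply continuous_C.
  - apply (ex_derive_continuous (V := R_NormedModule) (fun h => Re (f h))); now exists (Re a).
  - apply (ex_derive_continuous (V := R_NormedModule) (fun h => Im (f h))); now exists (Im a).
Qed.

Lemma Rderiv_inv (f : R -> R) t a : f t <> 0%R ->
  is_derive f t a -> is_derive (fun h => (/ f h)%R) t (- a / (f t * f t))%R.
Proof.
  intros H0 H1. apply is_derive_ext with (fun h => / f h)%R; auto.
  replace (- a / (f t * f t))%R with (- a / f t ^ 2)%R by (simpl; now rewrite Rmult_1_r).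
  now apply is_derive_inv.
Qed.

Lemma Cderiv_Cmod (f : R -> C) t a : f t <> 0 -> Cderiv f t a ->
  is_derive (fun h => Cmod (f h)) t ((Re (f t) * Re a + Im (f t) * Im a) / Cmod (f t))%R.
Proof.
  intros H0 [H1 H2].
  assert (Hm := H0). apply Cmod_gt_0 in Hm.
  assert (D : is_derive (fun h => (Re (f h) * Re (f h) + Im (f h) * Im (f h)))%R t
    (2 * (Re (f t) * Re a + Im (f t) * Im a))%R).
  { replace (2 * _)%R with ((Re a * Re (f t) + Re (f t) * Re a) + (Im a * Im (f t) + Im (f t) * Im a))%R by ring.
    apply (is_derive_plus (V := R_NormedModule) (fun h => Re (f h) * Re (f h))%R (fun h => Im (f h) * Im (f h))%R);
      now apply Rderiv_mult. }
  assert (E : forall h, sqrt (Re (f h) * Re (f h) + Im (f h) * Im (f h)) = Cmod (f h)).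
  { intros h. rewrite <- Cmod_sqr. apply sqrt_square, Cmod_ge_0. }
  apply is_derive_ext with (1 := E).
  replace ((Re (f t) * Re a + Im (f t) * Im a) / Cmod (f t))%R
    with (/ (2 * sqrt (Re (f t) * Re (f t) + Im (f t) * Im (f t))) * (2 * (Re (f t) * Re a + Im (f t) * Im a)))%R
    by (rewrite E; field; lra).
  apply (Rderiv_comp _ sqrt); auto.
  apply is_derive_Reals, derivable_pt_lim_sqrt. rewrite <- Cmod_sqr. nra.
Qed.

Lemma Cderiv_Cinv (f : R -> C) t a : f t <> 0 -> Cderiv f t a ->
  Cderiv (fun h => / f h) t (- a / (f t * f t)).
Proof.
  intros H0 H.
  assert (Hm := H0). apply Cmod_gt_0 in Hm.
  assert (HM := Cderiv_Cmod _ _ _ H0 H).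
  destruct H as [H1 H2].
  assert (D : is_derive (fun h => / (Cmod (f h) * Cmod (f h)))%R t
     (- (2 * (Re (f t) * Re a + Im (f t) * Im a)) / ((Cmod (f t) * Cmod (f t)) * (Cmod (f t) * Cmod (f t))))%R).
  { apply (Rderiv_inv (fun h => Cmod (f h) * Cmod (f h))%R). nra.
    replace (2 * (Re (f t) * Re a + Im (f t) * Im a))%R with
    ((Re (f t) * Re a + Im (f t) * Im a) / Cmod (f t) * Cmod (f t) + Cmod (f t) * ((Re (f t) * Re a + Im (f t) * Im a) / Cmod (f t)))%R by (field; lra).
    now apply Rderiv_mult. }
  apply Cderiv_ext with (fun h => (Re (f h) * / (Cmod (f h) * Cmod (f h)), - Im (f h) * / (Cmod (f h) * Cmod (f h)))%R).
  { intros h. now rewrite (Cinv_parts (f h)). }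
  assert (Hpos : (Re (f t) * Re (f t) + Im (f t) * Im (f t))%R <> 0%R).
  { rewrite <- Cmod_sqr. nra. }
  apply Cderiv_eq with
    (Re a * / (Cmod (f t) * Cmod (f t)) + Re (f t) * (- (2 * (Re (f t) * Re a + Im (f t) * Im a)) / ((Cmod (f t) * Cmod (f t)) * (Cmod (f t) * Cmod (f t)))),
     (- Im a) * / (Cmod (f t) * Cmod (f t)) + - Im (f t) * (- (2 * (Re (f t) * Re a + Im (f t) * Im a)) / ((Cmod (f t) * Cmod (f t)) * (Cmod (f t) * Cmod (f t)))))%R.
  - split; cbn -[Rmult Rinv].
    + now apply (Rderiv_mult (fun h => Re (f h)) (fun h => / (Cmod (f h) * Cmod (f h)))%R).
    + apply (Rderiv_mult (fun h => - Im (f h))%R (fun h => / (Cmod (f h) * Cmod (f h)))%R); auto.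
      now apply (is_derive_opp (V := R_NormedModule) (fun h => Im (f h))).
  - rewrite !Cmod_sqr.
    assert (G : f t * f t <> 0) by now apply Cmult_neq_0.
    unfold Cdiv. rewrite (Cinv_parts (f t * f t)), Cmod_sqr.
    destruct (f t) as [u v], a as [a1 a2]; cbn in *.
    assert (((u * u - v * v) * (u * u - v * v) + (u * v + v * u) * (u * v + v * u)) = (u*u+v*v)*(u*u+v*v))%R as E by ring.
    rewrite E. apply C_ext; cbn; field; nra.
Qed.

Lemma Cderiv_div (f g : R -> C) t a b : g t <> 0 -> Cderiv f t a -> Cderiv g t b ->
  Cderiv (fun h => f h / g h) t (a / g t - f t * b / (g t * g t)).
Proof.
  intros H0 H1 H2.
  apply Cderiv_eq with (a * / g t + f t * (- b / (g t * g t))).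
  - apply Cderiv_mult; auto. now apply Cderiv_Cinv.
  - field. auto.
Qed.

Lemma Cderiv_Clog (f : R -> C) t a : offcut (f t) -> Cderiv f t a ->
  Cderiv (fun h => Clog (f h)) t (a / f t).
Proof.
  intros H0 H.
  assert (Hn := offcut_neq0 _ H0).
  assert (Hm := Hn). apply Cmod_gt_0 in Hm.
  assert (HM := Cderiv_Cmod _ _ _ Hn H).
  destruct H as [H1 H2]. unfold offcut in H0.
  assert (Hs := Cmod_sqr (f t)).
  set (m := Cmod (f t)) in *.
  apply Cderiv_eq with
   (/ m * ((Re (f t) * Re a + Im (f t) * Im a) / m),
    2 * (/ (1 + (Im (f t) / (m + Re (f t)))²) *
       (Im a * / (m + Re (f t)) + Im (f t) * (- ((Re (f t) * Re a + Im (f t) * Im a) / m + Re a) / ((m + Re (f t)) * (m + Re (f t)))))))%R.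
  - split; cbn -[Rmult Rinv].
    + apply (Rderiv_comp (fun h => Cmod (f h)) ln); auto.
      apply is_derive_Reals, derivable_pt_lim_ln; auto.
    + apply (is_derive_scal (fun h => atan (Im (f h) / (Cmod (f h) + Re (f h)))) t 2%R).
      apply (Rderiv_comp (fun h => Im (f h) / (Cmod (f h) + Re (f h)))%R atan).
      * apply (Rderiv_mult (fun h => Im (f h)) (fun h => / (Cmod (f h) + Re (f h)))%R); auto.
        apply (Rderiv_inv (fun h => Cmod (f h) + Re (f h))%R). fold m; lra.
        now apply (is_derive_plus (V := R_NormedModule) (fun h => Cmod (f h)) (fun h => Re (f h))).
      * apply is_derive_Reals.
        assert (A := derivable_pt_lim_atan (Im (f t) / (Cmod (f t) + Re (f t)))%R).
        fold m in A. fold m. now rewrite Rsqr_pow2.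
  - unfold Cdiv. rewrite (Cinv_parts (f t)). fold m.
    clearbody m. clear HM H1 H2.
    destruct (f t) as [u v], a as [a1 a2]; unfold Re, Im in *; simpl in *.
    (* Since m^2 = u^2 + v^2. This evaluates 1 + tan^2 of the half argument as 2m / (m+u). *)
    assert (((m+u)*(m+u) + v*v = 2 * m * (m + u))%R) as E.
    { replace ((m+u)*(m+u) + v*v)%R with (m*m + 2*m*u + (u*u+v*v))%R by ring. rewrite <- Hs. ring. }
    apply C_ext; cbn; unfold Rsqr.
    + field. lra.
    + replace (1 + v / (m + u) * (v / (m + u)))%R with (2 * m / (m + u))%R
        by (replace (1 + v / (m + u) * (v / (m + u)))%R with (((m+u)*(m+u) + v*v) / ((m+u) * (m+u)))%R by (field; lra);
            rewrite E; field; lra).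
      apply Rmult_eq_reg_r with (m * m * (m + u))%R;
        [|apply Rgt_not_eq; repeat apply Rmult_lt_0_compat; lra].
      transitivity (m * (a2 * (m + u)) - v * (u * a1 + v * a2 + a1 * m))%R.
      * field. lra.
      * transitivity ((u * a2 - v * a1) * (m + u))%R; [|field; lra].
        replace (m * (a2 * (m + u)) - v * (u * a1 + v * a2 + a1 * m))%R
          with ((m * m) * a2 + m * u * a2 - v * u * a1 - v * v * a2 - v * m * a1)%R by ring.
        rewrite Hs. ring.
Qed.

Lemma Cexp_add z w : Cexp (z + w) = Cexp z * Cexp w.
Proof.
  unfold Cexp. apply C_ext; cbn; rewrite exp_plus, ?cos_plus, ?sin_plus; unfold Re, Im; ring.
Qed.

Lemma Cexp_0 : Cexp 0 = 1.
Proof. unfold Cexp. cbn. now rewrite exp_0, cos_0, sin_0, Rmult_1_l, Rmult_0_r. Qed.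

Lemma Cexp_neq0 z : Cexp z <> 0.
Proof.
  intros H. assert (E : Cexp z * Cexp (- z) = 1).
  { rewrite <- Cexp_add. replace (z + - z) with (RtoC 0) by ring. apply Cexp_0. }
  rewrite H, Cmult_0_l in E. injection E. lra.
Qed.

Lemma Cexp_opp z : Cexp (- z) = / Cexp z.
Proof.
  assert (E : Cexp z * Cexp (- z) = 1).
  { rewrite <- Cexp_add. replace (z + - z) with (RtoC 0) by ring. apply Cexp_0. }
  assert (H := Cexp_neq0 z).
  transitivity (/ Cexp z * (Cexp z * Cexp (- z))). field; auto. rewrite E. ring.
Qed.

Lemma Cmod_Cexp z : Cmod (Cexp z) = exp (Re z).
Proof.
  unfold Cexp, Cmod; cbn.
  replace (_ + _)%R with (exp (Re z) * exp (Re z) * (Rsqr (sin (Im z)) + Rsqr (cos (Im z))))%R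
    by (unfold Rsqr; ring).
  rewrite sin2_cos2, Rmult_1_r. apply sqrt_square. left; apply exp_pos.
Qed.

(** With w = tan (arg z / 2) one has 1 + w^2 = 2|z| / (|z| + Re z), and the double angle formulas
    turn cos and sin of 2 atan w into Re z / |z| and Im z / |z|. *)
Lemma Cexp_Clog z : offcut z -> Cexp (Clog z) = z.
Proof.
  intros H0.
  assert (Hn := offcut_neq0 _ H0).
  assert (Hm := Hn). apply Cmod_gt_0 in Hm. unfold offcut in H0.
  assert (Hs := Cmod_sqr z).
  set (w := (Im z / (Cmod z + Re z))%R).
  change (Cexp (Clog z)) with ((exp (ln (Cmod z)) * cos (2 * atan w), exp (ln (Cmod z)) * sin (2 * atan w))%R).
  rewrite exp_ln by auto.
  set (m := Cmod z) in *.
  rewrite cos_2a, sin_2a, cos_atan, sin_atan.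
  assert (E : (1 + w² = 2 * m / (m + Re z))%R).
  { unfold w, Rsqr. clearbody m. destruct z as [u v]; unfold Re, Im in *; simpl in *.
    transitivity ((m * m + 2 * m * u + (u * u + v * v)) / ((m + u) * (m + u)))%R; [field; lra|].
    rewrite <- Hs. field. lra. }
  assert (P : (0 < 1 + w²)%R) by (pose proof (Rle_0_sqr w); lra).
  assert (Q : (/ sqrt (1 + w²) * / sqrt (1 + w²) = (m + Re z) / (2 * m))%R).
  { rewrite <- Rinv_mult, sqrt_sqrt by lra. rewrite E. field. lra. }
  apply C_ext; cbn [Re Im fst snd].
  - replace (1 / sqrt (1 + w²) * (1 / sqrt (1 + w²)) - w / sqrt (1 + w²) * (w / sqrt (1 + w²)))%R
      with ((/ sqrt (1 + w²) * / sqrt (1 + w²)) * (1 - w * w))%R by (unfold Rdiv; ring).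
    rewrite Q. unfold w. clearbody m. destruct z as [u v]; unfold Re, Im in *; simpl in *.
    transitivity (((m + u) * (m + u) - v * v) / (2 * (m + u)))%R; [field; lra|].
    replace ((m + u) * (m + u) - v * v)%R with (m * m + 2 * m * u + u * u - v * v)%R by ring.
    rewrite Hs. field. lra.
  - replace (2 * (w / sqrt (1 + w²)) * (1 / sqrt (1 + w²)))%R
      with ((/ sqrt (1 + w²) * / sqrt (1 + w²)) * (2 * w))%R by (unfold Rdiv; ring).
    rewrite Q. unfold w. clearbody m. destruct z as [u v]; unfold Re, Im in *; simpl in *. field. lra.
Qed.

Lemma Clog_RtoC r : (0 < r)%R -> Clog (RtoC r) = RtoC (ln r).
Proof.
  intros H.
  change (Clog (RtoC r)) with ((ln (Cmod r), 2 * atan (0 / (Cmod r + r)))%R).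
  unfold Rdiv. rewrite Rmult_0_l, atan_0, Rmult_0_r, Cmod_R, Rabs_pos_eq by lra. easy.
Qed.

(** * Integrals of complex-valued functions *)

Notation exI := (ex_RInt (V := C_R_NormedModule)).
Notation isI := (is_RInt (V := C_R_NormedModule)).
Notation ccont f x := (continuous (f : _ -> C_UniformSpace) x).

Lemma CRInt_correct f a b : exI f a b -> isI f a b (CRInt f a b).
Proof. exact (RInt_correct (V := C_R_CompleteNormedModule) f a b). Qed.

Lemma CRInt_unique f a b l : isI f a b l -> CRInt f a b = l.
Proof. exact (is_RInt_unique (V := C_R_CompleteNormedModule) f a b l). Qed.

Lemma isI_parts (f : R -> C) a b l :
  is_RInt (fun t => Re (f t)) a b (Re l) -> is_RInt (fun t => Im (f t)) a b (Im l) -> isI f a b l.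
Proof.
  intros H1 H2. destruct l.
  exact (is_RInt_fct_extend_pair (U := R_NormedModule) (V := R_NormedModule) f a b _ _ H1 H2).
Qed.

Lemma isI_Re (f : R -> C) a b l : isI f a b l -> is_RInt (fun t => Re (f t)) a b (Re l).
Proof. exact (is_RInt_fct_extend_fst (U := R_NormedModule) (V := R_NormedModule) f a b l). Qed.

Lemma isI_Im (f : R -> C) a b l : isI f a b l -> is_RInt (fun t => Im (f t)) a b (Im l).
Proof. exact (is_RInt_fct_extend_snd (U := R_NormedModule) (V := R_NormedModule) f a b l). Qed.

Lemma CRInt_ext f g a b :
  (forall x, (Rmin a b < x < Rmax a b)%R -> f x = g x) -> CRInt f a b = CRInt g a b.
Proof. exact (RInt_ext (V := C_R_CompleteNormedModule) f g a b). Qed.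

Lemma CRInt_ext01 f g a b : (a <= b)%R ->
  (forall x, (a <= x <= b)%R -> f x = g x) -> CRInt f a b = CRInt g a b.
Proof.
  intros Hab H. apply CRInt_ext. intros x Hx. apply H.
  rewrite Rmin_left, Rmax_right in Hx; lra.
Qed.

Lemma exI_ext01 f g a b : (a <= b)%R ->
  (forall x, (a <= x <= b)%R -> f x = g x) -> exI f a b -> exI g a b.
Proof.
  intros Hab H. apply ex_RInt_ext. intros x Hx. apply H.
  rewrite Rmin_left, Rmax_right in Hx; lra.
Qed.

Lemma exI_cont (f : R -> C) a b : (a <= b)%R ->
  (forall x, (a <= x <= b)%R -> ccont f x) -> exI f a b.
Proof.
  intros Hab H. apply (ex_RInt_continuous (V := C_R_CompleteNormedModule)).
  intros z Hz. rewrite Rmin_left, Rmax_right in Hz by lra. now apply H.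
Qed.

Lemma exI_cont_all (f : R -> C) a b : (forall x, ccont f x) -> exI f a b.
Proof.
  intros H. apply (ex_RInt_continuous (V := C_R_CompleteNormedModule)).
  intros z Hz. now apply H.
Qed.

Lemma isI_scal f a b l c : isI f a b l -> isI (fun x => c * f x) a b (c * l).
Proof.
  intros H. assert (H1 := isI_Re _ _ _ _ H). assert (H2 := isI_Im _ _ _ _ H).
  apply isI_parts.
  - apply (is_RInt_minus (V := R_NormedModule) (fun t => Re c * Re (f t))%R (fun t => Im c * Im (f t))%R);
      now apply (is_RInt_scal (V := R_NormedModule)).
  - apply (is_RInt_plus (V := R_NormedModule) (fun t => Re c * Im (f t))%R (fun t => Im c * Re (f t))%R);
      now apply (is_RInt_scal (V := R_NormedModule)).
Qed.

Lemma exI_scal f a b c : exI f a b -> exI (fun x => c * f x) a b.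
Proof. intros [l H]. exists (c * l). now apply isI_scal. Qed.

Lemma CRInt_scal f a b c : exI f a b -> CRInt (fun x => c * f x) a b = c * CRInt f a b.
Proof. intros H. apply CRInt_unique, isI_scal, CRInt_correct, H. Qed.

Lemma exI_scalr f a b c : exI f a b -> exI (fun x => f x * c) a b.
Proof.
  intros H. apply ex_RInt_ext with (fun x => c * f x). intros; apply Cmult_comm. now apply exI_scal.
Qed.

Lemma CRInt_scalr f a b c : exI f a b -> CRInt (fun x => f x * c) a b = CRInt f a b * c.
Proof.
  intros H. rewrite Cmult_comm, <- CRInt_scal by auto. apply CRInt_ext; intros; apply Cmult_comm.
Qed.

Lemma exI_plus f g a b : exI f a b -> exI g a b -> exI (fun x => f x + g x) a b.
Proof. exact (ex_RInt_plus (V := C_R_NormedModule) f g a b). Qed.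

Lemma CRInt_plus f g a b : exI f a b -> exI g a b ->
  CRInt (fun x => f x + g x) a b = CRInt f a b + CRInt g a b.
Proof. exact (RInt_plus (V := C_R_CompleteNormedModule) f g a b). Qed.

Lemma exI_minus f g a b : exI f a b -> exI g a b -> exI (fun x => f x - g x) a b.
Proof. exact (ex_RInt_minus (V := C_R_NormedModule) f g a b). Qed.

Lemma CRInt_minus f g a b : exI f a b -> exI g a b ->
  CRInt (fun x => f x - g x) a b = CRInt f a b - CRInt g a b.
Proof. exact (RInt_minus (V := C_R_CompleteNormedModule) f g a b). Qed.

Lemma CRInt_Chasles f a b c : exI f a b -> exI f b c ->
  CRInt f a b + CRInt f b c = CRInt f a c.
Proof. exact (RInt_Chasles (V := C_R_CompleteNormedModule) f a b c). Qed.

Lemma CRInt_point f a : CRInt f a a = 0.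
Proof. exact (RInt_point (V := C_R_CompleteNormedModule) a f). Qed.

Lemma CRInt_const c a b : CRInt (fun _ => c) a b = RtoC (b - a) * c.
Proof.
  unfold CRInt. rewrite (RInt_const (V := C_R_CompleteNormedModule)).
  apply C_ext; cbn; unfold scal; simpl; unfold mult; simpl; ring.
Qed.

Lemma CRInt_comp_lin (f : R -> C) u v a b :
  exI f (u * a + v) (u * b + v) ->
  CRInt f (u * a + v) (u * b + v) = CRInt (fun y => RtoC u * f (u * y + v)%R) a b.
Proof.
  intros H. unfold CRInt.
  rewrite <- (RInt_comp_lin (V := C_R_CompleteNormedModule) f u v a b H).
  apply CRInt_ext. intros x _.
  apply C_ext; cbn; unfold scal; simpl; unfold mult; simpl; ring.
Qed.

Lemma Cmod_CRInt_le (f : R -> C) (g : R -> R) a b lg : (a <= b)%R ->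
  (forall x, (a <= x <= b)%R -> (Cmod (f x) <= g x)%R) ->
  exI f a b -> is_RInt g a b lg -> (Cmod (CRInt f a b) <= lg)%R.
Proof.
  intros Hab H Hf Hg.
  assert (N : forall z : C, norm (z : C_R_NormedModule) = Cmod z).
  { intros z. unfold norm; simpl; unfold prod_norm, Cmod; simpl.
    f_equal. unfold norm; simpl; unfold abs; simpl. rewrite !Rmult_1_r, <- !Rabs_mult.
    rewrite !Rabs_pos_eq by apply Rle_0_sqr. easy. }
  rewrite <- N. apply (norm_RInt_le (V := C_R_NormedModule) f g a b); auto.
  - intros x Hx. rewrite N. now apply H.
  - now apply CRInt_correct.
Qed.

Lemma Cmod_CRInt_le_const (f : R -> C) M a b : (a <= b)%R ->
  (forall x, (a <= x <= b)%R -> (Cmod (f x) <= M)%R) ->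
  exI f a b -> (Cmod (CRInt f a b) <= (b - a) * M)%R.
Proof.
  intros Hab H Hf. apply (Cmod_CRInt_le f (fun _ => M)); auto.
  apply (is_RInt_const (V := R_NormedModule)).
Qed.

Lemma isI_FTC (F f : R -> C) a b :
  (forall x, (Rmin a b <= x <= Rmax a b)%R -> Cderiv F x (f x)) ->
  (forall x, (Rmin a b <= x <= Rmax a b)%R -> ccont f x) ->
  isI f a b (F b - F a).
Proof.
  intros HD Hc. apply isI_parts.
  - apply (is_RInt_derive (V := R_CompleteNormedModule) (fun t => Re (F t)) (fun t => Re (f t))).
    + intros x Hx. now apply HD.
    + intros x Hx. apply continuous_Re. now apply Hc.
  - apply (is_RInt_derive (V := R_CompleteNormedModule) (fun t => Im (F t)) (fun t => Im (f t))).
    + intros x Hx. now apply HD.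
    + intros x Hx. apply continuous_Im. now apply Hc.
Qed.

Lemma CRInt_FTC (F f : R -> C) a b : (a <= b)%R ->
  (forall x, (a <= x <= b)%R -> Cderiv F x (f x)) ->
  (forall x, (a <= x <= b)%R -> ccont f x) ->
  CRInt f a b = F b - F a.
Proof.
  intros Hab HD Hc. apply CRInt_unique, isI_FTC; rewrite Rmin_left, Rmax_right by lra; auto.
Qed.

Lemma Cderiv0_const (f : R -> C) a b : (a <= b)%R ->
  (forall t, (a <= t <= b)%R -> Cderiv f t 0) -> f a = f b.
Proof.
  intros Hab H.
  destruct (Rle_lt_or_eq_dec _ _ Hab) as [H1| ->]; auto.
  apply C_ext.
  - apply (eq_is_derive (V := R_NormedModule) (fun h => Re (f h))); auto. intros; now apply H.
  - apply (eq_is_derive (V := R_NormedModule) (fun h => Im (f h))); auto. intros; now apply H.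
Qed.

Lemma Cderiv_RInt (f : R -> C) a t : (forall x, ccont f x) ->
  Cderiv (fun b => CRInt f a b) t (f t).
Proof.
  intros H.
  assert (I : forall b, isI f a b (CRInt f a b)).
  { intros b. apply CRInt_correct, exI_cont_all, H. }
  split.
  - apply (is_derive_RInt (V := R_NormedModule) (fun x => Re (f x)) (fun b => Re (CRInt f a b)) a).
    + apply filter_forall. intros b. now apply isI_Re.
    + apply continuous_Re, H.
  - apply (is_derive_RInt (V := R_NormedModule) (fun x => Im (f x)) (fun b => Im (CRInt f a b)) a).
    + apply filter_forall. intros b. now apply isI_Im.
    + apply continuous_Im, H.
Qed.

(** Composition with [clamp] extends a function continuous on an interval or a rectangle to a
    continuous one on the line or the plane, so that theorems about globally continuous integrands
    become available. *)
Definition clamp (a b x : R) : R := Rmax a (Rmin b x).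

Lemma clamp_in a b x : (a <= b)%R -> (a <= clamp a b x <= b)%R.
Proof. intros. unfold clamp, Rmax, Rmin; repeat destruct Rle_dec; lra. Qed.

Lemma clamp_id a b x : (a <= x <= b)%R -> clamp a b x = x.
Proof. intros. unfold clamp, Rmax, Rmin; repeat destruct Rle_dec; lra. Qed.

Lemma continuous_clamp a b x : continuous (clamp a b) x.
Proof.
  apply continuity_pt_filterlim. intros eps He. exists eps. split; auto.
  intros y [_ Hy]. simpl in *. unfold R_dist in *.
  eapply Rle_lt_trans; [|exact Hy].
  unfold clamp, Rmax, Rmin; repeat destruct Rle_dec; unfold Rabs; repeat destruct Rcase_abs; lra.
Qed.

(* Uniformity in [t] comes from the compactness of [a,b]. *)
Lemma tube {U : UniformSpace} (F : U -> R -> C) (u0 : U) a b (eps : R) :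
  (0 < eps)%R -> (a <= b)%R ->
  (forall t, (a <= t <= b)%R -> ccont (fun z : U * R => F (fst z) (snd z)) (u0, t)) ->
  locally u0 (fun u => forall t, (a <= t <= b)%R -> (Cmod (F u t - F u0 t) < eps)%R).
Proof.
  intros He Hab H.
  assert (E : forall t, exists d : posreal, (a <= t <= b)%R -> forall u s, ball u0 d u -> (Rabs (s - t) < d)%R ->
     (Cmod (F u s - F u0 t) < eps / 2)%R).
  { intros t. destruct (classic (a <= t <= b)%R) as [Ht|Ht]; [|exists (mkposreal 1 Rlt_0_1); tauto].
    assert (Hc := H t Ht).
    assert (Hm : continuous (fun z : U * R => Cmod (F (fst z) (snd z) - F u0 t)) (u0, t)).
    { apply continuous_Cmod, continuous_Cminus; auto. apply continuous_const. }
    assert (P : locally (u0, t) (fun z : U * R => (Cmod (F (fst z) (snd z) - F u0 t) < eps / 2)%R)).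
    { apply (Hm (fun y => (y < eps / 2)%R)).
      cbn. replace (F u0 t - F u0 t) with (RtoC 0) by ring. rewrite Cmod_0.
      apply (open_lt (eps / 2)%R 0%R). lra. }
    destruct P as [d Hd]. exists d. intros _ u s Hu Hs.
    apply (Hd (u, s)). split; auto. }
  pose (delta := fun t => proj1_sig (constructive_indefinite_description _ (E t))).
  assert (Hdel := fun t => proj2_sig (constructive_indefinite_description _ (E t))).
  change (forall t, (a <= t <= b)%R -> forall u s, ball u0 (delta t) u -> (Rabs (s - t) < delta t)%R ->
     (Cmod (F u s - F u0 t) < eps / 2)%R) in Hdel.
  destruct (compactness_value_1d a b delta) as [d Hd].
  exists d. intros u Hu t Ht.
  apply NNPP. intros N. apply (Hd t Ht). intros (s & Hs & Hts & Hds). apply N.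
  assert (A1 := Hdel s Hs u t (ball_le u0 d (delta s) Hds u Hu) Hts).
  assert (A2 := Hdel s Hs u0 t (ball_center u0 (delta s)) Hts).
  replace (F u t - F u0 t) with ((F u t - F u0 s) - (F u0 t - F u0 s)) by ring.
  eapply Rle_lt_trans; [apply Cmod_triangle|]. rewrite Cmod_opp. lra.
Qed.

Lemma Re_le_Cmod (z : C) : (Rabs (Re z) <= Cmod z)%R.
Proof. exact (re_le_Cmod z). Qed.

Lemma Im_le_Cmod (z : C) : (Rabs (Im z) <= Cmod z)%R.
Proof.
  apply Rsqr_incr_0_var; [|apply Cmod_ge_0]. rewrite <- Rsqr_abs. unfold Rsqr. rewrite Cmod_sqr. nra.
Qed.

Lemma continuous_Cmod_crit {U : UniformSpace} (f : U -> C) u0 :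
  (forall eps : R, (0 < eps)%R -> locally u0 (fun u => (Cmod (f u - f u0) < eps)%R)) ->
  ccont f u0.
Proof.
  intros H. apply continuous_C.
  - apply (filterlim_locally (F := locally u0) (fun u => Re (f u)) (Re (f u0))). intros eps.
    generalize (H eps (cond_pos eps)). apply filter_imp. intros u Hu.
    eapply Rle_lt_trans; [|exact Hu]. eapply Rle_trans; [|apply Re_le_Cmod]. cbn. apply Rle_refl.
  - apply (filterlim_locally (F := locally u0) (fun u => Im (f u)) (Im (f u0))). intros eps.
    generalize (H eps (cond_pos eps)). apply filter_imp. intros u Hu.
    eapply Rle_lt_trans; [|exact Hu]. eapply Rle_trans; [|apply Im_le_Cmod]. cbn. apply Rle_refl.
Qed.

Lemma continuous_RInt_param {U : UniformSpace} (F : U -> R -> C) (u0 : U) a b : (a <= b)%R ->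
  (forall u t, (a <= t <= b)%R -> ccont (fun s => F u s) t) ->
  (forall t, (a <= t <= b)%R -> ccont (fun z : U * R => F (fst z) (snd z)) (u0, t)) ->
  ccont (fun u => CRInt (F u) a b) u0.
Proof.
  intros Hab H1 H2. apply continuous_Cmod_crit. intros eps He.
  (* The summand 1 keeps the denominator positive when a = b. *)
  assert (He' : (0 < eps / (b - a + 1))%R) by (apply Rdiv_lt_0_compat; lra).
  generalize (tube F u0 a b _ He' Hab H2). apply filter_imp. intros u Hu.
  assert (I : forall v, exI (F v) a b) by (intros v; apply exI_cont; auto).
  rewrite <- CRInt_minus by auto.
  eapply Rle_lt_trans. apply Cmod_CRInt_le_const with (M := (eps / (b - a + 1))%R); auto.
  - intros x Hx. left. now apply Hu.
  - now apply exI_minus.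
  - apply Rmult_lt_reg_r with (b - a + 1)%R; [lra|]. field_simplify; nra.
Qed.

Lemma continuous_slice {U : UniformSpace} (F : U -> R -> C) u t :
  ccont (fun z : U * R => F (fst z) (snd z)) (u, t) -> ccont (F u) t.
Proof.
  intros H. apply (continuous_comp_2 (fun _ : R => u) (fun s : R => s) (fun a b => F a b) t).
  apply continuous_const. apply continuous_id. exact H.
Qed.

Lemma continuous_slice1 {U : UniformSpace} (F : U -> R -> C) u t :
  ccont (fun z : U * R => F (fst z) (snd z)) (u, t) -> ccont (fun v => F v t) u.
Proof.
  intros H. apply (continuous_comp_2 (fun v : U => v) (fun _ : U => t) (fun a b => F a b) u).
  apply continuous_id. apply continuous_const. exact H.
Qed.

Lemma continuous_RInt_param_all {U : UniformSpace} (F : U -> R -> C) a b : (a <= b)%R ->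
  (forall z, ccont (fun z : U * R => F (fst z) (snd z)) z) ->
  forall u, ccont (fun u => CRInt (F u) a b) u.
Proof.
  intros Hab H u. apply continuous_RInt_param; auto.
  intros v t _. apply continuous_slice, H.
Qed.

(** * Fubini and Stokes on rectangles *)

(** A difference quotient that extends to a continuous function N of h has limit N 0. Below, f is an
    integral with moving bounds and N an integral over fixed bounds, for which continuity is already
    known. *)
Lemma Rderiv_slope (f N : R -> R) t :
  (forall h, (f (t + h) - f t = h * N h)%R) -> continuous N 0 -> is_derive f t (N 0).
Proof.
  intros E HN. apply is_derive_Reals. intros eps He.
  assert (P := HN (fun y => (Rabs (y - N 0) < eps)%R)).
  destruct P as [d Hd].
  { exists (mkposreal eps He). intros y Hy. exact Hy. }
  exists d. intros h Hh Hd'. rewrite E.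
  replace (h * N h / h)%R with (N h) by (field; auto).
  apply (Hd h). unfold ball; simpl; unfold AbsRing_ball, abs, minus, plus, opp; simpl.
  now rewrite Ropp_0, Rplus_0_r.
Qed.

Lemma Cderiv_slope (f N : R -> C) t :
  (forall h, f (t + h)%R - f t = RtoC h * N h) -> ccont N 0%R -> Cderiv f t (N 0%R).
Proof.
  intros E HN. split.
  - apply (Rderiv_slope (fun h => Re (f h)) (fun h => Re (N h))).
    + intros h. transitivity (Re (f (t + h)%R - f t)). easy. rewrite E. cbn. unfold Re. ring.
    + now apply continuous_Re.
  - apply (Rderiv_slope (fun h => Im (f h)) (fun h => Im (N h))).
    + intros h. transitivity (Im (f (t + h)%R - f t)). easy. rewrite E. cbn. unfold Im. ring.
    + now apply continuous_Im.
Qed.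

(** Rescaling to [0,1] extracts the factor h; the formula also covers h = 0 and negative h. *)
Lemma CRInt_segment (G : R -> C) t h : (forall x, ccont G x) ->
  CRInt G t (t + h) = RtoC h * CRInt (fun s => G (t + h * s)%R) 0 1.
Proof.
  intros H.
  assert (Hc : forall x, ccont (fun s => G (t + h * s)%R) x).
  { intros x. apply (continuous_comp (fun s => (t + h * s)%R) (G : R -> C_UniformSpace)); auto.
    apply continuous_Rp. apply continuous_const. apply continuous_Rm. apply continuous_const. apply continuous_id. }
  rewrite <- CRInt_scal by now apply exI_cont_all.
  transitivity (CRInt G (h * 0 + t) (h * 1 + t)).
  { f_equal; ring. }
  rewrite CRInt_comp_lin by now apply exI_cont_all.
  apply CRInt_ext. intros x _. now rewrite Rplus_comm.
Qed.

Ltac cont2 F H :=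
  match goal with |- continuous _ ?u =>
    apply (continuous_comp_2 (V := R_UniformSpace) (W := R_UniformSpace) _ _ (F : R -> R -> C_UniformSpace) u); [| |apply H]
  end.

Lemma continuous_pfst {U V : UniformSpace} (z : U * V) : continuous fst z.
Proof. destruct z. apply continuous_fst. Qed.

Lemma continuous_psnd {U V : UniformSpace} (z : U * V) : continuous snd z.
Proof. destruct z. apply continuous_snd. Qed.

Ltac contR := repeat match goal with
  | |- continuous (fun _ => ?c) _ => apply continuous_const
  | |- continuous (fun x => x) _ => apply continuous_id
  | |- continuous (fun z => fst z) _ => apply continuous_pfst
  | |- continuous (fun z => snd z) _ => apply continuous_psnd
  | |- continuous fst _ => apply continuous_pfst
  | |- continuous snd _ => apply continuous_psnd
  | |- continuous (fun z => fst (fst z)) _ => apply (continuous_comp fst fst)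
  | |- continuous (fun z => snd (fst z)) _ => apply (continuous_comp fst snd)
  | |- continuous (fun z => Rplus _ _) _ => apply continuous_Rp
  | |- continuous (fun z => Rminus _ _) _ => apply continuous_Rmi
  | |- continuous (fun z => Rmult _ _) _ => apply continuous_Rm
  | |- continuous (fun z => Ropp _) _ => apply continuous_Ro
  | |- continuous (Rplus ?a) _ => apply (continuous_Rp (fun _ => a) (fun x => x))
  | |- continuous (Rminus ?a) _ => apply (continuous_Rmi (fun _ => a) (fun x => x))
  | |- continuous (Rmult ?a) _ => apply (continuous_Rm (fun _ => a) (fun x => x))
  end.

Section Fubini.
Variable F : R -> R -> C.
Hypothesis HF : forall z, ccont (fun z : R * R => F (fst z) (snd z)) z.

Lemma cont_fst x y : ccont (fun x => F x y) x.
Proof. cont2 F HF; contR. Qed.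

Lemma cont_snd x y : ccont (fun y => F x y) y.
Proof. cont2 F HF; contR. Qed.

(** The difference quotient in t is a double integral over fixed bounds, continuous in h. Nothing is
    differentiated under the integral sign, so continuity of [F] suffices. *)
Lemma Cderiv_RInt_inner a c d t : (c <= d)%R ->
  Cderiv (fun t => CRInt (fun y => CRInt (fun x => F x y) a t) c d) t (CRInt (F t) c d).
Proof.
  intros Hcd.
  set (N := fun h => CRInt (fun y => CRInt (fun s => F (t + h * s)%R y) 0 1) c d).
  assert (C3 : forall z : (R * R) * R, ccont (fun z : (R * R) * R => F (t + fst (fst z) * snd z)%R (snd (fst z))) z).
  { intros z. cont2 F HF; contR. }
  assert (C2 : forall z : R * R, ccont (fun z : R * R => CRInt (fun s => F (t + fst z * s)%R (snd z)) 0 1) z).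
  { intros z. apply (continuous_RInt_param_all (fun (z : R * R) s => F (t + fst z * s)%R (snd z))); auto. lra. }
  assert (I : forall s y, ccont (fun y => CRInt (fun x => F x y) s t) y).
  { intros s y.
    assert (forall h, ccont (fun y => RtoC h * CRInt (fun u => F (s + h * u)%R y) 0 1) y).
    { intros h. apply continuous_Cmult. apply continuous_const.
      apply (continuous_RInt_param_all (fun y u => F (s + h * u)%R y)). lra.
      intros z. cont2 F HF; contR. }
    apply continuous_ext with (fun y => RtoC (t - s) * CRInt (fun u => F (s + (t - s) * u)%R y) 0 1).
    intros v. rewrite <- (CRInt_segment (fun x => F x v)). f_equal; ring. intros; apply cont_fst. auto. }
  replace (CRInt (F t) c d) with (N 0%R).
  2:{ unfold N. apply CRInt_ext. intros y _. rewrite <- (Cmult_1_l (F t y)).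
      transitivity (CRInt (fun _ => F t y) 0 1).
      - apply CRInt_ext. intros s _. f_equal; ring.
      - rewrite CRInt_const. f_equal. f_equal. ring. }
  apply Cderiv_slope.
  - intros h. unfold N. rewrite <- CRInt_scal.
    2:{ apply exI_cont_all. intros y.
        apply (continuous_slice (fun h y => CRInt (fun s => F (t + h * s)%R y) 0 1)). apply C2. }
    assert (J : exI (fun y => CRInt (fun x => F x y) a t) c d) by now apply exI_cont_all.
    assert (S : forall y, CRInt (fun x => F x y) a (t + h) = CRInt (fun x => F x y) a t + RtoC h * CRInt (fun s => F (t + h * s)%R y) 0 1).
    { intros y. rewrite <- (CRInt_segment (fun x => F x y)) by (intros; apply cont_fst).
      symmetry; apply CRInt_Chasles; apply exI_cont_all; intros; apply cont_fst. }
    rewrite (CRInt_ext _ _ c d (fun y _ => S y)).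
    rewrite CRInt_plus; auto. ring.
    apply exI_scal, exI_cont_all. intros y.
    apply (continuous_slice (fun h y => CRInt (fun s => F (t + h * s)%R y) 0 1)). apply C2.
  - unfold N. refine (continuous_RInt_param_all (fun h y => CRInt (fun s => F (t + h * s)%R y) 0 1) c d Hcd _ 0%R). intros z. apply C2.
Qed.

(** As functions of the upper bound t of x, both sides vanish at t = a and have the same
    derivative. *)
Lemma Fubini_all a b c d : (a <= b)%R -> (c <= d)%R ->
  CRInt (fun x => CRInt (fun y => F x y) c d) a b = CRInt (fun y => CRInt (fun x => F x y) a b) c d.
Proof.
  intros Hab Hcd.
  set (Phi := fun t => CRInt (fun x => CRInt (fun y => F x y) c d) a t - CRInt (fun y => CRInt (fun x => F x y) a t) c d).
  assert (E : Phi a = Phi b).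
  { apply Cderiv0_const; auto. intros t _.
    replace (RtoC 0) with (CRInt (F t) c d - CRInt (F t) c d) by ring.
    apply Cderiv_minus.
    - apply (Cderiv_RInt (fun x => CRInt (F x) c d)). apply continuous_RInt_param_all; auto.
    - now apply Cderiv_RInt_inner. }
  assert (Z : Phi a = 0).
  { unfold Phi. rewrite CRInt_point. rewrite (CRInt_ext _ (fun _ => RtoC 0) c d), CRInt_const. ring.
    intros; apply CRInt_point. }
  rewrite Z in E. unfold Phi in E.
  apply Ceq_minus. now rewrite E.
Qed.

(** The two orders of integration over 0 <= x <= u <= L are compared by differentiating in L, as for
    the rectangle. *)
Lemma triangle_Fubini L : (0 <= L)%R ->
  CRInt (fun x => CRInt (fun u => F x u) x L) 0 L = CRInt (fun u => CRInt (fun x => F x u) 0 u) 0 L.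
Proof.
  intros HL.
  assert (K : forall x t h, CRInt (F x) t (t + h) = RtoC h * CRInt (fun s => F x (t + h * s)%R) 0 1).
  { intros. apply CRInt_segment. intros; apply cont_snd. }
  assert (I : forall x a b, exI (F x) a b).
  { intros. apply exI_cont_all. intros; apply cont_snd. }
  assert (C1 : forall L x, ccont (fun x => CRInt (F x) x L) x).
  { intros M x. apply continuous_ext with (fun x => RtoC (M - x) * CRInt (fun s => F x (x + (M - x) * s)%R) 0 1).
    - intros y. rewrite <- K. f_equal; ring.
    - apply continuous_Cmult. apply continuous_RtoC; contR.
      apply (continuous_RInt_param_all (fun x s => F x (x + (M - x) * s)%R)). lra.
      intros z. cont2 F HF; contR. }
  assert (C2 : forall u, ccont (fun u => CRInt (fun x => F x u) 0 u) u).
  { intros u. apply continuous_ext with (fun u => RtoC u * CRInt (fun s => F (0 + u * s)%R u) 0 1).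
    - intros y. rewrite <- (CRInt_segment (fun x => F x y)). f_equal; ring. intros; apply cont_fst.
    - apply continuous_Cmult. apply continuous_RtoC; contR.
      apply (continuous_RInt_param_all (fun u s => F (0 + u * s)%R u)). lra.
      intros z. cont2 F HF; contR. }
  set (Phi := fun t => CRInt (fun x => CRInt (F x) x t) 0 t - CRInt (fun u => CRInt (fun x => F x u) 0 u) 0 t).
  assert (E : Phi 0%R = Phi L).
  { apply Cderiv0_const; auto. intros t [Ht _].
    replace (RtoC 0) with (CRInt (fun x => F x t) 0 t - CRInt (fun x => F x t) 0 t) by ring.
    apply Cderiv_minus; [|apply (Cderiv_RInt (fun u => CRInt (fun x => F x u) 0 u)); auto].
    (* Passing from t to t+h adds the rectangle 0 <= x <= t, t <= u <= t+h and a small triangle next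
       to the diagonal. Both are scaled to [0,1]; the second keeps a factor h and disappears at h =
       0. *)
    set (N := fun h => CRInt (fun x => CRInt (fun s => F x (t + h * s)%R) 0 1) 0 t
        + RtoC h * CRInt (fun r => RtoC (1 - r) * CRInt (fun s => F (t + h * r) ((t + h * r) + h * (1 - r) * s))%R 0 1) 0 1).
    assert (X1 : forall z : R * R, ccont (fun z : R * R => CRInt (fun s => F (snd z) (t + fst z * s)%R) 0 1) z).
    { intros z. apply (continuous_RInt_param_all (fun (z : R * R) s => F (snd z) (t + fst z * s)%R)). lra.
      intros w. cont2 F HF; contR. }
    assert (X2 : forall z : R * R, ccont (fun z : R * R => RtoC (1 - snd z) * CRInt (fun s => F (t + fst z * snd z) ((t + fst z * snd z) + fst z * (1 - snd z) * s))%R 0 1) z).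
    { intros z. apply continuous_Cmult. apply continuous_RtoC; contR.
      apply (continuous_RInt_param_all (fun (z : R * R) s => F (t + fst z * snd z) ((t + fst z * snd z) + fst z * (1 - snd z) * s))%R). lra.
      intros w. cont2 F HF; contR. }
    replace (CRInt (fun x => F x t) 0 t) with (N 0%R).
    2:{ unfold N. rewrite Cmult_0_l, Cplus_0_r. apply CRInt_ext. intros x _.
      transitivity (CRInt (fun _ => F x t) 0 1).
      - apply CRInt_ext. intros s _. f_equal; ring.
      - rewrite CRInt_const. rewrite Rminus_0_r. ring. }
    apply Cderiv_slope.
    - intros h.
      rewrite <- (CRInt_Chasles _ 0 t (t + h)) by now apply exI_cont_all.
      assert (S1 : forall x, CRInt (F x) x (t + h) = CRInt (F x) x t + RtoC h * CRInt (fun s => F x (t + h * s)%R) 0 1).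
      { intros x. rewrite <- K. symmetry. now apply CRInt_Chasles. }
      rewrite (CRInt_ext _ _ 0 t (fun x _ => S1 x)).
      assert (J : exI (fun x => CRInt (fun s => F x (t + h * s)%R) 0 1) 0 t).
      { apply exI_cont_all. intros y. apply (continuous_slice (fun h x => CRInt (fun s => F x (t + h * s)%R) 0 1)). apply X1. }
      rewrite CRInt_plus; [|now apply exI_cont_all|now apply exI_scal].
      rewrite CRInt_scal by auto.
      rewrite (CRInt_segment (fun x => CRInt (F x) x (t + h))) by auto.
      unfold N.
      rewrite (CRInt_ext (fun s => CRInt (F (t + h * s)%R) (t + h * s) (t + h))
         (fun r => RtoC h * (RtoC (1 - r) * CRInt (fun s => F (t + h * r) ((t + h * r) + h * (1 - r) * s))%R 0 1))).
      2:{ intros r _. rewrite Cmult_assoc, <- RtoC_mult, <- K. f_equal. ring. }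
      rewrite CRInt_scal. ring.
      apply exI_cont_all. intros y.
      apply (continuous_slice (fun h r => RtoC (1 - r) * CRInt (fun s => F (t + h * r) ((t + h * r) + h * (1 - r) * s))%R 0 1)). apply X2.
    - apply continuous_Cplus.
      + apply (continuous_RInt_param_all (fun h x => CRInt (fun s => F x (t + h * s)%R) 0 1)); auto.
      + apply continuous_Cmult. apply continuous_RtoC; contR.
        apply (continuous_RInt_param_all (fun h r => RtoC (1 - r) * CRInt (fun s => F (t + h * r) ((t + h * r) + h * (1 - r) * s))%R 0 1)); auto. lra. }
  assert (Z : Phi 0%R = 0).
  { unfold Phi. rewrite !CRInt_point. ring. }
  rewrite Z in E. unfold Phi in E.
  apply Ceq_minus. now rewrite E.
Qed.

End Fubini.

(** Continuity is meant in the plane, also at boundary points of the rectangle, so that no one-sided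
    notions are needed. *)
Definition cont_rect (F : R -> R -> C) (a b c d : R) : Prop :=
  forall x y, (a <= x <= b)%R -> (c <= y <= d)%R ->
  ccont (fun z : R * R => F (fst z) (snd z)) (x, y).

Lemma cont_clamp F a b c d : (a <= b)%R -> (c <= d)%R -> cont_rect F a b c d ->
  forall z, ccont (fun z : R * R => F (clamp a b (fst z)) (clamp c d (snd z))) z.
Proof.
  intros Hab Hcd H z.
  apply (continuous_comp_2 (fun z : R * R => clamp a b (fst z)) (fun z : R * R => clamp c d (snd z)) (F : R -> R -> C_UniformSpace)).
  - apply (continuous_comp fst (clamp a b)). contR. apply continuous_clamp.
  - apply (continuous_comp snd (clamp c d)). contR. apply continuous_clamp.
  - apply H; now apply clamp_in.
Qed.

Lemma cont_rect_in F a b c d x y : cont_rect F a b c d -> (a <= x <= b)%R -> (c <= y <= d)%R ->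
  ccont (fun x => F x y) x /\ ccont (fun y => F x y) y.
Proof.
  intros H Hx Hy. split.
  - apply (continuous_slice1 F x y). now apply H.
  - apply (continuous_slice F x y). now apply H.
Qed.

Lemma cont_rect_exI F a b c d x : (c <= d)%R -> cont_rect F a b c d -> (a <= x <= b)%R -> exI (F x) c d.
Proof.
  intros Hcd H Hx. apply exI_cont; auto. intros y Hy. eapply cont_rect_in; eauto.
Qed.

Lemma cont_rect_exI2 F a b c d : (a <= b)%R -> (c <= d)%R -> cont_rect F a b c d ->
  exI (fun x => CRInt (F x) c d) a b.
Proof.
  intros Hab Hcd H.
  apply exI_ext01 with (fun x => CRInt (fun y => F (clamp a b x) (clamp c d y)) c d); auto.
  - intros x Hx. apply CRInt_ext01; auto. intros y Hy. now rewrite !clamp_id.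
  - apply exI_cont_all. apply (continuous_RInt_param_all (fun x y => F (clamp a b x) (clamp c d y)) c d Hcd).
    exact (cont_clamp F a b c d Hab Hcd H).
Qed.

Lemma Fubini_rect F a b c d : (a <= b)%R -> (c <= d)%R -> cont_rect F a b c d ->
  CRInt (fun x => CRInt (fun y => F x y) c d) a b = CRInt (fun y => CRInt (fun x => F x y) a b) c d.
Proof.
  intros Hab Hcd H.
  transitivity (CRInt (fun x => CRInt (fun y => F (clamp a b x) (clamp c d y)) c d) a b).
  - apply CRInt_ext01; auto. intros x Hx. apply CRInt_ext01; auto. intros y Hy. now rewrite !clamp_id.
  - rewrite (Fubini_all (fun x y => F (clamp a b x) (clamp c d y)) (cont_clamp F a b c d Hab Hcd H) a b c d Hab Hcd).
    apply CRInt_ext01; auto. intros x Hx. apply CRInt_ext01; auto. intros y Hy. now rewrite !clamp_id.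
Qed.

Lemma cont_rect_flip F a b c d : cont_rect F a b c d -> cont_rect (fun y x => F x y) c d a b.
Proof.
  intros H y x Hy Hx.
  apply (continuous_comp_2 (fun z : R * R => snd z) (fun z : R * R => fst z) (F : R -> R -> C_UniformSpace)); contR.
  now apply H.
Qed.

(** Green's formula for P dx + Q dy: after integration in the suitable order, each half is the
    fundamental theorem of calculus. *)
Lemma Stokes_rect P Q DP DQ a b c d : (a <= b)%R -> (c <= d)%R ->
  (forall x y, (a <= x <= b)%R -> (c <= y <= d)%R -> Cderiv (fun x => Q x y) x (DQ x y)) ->
  (forall x y, (a <= x <= b)%R -> (c <= y <= d)%R -> Cderiv (fun y => P x y) y (DP x y)) ->
  cont_rect DP a b c d -> cont_rect DQ a b c d ->
  CRInt (fun x => CRInt (fun y => DQ x y - DP x y) c d) a b =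
  CRInt (fun y => Q b y - Q a y) c d - CRInt (fun x => P x d - P x c) a b.
Proof.
  intros Hab Hcd HQ HP CP CQ.
  rewrite (CRInt_ext01 _ (fun x => CRInt (DQ x) c d - CRInt (DP x) c d) a b); auto.
  2:{ intros x Hx. apply CRInt_minus; eapply cont_rect_exI; eauto. }
  rewrite CRInt_minus by now apply cont_rect_exI2.
  f_equal.
  - rewrite (Fubini_rect DQ) by auto. apply CRInt_ext01; auto. intros y Hy.
    apply (CRInt_FTC (fun x => Q x y)); auto. intros x Hx. eapply cont_rect_in; eauto.
  - apply CRInt_ext01; auto. intros x Hx.
    apply (CRInt_FTC (fun y => P x y)); auto. intros y Hy. eapply cont_rect_in; eauto.
Qed.

(** * Stokes for a loaded cell *)

Definition cont01 (F : R -> R -> C) : Prop := cont_rect F 0 1 0 1.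

Definition in01 (p : R) : Prop := (0 <= p <= 1)%R.

(** The partial derivatives are carried as explicit functions, so that identities between
    differential forms reduce to [ring] and [field]. *)
Record C1pq (f fp fq : R -> R -> C) : Prop := {
  C1_p : forall p q, in01 p -> in01 q -> Cderiv (fun h => f h q) p (fp p q);
  C1_q : forall p q, in01 p -> in01 q -> Cderiv (fun h => f p h) q (fq p q);
  C1_c : cont01 f;
  C1_cp : cont01 fp;
  C1_cq : cont01 fq }.

Lemma cont01_const c : cont01 (fun _ _ => c).
Proof. intros p q _ _. apply continuous_const. Qed.

Lemma cont01_plus (f g : R -> R -> C) : cont01 f -> cont01 g -> cont01 (fun p q => f p q + g p q).
Proof. intros H1 H2 p q Hp Hq. apply continuous_Cplus; [now apply H1|now apply H2]. Qed.

Lemma cont01_minus (f g : R -> R -> C) : cont01 f -> cont01 g -> cont01 (fun p q => f p q - g p q).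
Proof. intros H1 H2 p q Hp Hq. apply continuous_Cminus; [now apply H1|now apply H2]. Qed.

Lemma cont01_opp (f : R -> R -> C) : cont01 f -> cont01 (fun p q => - f p q).
Proof. intros H1 p q Hp Hq. apply continuous_Copp; now apply H1. Qed.

Lemma cont01_mult (f g : R -> R -> C) : cont01 f -> cont01 g -> cont01 (fun p q => f p q * g p q).
Proof. intros H1 H2 p q Hp Hq. apply continuous_Cmult; [now apply H1|now apply H2]. Qed.

Lemma cont01_inv (f : R -> R -> C) : (forall p q, in01 p -> in01 q -> f p q <> 0) -> cont01 f -> cont01 (fun p q => / f p q).
Proof. intros H H1 p q Hp Hq. apply continuous_Cinv; [now apply H|now apply H1]. Qed.

Lemma cont01_div (f g : R -> R -> C) : (forall p q, in01 p -> in01 q -> g p q <> 0) -> cont01 f -> cont01 g ->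
  cont01 (fun p q => f p q / g p q).
Proof. intros H H1 H2. apply cont01_mult; auto. now apply cont01_inv. Qed.

Lemma cont01_exp (f : R -> R -> C) : cont01 f -> cont01 (fun p q => Cexp (f p q)).
Proof. intros H1 p q Hp Hq. apply continuous_Cexp; now apply H1. Qed.

Lemma cont01_log (f : R -> R -> C) : (forall p q, in01 p -> in01 q -> offcut (f p q)) -> cont01 f -> cont01 (fun p q => Clog (f p q)).
Proof. intros H H1 p q Hp Hq. apply continuous_Clog; [now apply H|now apply H1]. Qed.

Lemma cont01_ext f g : (forall p q, f p q = g p q) -> cont01 f -> cont01 g.
Proof. intros E H p q Hp Hq. apply continuous_ext with (fun z : R * R => f (fst z) (snd z)). intros; apply E. now apply H. Qed.

Lemma cont01_p (f : R -> C) : (forall p, ccont f p) -> cont01 (fun p _ => f p).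
Proof. intros H p q _ _. apply (continuous_comp fst (f : R -> C_UniformSpace)); [apply continuous_fst|apply H]. Qed.

Lemma cont01_q (f : R -> C) : (forall p, ccont f p) -> cont01 (fun _ q => f q).
Proof. intros H p q _ _. apply (continuous_comp snd (f : R -> C_UniformSpace)); [apply continuous_snd|apply H]. Qed.

Ltac c01 := repeat match goal with
  | H : cont01 ?f |- cont01 ?f => exact H
  | |- cont01 (fun _ _ => ?c) => apply (cont01_const c)
  | |- cont01 (fun p q => _ + _) => apply cont01_plus
  | |- cont01 (fun p q => _ - _) => apply cont01_minus
  | |- cont01 (fun p q => - _) => apply cont01_opp
  | |- cont01 (fun p q => _ * _) => apply cont01_mult
  | |- cont01 (fun p q => Cexp _) => apply cont01_exp
  end.

Lemma continuous_RtoC_R (f : R -> R) (x : R) : ex_derive f x -> ccont (fun u => RtoC (f u)) x.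
Proof. intros H. now apply continuous_RtoC, (ex_derive_continuous (V := R_NormedModule)). Qed.

Ltac cC := repeat match goal with
  | |- continuous (fun _ => ?c) _ => apply continuous_const
  | |- continuous (fun x => Cplus _ _) _ => apply continuous_Cplus
  | |- continuous (fun x => Cminus _ _) _ => apply continuous_Cminus
  | |- continuous (fun x => Copp _) _ => apply continuous_Copp
  | |- continuous (fun x => Cmult _ _) _ => apply continuous_Cmult
  | |- continuous (fun x => Cexp _) _ => apply continuous_Cexp
  | |- continuous (fun x => Clog _) _ => apply continuous_Clog
  | |- continuous (fun x => RtoC _) _ => apply continuous_RtoC_R; auto_derive; auto
  end.

Lemma C1pq_const c : C1pq (fun _ _ => c) (fun _ _ => 0) (fun _ _ => 0).
Proof. split; [intros; apply Cderiv_const|intros; apply Cderiv_const| | |]; apply cont01_const. Qed.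

Lemma C1pq_plus (f fp fq g gp gq : R -> R -> C) : C1pq f fp fq -> C1pq g gp gq ->
  C1pq (fun p q => f p q + g p q) (fun p q => fp p q + gp p q) (fun p q => fq p q + gq p q).
Proof.
  intros [A1 A2 A3 A4 A5] [B1 B2 B3 B4 B5]. split; [| |now apply cont01_plus|now apply cont01_plus|now apply cont01_plus].
  - intros. apply Cderiv_plus; auto.
  - intros. apply Cderiv_plus; auto.
Qed.

Lemma C1pq_minus (f fp fq g gp gq : R -> R -> C) : C1pq f fp fq -> C1pq g gp gq ->
  C1pq (fun p q => f p q - g p q) (fun p q => fp p q - gp p q) (fun p q => fq p q - gq p q).
Proof.
  intros [A1 A2 A3 A4 A5] [B1 B2 B3 B4 B5]. split; [| |now apply cont01_minus|now apply cont01_minus|now apply cont01_minus].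
  - intros. apply Cderiv_minus; auto.
  - intros. apply Cderiv_minus; auto.
Qed.

Lemma C1pq_mult (f fp fq g gp gq : R -> R -> C) : C1pq f fp fq -> C1pq g gp gq ->
  C1pq (fun p q => f p q * g p q) (fun p q => fp p q * g p q + f p q * gp p q)
    (fun p q => fq p q * g p q + f p q * gq p q).
Proof.
  intros [A1 A2 A3 A4 A5] [B1 B2 B3 B4 B5]. split; [| |c01|c01|c01].
  - intros. apply (Cderiv_mult (fun h => f h q) (fun h => g h q)); auto.
  - intros. apply (Cderiv_mult (fun h => f p h) (fun h => g p h)); auto.
Qed.

Lemma C1pq_exp (f fp fq : R -> R -> C) : C1pq f fp fq ->
  C1pq (fun p q => Cexp (f p q)) (fun p q => Cexp (f p q) * fp p q) (fun p q => Cexp (f p q) * fq p q).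
Proof.
  intros [A1 A2 A3 A4 A5]. split; [| |c01|c01|c01].
  - intros. apply (Cderiv_Cexp (fun h => f h q)); auto.
  - intros. apply (Cderiv_Cexp (fun h => f p h)); auto.
Qed.

Lemma C1pq_log (f fp fq : R -> R -> C) : (forall p q, in01 p -> in01 q -> offcut (f p q)) -> C1pq f fp fq ->
  C1pq (fun p q => Clog (f p q)) (fun p q => fp p q / f p q) (fun p q => fq p q / f p q).
Proof.
  intros H [A1 A2 A3 A4 A5].
  assert (forall p q, in01 p -> in01 q -> f p q <> 0) by (intros; now apply offcut_neq0, H).
  split; [| |now apply cont01_log|now apply cont01_div|now apply cont01_div].
  - intros. apply (Cderiv_Clog (fun h => f h q)); auto.
  - intros. apply (Cderiv_Clog (fun h => f p h)); auto.
Qed.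

Lemma C1pq_ext f fp fq g gp gq :
  (forall p q, f p q = g p q) -> (forall p q, fp p q = gp p q) -> (forall p q, fq p q = gq p q) ->
  C1pq f fp fq -> C1pq g gp gq.
Proof.
  intros E1 E2 E3 [A1 A2 A3 A4 A5]. split.
  - intros. rewrite <- E2. apply Cderiv_ext with (fun h => f h q); auto.
  - intros. rewrite <- E3. apply Cderiv_ext with (fun h => f p h); auto.
  - eapply cont01_ext; eauto.
  - eapply cont01_ext; eauto.
  - eapply cont01_ext; eauto.
Qed.

Lemma C1pq_p (f g : R -> C) : (forall p, Cderiv f p (g p)) -> (forall p, ccont g p) ->
  C1pq (fun p _ => f p) (fun p _ => g p) (fun _ _ => 0).
Proof.
  intros H1 H2. split; [| | |now apply cont01_p|apply cont01_const].
  - auto.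
  - intros; apply Cderiv_const.
  - apply cont01_p. intros p. eapply Cderiv_continuous; eauto.
Qed.

Lemma C1pq_q (f g : R -> C) : (forall p, Cderiv f p (g p)) -> (forall p, ccont g p) ->
  C1pq (fun _ q => f q) (fun _ _ => 0) (fun _ q => g q).
Proof.
  intros H1 H2. split; [| | |apply cont01_const|now apply cont01_q].
  - intros; apply Cderiv_const.
  - auto.
  - apply cont01_q. intros p. eapply Cderiv_continuous; eauto.
Qed.

Definition tau : C := (0, 2 * PI)%R.

Lemma Cderiv_circlog e p : Cderiv (circlog e) p tau.
Proof.
  split; cbn.
  - apply is_derive_Reals, derivable_pt_lim_const.
  - eapply Rderiv_eq. apply (is_derive_scal (fun t => t) p (2 * PI)%R). apply (is_derive_id (K := R_AbsRing)).
    apply Rmult_1_r.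
Qed.

Lemma circ_exp e p : (0 < e)%R -> Cexp (circlog e p) = circ e p.
Proof.
  intros He. unfold circ, Cexp, circlog. apply C_ext; cbn; rewrite exp_ln, exp_0 by auto; ring.
Qed.

Lemma circ_exp0 e p : circ e p = RtoC e * Cexp (RtoC p * tau).
Proof. unfold circ, tau. f_equal. f_equal. apply C_ext; cbn; ring. Qed.

Lemma Cderiv_id p : Cderiv RtoC p 1.
Proof. apply Cderiv_RtoC. apply (is_derive_id (K := R_AbsRing)). Qed.

Lemma Cderiv_circ e p : Cderiv (circ e) p (tau * circ e p).
Proof.
  apply Cderiv_ext with (fun p => RtoC e * Cexp (RtoC p * tau)). intros; now rewrite circ_exp0.
  eapply Cderiv_eq. apply Cderiv_mult. apply Cderiv_const.
  apply Cderiv_Cexp. apply Cderiv_mult. apply Cderiv_id. apply Cderiv_const.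
  rewrite circ_exp0. ring.
Qed.

Lemma ccont_circ e p : ccont (circ e) p.
Proof. eapply Cderiv_continuous, Cderiv_circ. Qed.

Lemma ccont_circlog e p : ccont (circlog e) p.
Proof. eapply Cderiv_continuous, Cderiv_circlog. Qed.

Lemma Cmod_circ e p : (0 < e)%R -> Cmod (circ e p) = e.
Proof. intros He. rewrite <- circ_exp, Cmod_Cexp by auto. cbn. now apply exp_ln. Qed.

Lemma Re_circ e p : (0 < e)%R -> (- e <= Re (circ e p) <= e)%R.
Proof.
  intros He. assert (H := Re_le_Cmod (circ e p)). rewrite Cmod_circ in H by auto.
  revert H. unfold Rabs. destruct Rcase_abs; lra.
Qed.

Lemma circ_neq0 e p : (0 < e)%R -> circ e p <> 0.
Proof. intros He. rewrite <- circ_exp by auto. apply Cexp_neq0. Qed.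

Lemma C1pq_circ_p e : C1pq (fun p _ => circ e p) (fun p _ => tau * circ e p) (fun _ _ => 0).
Proof.
  apply C1pq_p. apply Cderiv_circ. intros. apply continuous_Cmult. apply continuous_const. apply ccont_circ.
Qed.

Lemma C1pq_circ_q e : C1pq (fun _ q => circ e q) (fun _ _ => 0) (fun _ q => tau * circ e q).
Proof.
  apply C1pq_q. apply Cderiv_circ. intros. apply continuous_Cmult. apply continuous_const. apply ccont_circ.
Qed.

(** The derivatives are left as quotients dl / l, uncancelled, because this is the shape in which
    the Stokes lemma for cells expects the derivatives of its logarithms. *)
Lemma C1pq_circlog_p e : (0 < e)%R ->
  C1pq (fun p _ => circlog e p) (fun p _ => tau * circ e p / circ e p) (fun p _ => 0 / circ e p).
Proof.
  intros He. eapply C1pq_ext; [| | |apply (C1pq_p (circlog e) (fun _ => tau))].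
  - easy.
  - intros; cbn. field. now apply circ_neq0.
  - intros; cbn. field. now apply circ_neq0.
  - apply Cderiv_circlog.
  - intros; apply continuous_const.
Qed.

Lemma C1pq_circlog_q e : (0 < e)%R ->
  C1pq (fun _ q => circlog e q) (fun _ q => 0 / circ e q) (fun _ q => tau * circ e q / circ e q).
Proof.
  intros He. eapply C1pq_ext; [| | |apply (C1pq_q (circlog e) (fun _ => tau))].
  - easy.
  - intros; cbn. field. now apply circ_neq0.
  - intros; cbn. field. now apply circ_neq0.
  - apply Cderiv_circlog.
  - intros; apply continuous_const.
Qed.

Lemma C1pq_RtoC_p : C1pq (fun p _ => RtoC p) (fun _ _ => 1) (fun _ _ => 0).
Proof. apply (C1pq_p RtoC (fun _ => RtoC 1)). apply Cderiv_id. intros; apply continuous_const. Qed.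

Lemma C1pq_RtoC_q : C1pq (fun _ q => RtoC q) (fun _ _ => 0) (fun _ _ => 1).
Proof. apply (C1pq_q RtoC (fun _ => RtoC 1)). apply Cderiv_id. intros; apply continuous_const. Qed.

Definition pow3 (w0 w1 w2 a b c : C) : C := Cexp (w0 * a + w1 * b + w2 * c).

Lemma int2_lin3 (f g h : R -> R -> C) (a b c : C) : cont01 f -> cont01 g -> cont01 h ->
  CRInt (fun p => CRInt (fun q => a * f p q + b * g p q + c * h p q) 0 1) 0 1
  = a * CRInt (fun p => CRInt (f p) 0 1) 0 1 + b * CRInt (fun p => CRInt (g p) 0 1) 0 1
    + c * CRInt (fun p => CRInt (h p) 0 1) 0 1.
Proof.
  intros Hf Hg Hh.
  assert (I1 : forall k p, cont01 k -> in01 p -> exI (k p) 0 1).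
  { intros k p Hk Hp. exact (cont_rect_exI k 0 1 0 1 p Rle_0_1 Hk Hp). }
  assert (I2 : forall k, cont01 k -> exI (fun p => CRInt (k p) 0 1) 0 1).
  { intros k Hk. exact (cont_rect_exI2 k 0 1 0 1 Rle_0_1 Rle_0_1 Hk). }
  rewrite (CRInt_ext01 _ (fun p => a * CRInt (f p) 0 1 + b * CRInt (g p) 0 1 + c * CRInt (h p) 0 1) 0 1 Rle_0_1).
  - rewrite !CRInt_plus, !CRInt_scal; auto using exI_plus, exI_scal.
  - intros p Hp. rewrite !CRInt_plus, !CRInt_scal; auto using exI_plus, exI_scal.
Qed.

Lemma Cderiv_scal (c : C) (f : R -> C) t l : Cderiv f t l -> Cderiv (fun h => c * f h) t (c * l).
Proof.
  intros H. apply Cderiv_eq with (0 * f t + c * l); [|ring].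
  apply (Cderiv_mult (fun _ => c) f); auto. apply Cderiv_const.
Qed.

Section CellStokes.
Variables (x xp xq y yp yq L0 L1 L2 xpq ypq : R -> R -> C).
Let z p q := 1 - x p q - y p q.
Let zp p q := - xp p q - yp p q.
Let zq p q := - xq p q - yq p q.
Hypotheses (Hx : C1pq x xp xq) (Hy : C1pq y yp yq).
Hypotheses (Hxpq : forall p q, in01 p -> in01 q -> Cderiv (fun h => xp p h) q (xpq p q))
  (Hxqp : forall p q, in01 p -> in01 q -> Cderiv (fun h => xq h q) p (xpq p q))
  (Hypq : forall p q, in01 p -> in01 q -> Cderiv (fun h => yp p h) q (ypq p q))
  (Hyqp : forall p q, in01 p -> in01 q -> Cderiv (fun h => yq h q) p (ypq p q))
  (Cxpq : cont01 xpq) (Cypq : cont01 ypq).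
Hypotheses (HL0 : C1pq L0 (fun p q => xp p q / x p q) (fun p q => xq p q / x p q))
  (HL1 : C1pq L1 (fun p q => yp p q / y p q) (fun p q => yq p q / y p q))
  (HL2 : C1pq L2 (fun p q => zp p q / z p q) (fun p q => zq p q / z p q)).
Hypotheses (E0 : forall p q, in01 p -> in01 q -> Cexp (L0 p q) = x p q)
  (E1 : forall p q, in01 p -> in01 q -> Cexp (L1 p q) = y p q)
  (E2 : forall p q, in01 p -> in01 q -> Cexp (L2 p q) = z p q).

(** The integral of l_0^w0 l_1^w1 l_2^w2 dl_0 dl_1 over a cell with l_0 = x, l_1 = y, l_2 = z, the
    branch being fixed by the logarithms L0, L1, L2. *)
Definition cell_int (w0 w1 w2 : C) : C :=
  CRInt (fun p => CRInt (fun q =>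
    pow3 w0 w1 w2 (L0 p q) (L1 p q) (L2 p q) * (xp p q * yq p q - xq p q * yp p q)) 0 1) 0 1.

Lemma cell_int_cont w0 w1 w2 : cont01 (fun p q =>
  pow3 w0 w1 w2 (L0 p q) (L1 p q) (L2 p q) * (xp p q * yq p q - xq p q * yp p q)).
Proof.
  destruct Hx, Hy, HL0, HL1, HL2. unfold pow3. c01.
Qed.

Lemma cell_int_lin a b c (u v w u' v' w' u'' v'' w'' : C) :
  CRInt (fun p => CRInt (fun q =>
    (a * pow3 u v w (L0 p q) (L1 p q) (L2 p q) + b * pow3 u' v' w' (L0 p q) (L1 p q) (L2 p q)
    + c * pow3 u'' v'' w'' (L0 p q) (L1 p q) (L2 p q)) * (xp p q * yq p q - xq p q * yp p q)) 0 1) 0 1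
  = a * cell_int u v w + b * cell_int u' v' w' + c * cell_int u'' v'' w''.
Proof.
  unfold cell_int. rewrite <- (int2_lin3 _ _ _ a b c (cell_int_cont u v w) (cell_int_cont u' v' w') (cell_int_cont u'' v'' w'')).
  apply CRInt_ext. intros p _. apply CRInt_ext. intros q _. ring.
Qed.

(* Stokes for the form l_0^w0 l_1^w1 l_2^w2 (a dl_0 + b dl_1). *)
Lemma cell_Stokes (a b w0 w1 w2 : C) :
  let G p q := pow3 w0 w1 w2 (L0 p q) (L1 p q) (L2 p q) in
  b * w0 * cell_int (w0 - 1) w1 w2 - a * w1 * cell_int w0 (w1 - 1) w2 + (a - b) * w2 * cell_int w0 w1 (w2 - 1)
  = CRInt (fun q => G 1%R q * (a * xq 1%R q + b * yq 1%R q) - G 0%R q * (a * xq 0%R q + b * yq 0%R q)) 0 1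
  - CRInt (fun p => G p 1%R * (a * xp p 1%R + b * yp p 1%R) - G p 0%R * (a * xp p 0%R + b * yp p 0%R)) 0 1.
Proof.
  intros G.
  set (LL := fun p q => w0 * L0 p q + w1 * L1 p q + w2 * L2 p q).
  set (Lp := fun p q => w0 * (xp p q / x p q) + w1 * (yp p q / y p q) + w2 * (zp p q / z p q)).
  set (Lq := fun p q => w0 * (xq p q / x p q) + w1 * (yq p q / y p q) + w2 * (zq p q / z p q)).
  assert (HLL : C1pq LL Lp Lq).
  { assert (A := C1pq_plus _ _ _ _ _ _ (C1pq_plus _ _ _ _ _ _ (C1pq_mult _ _ _ _ _ _ (C1pq_const w0) HL0) (C1pq_mult _ _ _ _ _ _ (C1pq_const w1) HL1)) (C1pq_mult _ _ _ _ _ _ (C1pq_const w2) HL2)).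
    eapply C1pq_ext; [| | |exact A]; intros; unfold LL, Lp, Lq; cbv beta; ring. }
  assert (HG : C1pq G (fun p q => G p q * Lp p q) (fun p q => G p q * Lq p q)).
  { apply (C1pq_exp LL); auto. }
  assert (N0 : forall p q, in01 p -> in01 q -> x p q <> 0) by (intros; rewrite <- E0 by auto; apply Cexp_neq0).
  assert (N1 : forall p q, in01 p -> in01 q -> y p q <> 0) by (intros; rewrite <- E1 by auto; apply Cexp_neq0).
  assert (N2 : forall p q, in01 p -> in01 q -> z p q <> 0) by (intros; rewrite <- E2 by auto; apply Cexp_neq0).
  (* The mixed second derivatives enter [DQ] and [DP] alike and drop out of the difference, as d of
     dl_i is 0. *)
  set (DQ := fun p q => G p q * Lp p q * (a * xq p q + b * yq p q) + G p q * (a * xpq p q + b * ypq p q)).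
  set (DP := fun p q => G p q * Lq p q * (a * xp p q + b * yp p q) + G p q * (a * xpq p q + b * ypq p q)).
  rewrite <- (Stokes_rect (fun p q => G p q * (a * xp p q + b * yp p q)) (fun p q => G p q * (a * xq p q + b * yq p q)) DP DQ); try lra.
  - transitivity ((b * w0) * cell_int (w0 - 1) w1 w2 + (- a * w1) * cell_int w0 (w1 - 1) w2
      + ((a - b) * w2) * cell_int w0 w1 (w2 - 1)); [ring|]. rewrite <- cell_int_lin.
    apply CRInt_ext01. lra. intros p Hp. apply CRInt_ext01. lra. intros q Hq.
    assert (P0 : pow3 (w0 - 1) w1 w2 (L0 p q) (L1 p q) (L2 p q) = G p q / x p q).
    { unfold G, pow3. rewrite <- E0 by auto. unfold Cdiv. rewrite <- Cexp_opp, <- Cexp_add. f_equal. ring. }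
    assert (P1 : pow3 w0 (w1 - 1) w2 (L0 p q) (L1 p q) (L2 p q) = G p q / y p q).
    { unfold G, pow3. rewrite <- E1 by auto. unfold Cdiv. rewrite <- Cexp_opp, <- Cexp_add. f_equal. ring. }
    assert (P2 : pow3 w0 w1 (w2 - 1) (L0 p q) (L1 p q) (L2 p q) = G p q / z p q).
    { unfold G, pow3. rewrite <- E2 by auto. unfold Cdiv. rewrite <- Cexp_opp, <- Cexp_add. f_equal. ring. }
    rewrite P0, P1, P2. unfold DQ, DP, Lp, Lq, zp, zq. field.
    repeat split; auto.
  - intros p q Hp Hq. unfold DQ. apply (Cderiv_mult (fun h => G h q) (fun h => a * xq h q + b * yq h q)).
    + exact (C1_p _ _ _ HG p q Hp Hq).
    + apply (Cderiv_plus (fun h => a * xq h q) (fun h => b * yq h q)); apply Cderiv_scal; auto.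
  - intros p q Hp Hq. unfold DP. apply (Cderiv_mult (fun h => G p h) (fun h => a * xp p h + b * yp p h)).
    + exact (C1_q _ _ _ HG p q Hp Hq).
    + apply (Cderiv_plus (fun h => a * xp p h) (fun h => b * yp p h)); apply Cderiv_scal; auto.
  - destruct HG, HLL, Hx, Hy. unfold DP. change (cont01 DP). unfold DP. c01.
  - destruct HG, HLL, Hx, Hy. change (cont01 DQ). unfold DQ. c01.
Qed.

(** Multiply the integrand by l_0 + l_1 + l_2 = 1. *)
Lemma cell_int_sum w0 w1 w2 :
  cell_int (w0 + 1) w1 w2 + cell_int w0 (w1 + 1) w2 + cell_int w0 w1 (w2 + 1) = cell_int w0 w1 w2.
Proof.
  transitivity (1 * cell_int (w0 + 1) w1 w2 + 1 * cell_int w0 (w1 + 1) w2 + 1 * cell_int w0 w1 (w2 + 1)).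
  ring. rewrite <- cell_int_lin.
  apply CRInt_ext01. lra. intros p Hp. apply CRInt_ext01. lra. intros q Hq.
  f_equal. unfold pow3.
  replace ((w0 + 1) * L0 p q + w1 * L1 p q + w2 * L2 p q) with (L0 p q + (w0 * L0 p q + w1 * L1 p q + w2 * L2 p q)) by ring.
  replace (w0 * L0 p q + (w1 + 1) * L1 p q + w2 * L2 p q) with (L1 p q + (w0 * L0 p q + w1 * L1 p q + w2 * L2 p q)) by ring.
  replace (w0 * L0 p q + w1 * L1 p q + (w2 + 1) * L2 p q) with (L2 p q + (w0 * L0 p q + w1 * L1 p q + w2 * L2 p q)) by ring.
  rewrite !(Cexp_add (L0 p q)), !(Cexp_add (L1 p q)), !(Cexp_add (L2 p q)), E0, E1, E2 by auto.
  unfold z. ring.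
Qed.
End CellStokes.

(** * The regularized triangle as a twisted cycle *)

(** The factor c = exp (2 pi i w) that l^w acquires along a positive circle around l = 0. *)
Definition per (w : C) : C := Cexp (tau * w).

Lemma Cexp_tau : Cexp tau = 1.
Proof. unfold Cexp, tau. cbn. rewrite exp_0, cos_2PI, sin_2PI. apply C_ext; cbn; ring. Qed.

Lemma per_plus1 w : per (w + 1) = per w.
Proof.
  unfold per. replace (tau * (w + 1)) with (tau * w + tau) by ring. rewrite Cexp_add, Cexp_tau. ring.
Qed.

Lemma per_minus1 w : per (w - 1) = per w.
Proof. rewrite <- per_plus1. f_equal. ring. Qed.

Lemma circ_0 e : circ e 0 = RtoC e.
Proof.
  rewrite circ_exp0. replace (RtoC 0 * tau) with (RtoC 0) by ring. rewrite Cexp_0. ring.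
Qed.

Lemma circ_1 e : circ e 1 = RtoC e.
Proof.
  rewrite circ_exp0. replace (RtoC 1 * tau) with tau by ring. rewrite Cexp_tau. ring.
Qed.

Lemma circlog_0 e : circlog e 0 = RtoC (ln e).
Proof. unfold circlog. apply C_ext; cbn; ring. Qed.

Lemma circlog_1 e : circlog e 1 = RtoC (ln e) + tau.
Proof. unfold circlog, tau. apply C_ext; cbn; ring. Qed.

Lemma pow3_circ1 e w0 w1 w2 b c :
  pow3 w0 w1 w2 (circlog e 1) b c = per w0 * pow3 w0 w1 w2 (RtoC (ln e)) b c.
Proof.
  rewrite circlog_1. unfold pow3, per. rewrite <- Cexp_add. f_equal. ring.
Qed.

Lemma pow3_circ1' e w0 w1 w2 a c :
  pow3 w0 w1 w2 a (circlog e 1) c = per w1 * pow3 w0 w1 w2 a (RtoC (ln e)) c.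
Proof.
  rewrite circlog_1. unfold pow3, per. rewrite <- Cexp_add. f_equal. ring.
Qed.

Section Triangle.
Variable e : R.
Hypothesis he : (0 < e < 1 / 3)%R.

(** Collapsed coordinates on the triangle where all l_i >= e: the side p = 1 of the square is sent
    to one vertex and contributes nothing to the boundary. *)
Definition sx (p q : R) : C := RtoC (e + (1 - 3 * e) * p).
Definition sy (p q : R) : C := RtoC (e + (1 - 3 * e) * (1 - p) * q).
Definition sxp (p q : R) : C := RtoC (1 - 3 * e).
Definition syp (p q : R) : C := RtoC (- (1 - 3 * e) * q).
Definition syq (p q : R) : C := RtoC ((1 - 3 * e) * (1 - p)).

Definition ey (p q : R) : C := RtoC e + RtoC q * (1 - 2 * RtoC e - circ e p).
Definition eyp (p q : R) : C := - RtoC q * (tau * circ e p).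
Definition eyq (p q : R) : C := 1 - 2 * RtoC e - circ e p.

Definition lz (x y : R -> R -> C) (p q : R) : C := Clog (1 - x p q - y p q).

Definition tri_sigma : C -> C -> C -> C :=
  cell_int sxp (fun _ _ => 0) syp syq (fun p q => Clog (sx p q)) (fun p q => Clog (sy p q)) (lz sx sy).

Definition tri_edge : C -> C -> C -> C :=
  cell_int (fun p _ => tau * circ e p) (fun _ _ => 0) eyp eyq (fun p _ => circlog e p) (fun p q => Clog (ey p q))
    (lz (fun p _ => circ e p) ey).

Definition tri_vertex : C -> C -> C -> C :=
  cell_int (fun p _ => tau * circ e p) (fun _ _ => 0) (fun _ _ => 0) (fun _ q => tau * circ e q)
    (fun p _ => circlog e p) (fun _ q => circlog e q) (lz (fun p _ => circ e p) (fun _ q => circ e q)).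

Lemma RtoC3 : RtoC (1 - 3 * e) = 1 - 3 * RtoC e.
Proof. now rewrite RtoC_minus, RtoC_mult. Qed.

Lemma C1_sx : C1pq sx sxp (fun _ _ => 0).
Proof.
  eapply C1pq_ext; [| | |apply (C1pq_plus _ _ _ _ _ _ (C1pq_const (RtoC e)) (C1pq_mult _ _ _ _ _ _ (C1pq_const (RtoC (1 - 3 * e))) C1pq_RtoC_p))];
  intros; unfold sx, sxp; cbv beta; rewrite ?RtoC_plus, ?RtoC_mult, ?RtoC_minus; ring.
Qed.

Lemma C1_sy : C1pq sy syp syq.
Proof.
  eapply C1pq_ext; [| | |apply (C1pq_plus _ _ _ _ _ _ (C1pq_const (RtoC e)) (C1pq_mult _ _ _ _ _ _ (C1pq_const (RtoC (1 - 3 * e)))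
     (C1pq_mult _ _ _ _ _ _ (C1pq_minus _ _ _ _ _ _ (C1pq_const 1) C1pq_RtoC_p) C1pq_RtoC_q)))];
  intros; unfold sy, syp, syq; cbv beta; repeat first [rewrite RtoC_plus|rewrite RtoC_mult|rewrite RtoC_minus|rewrite RtoC_opp]; ring.
Qed.

Lemma C1_ey : C1pq ey eyp eyq.
Proof.
  eapply C1pq_ext; [| | |apply (C1pq_plus _ _ _ _ _ _ (C1pq_const (RtoC e)) (C1pq_mult _ _ _ _ _ _ C1pq_RtoC_q
     (C1pq_minus _ _ _ _ _ _ (C1pq_const (1 - 2 * RtoC e)) (C1pq_circ_p e))))];
  intros; unfold ey, eyp, eyq; cbv beta; ring.
Qed.

Lemma C1_lz (x xp xq y yp yq : R -> R -> C) : C1pq x xp xq -> C1pq y yp yq ->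
  (forall p q, in01 p -> in01 q -> offcut (1 - x p q - y p q)) ->
  C1pq (lz x y) (fun p q => (- xp p q - yp p q) / (1 - x p q - y p q)) (fun p q => (- xq p q - yq p q) / (1 - x p q - y p q)).
Proof.
  intros H1 H2 H3.
  assert (A := C1pq_minus _ _ _ _ _ _ (C1pq_minus _ _ _ _ _ _ (C1pq_const 1) H1) H2).
  eapply C1pq_ext; [| | |apply (C1pq_log _ _ _ H3 A)]; intros; unfold lz; cbv beta; try reflexivity; f_equal; ring.
Qed.

Lemma sx_pos p : in01 p -> (e <= e + (1 - 3 * e) * p)%R.
Proof. unfold in01. nra. Qed.

Lemma sy_pos p q : in01 p -> in01 q -> (e <= e + (1 - 3 * e) * (1 - p) * q)%R.
Proof.
  unfold in01. intros. assert (0 <= (1 - 3 * e) * ((1 - p) * q))%R by (repeat apply Rmult_le_pos; lra). lra.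
Qed.

Lemma sz_pos p q : in01 p -> in01 q -> (e <= 1 - (e + (1 - 3 * e) * p) - (e + (1 - 3 * e) * (1 - p) * q))%R.
Proof.
  unfold in01. intros. assert (0 <= (1 - 3 * e) * ((1 - p) * (1 - q)))%R by (repeat apply Rmult_le_pos; lra). nra.
Qed.

Lemma ey_Re p q : in01 q -> (e <= Re (ey p q))%R.
Proof.
  unfold in01. intros.
  assert (B := Re_circ e p ltac:(lra)).
  assert (E : Re (ey p q) = (e + q * (1 - 2 * e - Re (circ e p)))%R).
  { unfold ey. destruct (circ e p). cbn. ring. }
  rewrite E. nra.
Qed.

(** Replacing q by 1 - q exchanges l_1 and l_2 on the edge cell, so that estimates for l_1 carry
    over to l_2. *)
Lemma ez_eq p q : 1 - circ e p - ey p q = ey p (1 - q)%R.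
Proof. unfold ey. rewrite RtoC_minus. ring. Qed.

Lemma vz_Re p q : (e <= Re (1 - circ e p - circ e q)%C)%R.
Proof.
  assert (B := Re_circ e p ltac:(lra)). assert (B' := Re_circ e q ltac:(lra)). revert B B'. destruct (circ e p), (circ e q). cbn. lra.
Qed.

Lemma sz_RtoC p q : 1 - sx p q - sy p q = RtoC (1 - (e + (1 - 3 * e) * p) - (e + (1 - 3 * e) * (1 - p) * q)).
Proof. unfold sx, sy. now rewrite !RtoC_minus. Qed.

Lemma offcut_RtoC r : (0 < r)%R -> offcut (RtoC r).
Proof. intros. now apply offcut_Re. Qed.

Lemma offcut_e z : (e <= Re z)%R -> offcut z.
Proof. intros. apply offcut_Re. lra. Qed.

Lemma offcut_sx p q : in01 p -> offcut (sx p q).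
Proof. intros. apply offcut_e. now apply sx_pos. Qed.
Lemma offcut_sy p q : in01 p -> in01 q -> offcut (sy p q).
Proof. intros. apply offcut_e. now apply sy_pos. Qed.
Lemma offcut_sz p q : in01 p -> in01 q -> offcut (1 - sx p q - sy p q).
Proof. intros. rewrite sz_RtoC. apply offcut_e. now apply sz_pos. Qed.
Lemma offcut_ey p q : in01 q -> offcut (ey p q).
Proof. intros. now apply offcut_e, ey_Re. Qed.
Lemma in01_sub p : in01 p -> in01 (1 - p).
Proof. unfold in01; lra. Qed.
Lemma offcut_ez p q : in01 q -> offcut (1 - circ e p - ey p q).
Proof. intros. rewrite ez_eq. apply offcut_ey. now apply in01_sub. Qed.
Lemma offcut_vz p q : offcut (1 - circ e p - circ e q).
Proof. apply offcut_e, vz_Re. Qed.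

(** Integrand of l_0^w0 l_1^w1 l_2^w2 dl_1 along the side l_0 = e of the shrunken triangle, with l_1
    increasing. The other sides arise by permuting the weights. *)
Definition segi (w0 w1 w2 : C) (q : R) : C :=
  pow3 w0 w1 w2 (RtoC (ln e)) (Clog (RtoC (e + (1 - 3 * e) * q))) (Clog (RtoC (e + (1 - 3 * e) * (1 - q)))) * RtoC (1 - 3 * e).

Definition segm (w0 w1 w2 : C) : C := CRInt (segi w0 w1 w2) 0 1.

(** Integrand of l_0^w0 l_1^w1 l_2^w2 dl_0 along the circle of l_0 at l_1 = e, where edge cells meet
    the vertex tori. *)
Definition arci (w0 w1 w2 : C) (p : R) : C :=
  pow3 w0 w1 w2 (circlog e p) (RtoC (ln e)) (Clog (1 - circ e p - RtoC e)) * (tau * circ e p).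

Definition arc (w0 w1 w2 : C) : C := CRInt (arci w0 w1 w2) 0 1.

Lemma Clog_e : Clog (RtoC e) = RtoC (ln e).
Proof. apply Clog_RtoC; lra. Qed.

Lemma exI_segi w0 w1 w2 : exI (segi w0 w1 w2) 0 1.
Proof.
  apply exI_cont. lra. intros q Hq. unfold segi.
  unfold pow3. cC; apply offcut_RtoC; nra.
Qed.

Lemma offcut_arc p : offcut (1 - circ e p - RtoC e).
Proof.
  apply offcut_e. assert (B := Re_circ e p ltac:(lra)). revert B. destruct (circ e p). cbn. lra.
Qed.

Lemma exI_arci w0 w1 w2 : exI (arci w0 w1 w2) 0 1.
Proof.
  apply exI_cont. lra. intros q Hq. unfold arci.
  unfold pow3. cC; match goal with
    | |- offcut _ => apply offcut_arc
    | |- continuous (circ _) _ => apply ccont_circ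
    | |- continuous (circlog _) _ => apply ccont_circlog end.
Qed.

Lemma CRInt_flip (f : R -> C) : exI f 0 1 -> CRInt f 0 1 = CRInt (fun q => f (1 - q)%R) 0 1.
Proof.
  intros H.
  assert (H' : exI f (-1 * 0 + 1) (-1 * 1 + 1)).
  { replace (-1 * 0 + 1)%R with 1%R by ring. replace (-1 * 1 + 1)%R with 0%R by ring. now apply (ex_RInt_swap (V := C_R_NormedModule)). }
  assert (K := CRInt_comp_lin f (-1) 1 0 1 H').
  assert (J : exI (fun q => f (1 - q)%R) 0 1).
  { destruct H' as [l Hl]. apply (is_RInt_comp_lin (V := C_R_NormedModule)) in Hl.
    exists (RtoC (-1) * l).
    eapply (is_RInt_ext (V := C_R_NormedModule)); [|apply isI_scal; exact Hl].
    intros x _. cbv beta. replace (1 - x)%R with (-1 * x + 1)%R by ring.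
    destruct (f (-1 * x + 1)%R) as [u v].
    change (RtoC (-1) * (-1 * u, -1 * v)%R = (u, v)). apply C_ext; cbn; ring. }
  replace (-1 * 0 + 1)%R with 1%R in K by ring. replace (-1 * 1 + 1)%R with 0%R in K by ring.
  assert (S : CRInt f 0 1 + CRInt f 1 0 = 0).
  { rewrite CRInt_Chasles; auto. apply CRInt_point. now apply (ex_RInt_swap (V := C_R_NormedModule)). }
  replace (CRInt f 0 1) with (- CRInt f 1 0)
    by (transitivity (CRInt f 0 1 + CRInt f 1 0 - CRInt f 1 0); [rewrite S; ring|]; ring).
  rewrite K.
  rewrite (CRInt_ext _ (fun q => RtoC (-1) * f (1 - q)%R)).
  2:{ intros x _. f_equal. f_equal. ring. }
  rewrite CRInt_scal by exact J.
  replace (RtoC (-1)) with (- RtoC 1) by (apply C_ext; cbn; ring). ring.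
Qed.

Lemma segm_sym w0 w1 w2 : segm w0 w1 w2 = segm w0 w2 w1.
Proof.
  unfold segm. rewrite CRInt_flip by apply exI_segi.
  apply CRInt_ext. intros q _. unfold segi, pow3.
  replace (1 - (1 - q))%R with q by ring. f_equal. f_equal. ring.
Qed.

(** As dl_0 + dl_1 + dl_2 = 0, the form a dl_0 + b dl_1 restricts to b dl_1 on l_0 = e, to (a - b)
    dl_0 on l_2 = e and to a dl_0 on l_1 = e. The side p = 1 is degenerate. *)
Lemma tri_sigma_Stokes (a b w0 w1 w2 : C) :
  b * w0 * tri_sigma (w0 - 1) w1 w2 - a * w1 * tri_sigma w0 (w1 - 1) w2 + (a - b) * w2 * tri_sigma w0 w1 (w2 - 1)
  = - b * segm w0 w1 w2 - (a - b) * segm w2 w0 w1 + a * segm w1 w2 w0.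
Proof.
  unfold tri_sigma. rewrite (cell_Stokes sx sxp (fun _ _ => 0) sy syp syq _ _ _ (fun _ _ => 0) (fun _ _ => RtoC (- (1 - 3 * e)))).
  - rewrite (segm_sym w1).
    unfold segm. rewrite <- !CRInt_scal by apply exI_segi.
    rewrite (CRInt_ext01 _ (fun q => - b * segi w0 w1 w2 q) 0 1 Rle_0_1).
    rewrite (CRInt_ext01 (fun p => pow3 w0 w1 w2 (Clog (sx p 1)) _ _ * _ - _) (fun q => (a - b) * segi w2 w0 w1 q - a * segi w1 w0 w2 q) 0 1 Rle_0_1).
    + rewrite CRInt_minus by apply exI_scal, exI_segi. ring.
    + intros p Hp. unfold lz. rewrite !sz_RtoC. unfold sx, sy, sxp, syp, segi, pow3.
      replace (1 - (e + (1 - 3 * e) * p) - (e + (1 - 3 * e) * (1 - p) * 1))%R with e by ring.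
      replace (1 - (e + (1 - 3 * e) * p) - (e + (1 - 3 * e) * (1 - p) * 0))%R with (e + (1 - 3 * e) * (1 - p))%R by ring.
      replace (e + (1 - 3 * e) * (1 - p) * 1)%R with (e + (1 - 3 * e) * (1 - p))%R by ring.
      replace (e + (1 - 3 * e) * (1 - p) * 0)%R with e by ring.
      rewrite Clog_e, !Rmult_0_r, Rmult_1_r, RtoC_opp.
      set (X := Clog (RtoC (e + (1 - 3 * e) * p))). set (Y := Clog (RtoC (e + (1 - 3 * e) * (1 - p)))).
      replace (w2 * RtoC (ln e) + w0 * X + w1 * Y) with (w0 * X + w1 * Y + w2 * RtoC (ln e)) by ring.
      replace (w1 * RtoC (ln e) + w0 * X + w2 * Y) with (w0 * X + w1 * RtoC (ln e) + w2 * Y) by ring.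
      ring.
    + intros p Hp. unfold lz. rewrite !sz_RtoC. unfold sx, sy, syq, segi, pow3.
      replace (1 - 3 * e) with (1 - 3 * e) by ring.
      replace (e + (1 - 3 * e) * 0)%R with e by ring.
      replace (e + (1 - 3 * e) * (1 - 0) * p)%R with (e + (1 - 3 * e) * p)%R by ring.
      replace (1 - e - (e + (1 - 3 * e) * p))%R with (e + (1 - 3 * e) * (1 - p))%R by ring.
      rewrite Clog_e.
      replace ((1 - 3 * e) * (1 - 1))%R with 0%R by ring.
      replace ((1 - 3 * e) * (1 - 0))%R with (1 - 3 * e)%R by ring.
      ring.
  - apply C1_sx.
  - apply C1_sy.
  - intros; apply (Cderiv_const (RtoC (1 - 3 * e))).
  - intros; apply (Cderiv_const 0).
  - intros; unfold syp. apply (Cderiv_RtoC (fun h => - (1 - 3 * e) * h)%R). auto_derive; auto. ring.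
  - intros; unfold syq. apply (Cderiv_RtoC (fun h => (1 - 3 * e) * (1 - h))%R). auto_derive; auto. ring.
  - apply cont01_const.
  - apply cont01_const.
  - apply (C1pq_log sx); [intros; now apply offcut_sx|apply C1_sx].
  - apply (C1pq_log sy); [intros; now apply offcut_sy|apply C1_sy].
  - apply (C1_lz sx sxp (fun _ _ => 0) sy syp syq). apply C1_sx. apply C1_sy. intros; now apply offcut_sz.
  - intros; apply Cexp_Clog. now apply offcut_sx.
  - intros; apply Cexp_Clog. now apply offcut_sy.
  - intros; apply Cexp_Clog. now apply offcut_sz.
Qed.

Lemma ey_0 p : ey p 0 = RtoC e.
Proof. unfold ey. ring. Qed.

Lemma ey_1 p : ey p 1 = 1 - circ e p - RtoC e.
Proof. unfold ey. ring. Qed.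

Lemma ey_l q : circ e 0 = RtoC e -> ey 0 q = RtoC (e + (1 - 3 * e) * q).
Proof. intros H. unfold ey. rewrite H, RtoC_plus, RtoC_mult, RtoC3. ring. Qed.

Lemma ey_r q : circ e 1 = RtoC e -> ey 1 q = RtoC (e + (1 - 3 * e) * q).
Proof. intros H. unfold ey. rewrite H, RtoC_plus, RtoC_mult, RtoC3. ring. Qed.

(** The sides p = 0 and p = 1 are the same segment, with loads differing by the factor [per w0]:
    divided by per w0 - 1, they cancel a side of the shrunken triangle. The sides q = 0 and q = 1
    are arcs, to be cancelled by vertex tori. *)
Lemma tri_edge_Stokes (a b w0 w1 w2 : C) :
  b * w0 * tri_edge (w0 - 1) w1 w2 - a * w1 * tri_edge w0 (w1 - 1) w2 + (a - b) * w2 * tri_edge w0 w1 (w2 - 1)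
  = (per w0 - 1) * b * segm w0 w1 w2 - (a - b) * arc w0 w2 w1 + a * arc w0 w1 w2.
Proof.
  unfold tri_edge. rewrite (cell_Stokes (fun p _ => circ e p) (fun p _ => tau * circ e p) (fun _ _ => 0) ey eyp eyq
     _ _ _ (fun _ _ => 0) (fun p _ => - (tau * circ e p))).
  - unfold segm, arc. rewrite <- (CRInt_scal (segi w0 w1 w2)) by apply exI_segi.
    rewrite <- (CRInt_scal (arci w0 w2 w1)), <- (CRInt_scal (arci w0 w1 w2)) by apply exI_arci.
    rewrite (CRInt_ext01 _ (fun q => (per w0 - 1) * b * segi w0 w1 w2 q) 0 1 Rle_0_1).
    rewrite (CRInt_ext01 (fun p => pow3 w0 w1 w2 (circlog e p) (Clog (ey p 1)) _ * _ - _)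
      (fun q => (a - b) * arci w0 w2 w1 q - a * arci w0 w1 w2 q) 0 1 Rle_0_1).
    + rewrite CRInt_minus by apply exI_scal, exI_arci. ring.
    + intros p Hp. unfold lz. rewrite !ez_eq, Rminus_0_r. unfold arci, eyp.
      replace (1 - 1)%R with 0%R by ring.
      rewrite !ey_0, ey_1, Clog_e. set (X := Clog (1 - circ e p - RtoC e)).
      unfold pow3. replace (w0 * circlog e p + w2 * RtoC (ln e) + w1 * X) with (w0 * circlog e p + w1 * X + w2 * RtoC (ln e)) by ring.
      ring.
    + intros q Hq. unfold lz. rewrite !ez_eq. rewrite !ey_l by apply circ_0. rewrite !ey_r by apply circ_1.
      rewrite pow3_circ1. unfold segi, eyq. rewrite circ_0, circ_1, circlog_0, RtoC3. ring.
  - apply C1pq_circ_p.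
  - apply C1_ey.
  - intros; apply (Cderiv_const (tau * circ e p)).
  - intros; apply (Cderiv_const 0).
  - intros; unfold eyp.
    apply Cderiv_eq with ((- RtoC 1) * (tau * circ e p) + - RtoC q * 0); [|ring].
    apply (Cderiv_mult (fun h => - RtoC h) (fun _ => tau * circ e p)).
    apply Cderiv_opp, Cderiv_id. apply Cderiv_const.
  - intros; unfold eyq. apply Cderiv_eq with (0 - tau * circ e p); [|ring].
    apply (Cderiv_minus (fun _ => 1 - 2 * RtoC e) (circ e)). apply Cderiv_const. apply Cderiv_circ.
  - apply cont01_const.
  - apply cont01_opp. apply (C1_cp _ _ _ (C1pq_circ_p e)).
  - apply C1pq_circlog_p; lra.
  - apply (C1pq_log ey); [intros; now apply offcut_ey|apply C1_ey].
  - apply (C1_lz (fun p _ => circ e p) (fun p _ => tau * circ e p) (fun _ _ => 0) ey eyp eyq).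
    apply C1pq_circ_p. apply C1_ey. intros; now apply offcut_ez.
  - intros; apply circ_exp; lra.
  - intros; apply Cexp_Clog. now apply offcut_ey.
  - intros; apply Cexp_Clog. now apply offcut_ez.
Qed.

(** Opposite sides of the parameter square are the same circle on the torus, with loads differing by
    the monodromy of the other coordinate. *)
Lemma tri_vertex_Stokes (a b w0 w1 w2 : C) :
  b * w0 * tri_vertex (w0 - 1) w1 w2 - a * w1 * tri_vertex w0 (w1 - 1) w2 + (a - b) * w2 * tri_vertex w0 w1 (w2 - 1)
  = (per w0 - 1) * b * arc w1 w0 w2 - (per w1 - 1) * a * arc w0 w1 w2.
Proof.
  unfold tri_vertex. rewrite (cell_Stokes (fun p _ => circ e p) (fun p _ => tau * circ e p) (fun _ _ => 0)
     (fun _ q => circ e q) (fun _ _ => 0) (fun _ q => tau * circ e q)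
     _ _ _ (fun _ _ => 0) (fun _ _ => 0)).
  - unfold arc. rewrite <- (CRInt_scal (arci w1 w0 w2)), <- (CRInt_scal (arci w0 w1 w2)) by apply exI_arci.
    rewrite (CRInt_ext01 _ (fun q => (per w0 - 1) * b * arci w1 w0 w2 q) 0 1 Rle_0_1).
    rewrite (CRInt_ext01 (fun p => pow3 w0 w1 w2 (circlog e p) (circlog e 1) _ * _ - _)
      (fun q => (per w1 - 1) * a * arci w0 w1 w2 q) 0 1 Rle_0_1).
    + reflexivity.
    + intros p Hp. unfold lz. rewrite pow3_circ1'. unfold arci. rewrite circ_0, circ_1, circlog_0. ring.
    + intros q Hq. unfold lz. rewrite pow3_circ1. unfold arci. rewrite circ_0, circ_1, circlog_0.
      replace (1 - RtoC e - circ e q) with (1 - circ e q - RtoC e) by ring.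
      set (X := Clog (1 - circ e q - RtoC e)).
      unfold pow3. replace (w1 * circlog e q + w0 * RtoC (ln e) + w2 * X) with (w0 * RtoC (ln e) + w1 * circlog e q + w2 * X) by ring.
      ring.
  - apply C1pq_circ_p.
  - apply C1pq_circ_q.
  - intros; apply (Cderiv_const (tau * circ e p)).
  - intros; apply (Cderiv_const 0).
  - intros; apply (Cderiv_const 0).
  - intros; apply (Cderiv_const (tau * circ e q)).
  - apply cont01_const.
  - apply cont01_const.
  - apply C1pq_circlog_p; lra.
  - apply C1pq_circlog_q; lra.
  - apply (C1_lz (fun p _ => circ e p) (fun p _ => tau * circ e p) (fun _ _ => 0)
      (fun _ q => circ e q) (fun _ _ => 0) (fun _ q => tau * circ e q)).
    apply C1pq_circ_p. apply C1pq_circ_q. intros; apply offcut_vz.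
  - intros; apply circ_exp; lra.
  - intros; apply circ_exp; lra.
  - intros; apply Cexp_Clog, offcut_vz.
Qed.

Definition tri (w0 w1 w2 : C) : C :=
  tri_sigma w0 w1 w2
  + (tri_edge w0 w1 w2 / (per w0 - 1) + tri_edge w1 w2 w0 / (per w1 - 1) + tri_edge w2 w0 w1 / (per w2 - 1))
  + (tri_vertex w0 w1 w2 / ((per w0 - 1) * (per w1 - 1)) + tri_vertex w1 w2 w0 / ((per w1 - 1) * (per w2 - 1))
     + tri_vertex w2 w0 w1 / ((per w2 - 1) * (per w0 - 1))).

Section TriRelations.
Variables w0 w1 w2 : C.
Hypotheses (h0 : per w0 - 1 <> 0) (h1 : per w1 - 1 <> 0) (h2 : per w2 - 1 <> 0).

(* The boundaries of the cells cancel: the chain is a twisted cycle. *)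
Lemma tri_exact (a b : C) :
  b * w0 * tri (w0 - 1) w1 w2 - a * w1 * tri w0 (w1 - 1) w2 + (a - b) * w2 * tri w0 w1 (w2 - 1) = 0.
Proof.
  assert (S := tri_sigma_Stokes a b w0 w1 w2).
  assert (S0 := tri_edge_Stokes a b w0 w1 w2).
  (* The form a dl_0 + b dl_1 has to be rewritten in the rotated coordinates: it is (b - a) dl_1 - a
     dl_2 and also - b dl_2 + (a - b) dl_0. *)
  assert (S1 := tri_edge_Stokes (b - a) (- a) w1 w2 w0).
  assert (S2 := tri_edge_Stokes (- b) (a - b) w2 w0 w1).
  assert (V0 := tri_vertex_Stokes a b w0 w1 w2).
  assert (V1 := tri_vertex_Stokes (b - a) (- a) w1 w2 w0).
  assert (V2 := tri_vertex_Stokes (- b) (a - b) w2 w0 w1).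
  unfold tri. rewrite !per_minus1.
  set (c0 := per w0) in *. set (c1 := per w1) in *. set (c2 := per w2) in *.
  match type of S with ?l = ?r => match type of S0 with ?l0 = ?r0 => match type of S1 with ?l1 = ?r1 =>
  match type of S2 with ?l2 = ?r2 => match type of V0 with ?m0 = ?s0 => match type of V1 with ?m1 = ?s1 =>
  match type of V2 with ?m2 = ?s2 =>
    transitivity (l + (l0 / (c0 - 1) + l1 / (c1 - 1) + l2 / (c2 - 1))
      + (m0 / ((c0 - 1) * (c1 - 1)) + m1 / ((c1 - 1) * (c2 - 1)) + m2 / ((c2 - 1) * (c0 - 1))));
    [|rewrite S, S0, S1, S2, V0, V1, V2] end end end end end end end.
  - field; repeat split; assumption.
  - field; repeat split; assumption.
Qed.

(** Unit shifts do not change [per], so all four chains have the same coefficients and the relation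
    holds cell by cell. *)
Lemma tri_split : tri w0 w1 w2 = tri (w0 + 1) w1 w2 + tri w0 (w1 + 1) w2 + tri w0 w1 (w2 + 1).
Proof.
  assert (S : forall w0 w1 w2, tri_sigma w0 w1 w2 = tri_sigma (w0 + 1) w1 w2 + tri_sigma w0 (w1 + 1) w2 + tri_sigma w0 w1 (w2 + 1)).
  { intros u0 u1 u2. symmetry. unfold tri_sigma. apply (cell_int_sum sx sxp (fun _ _ => 0) sy syp syq).
  - apply C1_sx.
  - apply C1_sy.
  - apply (C1pq_log sx); [intros; now apply offcut_sx|apply C1_sx].
  - apply (C1pq_log sy); [intros; now apply offcut_sy|apply C1_sy].
  - apply (C1_lz sx sxp (fun _ _ => 0) sy syp syq). apply C1_sx. apply C1_sy. intros; now apply offcut_sz.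
  - intros; apply Cexp_Clog. now apply offcut_sx.
  - intros; apply Cexp_Clog. now apply offcut_sy.
  - intros; apply Cexp_Clog. now apply offcut_sz. }
  assert (E : forall w0 w1 w2, tri_edge w0 w1 w2 = tri_edge (w0 + 1) w1 w2 + tri_edge w0 (w1 + 1) w2 + tri_edge w0 w1 (w2 + 1)).
  { intros u0 u1 u2. symmetry. unfold tri_edge. apply (cell_int_sum (fun p _ => circ e p) (fun p _ => tau * circ e p) (fun _ _ => 0) ey eyp eyq).
  - apply C1pq_circ_p.
  - apply C1_ey.
  - apply C1pq_circlog_p; lra.
  - apply (C1pq_log ey); [intros; now apply offcut_ey|apply C1_ey].
  - apply (C1_lz (fun p _ => circ e p) (fun p _ => tau * circ e p) (fun _ _ => 0) ey eyp eyq).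
    apply C1pq_circ_p. apply C1_ey. intros; now apply offcut_ez.
  - intros; apply circ_exp; lra.
  - intros; apply Cexp_Clog. now apply offcut_ey.
  - intros; apply Cexp_Clog. now apply offcut_ez. }
  assert (V : forall w0 w1 w2, tri_vertex w0 w1 w2 = tri_vertex (w0 + 1) w1 w2 + tri_vertex w0 (w1 + 1) w2 + tri_vertex w0 w1 (w2 + 1)).
  { intros u0 u1 u2. symmetry. unfold tri_vertex. apply (cell_int_sum (fun p _ => circ e p) (fun p _ => tau * circ e p) (fun _ _ => 0)
     (fun _ q => circ e q) (fun _ _ => 0) (fun _ q => tau * circ e q)).
  - apply C1pq_circ_p.
  - apply C1pq_circ_q.
  - apply C1pq_circlog_p; lra.
  - apply C1pq_circlog_q; lra.
  - apply (C1_lz (fun p _ => circ e p) (fun p _ => tau * circ e p) (fun _ _ => 0)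
      (fun _ q => circ e q) (fun _ _ => 0) (fun _ q => tau * circ e q)).
    apply C1pq_circ_p. apply C1pq_circ_q. intros; apply offcut_vz.
  - intros; apply circ_exp; lra.
  - intros; apply circ_exp; lra.
  - intros; apply Cexp_Clog, offcut_vz. }
  unfold tri. rewrite !per_plus1.
  rewrite (S w0 w1 w2), (E w0 w1 w2), (E w1 w2 w0), (E w2 w0 w1), (V w0 w1 w2), (V w1 w2 w0), (V w2 w0 w1).
  unfold Cdiv. ring.
Qed.
End TriRelations.

(** Exactness makes the three raised integrals proportional to w0 + 1, w1 + 1, w2 + 1, and their sum
    is the unraised one. *)
Lemma tri_recurrence w0 w1 w2 :
  per w0 - 1 <> 0 -> per w1 - 1 <> 0 -> per w2 - 1 <> 0 ->
  (w0 + w1 + w2 + 3) * tri (w0 + 1) w1 w2 = (w0 + 1) * tri w0 w1 w2 /\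
  (w0 + w1 + w2 + 3) * tri w0 (w1 + 1) w2 = (w1 + 1) * tri w0 w1 w2 /\
  (w0 + w1 + w2 + 3) * tri w0 w1 (w2 + 1) = (w2 + 1) * tri w0 w1 w2.
Proof.
  intros h0 h1 h2.
  assert (A := tri_split w0 w1 w2).
  assert (B : forall w, w + 1 - 1 = w) by (intros; ring).
  assert (R01 := tri_exact (w0 + 1) (w1 + 1) w2).
  assert (R12 := tri_exact w0 (w1 + 1) (w2 + 1)).
  rewrite !per_plus1, !B in R01, R12.
  (* The values of a and b are chosen so that one of the three terms of [tri_exact] vanishes: a = b
     removes the third, b = 0 the first, and a = 0, used for [R20], the second. *)
  specialize (R01 h0 h1 h2 1 1). specialize (R12 h0 h1 h2 1 0).
  assert (E1 : (w0 + 1) * tri w0 (w1 + 1) w2 = (w1 + 1) * tri (w0 + 1) w1 w2).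
  { apply Ceq_minus. rewrite <- R01. ring. }
  assert (E2 : (w2 + 1) * tri w0 (w1 + 1) w2 = (w1 + 1) * tri w0 w1 (w2 + 1)).
  { apply Ceq_minus. rewrite <- R12. ring. }
  assert (R20 := tri_exact (w0 + 1) w1 (w2 + 1)).
  rewrite !per_plus1, !B in R20. specialize (R20 h0 h1 h2 0 1).
  assert (E3 : (w0 + 1) * tri w0 w1 (w2 + 1) = (w2 + 1) * tri (w0 + 1) w1 w2).
  { apply Ceq_minus. rewrite <- R20. ring. }
  rewrite A. repeat split.
  - transitivity ((w0 + 1) * tri (w0 + 1) w1 w2 + (w1 + 1) * tri (w0 + 1) w1 w2 + (w2 + 1) * tri (w0 + 1) w1 w2); [ring|].
    rewrite <- E1, <- E3. ring.
  - transitivity ((w0 + 1) * tri w0 (w1 + 1) w2 + (w1 + 1) * tri w0 (w1 + 1) w2 + (w2 + 1) * tri w0 (w1 + 1) w2); [ring|].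
    rewrite E1, E2. ring.
  - transitivity ((w0 + 1) * tri w0 w1 (w2 + 1) + (w1 + 1) * tri w0 w1 (w2 + 1) + (w2 + 1) * tri w0 w1 (w2 + 1)); [ring|].
    rewrite E3, <- E2. ring.
Qed.
End Triangle.

(** * Gauss' product *)

(** [CLim] is total and returns a default value for divergent sequences; this relation asserts
    convergence. [Clim_CLim] passes from it to [CLim]. *)
Definition Clim (u : nat -> C) (l : C) : Prop := is_lim_seq (fun n => Cmod (u n - l)) 0%R.

Lemma Clim_le0 (u : nat -> C) l (v : nat -> R) :
  (forall n, (Cmod (u n - l) <= v n)%R) -> is_lim_seq v 0%R -> Clim u l.
Proof.
  intros H1 H2. apply (is_lim_seq_le_le (fun _ => 0%R) _ v); auto.
  - intros n. split; auto. apply Cmod_ge_0.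
  - apply is_lim_seq_const.
Qed.

Lemma Clim_const c : Clim (fun _ => c) c.
Proof.
  apply Clim_le0 with (fun _ => 0%R); [|apply is_lim_seq_const].
  intros _. replace (c - c) with (RtoC 0) by ring. rewrite Cmod_0. apply Rle_refl.
Qed.

Lemma Clim_ext u v l : (forall n, u n = v n) -> Clim u l -> Clim v l.
Proof. intros H. apply is_lim_seq_ext. intros n. now rewrite H. Qed.

Lemma Clim_ext_loc u v l : eventually (fun n => u n = v n) -> Clim u l -> Clim v l.
Proof.
  intros H. apply is_lim_seq_ext_loc. revert H. apply filter_imp. intros n Hn. now rewrite Hn.
Qed.

Lemma is_lim_seq_plus0 u v : is_lim_seq u 0%R -> is_lim_seq v 0%R -> is_lim_seq (fun n => (u n + v n)%R) 0%R.
Proof.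
  intros H1 H2. replace 0%R with (0 + 0)%R by ring. now apply is_lim_seq_plus'.
Qed.

Lemma Clim_plus u v l m : Clim u l -> Clim v m -> Clim (fun n => u n + v n) (l + m).
Proof.
  intros H1 H2. apply Clim_le0 with (fun n => Cmod (u n - l) + Cmod (v n - m))%R.
  - intros n. replace (u n + v n - (l + m)) with ((u n - l) + (v n - m)) by ring. apply Cmod_triangle.
  - now apply is_lim_seq_plus0.
Qed.

Lemma Clim_opp u l : Clim u l -> Clim (fun n => - u n) (- l).
Proof.
  intros H1. apply Clim_le0 with (fun n => Cmod (u n - l))%R; auto.
  intros n. replace (- u n - - l) with (- (u n - l)) by ring. rewrite Cmod_opp. apply Rle_refl.
Qed.

Lemma Clim_mult u v l m : Clim u l -> Clim v m -> Clim (fun n => u n * v n) (l * m).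
Proof.
  intros H1 H2.
  apply Clim_le0 with (fun n => Cmod (u n - l) * Cmod (v n - m) + (Cmod m * Cmod (u n - l) + Cmod l * Cmod (v n - m)))%R.
  - intros n.
    replace (u n * v n - l * m) with ((u n - l) * (v n - m) + (m * (u n - l) + l * (v n - m))) by ring.
    eapply Rle_trans; [apply Cmod_triangle|]. apply Rplus_le_compat. rewrite Cmod_mult; apply Rle_refl.
    eapply Rle_trans; [apply Cmod_triangle|]. rewrite !Cmod_mult; apply Rle_refl.
  - assert (S : forall (w : nat -> R) c, is_lim_seq w 0%R -> is_lim_seq (fun n => (c * w n)%R) 0%R).
    { intros w c Hw. replace 0%R with (c * 0)%R by ring. now apply (is_lim_seq_scal_l w c 0%R). }
    apply is_lim_seq_plus0; [|apply is_lim_seq_plus0; now apply S].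
    replace 0%R with (0 * 0)%R by ring. now apply is_lim_seq_mult'.
Qed.

Lemma Clim_unique u l m : Clim u l -> Clim u m -> l = m.
Proof.
  intros H1 H2. apply Ceq_minus.
  assert (H : Clim (fun n => u n + - u n) (l + - m)) by (apply Clim_plus; [|apply Clim_opp]; auto).
  apply NNPP. intros N. apply Cmod_gt_0 in N.
  assert (L : is_lim_seq (fun _ => Cmod (l - m)) 0%R).
  { revert H. apply is_lim_seq_ext. intros n. replace (u n + - u n - (l + - m)) with (- (l - m)) by ring.
    apply Cmod_opp. }
  apply is_lim_seq_unique in L. rewrite Lim_seq_const in L. injection L. lra.
Qed.

Lemma Clim_parts u l : Clim u l -> is_lim_seq (fun n => Re (u n)) (Re l) /\ is_lim_seq (fun n => Im (u n)) (Im l).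
Proof.
  intros H.
  assert (S : forall (w : nat -> R) a, is_lim_seq (fun n => Rabs (w n - a)) 0%R -> is_lim_seq w a).
  { intros w a Hw. apply is_lim_seq_abs_0 in Hw.
    apply is_lim_seq_ext with (fun n => (w n - a) + a)%R. intros; ring.
    replace (Finite a) with (Finite (0 + a)) by (f_equal; ring).
    apply is_lim_seq_plus'; auto. apply is_lim_seq_const. }
  split; apply S; apply (is_lim_seq_le_le (fun _ => 0%R) _ (fun n => Cmod (u n - l))); auto; try apply is_lim_seq_const;
    intros n; (split; [apply Rabs_pos|]).
  - exact (Re_le_Cmod (u n - l)).
  - exact (Im_le_Cmod (u n - l)).
Qed.

Lemma Cmod_le_parts z : (Cmod z <= Rabs (Re z) + Rabs (Im z))%R.
Proof.
  apply Rsqr_incr_0_var; [|generalize (Rabs_pos (Re z)) (Rabs_pos (Im z)); lra].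
  unfold Rsqr. rewrite Cmod_sqr.
  assert (H1 := Rsqr_abs (Re z)). assert (H2 := Rsqr_abs (Im z)). unfold Rsqr in *.
  generalize (Rabs_pos (Re z)) (Rabs_pos (Im z)). nra.
Qed.

Lemma parts_Clim u l : is_lim_seq (fun n => Re (u n)) (Re l) -> is_lim_seq (fun n => Im (u n)) (Im l) -> Clim u l.
Proof.
  intros H1 H2. apply Clim_le0 with (fun n => Rabs (Re (u n) - Re l) + Rabs (Im (u n) - Im l))%R.
  - intros n. exact (Cmod_le_parts (u n - l)).
  - assert (S : forall (w : nat -> R) a, is_lim_seq w (Finite a) -> is_lim_seq (fun n => Rabs (w n - a)) 0%R).
    { intros w a Hw. replace 0%R with (Rabs (a - a)) by (rewrite Rminus_diag; apply Rabs_R0).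
      apply (is_lim_seq_abs (fun n => w n - a)%R (Finite (a - a))).
      apply is_lim_seq_minus'; auto. apply is_lim_seq_const. }
    apply is_lim_seq_plus0; now apply S.
Qed.

Lemma Clim_CLim u l : Clim u l -> CLim u = l.
Proof.
  intros H. destruct (Clim_parts _ _ H) as [H1 H2].
  apply is_lim_seq_unique in H1, H2. unfold CLim. rewrite H1, H2. now destruct l.
Qed.

Lemma Clim_incr_1 u l : Clim (fun n => u (S n)) l -> Clim u l.
Proof. intros H. apply (is_lim_seq_incr_1 (fun n => Cmod (u n - l))). exact H. Qed.

Lemma Clim_incr_n u N l : Clim (fun n => u (n + N)%nat) l -> Clim u l.
Proof. intros H. apply (is_lim_seq_incr_n (fun n => Cmod (u n - l)) N). exact H. Qed.

Lemma Clim_subn u N l : Clim u l -> Clim (fun n => u (n + N)%nat) l.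
Proof. intros H. apply (is_lim_seq_incr_n (fun n => Cmod (u n - l)) N). exact H. Qed.

Lemma is_lim_seq_invn : is_lim_seq (fun n => (/ INR n)%R) 0%R.
Proof.
  apply (is_lim_seq_inv INR p_infty). apply is_lim_seq_INR. easy.
Qed.

(* [sum 1/n^2] is compared with the telescoping [sum (1/(n-1) - 1/n)]. *)
Lemma product_converges (a : nat -> C) (K : R) (N : nat) : (2 <= N)%nat -> (0 <= K)%R ->
  (forall n, (N <= n)%nat -> (Cmod (a (S n) - a n) <= K / (INR n * INR n) * Cmod (a n))%R) ->
  exists l, Clim a l.
Proof.
  intros HN HK H.
  assert (P : forall n, (N <= n)%nat -> (1 < INR n)%R).
  { intros n Hn. change 1%R with (INR 1). apply lt_INR. lia. }
  assert (T : forall n, (N <= n)%nat -> (/ (INR n * INR n) <= / (INR n - 1) - / (INR (S n) - 1))%R).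
  { intros n Hn. specialize (P n Hn). rewrite S_INR.
    replace (INR n + 1 - 1)%R with (INR n) by ring.
    replace (/ (INR n - 1) - / INR n)%R with (/ ((INR n - 1) * INR n))%R by (field; lra).
    apply Rinv_le_contravar; nra. }
  (* From N on, |a_n| exp (K / (n-1)) does not increase, because K/n^2 + K/n <= K/(n-1). Hence all
     later terms are bounded by [M]. *)
  assert (Bd : forall k, (Cmod (a (N + k)%nat) * exp (K * / (INR (N + k) - 1)) <= Cmod (a N) * exp (K * / (INR N - 1)))%R).
  { induction k. rewrite Nat.add_0_r; lra.
    rewrite Nat.add_succ_r. eapply Rle_trans; [|apply IHk].
    set (n := (N + k)%nat) in *. assert (Hn : (N <= n)%nat) by lia.
    specialize (H n Hn). specialize (T n Hn). specialize (P n Hn).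
    assert (C1 : (Cmod (a (S n)) <= Cmod (a n) * exp (K / (INR n * INR n)))%R).
    { replace (a (S n)) with (a n + (a (S n) - a n)) by ring.
      eapply Rle_trans; [apply Cmod_triangle|].
      assert (X := exp_ineq1_le (K / (INR n * INR n))).
      assert (Y := Cmod_ge_0 (a n)). nra. }
    eapply Rle_trans. apply Rmult_le_compat_r; [left; apply exp_pos|apply C1].
    rewrite Rmult_assoc. apply Rmult_le_compat_l; [apply Cmod_ge_0|].
    rewrite <- exp_plus. apply exp_le_inv || idtac.
    destruct (Rle_lt_or_eq_dec (K / (INR n * INR n) + K * / (INR (S n) - 1)) (K * / (INR n - 1))) as [L|L].
    - unfold Rdiv. nra.
    - left. now apply exp_increasing.
    - rewrite L. lra. }
  set (M := (Cmod (a N) * exp (K * / (INR N - 1)))%R) in *.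
  assert (HM : forall n, (N <= n)%nat -> (Cmod (a n) <= M)%R).
  { intros n Hn. assert (X := Bd (n - N)%nat). replace (N + (n - N))%nat with n in X by lia.
    eapply Rle_trans; [|apply X]. rewrite <- (Rmult_1_r (Cmod (a n))) at 1.
    apply Rmult_le_compat_l; [apply Cmod_ge_0|].
    assert (Y := exp_ineq1_le (K * / (INR n - 1))).
    assert (0 <= K * / (INR n - 1))%R. { apply Rmult_le_pos; auto. left. apply Rinv_0_lt_compat. specialize (P n Hn); lra. }
    lra. }
  assert (HM0 : (0 <= M)%R) by (eapply Rle_trans; [apply (Cmod_ge_0 (a N))|now apply HM]).
  (* With |a_n| <= M the increments telescope and leave a tail of order K M / (n-1). *)
  assert (Cau : forall n k, (N <= n)%nat -> (Cmod (a (n + k)%nat - a n) <= K * M * (/ (INR n - 1) - / (INR (n + k) - 1)))%R).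
  { intros n k Hn. induction k.
    - rewrite Nat.add_0_r. replace (a n - a n) with (RtoC 0) by ring. rewrite Cmod_0. lra.
    - rewrite Nat.add_succ_r. set (m := (n + k)%nat) in *. assert (Hm : (N <= m)%nat) by lia.
      replace (a (S m) - a n) with ((a (S m) - a m) + (a m - a n)) by ring.
      eapply Rle_trans; [apply Cmod_triangle|].
      specialize (H m Hm). specialize (HM m Hm). specialize (T m Hm).
      assert (X : (K / (INR m * INR m) * Cmod (a m) <= K * M * / (INR m * INR m))%R).
      { unfold Rdiv. replace (K * M * / (INR m * INR m))%R with (K * / (INR m * INR m) * M)%R by ring.
        apply Rmult_le_compat_l; auto. apply Rmult_le_pos; auto. left. apply Rinv_0_lt_compat.
        specialize (P m Hm). nra. }
      assert (0 <= K * M)%R by now apply Rmult_le_pos. nra. }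
  assert (CC : forall eps : posreal, exists N0, forall n m, (N0 <= n)%nat -> (N0 <= m)%nat -> (Cmod (a n - a m) < eps)%R).
  { intros eps.
    assert (L : is_lim_seq (fun n => (K * M * / INR n)%R) 0%R).
    { replace 0%R with (K * M * 0)%R by ring. apply (is_lim_seq_scal_l _ (K * M)%R 0%R), is_lim_seq_invn. }
    apply is_lim_seq_spec in L. destruct (L eps) as [N1 HN1].
    assert (W : forall n m, (n <= m)%nat -> (N + N1 + 1 <= n)%nat -> (Cmod (a n - a m) < eps)%R).
    { intros n m Hnm Hn. replace (a n - a m) with (- (a m - a n)) by ring. rewrite Cmod_opp.
      assert (X := Cau n (m - n)%nat ltac:(lia)). replace (n + (m - n))%nat with m in X by lia.
      assert (Y := HN1 (n - 1)%nat ltac:(lia)). rewrite Rminus_0_r in Y.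
      rewrite minus_INR in Y by lia. change (INR 1) with 1%R in Y.
      assert (Z : (0 < / (INR m - 1))%R). { apply Rinv_0_lt_compat. specialize (P m ltac:(lia)); lra. }
      assert (0 <= K * M)%R by now apply Rmult_le_pos.
      apply Rabs_def2 in Y. nra. }
    exists (N + N1 + 1)%nat. intros n m Hn Hm. destruct (Nat.le_ge_cases n m).
    - now apply W.
    - replace (a n - a m) with (- (a m - a n)) by ring. rewrite Cmod_opp. now apply W. }
  assert (E1 : ex_finite_lim_seq (fun n => Re (a n))).
  { apply ex_lim_seq_cauchy_corr. intros eps. destruct (CC eps) as [N0 H0]. exists N0. intros n m Hn Hm.
    eapply Rle_lt_trans; [exact (Re_le_Cmod (a n - a m))|now apply H0]. }
  assert (E2 : ex_finite_lim_seq (fun n => Im (a n))).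
  { apply ex_lim_seq_cauchy_corr. intros eps. destruct (CC eps) as [N0 H0]. exists N0. intros n m Hn Hm.
    eapply Rle_lt_trans; [exact (Im_le_Cmod (a n - a m))|now apply H0]. }
  destruct E1 as [l1 E1], E2 as [l2 E2]. exists (l1, l2). now apply parts_Clim.
Qed.

Definition Gauss (z : C) (n : nat) : C :=
  RtoC (INR (fact n)) * Cexp (z * RtoC (ln (INR n))) / poch z (S n).

Lemma poch_neq0 z n : not_nonpos_int z -> poch z n <> 0.
Proof.
  intros H. induction n; simpl. apply C1_nz.
  apply Cmult_neq_0; auto. intros E. apply (H n).
  apply Ceq_minus. rewrite <- E. ring.
Qed.

Lemma Cderiv_ln1 t : (0 <= t)%R -> Cderiv (fun t => RtoC (ln (1 + t))) t (/ RtoC (1 + t)).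
Proof.
  intros Ht. rewrite <- RtoC_inv by lra. apply (Cderiv_RtoC (fun t => ln (1 + t))).
  auto_derive. lra. field. lra.
Qed.

(* Taylor's formula at order two for [exp (z ln (1+t)) (1+t) - (1+t+z t)]. *)
Lemma Gauss_ratio_estimate (z : C) (t : R) : (0 <= t <= 1)%R ->
  (Cmod (Cexp (z * RtoC (ln (1 + t))) * (1 + RtoC t) - (1 + RtoC t + z * RtoC t))
   <= Cmod (z + 1) * Cmod z * exp (Cmod z) * (t * t))%R.
Proof.
  intros Ht.
  set (g := fun t => Cexp (z * RtoC (ln (1 + t)))).
  assert (Dg : forall t, (0 <= t)%R -> Cderiv g t (g t * (z * / RtoC (1 + t)))).
  { intros s Hs. apply (Cderiv_Cexp (fun t => z * RtoC (ln (1 + t)))). apply Cderiv_scal. now apply Cderiv_ln1. }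
  assert (N : forall t, (0 <= t)%R -> 1 + RtoC t <> 0).
  { intros s Hs. rewrite <- RtoC_plus. intros E. injection E. lra. }
  assert (Cg : forall t, (0 <= t)%R -> ccont g t).
  { intros s Hs. eapply Cderiv_continuous. now apply Dg. }
  assert (Bg : forall t, (0 <= t <= 1)%R -> (Cmod (g t) <= exp (Cmod z))%R).
  { intros s Hs. unfold g. rewrite Cmod_Cexp.
    assert (E : Re (z * RtoC (ln (1 + s))) = (Re z * ln (1 + s))%R) by (destruct z; cbn; ring).
    rewrite E.
    assert (L0 : (0 <= ln (1 + s))%R) by (rewrite <- ln_1; apply ln_le; lra).
    assert (L1 : (ln (1 + s) <= 1)%R).
    { assert (X := exp_ineq1_le (ln (1 + s))). rewrite exp_ln in X by lra. lra. }
    assert (Q := Re_le_Cmod z). assert (Q' := Rle_abs (Re z)).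
    assert (W : (Re z * ln (1 + s) <= Cmod z)%R) by (generalize (Cmod_ge_0 z); nra).
    destruct W as [W|W]. left; now apply exp_increasing. rewrite W; lra. }
  assert (g0 : g 0%R = 1).
  { unfold g. rewrite Rplus_0_r, ln_1. replace (z * RtoC 0) with (RtoC 0) by ring. apply Cexp_0. }
  (* The left side is the derivative of the function [h] below, which vanishes at 0; a bound linear
     in s becomes quadratic in t after one more integration. *)
  assert (B1 : forall s, (0 <= s <= 1)%R -> (Cmod ((z + 1) * (g s - 1)) <= (Cmod (z + 1) * Cmod z * exp (Cmod z)) * s)%R).
  { intros s Hs.
    replace ((z + 1) * (g s - 1)) with ((z + 1) * g s - (z + 1) * g 0%R) by (rewrite g0; ring).
    rewrite <- (CRInt_FTC (fun t => (z + 1) * g t) (fun t => (z + 1) * (g t * (z * / RtoC (1 + t))))); try lra.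
    - eapply Rle_trans.
      apply Cmod_CRInt_le_const with (M := (Cmod (z + 1) * Cmod z * exp (Cmod z))%R). lra.
      + intros x Hx. rewrite !Cmod_mult, <- RtoC_inv, Cmod_R by lra.
        rewrite Rabs_pos_eq by (left; apply Rinv_0_lt_compat; lra).
        assert (/ (1 + x) <= 1)%R by (rewrite <- Rinv_1; apply Rinv_le_contravar; lra).
        assert (0 < / (1 + x))%R by (apply Rinv_0_lt_compat; lra).
        assert (X := Bg x ltac:(lra)).
        assert (X1 := Cmod_ge_0 (z + 1)). assert (X2 := Cmod_ge_0 z). assert (X3 := Cmod_ge_0 (g x)).
        rewrite Rmult_assoc. apply Rmult_le_compat_l; auto.
        rewrite (Rmult_comm (Cmod z) (exp _)).
        apply Rmult_le_compat; auto. nra. nra.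
      + apply exI_cont. lra. intros x Hx. cC. apply Cg; lra.
        apply continuous_Cinv. rewrite RtoC_plus. apply N; lra. cC.
      + rewrite Rminus_0_r. rewrite Rmult_comm. apply Rle_refl.
    - intros x Hx. apply Cderiv_scal. apply Dg; lra.
    - intros x Hx. cC. apply Cg; lra.
      apply continuous_Cinv. rewrite RtoC_plus. apply N; lra. cC. }
  set (h := fun t => g t * (1 + RtoC t) - (1 + RtoC t + z * RtoC t)).
  assert (Dh : forall s, (0 <= s <= 1)%R -> Cderiv h s ((z + 1) * (g s - 1))).
  { intros s Hs. unfold h.
    apply Cderiv_eq with ((g s * (z * / RtoC (1 + s)) * (1 + RtoC s) + g s * (0 + 1)) - ((0 + 1) + z * 1)).
    - apply Cderiv_minus.
      + apply (Cderiv_mult g (fun t => 1 + RtoC t)). apply Dg; lra. apply Cderiv_plus. apply Cderiv_const. apply Cderiv_id.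
      + apply Cderiv_plus. apply Cderiv_plus. apply Cderiv_const. apply Cderiv_id. apply Cderiv_scal. apply Cderiv_id.
    - rewrite RtoC_plus. field. apply N; lra. }
  change (Cmod (h t) <= Cmod (z + 1) * Cmod z * exp (Cmod z) * (t * t))%R.
  replace (h t) with (h t - h 0%R) by (unfold h; rewrite g0; ring).
  rewrite <- (CRInt_FTC h (fun s => (z + 1) * (g s - 1))); try lra.
  - eapply Rle_trans.
    apply Cmod_CRInt_le_const with (M := (Cmod (z + 1) * Cmod z * exp (Cmod z) * t)%R). lra.
    + intros x Hx. eapply Rle_trans. apply B1; lra. apply Rmult_le_compat_l; [|lra].
      repeat apply Rmult_le_pos; try apply Cmod_ge_0. left; apply exp_pos.
    + apply exI_cont. lra. intros x Hx. cC. apply Cg; lra.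
    + right. ring.
  - intros x Hx. apply Dh; lra.
  - intros x Hx. cC. apply Cg; lra.
Qed.

Lemma RtoC_neq0 r : r <> 0%R -> RtoC r <> 0.
Proof. intros H E. apply H. now injection E. Qed.

Lemma INR_fact_neq0C n : RtoC (INR (fact n)) <> 0.
Proof. apply RtoC_neq0, INR_fact_neq_0. Qed.

Lemma Gauss_neq0 z n : not_nonpos_int z -> Gauss z n <> 0.
Proof.
  intros H. unfold Gauss, Cdiv. apply Cmult_neq_0.
  - apply Cmult_neq_0. apply INR_fact_neq0C. apply Cexp_neq0.
  - intros E. apply (poch_neq0 z (S n) H).
    rewrite <- (Cmult_1_r (poch z (S n))), <- (Cinv_r (poch z (S n))) at 1 by now apply poch_neq0.
    rewrite E. ring.
Qed.

Lemma poch_S z n : poch z (S n) = poch z n * (z + RtoC (INR n)).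
Proof. reflexivity. Qed.

(** For t = 1/n the ratio of consecutive terms is (1+t)^(z+1) / (1+t+zt), which is 1 + O(t^2) by the
    preceding estimate: the situation of [product_converges]. *)
Lemma Gauss_step z n : not_nonpos_int z -> (1 <= n)%nat ->
  Gauss z (S n) * (1 + RtoC (/ INR n) + z * RtoC (/ INR n))
  = Cexp (z * RtoC (ln (1 + / INR n))) * (1 + RtoC (/ INR n)) * Gauss z n.
Proof.
  intros Hz Hn.
  assert (Hp : (0 < INR n)%R) by (apply lt_0_INR; lia).
  assert (E : ln (INR (S n)) = (ln (INR n) + ln (1 + / INR n))%R).
  { rewrite <- ln_mult; auto. f_equal. rewrite S_INR. field. lra.
    assert (0 < / INR n)%R by now apply Rinv_0_lt_compat. lra. }
  assert (Ec : Cexp (z * RtoC (ln (INR (S n)))) = Cexp (z * RtoC (ln (INR n))) * Cexp (z * RtoC (ln (1 + / INR n)))).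
  { rewrite E, <- Cexp_add. f_equal. rewrite RtoC_plus. ring. }
  unfold Gauss. rewrite Ec, fact_simpl, mult_INR, RtoC_mult, (poch_S z (S n)), S_INR, (RtoC_plus (INR n)), RtoC_inv by lra.
  field. repeat split.
  - now apply poch_neq0.
  - apply RtoC_neq0; lra.
  - intros Z. apply (Hz (S n)). rewrite S_INR, RtoC_plus. apply Ceq_minus. rewrite <- Z. ring.
Qed.

(** The sequence and its reciprocal satisfy the same kind of estimate, so both converge. The product
    of the limits is 1, hence the limit is not 0. *)
Lemma Gauss_converges z : not_nonpos_int z ->
  Clim (Gauss z) (CGamma z) /\ CGamma z <> 0.
Proof.
  intros Hz.
  set (M := (Cmod (z + 1) * Cmod z * exp (Cmod z))%R).
  assert (HM : (0 <= M)%R).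
  { unfold M. repeat apply Rmult_le_pos; try apply Cmod_ge_0. left; apply exp_pos. }
  (* Beyond 2|z| one has |z|/n <= 1/2, so that the denominator 1 + t + zt of the ratio has modulus
     at least 1/2. *)
  destruct (INR_unbounded (2 * Cmod z)) as [N0 HN0].
  set (N := (N0 + 2)%nat).
  assert (Est : forall n, (N <= n)%nat ->
    let t := (/ INR n)%R in let g := Cexp (z * RtoC (ln (1 + t))) in
    (0 < t <= 1)%R /\ (t * Cmod z <= / 2)%R /\
    (Cmod (g * (1 + RtoC t) - (1 + RtoC t + z * RtoC t)) <= M * (t * t))%R /\
    Gauss z (S n) * (1 + RtoC t + z * RtoC t) = g * (1 + RtoC t) * Gauss z n).
  { intros n Hn t g.
    assert (Hp : (2 * Cmod z < INR n)%R) by (eapply Rlt_le_trans; [apply HN0|apply le_INR; lia]).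
    assert (Hp1 : (1 <= INR n)%R) by (change 1%R with (INR 1); apply le_INR; lia).
    assert (T : (0 < t <= 1)%R).
    { split. apply Rinv_0_lt_compat; lra. unfold t. rewrite <- Rinv_1. apply Rinv_le_contravar; lra. }
    split; auto. split.
    - apply Rmult_le_reg_l with (INR n). lra. unfold t. rewrite <- Rmult_assoc, Rinv_r by lra. lra.
    - split. apply Gauss_ratio_estimate; lra. apply Gauss_step; auto. lia. }
  assert (tt : forall n K X, (N <= n)%nat -> (K * (/ INR n * / INR n) * X = K / (INR n * INR n) * X)%R).
  { intros n K X Hn. unfold Rdiv. now rewrite Rinv_mult. }
  assert (H1 : exists l, Clim (Gauss z) l).
  { apply (product_converges (Gauss z) (2 * M) N). lia. lra.
    intros n Hn. destruct (Est n Hn) as (T & Tz & B & S).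
    set (t := (/ INR n)%R) in *. set (g := Cexp (z * RtoC (ln (1 + t)))) in *.
    rewrite <- tt by auto. fold t.
    assert (D : (Gauss z (Datatypes.S n) - Gauss z n) * (1 + RtoC t + z * RtoC t) = (g * (1 + RtoC t) - (1 + RtoC t + z * RtoC t)) * Gauss z n).
    { transitivity (Gauss z (Datatypes.S n) * (1 + RtoC t + z * RtoC t) - (1 + RtoC t + z * RtoC t) * Gauss z n); [ring|].
      rewrite S. ring. }
    assert (L : (/ 2 <= Cmod (1 + RtoC t + z * RtoC t))%R).
    { assert (X := Cmod_triangle (1 + RtoC t + z * RtoC t) (- (z * RtoC t))).
      replace (1 + RtoC t + z * RtoC t + - (z * RtoC t)) with (RtoC (1 + t)) in X by (rewrite RtoC_plus; ring).
      rewrite Cmod_opp, Cmod_mult, !Cmod_R, !Rabs_pos_eq in X by lra. lra. }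
    apply (f_equal Cmod) in D. rewrite !Cmod_mult in D.
    assert (Y := Cmod_ge_0 (Gauss z n)). assert (Y' := Cmod_ge_0 (Gauss z (Datatypes.S n) - Gauss z n)).
    assert (Z : (Cmod (g * (1 + RtoC t) - (1 + RtoC t + z * RtoC t)) * Cmod (Gauss z n) <= M * (t * t) * Cmod (Gauss z n))%R)
      by now apply Rmult_le_compat_r.
    nra. }
  assert (H2 : exists l, Clim (fun n => / Gauss z n) l).
  { apply (product_converges (fun n => / Gauss z n) (exp (Cmod z) * M) N). lia.
    apply Rmult_le_pos; auto. left; apply exp_pos.
    intros n Hn. destruct (Est n Hn) as (T & Tz & B & S).
    set (t := (/ INR n)%R) in *. set (g := Cexp (z * RtoC (ln (1 + t)))) in *.
    rewrite <- tt by auto. fold t.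
    assert (NZ := Gauss_neq0 z n Hz). assert (NZ' := Gauss_neq0 z (Datatypes.S n) Hz).
    assert (D : (/ Gauss z (Datatypes.S n) - / Gauss z n) * (g * (1 + RtoC t)) = - (g * (1 + RtoC t) - (1 + RtoC t + z * RtoC t)) * / Gauss z n).
    { transitivity ((g * (1 + RtoC t) * Gauss z n) * / (Gauss z (Datatypes.S n) * Gauss z n) - / Gauss z n * (g * (1 + RtoC t))).
      field; split; auto. rewrite <- S. field; split; auto. }
    (* For the reciprocal sequence the denominator is (1+t)^(z+1); this lower bound accounts for the
       factor exp |z| in its constant. *)
    assert (L : (exp (- Cmod z) <= Cmod (g * (1 + RtoC t)))%R).
    { rewrite Cmod_mult, <- RtoC_plus, Cmod_R, Rabs_pos_eq by lra. unfold g. rewrite Cmod_Cexp.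
      assert (E : Re (z * RtoC (ln (1 + t))) = (Re z * ln (1 + t))%R) by (destruct z; cbn; ring).
      rewrite E.
      assert (L0 : (0 <= ln (1 + t))%R) by (rewrite <- ln_1; apply ln_le; lra).
      assert (L1 : (ln (1 + t) <= 1)%R).
      { assert (X := exp_ineq1_le (ln (1 + t))). rewrite exp_ln in X by lra. lra. }
      assert (Q := Re_le_Cmod z). apply Rabs_le_between in Q.
      assert (W : (- Cmod z <= Re z * ln (1 + t))%R) by (generalize (Cmod_ge_0 z); nra).
      assert (W' : (exp (- Cmod z) <= exp (Re z * ln (1 + t)))%R).
      { destruct W as [W|W]. left; now apply exp_increasing. rewrite W; lra. }
      assert (E0 := exp_pos (Re z * ln (1 + t))). nra. }
    apply (f_equal Cmod) in D. rewrite (Cmod_mult (/ _ - _)), (Cmod_mult (- _)), Cmod_opp in D.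
    assert (Y := Cmod_ge_0 (/ Gauss z n)). assert (Y' := Cmod_ge_0 (/ Gauss z (Datatypes.S n) - / Gauss z n)).
    assert (Z : (Cmod (g * (1 + RtoC t) - (1 + RtoC t + z * RtoC t)) * Cmod (/ Gauss z n) <= M * (t * t) * Cmod (/ Gauss z n))%R)
      by now apply Rmult_le_compat_r.
    assert (P := exp_pos (Cmod z)).
    assert (PP : (exp (Cmod z) * exp (- Cmod z) = 1)%R) by (rewrite <- exp_plus, Rplus_opp_r; apply exp_0).
    set (d := Cmod (/ Gauss z (Datatypes.S n) - / Gauss z n)) in *.
    assert (W : (d * exp (- Cmod z) <= M * (t * t) * Cmod (/ Gauss z n))%R).
    { eapply Rle_trans; [|apply Z]. rewrite <- D. now apply Rmult_le_compat_l. }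
    apply (Rmult_le_compat_l (exp (Cmod z))) in W; [|lra].
    replace (exp (Cmod z) * (d * exp (- Cmod z)))%R with (exp (Cmod z) * exp (- Cmod z) * d)%R in W by ring.
    rewrite PP in W. lra. }
  destruct H1 as [l H1], H2 as [l' H2].
  assert (El : CGamma z = l) by (apply (Clim_CLim (Gauss z)); exact H1).
  rewrite El. split; auto. intros Z.
  assert (H3 := Clim_mult _ _ _ _ H1 H2).
  assert (H4 : Clim (fun n => Gauss z n * / Gauss z n) 1).
  { apply Clim_ext with (fun _ => RtoC 1); [|apply Clim_const]. intros n. symmetry. apply Cinv_r. now apply Gauss_neq0. }
  assert (X := Clim_unique _ _ _ H3 H4). rewrite Z in X. apply C1_nz. rewrite <- X. ring.
Qed.

Lemma poch_shift z n : poch z (S n) = z * poch (z + 1) n.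
Proof.
  induction n. simpl. ring.
  rewrite poch_S, IHn, (poch_S (z + 1)), S_INR, RtoC_plus. ring.
Qed.

Lemma Clim_div_shift (a b : C) : (forall n : nat, a + RtoC (INR n) <> 0) ->
  Clim (fun n => (b + RtoC (INR n)) / (a + RtoC (INR n))) 1.
Proof.
  intros Ha.
  assert (H1 : Clim (fun n => RtoC (/ INR n)) 0).
  { apply Clim_le0 with (fun n => Rabs (/ INR n)).
    - intros n. replace (RtoC (/ INR n) - 0) with (RtoC (/ INR n)) by ring. rewrite Cmod_R. apply Rle_refl.
    - apply -> (is_lim_seq_abs_0 (fun n => / INR n)%R). apply is_lim_seq_invn. }
  assert (H2 : Clim (fun n => RtoC (INR n) / (a + RtoC (INR n))) 1).
  { destruct (INR_unbounded (2 * Cmod a + 1)) as [N HN].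
    apply (Clim_incr_n _ N).
    apply Clim_le0 with (fun n => 2 * Cmod a * / INR (n + N))%R.
    - intros n. set (m := (n + N)%nat).
      assert (Hm : (2 * Cmod a + 1 < INR m)%R) by (eapply Rlt_le_trans; [apply HN|apply le_INR; lia]).
      replace (RtoC (INR m) / (a + RtoC (INR m)) - 1) with (- (a / (a + RtoC (INR m)))).
      2:{ field. apply Ha. }
      rewrite Cmod_opp, Cmod_div by apply Ha.
      assert (X := Cmod_triangle (a + RtoC (INR m)) (- a)). rewrite Cmod_opp in X.
      replace (a + RtoC (INR m) + - a) with (RtoC (INR m)) in X by ring.
      assert (A0 := Cmod_ge_0 a).
      rewrite Cmod_R, Rabs_pos_eq in X by lra.
      unfold Rdiv. rewrite (Rmult_comm 2), Rmult_assoc. apply Rmult_le_compat_l; auto.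
      replace (2 * / INR m)%R with (/ (INR m / 2))%R by (field; lra).
      apply Rinv_le_contravar; lra.
    - replace 0%R with (2 * Cmod a * 0)%R by ring.
      apply (is_lim_seq_scal_l _ (2 * Cmod a)%R 0%R).
      apply (is_lim_seq_incr_n (fun n => / INR n)%R N), is_lim_seq_invn. }
  assert (H3 := Clim_plus _ _ _ _ H2 (Clim_mult _ _ _ _ (Clim_mult _ _ _ _ (Clim_const b) H1) H2)).
  replace (1 + b * 0 * 1) with (RtoC 1) in H3 by ring.
  revert H3. apply Clim_ext_loc. exists 1%nat. intros n Hn.
  assert (INR n <> 0)%R by (apply not_0_INR; lia).
  rewrite RtoC_inv by auto. field. split; auto. now apply RtoC_neq0.
Qed.

Lemma nonpos_plus1 z : not_nonpos_int z -> not_nonpos_int (z + 1).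
Proof.
  intros H n E. apply (H (S n)). rewrite S_INR, RtoC_plus.
  replace z with (z + 1 - 1) by ring. rewrite E. ring.
Qed.

Lemma nonpos_add z n : not_nonpos_int z -> z + RtoC (INR n) <> 0.
Proof. intros H E. apply (H n). apply Ceq_minus. rewrite <- E. ring. Qed.

(** Termwise, [Gauss (z + 1) n] is z n / (z + 1 + n) times [Gauss z n], and n / (z + 1 + n) tends to
    1. *)
Lemma CGamma_plus1 z : not_nonpos_int z -> CGamma (z + 1) = z * CGamma z.
Proof.
  intros H.
  destruct (Gauss_converges _ H) as [L1 _]. destruct (Gauss_converges _ (nonpos_plus1 _ H)) as [L2 _].
  apply (Clim_unique _ _ _ L2).
  assert (L3 := Clim_mult _ _ _ _ (Clim_mult _ _ _ _ (Clim_const z) L1) (Clim_div_shift (z + 1) 0 (fun n => nonpos_add _ n (nonpos_plus1 _ H)))).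
  rewrite Cmult_1_r in L3. revert L3. apply Clim_ext_loc. exists 1%nat. intros n Hn.
  assert (Hp : (0 < INR n)%R) by (apply lt_0_INR; lia).
  assert (X := poch_shift z (S n)). rewrite (poch_S z (S n)), S_INR, RtoC_plus in X.
  unfold Gauss. replace ((z + 1) * RtoC (ln (INR n))) with (z * RtoC (ln (INR n)) + RtoC (ln (INR n))) by ring.
  rewrite Cexp_add.
  replace (Cexp (RtoC (ln (INR n)))) with (RtoC (INR n)).
  2:{ unfold Cexp; cbn. rewrite exp_ln, cos_0, sin_0 by auto. apply C_ext; cbn; ring. }
  assert (Hz : z <> 0). { replace z with (z + RtoC (INR 0)) by (simpl; ring). now apply nonpos_add. }
  assert (P1 := poch_neq0 _ (S n) (nonpos_plus1 _ H)).
  assert (P2 := poch_neq0 _ (S n) H).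
  assert (Q := nonpos_add _ n (nonpos_plus1 _ H)).
  apply (f_equal (fun w => w * / (poch z (S n) * poch (z + 1) (S n) * (z + 1 + RtoC (INR n))))) in X.
  transitivity ((RtoC (INR (fact n)) * Cexp (z * RtoC (ln (INR n))) * RtoC (INR n)) *
    (z * poch (z + 1) (S n) * / (poch z (S n) * poch (z + 1) (S n) * (z + 1 + RtoC (INR n))))).
  - field. repeat split; auto.
  - rewrite <- X. field. repeat split; auto.
Qed.

(** * The Beta integral *)

(** The real-base power x^a, extended by 0 to x <= 0. For Re a >= 1 it is continuous on the whole
    line, so the Beta and Dirichlet integrals are proper and may be cut and shifted freely. *)
Definition rpow (a : C) (x : R) : C :=
  if Rlt_dec 0 x then Cexp (a * RtoC (ln x)) else 0.

Lemma rpow_pos a x : (0 < x)%R -> rpow a x = Cexp (a * RtoC (ln x)).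
Proof. intros H. unfold rpow. destruct Rlt_dec; tauto. Qed.

Lemma rpow_neg a x : (x <= 0)%R -> rpow a x = 0.
Proof. intros H. unfold rpow. destruct Rlt_dec; auto. lra. Qed.

Lemma rpow_add a b x : rpow (a + b) x = rpow a x * rpow b x.
Proof.
  unfold rpow. destruct Rlt_dec; [|ring]. rewrite <- Cexp_add. f_equal. ring.
Qed.

Lemma Cexp_ln x : (0 < x)%R -> Cexp (RtoC (ln x)) = RtoC x.
Proof.
  intros H. unfold Cexp; cbn. rewrite exp_ln, cos_0, sin_0 by auto. apply C_ext; cbn; ring.
Qed.

Lemma rpow_1 x : (0 <= x)%R -> rpow 1 x = RtoC x.
Proof.
  intros H. unfold rpow. destruct Rlt_dec.
  - rewrite Cmult_1_l. now apply Cexp_ln.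
  - f_equal. lra.
Qed.

Lemma rpow_S a x : rpow (a + 1) x = RtoC x * rpow a x.
Proof.
  rewrite rpow_add. destruct (Rle_dec 0 x).
  - rewrite rpow_1 by auto. ring.
  - rewrite !rpow_neg by lra. ring.
Qed.

Lemma rpow_mul a x y : (0 < x)%R -> rpow a (x * y) = rpow a x * rpow a y.
Proof.
  intros Hx. destruct (Rlt_dec 0 y) as [H|H].
  - rewrite !rpow_pos; auto; [|nra]. rewrite ln_mult, RtoC_plus by auto. rewrite <- Cexp_add. f_equal. ring.
  - rewrite (rpow_neg a y), rpow_neg by nra. ring.
Qed.

Lemma Cmod_rpow a x : (0 < x)%R -> Cmod (rpow a x) = exp (Re a * ln x).
Proof. intros H. rewrite rpow_pos, Cmod_Cexp by auto. f_equal. destruct a; cbn; ring. Qed.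

Lemma Cmod_rpow_le1 a x : (0 <= Re a)%R -> (x <= 1)%R -> (Cmod (rpow a x) <= 1)%R.
Proof.
  intros Ha Hx. destruct (Rlt_dec 0 x) as [H|H].
  - rewrite Cmod_rpow by auto. rewrite <- exp_0.
    assert (L : (ln x <= 0)%R) by (rewrite <- ln_1; apply ln_le; lra).
    assert (L' : (Re a * ln x <= 0)%R) by nra.
    destruct L' as [L'|L']. left; now apply exp_increasing. rewrite L'; lra.
  - rewrite rpow_neg by lra. rewrite Cmod_0. lra.
Qed.

Lemma Cmod_rpow_le a x : (1 <= Re a)%R -> (x <= 1)%R -> (Cmod (rpow a x) <= Rabs x)%R.
Proof.
  intros Ha Hx. replace a with (a - 1 + 1) by ring. rewrite rpow_S, Cmod_mult, Cmod_R.
  rewrite <- (Rmult_1_r (Rabs x)) at 2. apply Rmult_le_compat_l. apply Rabs_pos.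
  apply Cmod_rpow_le1; auto. cbn. unfold Re in *. lra.
Qed.

Lemma ccont_rpow a x : (1 <= Re a)%R -> ccont (rpow a) x.
Proof.
  intros Ha. destruct (Rtotal_order x 0) as [H|[->|H]].
  - apply (continuous_ext_loc (T := R_UniformSpace) (U := C_UniformSpace) (rpow a) (fun _ => RtoC 0) x).
    + exists (mkposreal (- x) ltac:(lra)). intros y Hy. symmetry. apply rpow_neg.
      cbn in Hy. unfold AbsRing_ball, abs, minus, plus, opp in Hy; cbn in Hy.
      apply Rabs_def2 in Hy. lra.
    + apply continuous_const.
  - apply continuous_Cmod_crit. intros eps He.
    assert (Hd : (0 < Rmin eps 1)%R) by (apply Rmin_pos; lra).
    exists (mkposreal _ Hd). intros y Hy. cbn in Hy. unfold AbsRing_ball, abs, minus, plus, opp in Hy; cbn in Hy.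
    rewrite Ropp_0, Rplus_0_r in Hy.
    rewrite (rpow_neg a 0) by lra. replace (rpow a y - 0) with (rpow a y) by ring.
    assert (Rabs y < 1)%R by (eapply Rlt_le_trans; [apply Hy|apply Rmin_r]).
    eapply Rle_lt_trans. apply Cmod_rpow_le; auto. apply Rabs_def2 in H. lra.
    eapply Rlt_le_trans; [apply Hy|apply Rmin_l].
  - apply (continuous_ext_loc (T := R_UniformSpace) (U := C_UniformSpace) (rpow a) (fun y => Cexp (a * RtoC (ln y))) x).
    + exists (mkposreal x H). intros y Hy. symmetry. apply rpow_pos.
      cbn in Hy. unfold AbsRing_ball, abs, minus, plus, opp in Hy; cbn in Hy.
      apply Rabs_def2 in Hy. lra.
    + apply continuous_Cexp, continuous_Cmult. apply continuous_const.
      apply continuous_RtoC_R. auto_derive. auto.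
Qed.

Lemma Cderiv_rpow a x : (1 <= Re a)%R -> Cderiv (rpow (a + 1)) x ((a + 1) * rpow a x).
Proof.
  intros Ha. destruct (Rtotal_order x 0) as [H|[->|H]].
  - apply Cderiv_ext_loc with (fun _ => RtoC 0).
    + exists (mkposreal (- x) ltac:(lra)). intros y Hy. symmetry. apply rpow_neg.
      cbn in Hy. unfold AbsRing_ball, abs, minus, plus, opp in Hy; cbn in Hy.
      apply Rabs_def2 in Hy. lra.
    + rewrite rpow_neg by lra. apply Cderiv_eq with (RtoC 0); [|ring]. apply Cderiv_const.
  - apply Cderiv_eq with (rpow a 0%R); [|rewrite rpow_neg by lra; ring].
    (* At 0 the difference quotient of x^(a+1) is x^a itself. *)
    apply Cderiv_slope; [|now apply ccont_rpow].
    intros h. rewrite Rplus_0_l, rpow_S, (rpow_neg (a + 1) 0) by lra. ring.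
  - apply Cderiv_ext_loc with (fun y => Cexp ((a + 1) * RtoC (ln y))).
    + exists (mkposreal x H). intros y Hy. symmetry. apply rpow_pos.
      cbn in Hy. unfold AbsRing_ball, abs, minus, plus, opp in Hy; cbn in Hy.
      apply Rabs_def2 in Hy. lra.
    + apply Cderiv_eq with (Cexp ((a + 1) * RtoC (ln x)) * ((a + 1) * RtoC (/ x))).
      * apply (Cderiv_Cexp (fun y => (a + 1) * RtoC (ln y))). apply Cderiv_scal. apply (Cderiv_RtoC ln).
        apply is_derive_Reals. now apply derivable_pt_lim_ln.
      * rewrite <- rpow_pos, rpow_S, RtoC_inv by lra. field. apply RtoC_neq0. lra.
Qed.

Lemma Cderiv_comp_affine (f : R -> C) l x : Cderiv f (1 - x)%R l -> Cderiv (fun y => f (1 - y)%R) x (- l).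
Proof.
  intros [H1 H2].
  assert (D : is_derive (fun y => (1 - y)%R) x (-1)%R) by (auto_derive; auto; ring).
  split.
  - apply (Rderiv_eq _ _ (Re l * -1)%R); [|cbn; unfold Re; ring].
    exact (Rderiv_comp (fun y => (1 - y)%R) (fun h => Re (f h)) x (-1) (Re l) D H1).
  - apply (Rderiv_eq _ _ (Im l * -1)%R); [|cbn; unfold Im; ring].
    exact (Rderiv_comp (fun y => (1 - y)%R) (fun h => Im (f h)) x (-1) (Im l) D H2).
Qed.

Lemma ccont_rpow' a x : (1 <= Re a)%R -> ccont (fun x => rpow a (1 - x)%R) x.
Proof.
  intros H. apply (continuous_comp (fun x => (1 - x)%R) (rpow a : R -> C_UniformSpace)).
  apply (ex_derive_continuous (V := R_NormedModule)). auto_derive; auto. now apply ccont_rpow.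
Qed.

(** Euler's B(u+1, v+1); it is indexed by the exponents, like the twisted integrals. *)
Definition Bt (u v : C) : C := CRInt (fun x => rpow u x * rpow v (1 - x)%R) 0 1.

Lemma ccont_Bt u v x : (1 <= Re u)%R -> (1 <= Re v)%R -> ccont (fun x => rpow u x * rpow v (1 - x)%R) x.
Proof. intros. apply continuous_Cmult. now apply ccont_rpow. now apply ccont_rpow'. Qed.

Lemma exI_Bt u v a b : (1 <= Re u)%R -> (1 <= Re v)%R -> exI (fun x => rpow u x * rpow v (1 - x)%R) a b.
Proof. intros. apply exI_cont_all. intros. now apply ccont_Bt. Qed.

Lemma Re_plus1 u : Re (u + 1) = (Re u + 1)%R.
Proof. reflexivity. Qed.

(** One relation comes from x + (1-x) = 1, the other from integrating the derivative of x^(u+1)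
    (1-x)^(v+1), which vanishes at both ends. *)
Lemma Bt_rec u v : (1 <= Re u)%R -> (1 <= Re v)%R ->
  (u + v + 2) * Bt u (v + 1) = (v + 1) * Bt u v /\ (u + v + 2) * Bt (u + 1) v = (u + 1) * Bt u v.
Proof.
  intros Hu Hv.
  assert (Hu' : (1 <= Re (u + 1))%R) by (rewrite Re_plus1; lra).
  assert (Hv' : (1 <= Re (v + 1))%R) by (rewrite Re_plus1; lra).
  assert (S : Bt u v = Bt (u + 1) v + Bt u (v + 1)).
  { unfold Bt. rewrite <- CRInt_plus by now apply exI_Bt. apply CRInt_ext. intros x _.
    rewrite !rpow_S, RtoC_minus. ring. }
  assert (D : (u + 1) * Bt u (v + 1) = (v + 1) * Bt (u + 1) v).
  { apply Ceq_minus. unfold Bt. rewrite <- !CRInt_scal by now apply exI_Bt.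
    rewrite <- CRInt_minus by (apply exI_scal; now apply exI_Bt).
    rewrite (CRInt_FTC (fun x => rpow (u + 1) x * rpow (v + 1) (1 - x)%R)); [| lra | |].
    - rewrite (rpow_neg (u + 1) 0), Rminus_diag, (rpow_neg (v + 1) 0) by lra. ring.
    - intros x _. apply Cderiv_eq with ((u + 1) * rpow u x * rpow (v + 1) (1 - x)%R + rpow (u + 1) x * - ((v + 1) * rpow v (1 - x)%R)); [|ring].
      apply (Cderiv_mult (rpow (u + 1)) (fun x => rpow (v + 1) (1 - x)%R)). now apply Cderiv_rpow.
      apply Cderiv_comp_affine. now apply Cderiv_rpow.
    - intros x _. apply continuous_Cminus; apply continuous_Cmult; try apply continuous_const; now apply ccont_Bt. }
  split.
  - transitivity ((u + 1) * Bt u (v + 1) + (v + 1) * Bt u (v + 1)); [ring|]. rewrite D, S. ring.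
  - transitivity ((u + 1) * Bt (u + 1) v + (v + 1) * Bt (u + 1) v); [ring|]. rewrite <- D, S. ring.
Qed.

Lemma Re_neq0 z : (0 < Re z)%R -> z <> 0.
Proof. intros H E. rewrite E in H. cbn in H. lra. Qed.

Lemma Bt_1 u : (1 <= Re u)%R -> Bt u 1 = 1 / ((u + 1) * (u + 2)).
Proof.
  intros Hu.
  assert (Hu' : (1 <= Re (u + 1))%R) by (rewrite Re_plus1; lra).
  assert (N1 : u + 1 <> 0) by (apply Re_neq0; cbn; unfold Re in *; lra).
  assert (N2 : u + 2 <> 0) by (apply Re_neq0; cbn; unfold Re in *; lra).
  assert (I : forall a, (1 <= Re a)%R -> CRInt (rpow a) 0 1 = 1 / (a + 1)).
  { intros a Ha. assert (N : a + 1 <> 0) by (apply Re_neq0; cbn; unfold Re in *; lra).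
    rewrite (CRInt_FTC (fun x => / (a + 1) * rpow (a + 1) x)); [| lra | |].
    - rewrite (rpow_neg _ 0) by lra.
      rewrite rpow_pos, ln_1 by lra. replace ((a + 1) * RtoC 0) with (RtoC 0) by ring. rewrite Cexp_0.
      unfold Cdiv. ring.
    - intros x _. apply Cderiv_eq with (/ (a + 1) * ((a + 1) * rpow a x)); [|field; auto].
      apply Cderiv_scal. now apply Cderiv_rpow.
    - intros x _. now apply ccont_rpow. }
  unfold Bt. rewrite (CRInt_ext01 _ (fun x => rpow u x - rpow (u + 1) x)); [|lra|].
  - rewrite CRInt_minus, !I by (auto; apply exI_cont_all; intros; now apply ccont_rpow).
    field. split; auto.
  - intros x Hx. rewrite rpow_1, rpow_S, RtoC_minus by lra. ring.
Qed.

(** Here Gauss' product meets the Beta integral: multiplied by n^(u+1), the right side is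
    [Gauss (u + 1) n]. *)
Lemma Bt_nat u n : (1 <= Re u)%R -> (1 <= n)%nat ->
  Bt u (RtoC (INR n)) = RtoC (INR (fact n)) / poch (u + 1) (S n).
Proof.
  intros Hu Hn. induction n as [|n IH]; [lia|].
  assert (NP : not_nonpos_int (u + 1)).
  { intros k E. apply (f_equal Re) in E. rewrite Re_plus1 in E. cbn in E. generalize (pos_INR k). unfold Re in *. lra. }
  destruct n as [|n].
  - change (RtoC (INR 1)) with (RtoC 1). rewrite Bt_1 by auto.
    assert (P := poch_neq0 _ 2 NP). cbn [fact poch] in *. cbn [Nat.mul Nat.add]. change (INR 1) with 1%R. change (INR 0) with 0%R. change (INR 0) with 0%R in P. change (INR 1) with 1%R in P.
    replace (1 * (u + 1 + 0) * (u + 1 + 1)) with ((u + 1) * (u + 2)); auto. replace (u + 2) with (u + 1 + 1). ring.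
    apply C_ext; cbn; ring.
  - assert (Hn' : (1 <= Re (RtoC (INR (S n))))%R). { cbn [Re RtoC fst]. change 1%R with (INR 1). apply le_INR. lia. }
    destruct (Bt_rec u (RtoC (INR (S n))) Hu Hn') as [R1 _].
    rewrite IH in R1 by lia.
    assert (P := poch_neq0 _ (S (S n)) NP). assert (Q := nonpos_add _ (S (S n)) NP).
    rewrite (poch_S _ (S (S n))), fact_simpl, mult_INR, RtoC_mult.
    assert (E : RtoC (INR (S (S n))) = RtoC (INR (S n)) + 1) by (rewrite <- RtoC_plus, <- S_INR; reflexivity).
    rewrite E in *. rewrite <- (Cmult_1_l (Bt _ _)).
    assert (Q' : u + RtoC (INR (S n)) + 2 <> 0).
    { intros Z. apply Q. rewrite <- Z. apply C_ext; cbn; ring. }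
    replace (u + 1 + (RtoC (INR (S n)) + 1)) with (u + RtoC (INR (S n)) + 2) in * by (apply C_ext; cbn; ring).
    transitivity (/ (u + RtoC (INR (S n)) + 2) * ((u + RtoC (INR (S n)) + 2) * Bt u (RtoC (INR (S n)) + 1))).
    field; auto. rewrite R1. field. auto.
Qed.

Lemma nonpos_Re z : (0 < Re z)%R -> not_nonpos_int z.
Proof.
  intros H n E. rewrite E in H. cbn in H. generalize (pos_INR n). lra.
Qed.

Lemma Bt_poch u v n : (1 <= Re u)%R -> (1 <= Re v)%R ->
  poch (u + v + 2) n * Bt u (v + RtoC (INR n)) = poch (v + 1) n * Bt u v.
Proof.
  intros Hu Hv. induction n.
  - simpl. replace (v + RtoC 0) with v by ring. ring.
  - assert (Hv' : (1 <= Re (v + RtoC (INR n)))%R).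
    { cbn. generalize (pos_INR n). unfold Re in Hv. lra. }
    destruct (Bt_rec u _ Hu Hv') as [R _].
    rewrite !poch_S, S_INR, RtoC_plus.
    replace (v + (RtoC (INR n) + 1)) with (v + RtoC (INR n) + 1) by ring.
    transitivity (poch (u + v + 2) n * ((u + (v + RtoC (INR n)) + 2) * Bt u (v + RtoC (INR n) + 1))); [ring|].
    rewrite R. transitivity ((v + RtoC (INR n) + 1) * (poch (u + v + 2) n * Bt u (v + RtoC (INR n)))); [ring|].
    rewrite IHn. ring.
Qed.

Lemma rpow_one_minus v x : (2 <= Re v)%R -> (0 <= x <= 1)%R -> (Cmod (rpow v (1 - x)%R - 1) <= Cmod v * x)%R.
Proof.
  intros Hv Hx.
  assert (Hv1 : (1 <= Re (v - 1))%R) by (cbn; unfold Re in Hv; lra).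
  replace (rpow v (1 - x)%R - 1) with (rpow v (1 - x)%R - rpow v (1 - 0)%R).
  2:{ rewrite (rpow_pos v (1 - 0)), Rminus_0_r, ln_1 by lra. replace (v * RtoC 0) with (RtoC 0) by ring. now rewrite Cexp_0. }
  rewrite <- (CRInt_FTC (fun x => rpow v (1 - x)%R) (fun x => - (v * rpow (v - 1) (1 - x)%R))); try lra.
  - eapply Rle_trans. apply Cmod_CRInt_le_const with (M := Cmod v). lra.
    + intros y Hy. rewrite Cmod_opp, Cmod_mult. rewrite <- (Rmult_1_r (Cmod v)) at 2.
      apply Rmult_le_compat_l. apply Cmod_ge_0. apply Cmod_rpow_le1; lra.
    + apply exI_cont_all. intros y. apply continuous_Copp, continuous_Cmult. apply continuous_const. now apply ccont_rpow'.
    + right; ring.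
  - intros y Hy. apply Cderiv_comp_affine.
    assert (D := Cderiv_rpow (v - 1) (1 - y)%R Hv1).
    replace (v - 1 + 1) with v in D by ring. exact D.
  - intros y Hy. apply continuous_Copp, continuous_Cmult. apply continuous_const. now apply ccont_rpow'.
Qed.

Lemma rpow_real a x : (0 <= x)%R -> rpow (RtoC a) x = RtoC (Cmod (rpow (RtoC a) x)).
Proof.
  intros Hx. destruct (Rlt_dec 0 x).
  - rewrite Cmod_rpow by auto. rewrite rpow_pos by auto. cbn. unfold Cexp. apply C_ext; cbn.
    + replace (a * 0 + 0 * ln x)%R with 0%R by ring. rewrite cos_0. replace (a * ln x - 0 * 0)%R with (a * ln x)%R by ring. ring.
    + replace (a * 0 + 0 * ln x)%R with 0%R by ring. rewrite sin_0. ring.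
  - rewrite rpow_neg, Cmod_0 by lra. easy.
Qed.

Lemma Cmod_rpow_Re a x : Cmod (rpow a x) = Cmod (rpow (RtoC (Re a)) x).
Proof.
  destruct (Rlt_dec 0 x).
  - rewrite !Cmod_rpow by auto. easy.
  - now rewrite !rpow_neg by lra.
Qed.

(** The weight (1-x)^n concentrates near 0, where (1-x)^v differs from 1 by at most |v| x. The extra
    power of x makes the error smaller than the main term by a factor of order 1/n. *)
Lemma Bt_error u v n : (1 <= Re u)%R -> (2 <= Re v)%R -> (1 <= n)%nat ->
  (Cmod (Bt u (v + RtoC (INR n)) - Bt u (RtoC (INR n))) <= Cmod v * Cmod (Bt (RtoC (Re u) + 1) (RtoC (INR n))))%R.
Proof.
  intros Hu Hv Hn.
  assert (Hn1 : (1 <= INR n)%R) by (change 1%R with (INR 1); apply le_INR; lia).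
  assert (Hn' : (1 <= Re (RtoC (INR n)))%R) by exact Hn1.
  assert (Hvn : (1 <= Re (v + RtoC (INR n)))%R) by (cbn; unfold Re in Hv; lra).
  assert (Hu' : (1 <= Re (RtoC (Re u) + 1))%R) by (cbn; unfold Re in *; lra).
  unfold Bt at 1 2. rewrite <- CRInt_minus by now apply exI_Bt.
  assert (I := CRInt_correct _ _ _ (exI_Bt (RtoC (Re u) + 1) (RtoC (INR n)) 0 1 Hu' Hn')).
  apply isI_Re in I. apply (is_RInt_scal (V := R_NormedModule) _ _ _ (Cmod v)) in I.
  eapply Rle_trans. eapply (Cmod_CRInt_le _ _ 0 1 _ Rle_0_1); [|apply exI_minus; now apply exI_Bt|exact I].
  - intros x Hx. cbv beta.
    replace (rpow u x * rpow (v + RtoC (INR n)) (1 - x)%R - rpow u x * rpow (RtoC (INR n)) (1 - x)%R)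
      with (rpow u x * rpow (RtoC (INR n)) (1 - x)%R * (rpow v (1 - x)%R - 1)) by (rewrite rpow_add; ring).
    rewrite rpow_S, !Cmod_mult, (Cmod_rpow_Re u).
    assert (X := rpow_one_minus v x Hv Hx).
    rewrite (rpow_real (Re u)), (rpow_real (INR n)) by lra. rewrite !Cmod_R, !Rabs_pos_eq by apply Cmod_ge_0.
    rewrite <- !RtoC_mult. unfold scal; cbn; unfold mult; cbn.
    assert (Y := Cmod_ge_0 (rpow (RtoC (Re u)) x)). assert (Y' := Cmod_ge_0 (rpow (RtoC (INR n)) (1 - x))).
    set (A := Cmod (rpow (RtoC (Re u)) x)) in *. set (B := Cmod (rpow (RtoC (INR n)) (1 - x))) in *.
    replace (Cmod v * (x * A * B))%R with (A * B * (Cmod v * x))%R by ring.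
    apply Rmult_le_compat_l; auto. now apply Rmult_le_pos.
  - apply Rmult_le_compat_l. apply Cmod_ge_0. eapply Rle_trans; [apply Rle_abs|]. exact (Re_le_Cmod _).
Qed.

(** By the last two facts n^(u+1) [Bt u (v + n)] tends to Gamma(u+1). By [Bt_poch] it also equals
    [Bt u v] times a quotient of Pochhammer symbols, which the Gauss products for v + 1 and u + v +
    2 describe in the limit. *)
Lemma Bt_Gamma u v : (1 <= Re u)%R -> (2 <= Re v)%R ->
  Bt u v * CGamma (u + v + 2) = CGamma (u + 1) * CGamma (v + 1).
Proof.
  intros Hu Hv.
  assert (G1 : not_nonpos_int (u + 1)) by (apply nonpos_Re; cbn; unfold Re in *; lra).
  assert (G2 : not_nonpos_int (v + 1)) by (apply nonpos_Re; cbn; unfold Re in *; lra).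
  assert (G3 : not_nonpos_int (u + v + 2)) by (apply nonpos_Re; cbn; unfold Re in *; lra).
  assert (G4 : not_nonpos_int (RtoC (Re u) + 2)) by (apply nonpos_Re; cbn; unfold Re in *; lra).
  destruct (Gauss_converges _ G1) as [L1 _]. destruct (Gauss_converges _ G2) as [L2 _].
  destruct (Gauss_converges _ G3) as [L3 _]. destruct (Gauss_converges _ G4) as [L4 _].
  assert (Hu' : (1 <= Re (RtoC (Re u) + 1))%R) by (cbn; unfold Re in *; lra).
  assert (L5 : Clim (fun n => Cexp ((u + 1) * RtoC (ln (INR n))) * (Bt u (v + RtoC (INR n)) - Bt u (RtoC (INR n)))) 0).
  { assert (L6 : Clim (fun n => RtoC (Cmod v) * (Gauss (RtoC (Re u) + 2) n * RtoC (/ INR n))) 0).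
    { replace (RtoC 0) with (RtoC (Cmod v) * (CGamma (RtoC (Re u) + 2) * 0)) by ring.
      apply Clim_mult. apply Clim_const. apply Clim_mult; auto.
      apply Clim_le0 with (fun n => Rabs (/ INR n)).
      - intros n. replace (RtoC (/ INR n) - 0) with (RtoC (/ INR n)) by ring. rewrite Cmod_R. apply Rle_refl.
      - apply -> (is_lim_seq_abs_0 (fun n => / INR n)%R). apply is_lim_seq_invn. }
    apply (Clim_incr_n _ 1). apply (Clim_subn _ 1) in L6.
    apply Clim_le0 with (2 := L6). intros n.
    set (m := (n + 1)%nat). assert (Hm : (1 <= m)%nat) by lia.
    assert (Hp : (0 < INR m)%R) by (apply lt_0_INR; lia).
    replace (Cexp ((u + 1) * RtoC (ln (INR m))) * (Bt u (v + RtoC (INR m)) - Bt u (RtoC (INR m))) - 0)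
      with (Cexp ((u + 1) * RtoC (ln (INR m))) * (Bt u (v + RtoC (INR m)) - Bt u (RtoC (INR m)))) by ring.
    replace (RtoC (Cmod v) * (Gauss (RtoC (Re u) + 2) m * RtoC (/ INR m)) - 0)
      with (RtoC (Cmod v) * (Cexp ((RtoC (Re u) + 1) * RtoC (ln (INR m))) * Bt (RtoC (Re u) + 1) (RtoC (INR m)))).
    - rewrite !Cmod_mult, Cmod_R, Rabs_pos_eq by apply Cmod_ge_0.
      rewrite !Cmod_Cexp.
      replace (Re ((RtoC (Re u) + 1) * RtoC (ln (INR m)))) with (Re ((u + 1) * RtoC (ln (INR m)))) by (cbn; unfold Re; ring).
      assert (X := Bt_error u v m Hu Hv Hm). assert (E := exp_pos (Re ((u + 1) * RtoC (ln (INR m))))). nra.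
    - rewrite Bt_nat by auto. unfold Gauss.
      replace (RtoC (Re u) + 1 + 1) with (RtoC (Re u) + 2) by (apply C_ext; cbn; ring).
      replace ((RtoC (Re u) + 2) * RtoC (ln (INR m))) with ((RtoC (Re u) + 1) * RtoC (ln (INR m)) + RtoC (ln (INR m)))
        by (apply C_ext; cbn; ring).
      rewrite Cexp_add, Cexp_ln, RtoC_inv by lra. field. split; [apply RtoC_neq0; lra|now apply poch_neq0]. }
  assert (L7 : Clim (fun n => Cexp ((u + 1) * RtoC (ln (INR n))) * Bt u (v + RtoC (INR n))) (CGamma (u + 1))).
  { assert (L8 := Clim_plus _ _ _ _ L1 L5). rewrite Cplus_0_r in L8. revert L8.
    apply Clim_ext_loc. exists 1%nat. intros n Hn.
    assert (Z := Bt_nat u n Hu Hn). unfold Gauss.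
    replace (RtoC (INR (fact n)) * Cexp ((u + 1) * RtoC (ln (INR n))) / poch (u + 1) (S n))
      with (Cexp ((u + 1) * RtoC (ln (INR n))) * Bt u (RtoC (INR n))). ring.
    rewrite Z. unfold Cdiv. ring. }
  (* The quotient (v+1+n) / (u+v+2+n) converts Pochhammer symbols of length n + 1, as in [Gauss],
     into those of length n in [Bt_poch]. *)
  assert (L9 := Clim_mult _ _ _ _ (Clim_mult _ _ _ _ L2 (Clim_div_shift (u + v + 2) (v + 1) (fun n => nonpos_add _ n G3))) L7).
  assert (L10 := Clim_mult _ _ _ _ (Clim_const (Bt u v)) L3).
  replace (CGamma (u + 1) * CGamma (v + 1)) with (CGamma (v + 1) * 1 * CGamma (u + 1)) by ring.
  apply (Clim_unique _ _ _ L10). revert L9. apply Clim_ext. intros n.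
  assert (P := Bt_poch u v n Hu ltac:(lra)).
  unfold Gauss. rewrite !poch_S.
  replace ((u + v + 2) * RtoC (ln (INR n))) with ((v + 1) * RtoC (ln (INR n)) + (u + 1) * RtoC (ln (INR n))) by (apply C_ext; cbn; ring).
  rewrite Cexp_add.
  assert (N1 := poch_neq0 _ n G2). assert (N2 := poch_neq0 _ n G3). assert (N3 := nonpos_add _ n G2). assert (N4 := nonpos_add _ n G3).
  set (p := poch (u + v + 2) n) in *. set (q := poch (v + 1) n) in *.
  set (d := u + v + 2 + RtoC (INR n)) in *. set (d' := v + 1 + RtoC (INR n)) in *.
  transitivity (RtoC (INR (fact n)) * Cexp ((v + 1) * RtoC (ln (INR n))) * Cexp ((u + 1) * RtoC (ln (INR n))) * (p * Bt u (v + RtoC (INR n))) / (p * q * d)).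
  - field. auto.
  - rewrite P. field. auto.
Qed.

(** * Collapsing a loop onto a segment *)

Lemma EVT1 (f : R -> R) a b : (a <= b)%R -> (forall x, continuous f x) ->
  exists x0, (a <= x0 <= b)%R /\ forall x, (a <= x <= b)%R -> (f x <= f x0)%R.
Proof.
  intros Hab H. destruct (continuity_ab_maj f a b Hab) as [M [H1 H2]].
  - intros c _. apply continuity_pt_filterlim. apply H.
  - exists M. split; auto.
Qed.

(** The maximum over y is a continuous function of x, although the chosen maximizer [m x] need not
    be: by [tube], F x and F u are uniformly close for u near x. *)
Lemma EVT2 (F : R -> R -> R) a b c d : (a <= b)%R -> (c <= d)%R ->
  (forall z, continuous (fun z : R * R => F (fst z) (snd z)) z) ->
  exists x0 y0, (a <= x0 <= b)%R /\ (c <= y0 <= d)%R /\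
    forall x y, (a <= x <= b)%R -> (c <= y <= d)%R -> (F x y <= F x0 y0)%R.
Proof.
  intros Hab Hcd H.
  assert (S : forall x, exists y0, (c <= y0 <= d)%R /\ forall y, (c <= y <= d)%R -> (F x y <= F x y0)%R).
  { intros x. apply EVT1; auto. intros y.
    apply (continuous_comp_2 (fun _ : R => x) (fun s : R => s) F y).
    apply continuous_const. apply continuous_id. apply (H (x, y)). }
  set (m := fun x => proj1_sig (constructive_indefinite_description _ (S x))).
  assert (Hm : forall x, (c <= m x <= d)%R /\ forall y, (c <= y <= d)%R -> (F x y <= F x (m x))%R).
  { intros x. exact (proj2_sig (constructive_indefinite_description _ (S x))). }
  destruct (EVT1 (fun x => F x (m x)) a b Hab) as [x0 [Hx0 HM]].
  - intros x. apply (filterlim_locally (F := locally x) (fun x => F x (m x)) (F x (m x))). intros eps.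
    assert (T := tube (fun (u : R) t => RtoC (F u t)) x c d eps (cond_pos eps) Hcd).
    assert (T' : forall t, (c <= t <= d)%R -> ccont (fun z : R * R => RtoC (F (fst z) (snd z))) (x, t)).
    { intros t _. apply continuous_RtoC, H. }
    generalize (T T'). apply filter_imp. intros u Hu.
    assert (U : forall t, (c <= t <= d)%R -> (Rabs (F u t - F x t) < eps)%R).
    { intros t Ht. rewrite <- Cmod_R, RtoC_minus. now apply Hu. }
    destruct (Hm x) as [A1 A2]. destruct (Hm u) as [B1 B2].
    assert (U1 := U _ A1). assert (U2 := U _ B1).
    assert (A3 := A2 _ B1). assert (B3 := B2 _ A1).
    apply Rabs_def1; cbn; unfold minus, plus, opp; cbn;
    apply Rabs_def2 in U1; apply Rabs_def2 in U2; lra.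
  - exists x0, (m x0). split; auto. split. apply Hm.
    intros x y Hx Hy. eapply Rle_trans; [apply (proj2 (Hm x)); auto|]. now apply HM.
Qed.

Lemma EVT_rect (F : R -> R -> C) a b c d : (a <= b)%R -> (c <= d)%R -> cont_rect F a b c d ->
  exists x0 y0, (a <= x0 <= b)%R /\ (c <= y0 <= d)%R /\
    forall x y, (a <= x <= b)%R -> (c <= y <= d)%R -> (Cmod (F x y) <= Cmod (F x0 y0))%R.
Proof.
  intros Hab Hcd H.
  destruct (EVT2 (fun x y => Cmod (F (clamp a b x) (clamp c d y))) a b c d Hab Hcd) as (x0 & y0 & Hx0 & Hy0 & HM).
  - intros z. apply continuous_Cmod. now apply cont_clamp.
  - exists x0, y0. split; auto. split; auto. intros x y Hx Hy.
    specialize (HM x y Hx Hy). now rewrite !clamp_id in HM.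
Qed.

Lemma cont_rect_bounded (F : R -> R -> C) a b c d : (a <= b)%R -> (c <= d)%R -> cont_rect F a b c d ->
  exists M, (0 <= M)%R /\ forall x y, (a <= x <= b)%R -> (c <= y <= d)%R -> (Cmod (F x y) <= M)%R.
Proof.
  intros Hab Hcd H. destruct (EVT_rect F a b c d Hab Hcd H) as (x0 & y0 & _ & _ & HM).
  exists (Cmod (F x0 y0)). split; auto. apply Cmod_ge_0.
Qed.

(* Complex differentiability on the disc |x| <= e, tested along curves. *)
Record holo (e : R) (A dA : C -> C) : Prop := {
  holo_d : forall (g : R -> C) t g', (Cmod (g t) <= e)%R -> Cderiv g t g' -> Cderiv (fun s => A (g s)) t (dA (g t) * g');
  holo_c : forall (g : R * R -> C) x, (Cmod (g x) <= e)%R -> ccont g x -> ccont (fun s => A (g s)) x;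
  holo_c' : forall (g : R * R -> C) x, (Cmod (g x) <= e)%R -> ccont g x -> ccont (fun s => dA (g s)) x }.

Lemma holo_const e c : holo e (fun _ => c) (fun _ => 0).
Proof.
  split; intros; try apply continuous_const. apply Cderiv_eq with (RtoC 0); [apply Cderiv_const|ring].
Qed.

Lemma holo_id e : holo e (fun x => x) (fun _ => 1).
Proof.
  split; intros; auto; try apply continuous_const. apply Cderiv_eq with g'; [auto|ring].
Qed.

Lemma holo_plus e A dA B dB : holo e A dA -> holo e B dB -> holo e (fun x => A x + B x) (fun x => dA x + dB x).
Proof.
  intros [A1 A2 A3] [B1 B2 B3]. split.
  - intros g t g' Hg HD. apply Cderiv_eq with (dA (g t) * g' + dB (g t) * g'); [|ring].
    apply (Cderiv_plus (fun s => A (g s)) (fun s => B (g s))); auto.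
  - intros; apply continuous_Cplus; auto.
  - intros; apply continuous_Cplus; auto.
Qed.

Lemma holo_mult e A dA B dB : holo e A dA -> holo e B dB ->
  holo e (fun x => A x * B x) (fun x => dA x * B x + A x * dB x).
Proof.
  intros [A1 A2 A3] [B1 B2 B3]. split.
  - intros g t g' Hg HD. apply Cderiv_eq with (dA (g t) * g' * B (g t) + A (g t) * (dB (g t) * g')); [|ring].
    apply (Cderiv_mult (fun s => A (g s)) (fun s => B (g s))); auto.
  - intros; apply continuous_Cmult; auto.
  - intros; apply continuous_Cplus; apply continuous_Cmult; auto.
Qed.

Lemma holo_exp e A dA : holo e A dA -> holo e (fun x => Cexp (A x)) (fun x => Cexp (A x) * dA x).
Proof.
  intros [A1 A2 A3]. split.
  - intros g t g' Hg HD. apply Cderiv_eq with (Cexp (A (g t)) * (dA (g t) * g')); [|ring].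
    apply (Cderiv_Cexp (fun s => A (g s))); auto.
  - intros; apply continuous_Cexp; auto.
  - intros; apply continuous_Cmult; [apply continuous_Cexp|]; auto.
Qed.

Lemma holo_log e A dA : (forall x, (Cmod x <= e)%R -> offcut (A x)) -> holo e A dA ->
  holo e (fun x => Clog (A x)) (fun x => dA x / A x).
Proof.
  intros H [A1 A2 A3]. split.
  - intros g t g' Hg HD. apply Cderiv_eq with (dA (g t) * g' / A (g t)).
    + apply (Cderiv_Clog (fun s => A (g s))); auto.
    + unfold Cdiv. ring.
  - intros; apply continuous_Clog; auto.
  - intros; apply continuous_Cdiv; auto. now apply offcut_neq0, H.
Qed.

Lemma circ_lin r p : circ r p = RtoC r * circ 1 p.
Proof. rewrite !circ_exp0. ring. Qed.

Lemma Cmod_circ1 p : Cmod (circ 1 p) = 1%R.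
Proof. apply Cmod_circ. lra. Qed.

Lemma Cmod_circ' r p : (0 <= r)%R -> Cmod (circ r p) = r.
Proof. intros Hr. rewrite circ_lin, Cmod_mult, Cmod_circ1, Cmod_R, Rabs_pos_eq; lra. Qed.

Section Collapse.
Variables (e : R) (A dA : C -> C) (a : C).
Hypotheses (he : (0 < e <= 1)%R) (HA : holo e A dA) (Ha : (1 <= Re a)%R).

(** The integral of x^a A(x) dx over the circle of radius r, with the branch of x^a continued from
    the real one at the base point. *)
Definition loop (r : R) : C :=
  CRInt (fun p => Cexp (a * circlog r p) * A (circ r p) * (tau * circ r p)) 0 1.

Let F r p := Cexp (a * circlog r p) * A (circ r p).
Let Fr r p := Cexp (a * circlog r p) * (a * RtoC (/ r)) * A (circ r p) + Cexp (a * circlog r p) * (dA (circ r p) * circ 1 p).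
Let Fp r p := Cexp (a * circlog r p) * (a * tau) * A (circ r p) + Cexp (a * circlog r p) * (dA (circ r p) * (tau * circ r p)).

Lemma Cderiv_circ_r r p : Cderiv (fun r => circ r p) r (circ 1 p).
Proof.
  apply Cderiv_ext with (fun r => RtoC r * circ 1 p). intros; now rewrite <- circ_lin.
  apply Cderiv_eq with (1 * circ 1 p + RtoC r * 0); [|ring].
  apply (Cderiv_mult RtoC (fun _ => circ 1 p)). apply Cderiv_id. apply Cderiv_const.
Qed.

Lemma Cderiv_circlog_r r p : (0 < r)%R -> Cderiv (fun r => circlog r p) r (RtoC (/ r)).
Proof.
  intros Hr. split; cbn.
  - apply is_derive_Reals. now apply derivable_pt_lim_ln.
  - apply is_derive_Reals, derivable_pt_lim_const.
Qed.

Lemma cont_circ2 z : ccont (fun z : R * R => circ (fst z) (snd z)) z.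
Proof.
  apply continuous_ext with (fun z : R * R => RtoC (fst z) * circ 1 (snd z)).
  intros; now rewrite <- circ_lin.
  apply continuous_Cmult. apply continuous_RtoC. contR.
  apply (continuous_comp snd (circ 1 : R -> C_UniformSpace)). contR. apply ccont_circ.
Qed.

Lemma cont_circlog2 x y : (0 < x)%R -> ccont (fun z : R * R => circlog (fst z) (snd z)) (x, y).
Proof.
  intros Hx. apply continuous_C; cbn.
  - apply (continuous_comp fst ln). contR. now apply continuous_ln.
  - apply continuous_Rm. apply continuous_const. contR.
Qed.

Lemma cont_disc z : (0 <= fst z <= e)%R -> ccont (fun z : R * R => A (circ (fst z) (snd z))) z.
Proof.
  intros Hz. apply (holo_c _ _ _ HA (fun z => circ (fst z) (snd z))).
  cbv beta. rewrite Cmod_circ' by apply Hz. apply Hz. apply cont_circ2.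
Qed.

Lemma ccont_disc r p : (0 <= r <= e)%R -> ccont (fun p => A (circ r p)) p.
Proof. intros Hr. apply (continuous_slice (fun r p => A (circ r p))). now apply cont_disc. Qed.

Lemma exI_loop r : (0 <= r <= e)%R -> exI (fun p => Cexp (a * circlog r p) * A (circ r p) * (tau * circ r p)) 0 1.
Proof.
  intros Hr. apply exI_cont_all. intros p.
  apply continuous_Cmult; [apply continuous_Cmult|apply continuous_Cmult; [apply continuous_const|apply ccont_circ]].
  - apply continuous_Cexp, continuous_Cmult. apply continuous_const. apply ccont_circlog.
  - now apply ccont_disc.
Qed.

Lemma exI_radial s t : (0 <= s <= e)%R -> (0 <= t <= e)%R -> exI (fun x => rpow a x * A (RtoC x)) s t.
Proof.
  intros Hs Ht. apply (ex_RInt_continuous (V := C_R_CompleteNormedModule)). intros x Hx.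
  assert (Hx' : (0 <= x <= e)%R).
  { revert Hx. unfold Rmin, Rmax. destruct Rle_dec; lra. }
  apply continuous_Cmult. now apply ccont_rpow.
  apply continuous_ext with (fun x => A (circ x 0)). intros; now rewrite circ_0.
  apply (continuous_slice1 (fun r p => A (circ r p)) x 0). now apply cont_disc.
Qed.

(** Green's formula in polar coordinates on the annulus cut along the positive axis: the form is
    closed because [A] is holomorphic, and the values of x^a on the two sides of the cut differ by
    the factor [per a]. *)
Lemma loop_annulus rho : (0 < rho <= e)%R ->
  loop e - loop rho = (per a - 1) * CRInt (fun x => rpow a x * A (RtoC x)) rho e.
Proof.
  intros Hr.
  assert (Z : RtoC 0 = CRInt (fun p => F e p * (tau * circ e p) - F rho p * (tau * circ rho p)) 0 1
                  - CRInt (fun r => F r 1%R * circ 1 1 - F r 0%R * circ 1 0) rho e).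
  { set (DQ := fun r p => Fr r p * (tau * circ r p) + F r p * (tau * circ 1 p)).
    set (DP := fun r p => Fp r p * circ 1 p + F r p * (tau * circ 1 p)).
    assert (CF : forall x y, (rho <= x <= e)%R -> ccont (fun z : R * R => Cexp (a * circlog (fst z) (snd z))) (x, y)).
    { intros x y Hx. apply continuous_Cexp, continuous_Cmult. apply continuous_const. apply cont_circlog2. lra. }
    assert (CA : forall x y, (rho <= x <= e)%R -> ccont (fun z : R * R => A (circ (fst z) (snd z))) (x, y)).
    { intros x y Hx. apply cont_disc. simpl. lra. }
    assert (CdA : forall x y, (rho <= x <= e)%R -> ccont (fun z : R * R => dA (circ (fst z) (snd z))) (x, y)).
    { intros x y Hx. apply (holo_c' _ _ _ HA (fun z => circ (fst z) (snd z))). simpl.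
      rewrite Cmod_circ' by lra. lra. apply cont_circ2. }
    assert (C1 : forall z, ccont (fun z : R * R => circ 1 (snd z)) z).
    { intros z. apply (continuous_comp snd (circ 1 : R -> C_UniformSpace)). contR. apply ccont_circ. }
    rewrite <- (Stokes_rect (fun r p => F r p * circ 1 p) (fun r p => F r p * (tau * circ r p)) DP DQ rho e 0 1); try lra.
    - symmetry. rewrite (CRInt_ext01 _ (fun _ => RtoC 0)); [|lra|].
      + rewrite CRInt_const. ring.
      + intros x Hx. rewrite (CRInt_ext01 _ (fun _ => RtoC 0)); [|lra|].
        * rewrite CRInt_const. ring.
        * intros y Hy. unfold DQ, DP, Fr, Fp. rewrite (circ_lin x y), RtoC_inv by lra. field. apply RtoC_neq0; lra.
    - intros x y Hx Hy. unfold DQ. apply (Cderiv_mult (fun r => F r y) (fun r => tau * circ r y)).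
      + apply (Cderiv_mult (fun r => Cexp (a * circlog r y)) (fun r => A (circ r y))).
        * apply (Cderiv_Cexp (fun r => a * circlog r y)). apply Cderiv_scal. apply Cderiv_circlog_r. lra.
        * apply (holo_d _ _ _ HA (fun r => circ r y)). rewrite Cmod_circ'; lra. apply Cderiv_circ_r.
      + apply Cderiv_scal, Cderiv_circ_r.
    - intros x y Hx Hy. unfold DP. apply (Cderiv_mult (fun p => F x p) (fun p => circ 1 p)).
      + apply (Cderiv_mult (fun p => Cexp (a * circlog x p)) (fun p => A (circ x p))).
        * apply (Cderiv_Cexp (fun p => a * circlog x p)). apply Cderiv_scal. apply Cderiv_circlog.
        * apply (holo_d _ _ _ HA (fun p => circ x p)). rewrite Cmod_circ'; lra. apply Cderiv_circ.
      + apply Cderiv_circ.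
    - intros x y Hx Hy. unfold DP, Fp, F.
      repeat match goal with
      | |- continuous (fun _ => ?c) _ => apply continuous_const
      | |- continuous (fun z => Cplus _ _) _ => apply continuous_Cplus
      | |- continuous (fun z => Cmult _ _) _ => apply continuous_Cmult
      | |- continuous (fun z => Cexp _) _ => apply CF; exact Hx
      | |- continuous (fun z => A _) _ => apply CA; exact Hx
      | |- continuous (fun z => dA _) _ => apply CdA; exact Hx
      | |- continuous (fun z => circ 1 _) _ => apply C1
      | |- continuous (fun z => circ _ _) _ => apply cont_circ2
      end.
    - intros x y Hx Hy. unfold DQ, Fr, F.
      repeat match goal with
      | |- continuous (fun _ => ?c) _ => apply continuous_const
      | |- continuous (fun z => Cplus _ _) _ => apply continuous_Cplus
      | |- continuous (fun z => Cmult _ _) _ => apply continuous_Cmult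
      | |- continuous (fun z => Cexp _) _ => apply CF; exact Hx
      | |- continuous (fun z => A _) _ => apply CA; exact Hx
      | |- continuous (fun z => dA _) _ => apply CdA; exact Hx
      | |- continuous (fun z => circ 1 _) _ => apply C1
      | |- continuous (fun z => circ _ _) _ => apply cont_circ2
      end.
      apply (continuous_comp fst (fun r => RtoC (/ r)) (x, y)). contR. apply continuous_RtoC, continuous_Rinv. simpl. lra. }
  rewrite CRInt_minus in Z by (unfold F; apply exI_loop; lra).
  change (RtoC 0 = loop e - loop rho - CRInt (fun r => F r 1%R * circ 1 1 - F r 0%R * circ 1 0) rho e) in Z.
  rewrite <- CRInt_scal by (apply exI_radial; lra).
  apply Ceq_minus. rewrite Z. f_equal. apply CRInt_ext01. lra.
  intros x Hx. unfold F. rewrite circlog_0, circlog_1, !circ_0, !circ_1, rpow_pos by lra.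
  replace (a * (RtoC (ln x) + tau)) with (tau * a + a * RtoC (ln x)) by ring. rewrite Cexp_add.
  unfold per. ring.
Qed.

(* As A is holomorphic, the derivative of the loop integral with respect to its
   radius is a boundary term, carried by the segment where the branch jumps. *)
Lemma loop_collapse : loop e = (per a - 1) * CRInt (fun x => rpow a x * A (RtoC x)) 0 e.
Proof.
  destruct (cont_rect_bounded (fun r p => A (circ r p)) 0 e 0 1) as (M & HM0 & HM); try lra.
  { intros x y Hx Hy. now apply cont_disc. }
  set (K := exp (2 * PI * Rabs (Im a))).
  assert (PI0 := PI_RGT_0).
  (* Since Re a >= 1 and rho <= 1, |x^a| is at most the constant [K] on the circle, so the loop
     integral is O(rho); [Br] does the same for the radial integral. *)
  assert (Bl : forall rho, (0 < rho <= e)%R -> (Cmod (loop rho) <= K * M * (2 * PI) * rho)%R).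
  { intros rho Hr. replace (K * M * (2 * PI) * rho)%R with ((1 - 0) * (K * M * (2 * PI * rho)))%R by ring.
    apply Cmod_CRInt_le_const; [lra| |apply exI_loop; lra].
    intros p Hp. rewrite !Cmod_mult, Cmod_Cexp, Cmod_circ' by lra.
    assert (T : Cmod tau = (2 * PI)%R).
    { unfold tau, Cmod. cbn. replace (_ + _)%R with ((2 * PI) * (2 * PI))%R by ring. apply sqrt_square. lra. }
    rewrite T. apply Rmult_le_compat_r. nra.
    apply Rmult_le_compat; [left; apply exp_pos|apply Cmod_ge_0| |apply HM; lra].
    unfold K.
    assert (E : Re (a * circlog rho p) = (Re a * ln rho - Im a * (2 * PI * p))%R) by (destruct a; cbn; ring).
    rewrite E.
    assert (L : (ln rho <= 0)%R) by (rewrite <- ln_1; apply ln_le; lra).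
    assert (L1 : (Re a * ln rho <= 0)%R) by nra.
    assert (Q := Rle_abs (- Im a)). rewrite Rabs_Ropp in Q. assert (Q' := Rabs_pos (Im a)).
    assert (L2 : (- Im a * (2 * PI * p) <= 2 * PI * Rabs (Im a))%R).
    { eapply Rle_trans. apply Rmult_le_compat_r; [nra|apply Q].
      replace (2 * PI * Rabs (Im a))%R with (Rabs (Im a) * (2 * PI * 1))%R by ring.
      apply Rmult_le_compat_l; auto. apply Rmult_le_compat_l; lra. }
    assert (L3 : (Re a * ln rho - Im a * (2 * PI * p) <= 2 * PI * Rabs (Im a))%R) by lra.
    destruct L3 as [L3|L3]. left; now apply exp_increasing. rewrite L3; lra. }
  assert (Br : forall rho, (0 < rho <= e)%R -> (Cmod (CRInt (fun x => rpow a x * A (RtoC x))%C 0 rho) <= M * rho)%R).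
  { intros rho Hr. replace (M * rho)%R with ((rho - 0) * M)%R by ring.
    apply Cmod_CRInt_le_const; [lra| |apply exI_radial; lra].
    intros x Hx. rewrite Cmod_mult. rewrite <- (Rmult_1_l M).
    apply Rmult_le_compat; try apply Cmod_ge_0. apply Cmod_rpow_le1; lra.
    rewrite <- circ_0. apply HM; lra. }
  apply Ceq_minus. apply NNPP. intros N. apply Cmod_gt_0 in N.
  set (d := Cmod (loop e - (per a - 1) * CRInt (fun x => rpow a x * A (RtoC x)) 0 e)) in *.
  set (L := (K * M * (2 * PI) + Cmod (per a - 1) * M)%R).
  assert (HK : (0 < K)%R) by apply exp_pos.
  assert (HL : (0 <= L)%R).
  { unfold L. assert (X := Cmod_ge_0 (per a - 1)). assert (0 <= K * M)%R by nra. assert (0 <= 2 * PI)%R by lra. nra. }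
  assert (B : forall rho, (0 < rho <= e)%R -> (d <= L * rho)%R).
  { intros rho Hr. unfold d, L.
    rewrite <- (CRInt_Chasles _ 0 rho e) by (apply exI_radial; lra).
    replace (loop e - (per a - 1) * (CRInt (fun x => rpow a x * A (RtoC x)) 0 rho + CRInt (fun x => rpow a x * A (RtoC x)) rho e))
      with ((loop e - loop rho - (per a - 1) * CRInt (fun x => rpow a x * A (RtoC x)) rho e)
         + (loop rho + - ((per a - 1) * CRInt (fun x => rpow a x * A (RtoC x)) 0 rho))) by ring.
    rewrite loop_annulus by auto.
    replace ((per a - 1) * CRInt (fun x => rpow a x * A (RtoC x)) rho e - (per a - 1) * CRInt (fun x => rpow a x * A (RtoC x)) rho e)
      with (RtoC 0) by ring. rewrite Cplus_0_l.
    eapply Rle_trans; [apply Cmod_triangle|]. rewrite Cmod_opp, Cmod_mult.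
    specialize (Bl rho Hr). specialize (Br rho Hr). assert (X := Cmod_ge_0 (per a - 1)). nra. }
  assert (Hq : (0 < d / (2 * (L + 1)))%R) by (apply Rdiv_lt_0_compat; lra).
  (* With this radius L rho <= d/2, against d <= L rho and d > 0; L + 1 is used since L may be 0. *)
  set (rho := Rmin e (d / (2 * (L + 1)))).
  assert (Hr : (0 < rho <= e)%R) by (split; [apply Rmin_pos; lra|apply Rmin_l]).
  assert (Hr2 : (rho <= d / (2 * (L + 1)))%R) by apply Rmin_r.
  specialize (B rho Hr).
  assert (L * rho <= L * (d / (2 * (L + 1))))%R by (apply Rmult_le_compat_l; auto).
  assert (L * (d / (2 * (L + 1))) <= d / 2)%R.
  { replace (d / 2)%R with ((L + 1) * (d / (2 * (L + 1))))%R by (field; lra). apply Rmult_le_compat_r; lra. }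
  lra.
Qed.
End Collapse.

(** * The regularized interval *)

(** If exp (2 pi i w) = 1, the modulus forces Im w = 0, and the real part then gives sin (pi Re w) =
    0. *)
Lemma per_neq1 w : not_int w -> per w - 1 <> 0.
Proof.
  intros H E. apply Ceq_minus in E. unfold per in E.
  assert (PI0 := PI_RGT_0).
  destruct w as [x y].
  assert (E1 : tau * (x, y) = ((- (2 * PI * y), 2 * PI * x)%R : C)).
  { unfold tau. apply C_ext; cbn; ring. }
  rewrite E1 in E.
  assert (M := f_equal Cmod E). rewrite Cmod_Cexp, Cmod_1 in M. cbn in M.
  assert (Y : y = 0%R).
  { rewrite <- exp_0 in M. apply exp_inv in M. nra. }
  subst y. unfold Cexp in E. cbn in E. rewrite M in E. injection E as Ec Es.
  rewrite Rmult_1_l in Ec.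
  replace (2 * PI * x)%R with (2 * (PI * x))%R in Ec by ring. rewrite cos_2a_sin in Ec.
  assert (S : sin (PI * x) = 0%R) by nra.
  destruct (sin_eq_0_0 _ S) as [k Hk]. apply (H k). apply C_ext; cbn; auto.
  apply Rmult_eq_reg_l with PI; lra.
Qed.

Lemma not_int_plus w (k : Z) : not_int w -> not_int (w + RtoC (IZR k)).
Proof.
  intros H m E. apply (H (m - k)%Z). rewrite minus_IZR, RtoC_minus, <- E. ring.
Qed.

Lemma not_int_plus1 w : not_int w -> not_int (w + 1).
Proof. apply (not_int_plus w 1). Qed.

Lemma not_int_opp w : not_int w -> not_int (- w).
Proof. intros H m E. apply (H (- m)%Z). rewrite opp_IZR, RtoC_opp, <- E. ring. Qed.

Lemma not_int_nonpos w : not_int w -> not_nonpos_int w.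
Proof. intros H n E. apply (H (- Z.of_nat n)%Z). now rewrite opp_IZR, RtoC_opp, <- INR_IZR_INZ. Qed.

Lemma not_int_neq0 w : not_int w -> w <> 0.
Proof. intros H E. apply (H 0%Z). exact E. Qed.

Section Interval.
Variable e : R.
Hypothesis he : (0 < e < 1 / 3)%R.

Definition sd (r : R) : C := RtoC (e + (1 - 2 * e) * r).

Definition side_int (u v : C) : C :=
  CRInt (fun r => Cexp (u * Clog (sd r) + v * Clog (1 - sd r)) * RtoC (1 - 2 * e)) 0 1.

Definition loop_int (u v : C) : C :=
  CRInt (fun p => Cexp (u * circlog e p + v * Clog (1 - circ e p)) * (tau * circ e p)) 0 1.

(** The regularized interval loaded with x^u (1-x)^v. The circle around 1 is written in the
    coordinate 1 - x, which exchanges u and v. *)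
Definition regI (u v : C) : C :=
  side_int u v + loop_int u v / (per u - 1) + loop_int v u / (per v - 1).

Lemma sd_bounds r : in01 r -> (e <= e + (1 - 2 * e) * r <= 1 - e)%R.
Proof. unfold in01. nra. Qed.

Lemma offcut_sd r : in01 r -> offcut (sd r).
Proof. intros H. apply offcut_RtoC. apply sd_bounds in H. lra. Qed.

Lemma sd_compl r : 1 - sd r = RtoC (1 - (e + (1 - 2 * e) * r)).
Proof. unfold sd. now rewrite RtoC_minus. Qed.

Lemma offcut_sd' r : in01 r -> offcut (1 - sd r).
Proof. intros H. rewrite sd_compl. apply offcut_RtoC. apply sd_bounds in H. lra. Qed.

Lemma offcut_circ1 p : offcut (1 - circ e p).
Proof.
  apply offcut_Re. assert (B := Re_circ e p ltac:(lra)). revert B. destruct (circ e p). cbn. lra.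
Qed.

Lemma Cderiv_sd r : Cderiv sd r (RtoC (1 - 2 * e)).
Proof. apply (Cderiv_RtoC (fun r => e + (1 - 2 * e) * r)%R). auto_derive; auto. ring. Qed.

Lemma ccont_sd r : ccont sd r.
Proof. eapply Cderiv_continuous, Cderiv_sd. Qed.

Lemma ccont_side u v r : in01 r -> ccont (fun r => Cexp (u * Clog (sd r) + v * Clog (1 - sd r)) * RtoC (1 - 2 * e)) r.
Proof.
  intros H. cC; try apply ccont_sd. now apply offcut_sd. now apply offcut_sd'.
Qed.

Lemma ccont_loop u v p : ccont (fun p => Cexp (u * circlog e p + v * Clog (1 - circ e p)) * (tau * circ e p)) p.
Proof.
  cC; match goal with
    | |- offcut _ => apply offcut_circ1
    | |- continuous (circ _) _ => apply ccont_circ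
    | |- continuous (circlog _) _ => apply ccont_circlog end.
Qed.

Lemma exI_side u v : exI (fun r => Cexp (u * Clog (sd r) + v * Clog (1 - sd r)) * RtoC (1 - 2 * e)) 0 1.
Proof. apply exI_cont. lra. intros r Hr. now apply ccont_side. Qed.

Lemma exI_loop1 u v : exI (fun p => Cexp (u * circlog e p + v * Clog (1 - circ e p)) * (tau * circ e p)) 0 1.
Proof. apply exI_cont_all. intros p. apply ccont_loop. Qed.

(** The integral of the derivative of x^(u+1) (1-x)^(v+1). Its values at e and 1 - e are cancelled
    by the two loops, which close up only to the factor [per]. *)
Lemma side_exact u v :
  (u + 1) * side_int u (v + 1) - (v + 1) * side_int (u + 1) v
  = Cexp ((u + 1) * Clog (sd 1) + (v + 1) * Clog (1 - sd 1)) - Cexp ((u + 1) * Clog (sd 0) + (v + 1) * Clog (1 - sd 0)).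
Proof.
  unfold side_int. rewrite <- !CRInt_scal by apply exI_side.
  rewrite <- CRInt_minus by apply exI_scal, exI_side.
  apply (CRInt_FTC (fun r => Cexp ((u + 1) * Clog (sd r) + (v + 1) * Clog (1 - sd r)))); [lra| |].
  - intros r Hr. assert (O1 := offcut_sd r Hr). assert (O2 := offcut_sd' r Hr).
    apply Cderiv_eq with (Cexp ((u + 1) * Clog (sd r) + (v + 1) * Clog (1 - sd r)) *
      ((u + 1) * (RtoC (1 - 2 * e) / sd r) + (v + 1) * ((0 - RtoC (1 - 2 * e)) / (1 - sd r)))).
    + apply (Cderiv_Cexp (fun r => (u + 1) * Clog (sd r) + (v + 1) * Clog (1 - sd r))).
      apply Cderiv_plus; apply Cderiv_scal.
      * apply (Cderiv_Clog sd); auto. apply Cderiv_sd.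
      * apply (Cderiv_Clog (fun r => 1 - sd r)); auto. apply Cderiv_minus. apply Cderiv_const. apply Cderiv_sd.
    + assert (N1 := offcut_neq0 _ O1). assert (N2 := offcut_neq0 _ O2).
      replace ((u + 1) * Clog (sd r) + (v + 1) * Clog (1 - sd r)) with (u * Clog (sd r) + v * Clog (1 - sd r) + (Clog (sd r) + Clog (1 - sd r))) by ring.
      replace (u * Clog (sd r) + (v + 1) * Clog (1 - sd r)) with (u * Clog (sd r) + v * Clog (1 - sd r) + Clog (1 - sd r)) by ring.
      replace ((u + 1) * Clog (sd r) + v * Clog (1 - sd r)) with (u * Clog (sd r) + v * Clog (1 - sd r) + Clog (sd r)) by ring.
      rewrite !(Cexp_add (u * Clog (sd r) + v * Clog (1 - sd r))), (Cexp_add (Clog (sd r))), !Cexp_Clog by auto.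
      field. auto.
  - intros r Hr. apply continuous_Cminus; (apply continuous_Cmult; [apply continuous_const|now apply ccont_side]).
Qed.

Lemma loop_exact u v :
  (u + 1) * loop_int u (v + 1) - (v + 1) * loop_int (u + 1) v
  = (per u - 1) * Cexp ((u + 1) * RtoC (ln e) + (v + 1) * Clog (1 - RtoC e)).
Proof.
  unfold loop_int. rewrite <- !CRInt_scal by apply exI_loop1.
  rewrite <- CRInt_minus by apply exI_scal, exI_loop1.
  rewrite (CRInt_FTC (fun r => Cexp ((u + 1) * circlog e r + (v + 1) * Clog (1 - circ e r)))); [|lra| |].
  - rewrite circlog_0, circlog_1, circ_0, circ_1.
    replace ((u + 1) * (RtoC (ln e) + tau) + (v + 1) * Clog (1 - RtoC e)) with (tau * (u + 1) + ((u + 1) * RtoC (ln e) + (v + 1) * Clog (1 - RtoC e))) by ring.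
    rewrite Cexp_add. fold (per (u + 1)). rewrite per_plus1. ring.
  - intros r Hr. assert (O1 := circ_neq0 e r ltac:(lra)). assert (O2 := offcut_circ1 r).
    apply Cderiv_eq with (Cexp ((u + 1) * circlog e r + (v + 1) * Clog (1 - circ e r)) *
      ((u + 1) * tau + (v + 1) * ((0 - tau * circ e r) / (1 - circ e r)))).
    + apply (Cderiv_Cexp (fun r => (u + 1) * circlog e r + (v + 1) * Clog (1 - circ e r))).
      apply Cderiv_plus; apply Cderiv_scal.
      * apply Cderiv_circlog.
      * apply (Cderiv_Clog (fun r => 1 - circ e r)); auto. apply Cderiv_minus. apply Cderiv_const. apply Cderiv_circ.
    + assert (N2 := offcut_neq0 _ O2).
      replace ((u + 1) * circlog e r + (v + 1) * Clog (1 - circ e r)) with (u * circlog e r + v * Clog (1 - circ e r) + (circlog e r + Clog (1 - circ e r))) by ring.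
      replace (u * circlog e r + (v + 1) * Clog (1 - circ e r)) with (u * circlog e r + v * Clog (1 - circ e r) + Clog (1 - circ e r)) by ring.
      replace ((u + 1) * circlog e r + v * Clog (1 - circ e r)) with (u * circlog e r + v * Clog (1 - circ e r) + circlog e r) by ring.
      rewrite !(Cexp_add (u * circlog e r + v * Clog (1 - circ e r))), (Cexp_add (circlog e r)), !Cexp_Clog, !circ_exp by (auto; lra).
      field. auto.
  - intros r Hr. apply continuous_Cminus; (apply continuous_Cmult; [apply continuous_const|apply ccont_loop]).
Qed.

Lemma side_split u v : side_int u v = side_int (u + 1) v + side_int u (v + 1).
Proof.
  unfold side_int. rewrite <- CRInt_plus by apply exI_side.
  apply CRInt_ext01. lra. intros r Hr.
  replace (u * Clog (sd r) + (v + 1) * Clog (1 - sd r)) with (u * Clog (sd r) + v * Clog (1 - sd r) + Clog (1 - sd r)) by ring.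
  replace ((u + 1) * Clog (sd r) + v * Clog (1 - sd r)) with (u * Clog (sd r) + v * Clog (1 - sd r) + Clog (sd r)) by ring.
  rewrite !(Cexp_add (u * Clog (sd r) + v * Clog (1 - sd r))), !Cexp_Clog by (now apply offcut_sd || now apply offcut_sd').
  ring.
Qed.

Lemma loop_split u v : loop_int u v = loop_int (u + 1) v + loop_int u (v + 1).
Proof.
  unfold loop_int. rewrite <- CRInt_plus by apply exI_loop1.
  apply CRInt_ext. intros r _.
  replace (u * circlog e r + (v + 1) * Clog (1 - circ e r)) with (u * circlog e r + v * Clog (1 - circ e r) + Clog (1 - circ e r)) by ring.
  replace ((u + 1) * circlog e r + v * Clog (1 - circ e r)) with (u * circlog e r + v * Clog (1 - circ e r) + circlog e r) by ring.
  rewrite !(Cexp_add (u * circlog e r + v * Clog (1 - circ e r))), !Cexp_Clog, !circ_exp by (try apply offcut_circ1; lra).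
  ring.
Qed.

(** The argument of [Bt_rec]; the boundary terms now cancel between the segment and the loops
    instead of vanishing, so no bound on Re u or Re v is needed. *)
Lemma regI_recurrence u v : per u - 1 <> 0 -> per v - 1 <> 0 ->
  (u + v + 2) * regI (u + 1) v = (u + 1) * regI u v /\
  (u + v + 2) * regI u (v + 1) = (v + 1) * regI u v.
Proof.
  intros hu hv.
  assert (S : regI u v = regI (u + 1) v + regI u (v + 1)).
  { unfold regI. rewrite !per_plus1, (side_split u v), (loop_split u v), (loop_split v u). unfold Cdiv. ring. }
  assert (D : (u + 1) * regI u (v + 1) = (v + 1) * regI (u + 1) v).
  { apply Ceq_minus. unfold regI. rewrite !per_plus1.
    assert (E1 := side_exact u v). assert (E2 := loop_exact u v). assert (E3 := loop_exact v u).
    assert (S0 : sd 0 = RtoC e) by (unfold sd; f_equal; ring).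
    assert (S1 : 1 - sd 1 = RtoC e) by (rewrite sd_compl; f_equal; ring).
    assert (S2 : sd 1 = 1 - RtoC e) by (unfold sd; rewrite <- RtoC_minus; f_equal; ring).
    rewrite S1, S0, S2, Clog_e in E1 by lra.
    transitivity (((u + 1) * side_int u (v + 1) - (v + 1) * side_int (u + 1) v)
      + ((u + 1) * loop_int u (v + 1) - (v + 1) * loop_int (u + 1) v) / (per u - 1)
      - ((v + 1) * loop_int v (u + 1) - (u + 1) * loop_int (v + 1) u) / (per v - 1)).
    - unfold Cdiv. ring.
    - rewrite E1, E2, E3.
      replace ((v + 1) * RtoC (ln e) + (u + 1) * Clog (1 - RtoC e)) with ((u + 1) * Clog (1 - RtoC e) + (v + 1) * RtoC (ln e)) by ring.
      field. auto. }
  split.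
  - transitivity ((u + 1) * regI (u + 1) v + (v + 1) * regI (u + 1) v); [ring|]. rewrite <- D, S. ring.
  - transitivity ((u + 1) * regI u (v + 1) + (v + 1) * regI u (v + 1)); [ring|]. rewrite D, S. ring.
Qed.

Lemma rpow_Clog v x : (0 < x)%R -> Cexp (v * Clog (RtoC x)) = rpow v x.
Proof. intros H. rewrite Clog_RtoC, rpow_pos; auto. Qed.

Lemma loop_int_collapse u v : (1 <= Re u)%R ->
  loop_int u v = (per u - 1) * CRInt (fun x => rpow u x * rpow v (1 - x)%R) 0 e.
Proof.
  intros Hu.
  assert (HA : exists dA, holo e (fun x => Cexp (v * Clog (1 + (- 1) * x))) dA).
  { eexists. apply holo_exp, holo_mult. apply holo_const. apply holo_log.
    2:{ apply holo_plus. apply holo_const. apply holo_mult. apply holo_const. apply holo_id. }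
    intros x Hx. apply offcut_Re. assert (B := Re_le_Cmod x). apply Rabs_le_between in B.
    destruct x as [x1 x2]. cbn in *. lra. }
  destruct HA as [dA HA].
  assert (K := loop_collapse e _ dA u ltac:(lra) HA Hu).
  transitivity (loop (fun x => Cexp (v * Clog (1 + (- 1) * x))) u e).
  - unfold loop, loop_int. apply CRInt_ext. intros p _. rewrite <- Cexp_add.
    replace (1 + (-1) * circ e p) with (1 - circ e p). reflexivity. apply C_ext; cbn; ring.
  - rewrite K. f_equal. apply CRInt_ext01. lra. intros x Hx. f_equal.
    replace (1 + (-1) * RtoC x) with (RtoC (1 - x)) by (apply C_ext; cbn; ring).
    apply rpow_Clog. lra.
Qed.

(** After the collapse the three terms are the integrals over [e, 1-e], [0, e] and [1-e, 1]. *)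
Lemma regI_Bt u v : per u - 1 <> 0 -> per v - 1 <> 0 -> (1 <= Re u)%R -> (1 <= Re v)%R -> regI u v = Bt u v.
Proof.
  intros hu hv Hu Hv. unfold regI. rewrite !loop_int_collapse by auto.
  assert (S : side_int u v = CRInt (fun x => rpow u x * rpow v (1 - x)%R) e (1 - e)).
  { assert (X := CRInt_comp_lin (fun x => rpow u x * rpow v (1 - x)%R) (1 - 2 * e) e 0 1 (exI_Bt u v _ _ Hu Hv)).
    replace ((1 - 2 * e) * 0 + e)%R with e in X by ring. replace ((1 - 2 * e) * 1 + e)%R with (1 - e)%R in X by ring.
    rewrite X. unfold side_int. apply CRInt_ext01. lra. intros r Hr.
    rewrite sd_compl. unfold sd. assert (B := sd_bounds r Hr).
    rewrite Cexp_add, !rpow_Clog by lra. rewrite (Rplus_comm e). ring. }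
  assert (F : CRInt (fun x => rpow v x * rpow u (1 - x)%R) 0 e = CRInt (fun x => rpow u x * rpow v (1 - x)%R) (1 - e) 1).
  { assert (X := CRInt_comp_lin (fun x => rpow u x * rpow v (1 - x)%R) (-1) 1 0 e (exI_Bt u v _ _ Hu Hv)).
    replace (-1 * 0 + 1)%R with 1%R in X by ring. replace (-1 * e + 1)%R with (1 - e)%R in X by ring.
    assert (C := CRInt_Chasles (fun x => rpow u x * rpow v (1 - x)%R) 1 (1 - e) 1 (exI_Bt u v _ _ Hu Hv) (exI_Bt u v _ _ Hu Hv)).
    rewrite CRInt_point, X in C.
    rewrite (CRInt_ext _ (fun y => RtoC (-1) * (rpow v y * rpow u (1 - y)%R))) in C.
    - rewrite CRInt_scal in C by now apply exI_Bt.
      transitivity (CRInt (fun x => rpow u x * rpow v (1 - x)%R) (1 - e) 1 - (RtoC (-1) * CRInt (fun x => rpow v x * rpow u (1 - x)%R) 0 e + CRInt (fun x => rpow u x * rpow v (1 - x)%R) (1 - e) 1)).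
      replace (RtoC (-1)) with (- RtoC 1) by (apply C_ext; cbn; ring). ring.
      rewrite C. ring.
    - intros y _. replace (-1 * y + 1)%R with (1 - y)%R by ring. replace (1 - (1 - y))%R with y by ring. ring. }
  rewrite S, F. unfold Bt.
  rewrite <- (CRInt_Chasles _ 0 e 1), <- (CRInt_Chasles _ e (1 - e) 1) by now apply exI_Bt.
  field. auto.
Qed.

(** Both exponents are raised by the recurrence until the Beta formula applies. Each step divides by
    u + 1 or v + 1, nonzero since u and v are not integers, while the sum u + v + 2 only has to
    avoid the poles of Gamma. *)
Lemma regI_Gamma u v : not_int u -> not_int v -> not_nonpos_int (u + v + 2) ->
  regI u v * CGamma (u + v + 2) = CGamma (u + 1) * CGamma (v + 1).
Proof.
  assert (Su : forall u v, not_int u -> not_int v -> not_nonpos_int (u + v + 2) ->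
    regI (u + 1) v * CGamma (u + 1 + v + 2) = CGamma (u + 1 + 1) * CGamma (v + 1) ->
    regI u v * CGamma (u + v + 2) = CGamma (u + 1) * CGamma (v + 1)).
  { intros u' v' hu hv huv E.
    destruct (regI_recurrence u' v' (per_neq1 _ hu) (per_neq1 _ hv)) as [R _].
    replace (u' + 1 + v' + 2) with (u' + v' + 2 + 1) in E by ring.
    rewrite (CGamma_plus1 (u' + 1)), (CGamma_plus1 (u' + v' + 2)) in E by (auto; apply not_int_nonpos; auto using not_int_plus1).
    assert (N := not_int_neq0 _ (not_int_plus1 _ hu)).
    transitivity (/ (u' + 1) * ((u' + 1) * regI u' v' * CGamma (u' + v' + 2))). field; auto.
    rewrite <- R.
    transitivity (/ (u' + 1) * (regI (u' + 1) v' * ((u' + v' + 2) * CGamma (u' + v' + 2)))). ring.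
    rewrite E. field. auto. }
  assert (Sv : forall u v, not_int u -> not_int v -> not_nonpos_int (u + v + 2) ->
    regI u (v + 1) * CGamma (u + (v + 1) + 2) = CGamma (u + 1) * CGamma (v + 1 + 1) ->
    regI u v * CGamma (u + v + 2) = CGamma (u + 1) * CGamma (v + 1)).
  { intros u' v' hu hv huv E.
    destruct (regI_recurrence u' v' (per_neq1 _ hu) (per_neq1 _ hv)) as [_ R].
    replace (u' + (v' + 1) + 2) with (u' + v' + 2 + 1) in E by ring.
    rewrite !(CGamma_plus1 (v' + 1)), (CGamma_plus1 (u' + v' + 2)) in E by (auto; apply not_int_nonpos; auto using not_int_plus1).
    assert (N := not_int_neq0 _ (not_int_plus1 _ hv)).
    transitivity (/ (v' + 1) * ((v' + 1) * regI u' v' * CGamma (u' + v' + 2))). field; auto.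
    rewrite <- R.
    transitivity (/ (v' + 1) * (regI u' (v' + 1) * ((u' + v' + 2) * CGamma (u' + v' + 2)))). ring.
    rewrite E. field. auto. }
  assert (Base : forall n u v, not_int u -> not_int v -> not_nonpos_int (u + v + 2) ->
    (1 <= Re u + INR n)%R -> (2 <= Re v + INR n)%R -> regI u v * CGamma (u + v + 2) = CGamma (u + 1) * CGamma (v + 1)).
  { induction n; intros u' v' hu hv huv Hu Hv.
    - simpl in Hu, Hv. rewrite regI_Bt by (try lra; now apply per_neq1). apply Bt_Gamma; lra.
    - rewrite S_INR in Hu, Hv. apply Su; auto. apply Sv; auto using not_int_plus1.
      { replace (u' + 1 + v' + 2) with (u' + v' + 2 + 1) by ring. now apply nonpos_plus1. }
      apply IHn; auto using not_int_plus1.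
      { replace (u' + 1 + (v' + 1) + 2) with (u' + v' + 2 + 1 + 1) by ring. now apply nonpos_plus1, nonpos_plus1. }
      all: rewrite Re_plus1; lra. }
  intros hu hv huv.
  destruct (INR_unbounded (2 - Re u)) as [n1 H1]. destruct (INR_unbounded (2 - Re v)) as [n2 H2].
  apply (Base (n1 + n2)%nat); auto; rewrite plus_INR; generalize (pos_INR n1) (pos_INR n2); lra.
Qed.
End Interval.

(** * Simplex integrals *)

Lemma CRInt_shift (f : R -> C) v s t : (forall x, ccont f x) ->
  CRInt (fun x => f (x + v)%R) s t = CRInt f (s + v) (t + v).
Proof.
  intros H. assert (X := CRInt_comp_lin f 1 v s t (exI_cont_all f _ _ H)).
  rewrite !Rmult_1_l in X. rewrite X. apply CRInt_ext. intros x _. rewrite Rmult_1_l. ring.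
Qed.

Lemma CRInt_reflect (f : R -> C) v s t : (forall x, ccont f x) ->
  CRInt (fun x => f (v - x)%R) s t = CRInt f (v - t) (v - s).
Proof.
  intros H. assert (X := CRInt_comp_lin f (-1) v s t (exI_cont_all f _ _ H)).
  replace (-1 * s + v)%R with (v - s)%R in X by ring. replace (-1 * t + v)%R with (v - t)%R in X by ring.
  assert (C := CRInt_Chasles f (v - s) (v - t) (v - s) (exI_cont_all f _ _ H) (exI_cont_all f _ _ H)).
  rewrite CRInt_point, X in C.
  assert (J : forall x, ccont (fun x => f (v - x)%R) x).
  { intros x. apply (continuous_comp (fun x => (v - x)%R) (f : R -> C_UniformSpace)); auto.
    apply (ex_derive_continuous (V := R_NormedModule)). auto_derive. auto. }
  rewrite (CRInt_ext _ (fun y => RtoC (-1) * f (v - y)%R)) in C.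
  - rewrite CRInt_scal in C by now apply exI_cont_all.
    replace (RtoC (-1)) with (- RtoC 1) in C by (apply C_ext; cbn; ring).
    transitivity (CRInt f (v - t) (v - s) - (- RtoC 1 * CRInt (fun x : R => f (v - x)%R) s t + CRInt f (v - t) (v - s))).
    ring. rewrite C. ring.
  - intros y _. replace (-1 * y + v)%R with (v - y)%R by ring. reflexivity.
Qed.

Lemma ccont_RInt_bounds (F : R -> R -> C) (g h : R -> R) x :
  (forall z, ccont (fun z : R * R => F (fst z) (snd z)) z) ->
  (forall x, continuous g x) -> (forall x, continuous h x) ->
  ccont (fun x => CRInt (F x) (g x) (h x)) x.
Proof.
  intros HF Hg Hh.
  apply continuous_ext with (fun x => RtoC (h x - g x) * CRInt (fun s => F x (g x + (h x - g x) * s)%R) 0 1).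
  - intros y. rewrite <- (CRInt_segment (F y)) by (intros; apply (cont_snd F HF)). f_equal; ring.
  - apply continuous_Cmult. apply continuous_RtoC, continuous_Rmi; auto.
    refine (continuous_RInt_param_all (fun x s => F x (g x + (h x - g x) * s)%R) 0 1 Rle_0_1 _ x).
    intros z. apply (continuous_comp_2 (V := R_UniformSpace) (W := R_UniformSpace) fst (fun z : R * R => g (fst z) + (h (fst z) - g (fst z)) * snd z)%R (F : R -> R -> C_UniformSpace) z).
    + apply continuous_pfst.
    + assert (Cg : continuous (fun z : R * R => g (fst z)) z) by (apply (continuous_comp fst g); [apply continuous_pfst|apply Hg]).
      assert (Ch : continuous (fun z : R * R => h (fst z)) z) by (apply (continuous_comp fst h); [apply continuous_pfst|apply Hh]).
      apply continuous_Rp; [exact Cg|]. apply continuous_Rm; [|apply continuous_psnd]. apply continuous_Rmi; assumption.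
    + apply HF.
Qed.

Lemma continuous_sub a x : continuous (fun x => a - x)%R x.
Proof. apply (ex_derive_continuous (V := R_NormedModule)). auto_derive. auto. Qed.

Section Simplex.
Variables w0 w1 w2 : C.
Hypotheses (h0 : (1 <= Re w0)%R) (h1 : (1 <= Re w1)%R) (h2 : (1 <= Re w2)%R).

Definition mon (w0 w1 w2 : C) (x y : R) : C := rpow w0 x * rpow w1 y * rpow w2 (1 - x - y)%R.

Lemma mon_cont z : ccont (fun z : R * R => mon w0 w1 w2 (fst z) (snd z)) z.
Proof.
  unfold mon. apply continuous_Cmult; [apply continuous_Cmult|].
  - apply (continuous_comp fst (rpow w0 : R -> C_UniformSpace)). contR. now apply ccont_rpow.
  - apply (continuous_comp snd (rpow w1 : R -> C_UniformSpace)). contR. now apply ccont_rpow.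
  - apply (continuous_comp (fun z : R * R => 1 - fst z - snd z)%R (rpow w2 : R -> C_UniformSpace)). contR. now apply ccont_rpow.
Qed.

Lemma mon_cx x y : ccont (fun x => mon w0 w1 w2 x y) x.
Proof. exact (cont_fst _ mon_cont x y). Qed.

Lemma mon_cy x y : ccont (fun y => mon w0 w1 w2 x y) y.
Proof. exact (cont_snd _ mon_cont x y). Qed.

(** The integral over the part of the triangle where l_0 >= a, l_1 >= b, l_2 >= c. *)
Definition simplex (w0 w1 w2 : C) (a b c : R) : C :=
  CRInt (fun x => CRInt (mon w0 w1 w2 x) b (1 - c - x)) a (1 - b - c).

(* Both orders of integration equal the integral over the lines [x + y = const]. *)
Lemma simplex_rot a b c : (a + b + c <= 1)%R ->
  simplex w0 w1 w2 a b c = simplex w1 w2 w0 b c a.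
Proof.
  intros Habc. set (L := (1 - a - b - c)%R). assert (HL : (0 <= L)%R) by (unfold L; lra).
  set (F := fun x u => mon w0 w1 w2 (a + x) (b + u - x)).
  set (F' := fun y u => mon w0 w1 w2 (a + u - y) (b + y)).
  assert (CF : forall z, ccont (fun z : R * R => F (fst z) (snd z)) z).
  { intros z. unfold F. cont2 (mon w0 w1 w2) mon_cont; contR. }
  assert (CF' : forall z, ccont (fun z : R * R => F' (fst z) (snd z)) z).
  { intros z. unfold F'. cont2 (mon w0 w1 w2) mon_cont; contR. }
  assert (T1 := triangle_Fubini F CF L HL). assert (T2 := triangle_Fubini F' CF' L HL).
  assert (E : CRInt (fun u => CRInt (fun x => F x u) 0 u) 0 L = CRInt (fun u => CRInt (fun x => F' x u) 0 u) 0 L).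
  { apply CRInt_ext. intros u _.
    assert (X := CRInt_reflect (fun y => F' y u) u 0 u (fun y => cont_fst F' CF' y u)).
    rewrite Rminus_diag, Rminus_0_r in X. rewrite <- X. apply CRInt_ext. intros x _.
    unfold F, F'. f_equal; ring. }
  assert (S1 : simplex w0 w1 w2 a b c = CRInt (fun x => CRInt (F x) x L) 0 L).
  { unfold simplex.
    assert (X := CRInt_shift (fun x => CRInt (mon w0 w1 w2 x) b (1 - c - x)) a 0 L
      (fun x => ccont_RInt_bounds _ (fun _ => b) (fun x => 1 - c - x)%R x mon_cont (fun x => continuous_const b x) (continuous_sub _))).
    replace (0 + a)%R with a in X by ring. replace (L + a)%R with (1 - b - c)%R in X by (unfold L; ring).
    rewrite <- X. apply CRInt_ext. intros x _.
    assert (Y := CRInt_shift (mon w0 w1 w2 (a + x)) (b - x) x L (mon_cy (a + x))).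
    replace (x + (b - x))%R with b in Y by ring. replace (L + (b - x))%R with (1 - c - (x + a))%R in Y by (unfold L; ring).
    rewrite (Rplus_comm x a) in *. rewrite <- Y. apply CRInt_ext. intros u _. unfold F. f_equal; ring. }
  assert (S2 : simplex w1 w2 w0 b c a = CRInt (fun y => CRInt (F' y) y L) 0 L).
  { transitivity (CRInt (fun y => CRInt (fun x => mon w0 w1 w2 x y) a (1 - c - y)) b (1 - c - a)).
    - unfold simplex. apply CRInt_ext. intros y _.
      assert (X := CRInt_reflect (fun x => mon w0 w1 w2 x y) (1 - y) c (1 - a - y) (fun x => mon_cx x y)).
      replace (1 - y - (1 - a - y))%R with a in X by ring. replace (1 - y - c)%R with (1 - c - y)%R in X by ring.
      rewrite <- X. apply CRInt_ext. intros z _. unfold mon.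
      replace (1 - (1 - y - z) - y)%R with z by ring. ring.
    - assert (CM : forall z, ccont (fun z : R * R => mon w0 w1 w2 (snd z) (fst z)) z) by (intros z; cont2 (mon w0 w1 w2) mon_cont; contR).
      assert (X := CRInt_shift (fun y => CRInt (fun x => mon w0 w1 w2 x y) a (1 - c - y)) b 0 L
        (fun x => ccont_RInt_bounds (fun y x => mon w0 w1 w2 x y) (fun _ => a) (fun x => 1 - c - x)%R x CM (fun x => continuous_const a x) (continuous_sub _))).
      replace (0 + b)%R with b in X by ring. replace (L + b)%R with (1 - c - a)%R in X by (unfold L; ring).
      rewrite <- X. apply CRInt_ext. intros y _.
      assert (Y := CRInt_shift (fun x => mon w0 w1 w2 x (b + y)) (a - y) y L (fun x => mon_cx x (b + y))).
      replace (y + (a - y))%R with a in Y by ring. replace (L + (a - y))%R with (1 - c - (y + b))%R in Y by (unfold L; ring).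
      rewrite (Rplus_comm y b) in *. rewrite <- Y. apply CRInt_ext. intros u _. unfold F'. f_equal; ring. }
  rewrite S1, S2. etransitivity; [exact T1|]. etransitivity; [exact E|]. symmetry; exact T2.
Qed.

Lemma exI_mon_y x s t : exI (mon w0 w1 w2 x) s t.
Proof. apply exI_cont_all. intros y. apply mon_cy. Qed.

Lemma exI_mon_xy (g h : R -> R) s t : (forall x, continuous g x) -> (forall x, continuous h x) ->
  exI (fun x => CRInt (mon w0 w1 w2 x) (g x) (h x)) s t.
Proof. intros Hg Hh. apply exI_cont_all. intros x. now apply (ccont_RInt_bounds _ g h x mon_cont). Qed.

Lemma simplex_cut e b c :
  simplex w0 w1 w2 0 b c = CRInt (fun x => CRInt (mon w0 w1 w2 x) b (1 - c - x)) 0 e + simplex w0 w1 w2 e b c.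
Proof.
  unfold simplex. symmetry. apply CRInt_Chasles; apply exI_mon_xy;
    intros; first [apply continuous_const|apply continuous_sub].
Qed.

(** The fibre over x has length 1 - x; scaling it to [0,1] splits Dirichlet's integral into two Beta
    integrals, the Jacobian adding 1 to the exponent of 1 - x. *)
Lemma simplex_Bt : simplex w0 w1 w2 0 0 0 = Bt w0 (w1 + w2 + 1) * Bt w1 w2.
Proof.
  assert (H12 : (1 <= Re (w1 + w2 + 1))%R) by (cbn; unfold Re in *; lra).
  unfold simplex. unfold Bt at 1. rewrite <- CRInt_scalr by now apply exI_Bt.
  replace (1 - 0 - 0)%R with 1%R by ring. apply CRInt_ext01. lra. intros x Hx.
  replace (1 - 0 - x)%R with (1 - x)%R by ring.
  (* At x = 1 the fibre is a point and cannot be rescaled; both sides are 0 there. *)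
  destruct (Req_dec x 1) as [->|Hx1].
  - rewrite Rminus_diag, CRInt_point, (rpow_neg _ 0) by lra. ring.
  - set (m := (1 - x)%R). assert (Hm : (0 < m)%R) by (unfold m; lra).
    assert (X := CRInt_comp_lin (mon w0 w1 w2 x) m 0 0 1 (exI_mon_y x _ _)).
    replace (m * 0 + 0)%R with 0%R in X by ring. replace (m * 1 + 0)%R with m in X by ring.
    rewrite X. unfold Bt. rewrite <- CRInt_scal by now apply exI_Bt.
    apply CRInt_ext. intros t _. unfold mon. fold m. rewrite Rplus_0_r.
    replace (m - m * t)%R with (m * (1 - t))%R by ring.
    rewrite !rpow_mul by auto. rewrite rpow_S, rpow_add. ring.
Qed.

(** The region onto which the edge cell collapses: l_0 <= e, with l_1 and l_2 at least e. In the
    next definition, [corner], both l_0 and l_1 are at most e. *)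
Definition strip (e : R) (w0 w1 w2 : C) : C := CRInt (fun x => CRInt (mon w0 w1 w2 x) e (1 - e - x)) 0 e.
Definition corner (e : R) (w0 w1 w2 : C) : C := CRInt (fun x => CRInt (mon w0 w1 w2 x) 0 e) 0 e.
End Simplex.

Section Decomposition.
Variables (e : R) (w0 w1 w2 : C).
Hypothesis he : (0 < e < 1 / 3)%R.
Hypotheses (h0 : (1 <= Re w0)%R) (h1 : (1 <= Re w1)%R) (h2 : (1 <= Re w2)%R).

(** The region is l_0 <= e, l_2 <= e, a corner for the rotated numbering; reflecting y in each fibre
    makes l_2 the variable. *)
Lemma corner_far : CRInt (fun x => CRInt (mon w0 w1 w2 x) (1 - e - x) (1 - x)) 0 e = corner e w2 w0 w1.
Proof.
  unfold corner.
  assert (M := mon_cont w2 w0 w1 h2 h0 h1).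
  assert (Z : (0 <= e)%R) by lra.
  etransitivity; [|symmetry; exact (Fubini_all (mon w2 w0 w1) M 0 e 0 e Z Z)].
  apply CRInt_ext. intros x _.
  assert (X := CRInt_reflect (mon w0 w1 w2 x) (1 - x) 0 e (mon_cy w0 w1 w2 h0 h1 h2 x)).
  replace (1 - x - e)%R with (1 - e - x)%R in X by ring. replace (1 - x - 0)%R with (1 - x)%R in X by ring.
  rewrite <- X. apply CRInt_ext. intros z _. unfold mon.
  replace (1 - x - (1 - x - z))%R with z by ring. replace (1 - z - x)%R with (1 - x - z)%R by ring. ring.
Qed.

(** The triangle is cut along l_0 = e, l_1 = e and l_2 = e in turn, with a rotation between the cuts
    so that each one concerns the outer variable. Each rotation requires the remaining region to be
    a genuine triangle, whence 3e <= 1. *)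
Lemma simplex_decomposition :
  simplex w0 w1 w2 0 0 0 = simplex w0 w1 w2 e e e
    + (strip e w0 w1 w2 + strip e w1 w2 w0 + strip e w2 w0 w1)
    + (corner e w0 w1 w2 + corner e w1 w2 w0 + corner e w2 w0 w1).
Proof.
  assert (A1 : CRInt (fun x => CRInt (mon w0 w1 w2 x) 0 (1 - 0 - x)) 0 e = corner e w0 w1 w2 + strip e w0 w1 w2 + corner e w2 w0 w1).
  { rewrite <- corner_far. unfold corner, strip.
    assert (I1 := exI_mon_xy w0 w1 w2 h0 h1 h2 _ _ 0 e (continuous_const 0%R) (continuous_const e)).
    assert (I2 := exI_mon_xy w0 w1 w2 h0 h1 h2 _ _ 0 e (continuous_const e) (continuous_sub (1 - e))).
    assert (I3 := exI_mon_xy w0 w1 w2 h0 h1 h2 _ _ 0 e (continuous_sub (1 - e)) (continuous_sub 1)).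
    rewrite <- (CRInt_plus _ _ _ _ I1 I2), <- (CRInt_plus _ _ _ _ (exI_plus _ _ _ _ I1 I2) I3).
    apply CRInt_ext. intros x _. rewrite !CRInt_Chasles by (apply exI_mon_y; assumption). f_equal. ring. }
  assert (A2 : CRInt (fun x => CRInt (mon w1 w2 w0 x) 0 (1 - e - x)) 0 e = corner e w1 w2 w0 + strip e w1 w2 w0).
  { unfold corner, strip.
    assert (I1 := exI_mon_xy w1 w2 w0 h1 h2 h0 _ _ 0 e (continuous_const 0%R) (continuous_const e)).
    assert (I2 := exI_mon_xy w1 w2 w0 h1 h2 h0 _ _ 0 e (continuous_const e) (continuous_sub (1 - e))).
    rewrite <- (CRInt_plus _ _ _ _ I1 I2).
    apply CRInt_ext. intros x _. rewrite !CRInt_Chasles by (apply exI_mon_y; assumption). reflexivity. }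
  rewrite (simplex_cut w0 w1 w2 h0 h1 h2 e), A1.
  rewrite (simplex_rot w0 w1 w2 h0 h1 h2 e 0 0) by lra.
  rewrite (simplex_cut w1 w2 w0 h1 h2 h0 e), A2.
  rewrite (simplex_rot w1 w2 w0 h1 h2 h0 e 0 e) by lra.
  rewrite (simplex_cut w2 w0 w1 h2 h0 h1 e). fold (strip e w2 w0 w1).
  rewrite (simplex_rot w2 w0 w1 h2 h0 h1 e e e) by lra. ring.
Qed.
End Decomposition.

(** * Evaluation of the regularized triangle *)

Lemma pow3_mon w0 w1 w2 x y : (0 < x)%R -> (0 < y)%R -> (0 < 1 - x - y)%R ->
  pow3 w0 w1 w2 (Clog (RtoC x)) (Clog (RtoC y)) (Clog (1 - RtoC x - RtoC y)) = mon w0 w1 w2 x y.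
Proof.
  intros Hx Hy Hz. rewrite <- !RtoC_minus. unfold pow3, mon.
  now rewrite !Cexp_add, !rpow_Clog.
Qed.

Section Evaluate.
Variables (e : R) (w0 w1 w2 : C).
Hypothesis he : (0 < e < 1 / 3)%R.
Hypotheses (h0 : (1 <= Re w0)%R) (h1 : (1 <= Re w1)%R) (h2 : (1 <= Re w2)%R).

Lemma tri_sigma_simplex : tri_sigma e w0 w1 w2 = simplex w0 w1 w2 e e e.
Proof.
  unfold tri_sigma, cell_int, simplex.
  assert (X := CRInt_comp_lin (fun x => CRInt (mon w0 w1 w2 x) e (1 - e - x)) (1 - 3 * e) e 0 1
     (exI_mon_xy w0 w1 w2 h0 h1 h2 _ _ _ _ (continuous_const e) (continuous_sub (1 - e)))).
  replace ((1 - 3 * e) * 0 + e)%R with e in X by ring. replace ((1 - 3 * e) * 1 + e)%R with (1 - e - e)%R in X by ring.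
  rewrite X. apply CRInt_ext01. lra. intros p Hp.
  set (x := ((1 - 3 * e) * p + e)%R).
  assert (Y := CRInt_comp_lin (mon w0 w1 w2 x) ((1 - 3 * e) * (1 - p)) e 0 1 (exI_mon_y w0 w1 w2 h0 h1 h2 x _ _)).
  replace ((1 - 3 * e) * (1 - p) * 0 + e)%R with e in Y by ring.
  replace ((1 - 3 * e) * (1 - p) * 1 + e)%R with (1 - e - x)%R in Y by (unfold x; ring).
  rewrite Y, <- CRInt_scal.
  2:{ apply exI_scal, exI_cont_all. intros y.
      apply (continuous_comp (fun y => (1 - 3 * e) * (1 - p) * y + e)%R (mon w0 w1 w2 x : R -> C_UniformSpace)).
      apply (ex_derive_continuous (V := R_NormedModule)). auto_derive. auto. now apply mon_cy. }
  apply CRInt_ext01. lra. intros q Hq.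
  assert (P1 := sx_pos e he p Hp). assert (P2 := sy_pos e he p q Hp Hq). assert (P3 := sz_pos e he p q Hp Hq).
  unfold lz, sx, sy, sxp, syp, syq. rewrite pow3_mon by lra.
  replace (mon w0 w1 w2 (e + (1 - 3 * e) * p) (e + (1 - 3 * e) * (1 - p) * q)) with (mon w0 w1 w2 x ((1 - 3 * e) * (1 - p) * q + e)).
  ring. f_equal; unfold x; ring.
Qed.

Lemma cont_rect_prod1 (f : R -> C) (g : R -> R -> C) a b c d : (forall x, ccont f x) -> cont_rect g a b c d ->
  cont_rect (fun x y => f x * g x y) a b c d.
Proof.
  intros Hf Hg x y Hx Hy. apply continuous_Cmult.
  - apply (continuous_comp fst (f : R -> C_UniformSpace)). apply continuous_pfst. apply Hf.
  - now apply Hg.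
Qed.

(** At fixed q, what multiplies l_0^w0 dl_0 on the edge cell, as a holomorphic function of x = l_0:
    the factors l_1^w1 and l_2^w2 and the derivative 1 - 2e - x of l_1 in q. *)
Definition edge_amp (q : R) (x : C) : C :=
  Cexp (w1 * Clog (RtoC (e + q * (1 - 2 * e)) + (- RtoC q) * x)
      + w2 * Clog (RtoC (e + (1 - q) * (1 - 2 * e)) + (- RtoC (1 - q)) * x)) * (RtoC (1 - 2 * e) + (- (1)) * x).

Lemma edge_amp_offcut q x : in01 q -> (Cmod x <= e)%R -> offcut (RtoC (e + q * (1 - 2 * e)) + (- RtoC q) * x).
Proof.
  unfold in01. intros Hq Hx. apply offcut_Re. assert (B := Re_le_Cmod x). apply Rabs_le_between in B.
  destruct x as [x1 x2]. cbn in *. nra.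
Qed.

Lemma holo_edge_amp q : in01 q -> exists dA, holo e (edge_amp q) dA.
Proof.
  intros Hq. eexists. apply holo_mult; [apply holo_exp, holo_plus; (apply holo_mult; [apply holo_const|apply holo_log])|].
  - intros x Hx. now apply edge_amp_offcut.
  - apply holo_plus. apply holo_const. apply holo_mult. apply holo_const. apply holo_id.
  - intros x Hx. apply edge_amp_offcut; auto. now apply in01_sub.
  - apply holo_plus. apply holo_const. apply holo_mult. apply holo_const. apply holo_id.
  - apply holo_plus. apply holo_const. apply holo_mult. apply holo_const. apply holo_id.
Qed.

Lemma edge_amp_cont : cont_rect (fun x q => edge_amp q (RtoC x)) 0 e 0 1.
Proof.
  intros x q Hx Hq. unfold edge_amp.
  assert (HX : (Cmod (RtoC x) <= e)%R) by (rewrite Cmod_R, Rabs_pos_eq; lra).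
  assert (Cx : ccont (fun z : R * R => RtoC (fst z)) (x, q)) by (apply continuous_RtoC; contR).
  assert (Cq : forall a b, ccont (fun z : R * R => RtoC (a + snd z * b)) (x, q)) by (intros; apply continuous_RtoC; contR).
  assert (Cq' : forall a b, ccont (fun z : R * R => RtoC (a + (1 - snd z) * b)) (x, q)) by (intros; apply continuous_RtoC; contR).
  assert (Cq1 : ccont (fun z : R * R => RtoC (snd z)) (x, q)) by (apply continuous_RtoC; contR).
  assert (Cq2 : ccont (fun z : R * R => RtoC (1 - snd z)) (x, q)) by (apply continuous_RtoC; contR).
  assert (C1 : forall c, ccont (fun _ : R * R => c) (x, q)) by (intros; apply continuous_const).
  apply continuous_Cmult; [|apply continuous_Cplus; [apply C1|apply continuous_Cmult; [apply C1|exact Cx]]].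
  apply continuous_Cexp, continuous_Cplus; (apply continuous_Cmult; [apply C1|apply continuous_Clog]).
  - now apply edge_amp_offcut.
  - apply continuous_Cplus; [apply Cq|]. apply continuous_Cmult; [apply continuous_Copp; exact Cq1|exact Cx].
  - apply edge_amp_offcut; auto. now apply in01_sub.
  - apply continuous_Cplus; [apply Cq'|]. apply continuous_Cmult; [apply continuous_Copp; exact Cq2|exact Cx].
Qed.

(** Fubini puts the circle inside, where it collapses for each fixed q; with the order restored, the
    substitution from q to l_1 at fixed x yields the strip. *)
Lemma tri_edge_strip : tri_edge e w0 w1 w2 = (per w0 - 1) * strip e w0 w1 w2.
Proof.
  assert (Hc : cont01 (fun p q => pow3 w0 w1 w2 (circlog e p) (Clog (ey e p q)) (lz (fun p _ => circ e p) (ey e) p q)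
     * (tau * circ e p * eyq e p q - 0 * eyp e p q))).
  { apply (cell_int_cont (fun p _ => circ e p) (fun p _ => tau * circ e p) (fun _ _ => 0) (ey e) (eyp e) (eyq e)
     (fun p _ => circlog e p) (fun p q => Clog (ey e p q)) (lz (fun p _ => circ e p) (ey e))).
    - apply C1pq_circ_p.
    - apply C1_ey.
    - apply C1pq_circlog_p; lra.
    - apply (C1pq_log (ey e)); [intros; now apply offcut_ey|apply C1_ey].
    - apply (C1_lz (fun p _ => circ e p) (fun p _ => tau * circ e p) (fun _ _ => 0) (ey e) (eyp e) (eyq e)).
      apply C1pq_circ_p. apply C1_ey. intros; now apply offcut_ez. }
  unfold tri_edge, cell_int.
  etransitivity; [exact (Fubini_rect _ 0 1 0 1 Rle_0_1 Rle_0_1 Hc)|].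
  assert (EQ : forall q, in01 q -> CRInt (fun p => pow3 w0 w1 w2 (circlog e p) (Clog (ey e p q)) (lz (fun p _ => circ e p) (ey e) p q)
     * (tau * circ e p * eyq e p q - 0 * eyp e p q)) 0 1 = (per w0 - 1) * CRInt (fun x => rpow w0 x * edge_amp q (RtoC x)) 0 e).
  { intros q Hq. destruct (holo_edge_amp q Hq) as [dA HA].
    rewrite <- (loop_collapse e (edge_amp q) dA w0 ltac:(lra) HA h0).
    unfold loop. apply CRInt_ext. intros p _. unfold pow3, edge_amp, lz, eyq. rewrite ez_eq.
    replace (RtoC (e + q * (1 - 2 * e)) + - RtoC q * circ e p) with (ey e p q).
    2:{ unfold ey. rewrite RtoC_plus, RtoC_mult, RtoC_minus, RtoC_mult. ring. }
    replace (RtoC (e + (1 - q) * (1 - 2 * e)) + - RtoC (1 - q) * circ e p) with (ey e p (1 - q)).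
    2:{ unfold ey. rewrite RtoC_plus, RtoC_mult, !RtoC_minus, RtoC_mult. ring. }
    rewrite RtoC_minus, RtoC_mult, !Cexp_add. ring. }
  etransitivity; [exact (CRInt_ext01 _ _ 0 1 Rle_0_1 EQ)|].
  assert (C2 : cont_rect (fun x q => rpow w0 x * edge_amp q (RtoC x)) 0 e 0 1).
  { apply (cont_rect_prod1 (rpow w0)). intros; now apply ccont_rpow. apply edge_amp_cont. }
  assert (He : (0 <= e)%R) by lra.
  rewrite CRInt_scal by (apply (cont_rect_exI2 (fun q x => rpow w0 x * edge_amp q (RtoC x)) 0 1 0 e Rle_0_1 He); now apply cont_rect_flip in C2).
  f_equal.
  etransitivity; [symmetry; exact (Fubini_rect _ 0 e 0 1 He Rle_0_1 C2)|].
  unfold strip. apply CRInt_ext01. lra. intros x Hx.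
  assert (X := CRInt_comp_lin (mon w0 w1 w2 x) (1 - 2 * e - x) e 0 1 (exI_mon_y w0 w1 w2 h0 h1 h2 x _ _)).
  replace ((1 - 2 * e - x) * 0 + e)%R with e in X by ring. replace ((1 - 2 * e - x) * 1 + e)%R with (1 - e - x)%R in X by ring.
  rewrite X. apply CRInt_ext01. lra. intros q Hq. unfold edge_amp, mon.
  replace (RtoC (e + q * (1 - 2 * e)) + - RtoC q * RtoC x) with (RtoC ((1 - 2 * e - x) * q + e)) by (apply C_ext; cbn; ring).
  replace (RtoC (e + (1 - q) * (1 - 2 * e)) + - RtoC (1 - q) * RtoC x) with (RtoC (1 - x - ((1 - 2 * e - x) * q + e))) by (apply C_ext; cbn; ring).
  replace (RtoC (1 - 2 * e) + - (1) * RtoC x) with (RtoC (1 - 2 * e - x)) by (apply C_ext; cbn; ring).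
  rewrite Cexp_add, !rpow_Clog. ring.
  - assert (0 <= (1 - 2 * e - x) * (1 - q))%R by (apply Rmult_le_pos; lra). lra.
  - assert (0 <= (1 - 2 * e - x) * q)%R by (apply Rmult_le_pos; lra). lra.
Qed.

Definition vertex_amp (c x : C) : C := Cexp (w2 * Clog ((1 - c) + (- (1)) * x)).

Lemma vertex_amp_offcut c x : (Cmod c <= e)%R -> (Cmod x <= e)%R -> offcut ((1 - c) + (- (1)) * x).
Proof.
  intros Hc Hx. apply offcut_Re. assert (B := Re_le_Cmod x). apply Rabs_le_between in B.
  assert (B' := Re_le_Cmod c). apply Rabs_le_between in B'.
  destruct x as [x1 x2], c as [c1 c2]. cbn in *. lra.
Qed.

Lemma holo_vertex_amp c : (Cmod c <= e)%R -> exists dA, holo e (vertex_amp c) dA.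
Proof.
  intros Hc. eexists. apply holo_exp. apply holo_mult; [apply holo_const|apply holo_log].
  - intros x Hx. now apply vertex_amp_offcut.
  - apply holo_plus. apply holo_const. apply holo_mult. apply holo_const. apply holo_id.
Qed.

(** The two circles collapse one after the other: first that of l_0 with l_1 still on its circle,
    then that of l_1 with l_0 already real in [0, e]. *)
Lemma tri_vertex_corner : tri_vertex e w0 w1 w2 = (per w0 - 1) * (per w1 - 1) * corner e w0 w1 w2.
Proof.
  assert (Hc : cont01 (fun p q => pow3 w0 w1 w2 (circlog e p) (circlog e q) (lz (fun p _ => circ e p) (fun _ q => circ e q) p q)
     * (tau * circ e p * (tau * circ e q) - 0 * 0))).
  { apply (cell_int_cont (fun p _ => circ e p) (fun p _ => tau * circ e p) (fun _ _ => 0) (fun _ q => circ e q) (fun _ _ => 0) (fun _ q => tau * circ e q)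
     (fun p _ => circlog e p) (fun _ q => circlog e q) (lz (fun p _ => circ e p) (fun _ q => circ e q))).
    - apply C1pq_circ_p.
    - apply C1pq_circ_q.
    - apply C1pq_circlog_p; lra.
    - apply C1pq_circlog_q; lra.
    - apply (C1_lz (fun p _ => circ e p) (fun p _ => tau * circ e p) (fun _ _ => 0)
        (fun _ q => circ e q) (fun _ _ => 0) (fun _ q => tau * circ e q)).
      apply C1pq_circ_p. apply C1pq_circ_q. intros; now apply offcut_vz. }
  unfold tri_vertex, cell_int.
  etransitivity; [exact (Fubini_rect _ 0 1 0 1 Rle_0_1 Rle_0_1 Hc)|].
  assert (He : (0 <= e)%R) by lra.
  assert (MC : forall q, (Cmod (circ e q) <= e)%R) by (intros; rewrite Cmod_circ; lra).
  assert (MR : forall x, (0 <= x <= e)%R -> (Cmod (RtoC x) <= e)%R) by (intros; rewrite Cmod_R, Rabs_pos_eq; lra).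
  set (g := fun q => Cexp (w1 * circlog e q) * (tau * circ e q)).
  assert (Cg : forall q, ccont g q).
  { intros q. unfold g. apply continuous_Cmult; [|apply continuous_Cmult; [apply continuous_const|apply ccont_circ]].
    apply continuous_Cexp, continuous_Cmult. apply continuous_const. apply ccont_circlog. }
  assert (CV : cont_rect (fun x q => vertex_amp (circ e q) (RtoC x)) 0 e 0 1).
  { intros x q Hx Hq. unfold vertex_amp.
    assert (Cx : ccont (fun z : R * R => RtoC (fst z)) (x, q)) by (apply continuous_RtoC; contR).
    assert (Cq : ccont (fun z : R * R => circ e (snd z)) (x, q)).
    { apply (continuous_comp snd (circ e : R -> C_UniformSpace)). apply continuous_psnd. apply ccont_circ. }
    apply continuous_Cexp, continuous_Cmult; [apply continuous_const|]. apply continuous_Clog.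
    apply vertex_amp_offcut. apply MC. now apply MR.
    apply continuous_Cplus. apply continuous_Cminus; [apply continuous_const|exact Cq].
    apply continuous_Cmult; [apply continuous_const|exact Cx]. }
  assert (EI : forall c s t, (Cmod c <= e)%R -> (0 <= s <= e)%R -> (0 <= t <= e)%R -> exI (fun x => rpow w0 x * vertex_amp c (RtoC x)) s t).
  { intros c s t Hcc Hs Ht. destruct (holo_vertex_amp c Hcc) as [dA HA]. apply (exI_radial e _ dA w0 HA h0); auto. }
  assert (EQ : forall q, in01 q -> CRInt (fun p => pow3 w0 w1 w2 (circlog e p) (circlog e q) (lz (fun p _ => circ e p) (fun _ q => circ e q) p q)
     * (tau * circ e p * (tau * circ e q) - 0 * 0)) 0 1 = (per w0 - 1) * CRInt (fun x => g q * (rpow w0 x * vertex_amp (circ e q) (RtoC x))) 0 e).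
  { intros q Hq. destruct (holo_vertex_amp (circ e q) (MC q)) as [dA HA].
    rewrite CRInt_scal by (apply EI; auto; lra).
    replace ((per w0 - 1) * (g q * CRInt (fun x => rpow w0 x * vertex_amp (circ e q) (RtoC x)) 0 e))
      with (g q * ((per w0 - 1) * CRInt (fun x => rpow w0 x * vertex_amp (circ e q) (RtoC x)) 0 e)) by ring.
    rewrite <- (loop_collapse e _ dA w0 ltac:(lra) HA h0).
    unfold loop. rewrite <- CRInt_scal by (apply (exI_loop e _ dA w0 HA); lra).
    apply CRInt_ext. intros p _. unfold pow3, vertex_amp, lz, g.
    replace (1 - circ e q + - (1) * circ e p) with (1 - circ e p - circ e q) by ring.
    rewrite !Cexp_add. ring. }
  etransitivity; [exact (CRInt_ext01 _ _ 0 1 Rle_0_1 EQ)|].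
  assert (C2 : cont_rect (fun x q => g q * (rpow w0 x * vertex_amp (circ e q) (RtoC x))) 0 e 0 1).
  { apply cont_rect_flip. apply (cont_rect_prod1 g); auto. apply (cont_rect_flip (fun x q => rpow w0 x * vertex_amp (circ e q) (RtoC x))).
    apply (cont_rect_prod1 (rpow w0)); auto. intros; now apply ccont_rpow. }
  rewrite CRInt_scal by (apply (cont_rect_exI2 (fun q x => g q * (rpow w0 x * vertex_amp (circ e q) (RtoC x))) 0 1 0 e Rle_0_1 He); now apply cont_rect_flip in C2).
  rewrite <- Cmult_assoc. f_equal.
  etransitivity; [symmetry; exact (Fubini_rect _ 0 e 0 1 He Rle_0_1 C2)|].
  unfold corner. rewrite <- CRInt_scal.
  2:{ apply (exI_mon_xy w0 w1 w2 h0 h1 h2 _ _ 0 e (continuous_const 0%R) (continuous_const e)). }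
  apply CRInt_ext01. lra. intros x Hx.
  destruct (holo_vertex_amp (RtoC x) (MR x Hx)) as [dA HA].
  transitivity (rpow w0 x * loop (vertex_amp (RtoC x)) w1 e).
  - unfold loop. rewrite <- CRInt_scal by (apply (exI_loop e _ dA w1 HA); lra).
    apply CRInt_ext. intros q _. unfold g, vertex_amp.
    replace (1 - circ e q + - (1) * RtoC x) with (1 - RtoC x + - (1) * circ e q) by ring. ring.
  - rewrite (loop_collapse e _ dA w1 ltac:(lra) HA h1).
    replace (rpow w0 x * ((per w1 - 1) * CRInt (fun y => rpow w1 y * vertex_amp (RtoC x) (RtoC y)) 0 e))
      with ((per w1 - 1) * (rpow w0 x * CRInt (fun y => rpow w1 y * vertex_amp (RtoC x) (RtoC y)) 0 e)) by ring.
    f_equal. rewrite <- CRInt_scal by (apply (exI_radial e _ dA w1 HA h1); lra).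
    apply CRInt_ext01. lra. intros y Hy. unfold vertex_amp, mon.
    replace (1 - RtoC x + - (1) * RtoC y) with (RtoC (1 - x - y)) by (apply C_ext; cbn; ring).
    rewrite rpow_Clog by lra. ring.
Qed.
End Evaluate.

Section TriGamma.
Variable e : R.
Hypothesis he : (0 < e < 1 / 3)%R.

(** The coefficients of the chain cancel exactly the factors produced by the collapse, and the
    pieces tile the simplex. *)
Lemma tri_Bt w0 w1 w2 : not_int w0 -> not_int w1 -> not_int w2 ->
  (1 <= Re w0)%R -> (1 <= Re w1)%R -> (1 <= Re w2)%R ->
  tri e w0 w1 w2 = Bt w0 (w1 + w2 + 1) * Bt w1 w2.
Proof.
  intros n0 n1 n2 h0 h1 h2.
  rewrite <- simplex_Bt by auto. rewrite (simplex_decomposition e) by auto.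
  unfold tri. rewrite (tri_sigma_simplex e w0 w1 w2 he h0 h1 h2), (tri_edge_strip e w0 w1 w2 he h0 h1 h2), (tri_edge_strip e w1 w2 w0 he h1 h2 h0),
    (tri_edge_strip e w2 w0 w1 he h2 h0 h1), (tri_vertex_corner e w0 w1 w2 he h0 h1 h2),
    (tri_vertex_corner e w1 w2 w0 he h1 h2 h0), (tri_vertex_corner e w2 w0 w1 he h2 h0 h1).
  assert (N0 := per_neq1 _ n0). assert (N1 := per_neq1 _ n1). assert (N2 := per_neq1 _ n2).
  field. auto.
Qed.

Lemma tri_Gamma w0 w1 w2 : not_int w0 -> not_int w1 -> not_int w2 -> not_nonpos_int (w0 + w1 + w2 + 3) ->
  tri e w0 w1 w2 * CGamma (w0 + w1 + w2 + 3) = CGamma (w0 + 1) * CGamma (w1 + 1) * CGamma (w2 + 1).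
Proof.
  (* One step of raising, stated once for all three exponents: t stands for w_i + 1, where w_i is
     the exponent that is raised. *)
  assert (St : forall w0 w1 w2 w0' w1' w2' t : C, not_nonpos_int (w0 + w1 + w2 + 3) ->
     t <> 0 -> (w0 + w1 + w2 + 3) * tri e w0' w1' w2' = t * tri e w0 w1 w2 ->
     CGamma (w0' + 1) * CGamma (w1' + 1) * CGamma (w2' + 1) = t * (CGamma (w0 + 1) * CGamma (w1 + 1) * CGamma (w2 + 1)) ->
     w0' + w1' + w2' + 3 = w0 + w1 + w2 + 3 + 1 ->
     tri e w0' w1' w2' * CGamma (w0' + w1' + w2' + 3) = CGamma (w0' + 1) * CGamma (w1' + 1) * CGamma (w2' + 1) ->
     tri e w0 w1 w2 * CGamma (w0 + w1 + w2 + 3) = CGamma (w0 + 1) * CGamma (w1 + 1) * CGamma (w2 + 1)).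
  { intros u0 u1 u2 u0' u1' u2' t hn ht R EG Es E. rewrite Es, EG, CGamma_plus1 in E by auto.
    transitivity (/ t * (t * tri e u0 u1 u2 * CGamma (u0 + u1 + u2 + 3))). field; auto.
    rewrite <- R. transitivity (/ t * (tri e u0' u1' u2' * ((u0 + u1 + u2 + 3) * CGamma (u0 + u1 + u2 + 3)))). ring.
    rewrite E. field. auto. }
  assert (Base : forall n w0 w1 w2, not_int w0 -> not_int w1 -> not_int w2 -> not_nonpos_int (w0 + w1 + w2 + 3) ->
    (1 <= Re w0 + INR n)%R -> (1 <= Re w1 + INR n)%R -> (2 <= Re w2 + INR n)%R ->
    tri e w0 w1 w2 * CGamma (w0 + w1 + w2 + 3) = CGamma (w0 + 1) * CGamma (w1 + 1) * CGamma (w2 + 1)).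
  { induction n; intros u0 u1 u2 n0 n1 n2 hn H0 H1 H2.
    - simpl in H0, H1, H2. rewrite tri_Bt by (auto; lra).
      assert (B1 := Bt_Gamma u0 (u1 + u2 + 1) ltac:(lra)).
      assert (B2 := Bt_Gamma u1 u2 ltac:(lra) ltac:(lra)).
      replace (u0 + (u1 + u2 + 1) + 2) with (u0 + u1 + u2 + 3) in B1 by (apply C_ext; cbn; ring).
      replace (u1 + u2 + 1 + 1) with (u1 + u2 + 2) in B1 by (apply C_ext; cbn; ring).
      transitivity (Bt u1 u2 * (Bt u0 (u1 + u2 + 1) * CGamma (u0 + u1 + u2 + 3))). ring.
      rewrite B1 by (cbn; unfold Re in *; lra).
      transitivity (CGamma (u0 + 1) * (Bt u1 u2 * CGamma (u1 + u2 + 2))). ring. rewrite B2. ring.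
    - rewrite S_INR in H0, H1, H2.
      assert (hn1 : not_nonpos_int (u0 + 1 + u1 + u2 + 3)).
      { replace (u0 + 1 + u1 + u2 + 3) with (u0 + u1 + u2 + 3 + 1) by ring. now apply nonpos_plus1. }
      assert (hn2 : not_nonpos_int (u0 + 1 + (u1 + 1) + u2 + 3)).
      { replace (u0 + 1 + (u1 + 1) + u2 + 3) with (u0 + 1 + u1 + u2 + 3 + 1) by ring. now apply nonpos_plus1. }
      assert (hn3 : not_nonpos_int (u0 + 1 + (u1 + 1) + (u2 + 1) + 3)).
      { replace (u0 + 1 + (u1 + 1) + (u2 + 1) + 3) with (u0 + 1 + (u1 + 1) + u2 + 3 + 1) by ring. now apply nonpos_plus1. }
      assert (m0 := not_int_plus1 _ n0). assert (m1 := not_int_plus1 _ n1). assert (m2 := not_int_plus1 _ n2).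
      destruct (tri_recurrence e he u0 u1 u2 (per_neq1 _ n0) (per_neq1 _ n1) (per_neq1 _ n2)) as (R0 & _ & _).
      destruct (tri_recurrence e he (u0 + 1) u1 u2 (per_neq1 _ m0) (per_neq1 _ n1) (per_neq1 _ n2)) as (_ & R1 & _).
      destruct (tri_recurrence e he (u0 + 1) (u1 + 1) u2 (per_neq1 _ m0) (per_neq1 _ m1) (per_neq1 _ n2)) as (_ & _ & R2).
      assert (G0 := CGamma_plus1 (u0 + 1) (not_int_nonpos _ m0)).
      assert (G1 := CGamma_plus1 (u1 + 1) (not_int_nonpos _ m1)).
      assert (G2 := CGamma_plus1 (u2 + 1) (not_int_nonpos _ m2)).
      apply (St u0 u1 u2 (u0 + 1) u1 u2 (u0 + 1)); auto using not_int_neq0; try ring. rewrite G0; ring.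
      apply (St (u0 + 1) u1 u2 (u0 + 1) (u1 + 1) u2 (u1 + 1)); auto using not_int_neq0; try ring. rewrite G1; ring.
      apply (St (u0 + 1) (u1 + 1) u2 (u0 + 1) (u1 + 1) (u2 + 1) (u2 + 1)); auto using not_int_neq0; try ring. rewrite G2; ring.
      apply IHn; auto; rewrite Re_plus1; lra. }
  intros n0 n1 n2 hn.
  destruct (INR_unbounded (2 - Re w0)) as [k0 H0]. destruct (INR_unbounded (2 - Re w1)) as [k1 H1].
  destruct (INR_unbounded (2 - Re w2)) as [k2 H2].
  apply (Base (k0 + k1 + k2)%nat); auto; rewrite !plus_INR; generalize (pos_INR k0) (pos_INR k1) (pos_INR k2); lra.
Qed.
End TriGamma.

(** * The binomial series *)

(** Sums of the first n terms, starting with the empty sum, whereas [sum_n] includes the term of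
    index n. *)
Fixpoint csum (u : nat -> C) (n : nat) : C :=
  match n with O => 0 | S m => csum u m + u m end.

Fixpoint rsum (u : nat -> R) (n : nat) : R :=
  match n with O => 0%R | S m => (rsum u m + u m)%R end.

Lemma csum_ext u v n : (forall k, u k = v k) -> csum u n = csum v n.
Proof. intros H. induction n; simpl; congruence. Qed.

Lemma csum_plus u v n : csum (fun k => u k + v k) n = csum u n + csum v n.
Proof. induction n; simpl; [|rewrite IHn]; ring. Qed.

Lemma csum_scal c u n : csum (fun k => c * u k) n = c * csum u n.
Proof. induction n; simpl; [|rewrite IHn]; ring. Qed.

Lemma csum_Re u n : Re (csum u n) = rsum (fun k => Re (u k)) n.
Proof. induction n; simpl; auto. rewrite <- IHn. reflexivity. Qed.

Lemma csum_Im u n : Im (csum u n) = rsum (fun k => Im (u k)) n.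
Proof. induction n; simpl; auto. rewrite <- IHn. reflexivity. Qed.

Lemma sum_n_rsum (u : nat -> R) n : sum_n u n = rsum u (S n).
Proof.
  induction n. rewrite sum_O. simpl. now rewrite Rplus_0_l.
  rewrite sum_Sn, IHn. reflexivity.
Qed.

Lemma Clim_CSeries u l : Clim (csum u) l -> CSeries u = l.
Proof.
  intros H. destruct (Clim_parts _ _ H) as [H1 H2].
  assert (S : forall (v : nat -> R) a, is_lim_seq (rsum v) (Finite a) -> Series v = a).
  { intros v a Hv. unfold Series. apply (is_lim_seq_incr_1 (rsum v)) in Hv.
    rewrite (Lim_seq_ext _ (fun n => rsum v (S n))) by apply sum_n_rsum.
    now rewrite (is_lim_seq_unique _ _ Hv). }
  apply C_ext; cbn; apply S.
  - apply is_lim_seq_ext with (2 := H1). apply csum_Re.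
  - apply is_lim_seq_ext with (2 := H2). apply csum_Im.
Qed.

Definition summable (M : nat -> R) (S : R) : Prop := is_lim_seq (rsum M) (Finite S).

Lemma ex_series_summable M : ex_series M -> exists S, summable M S.
Proof.
  intros [S H]. exists S. apply (is_lim_seq_incr_1 (rsum M)).
  apply is_lim_seq_ext with (sum_n M). apply sum_n_rsum. exact H.
Qed.

Lemma summable_scal c M S : summable M S -> summable (fun n => (c * M n)%R) (c * S)%R.
Proof.
  intros H. apply is_lim_seq_ext with (fun n => (c * rsum M n)%R).
  - intros n. induction n; simpl; [|rewrite <- IHn]; ring.
  - apply (is_lim_seq_scal_l _ c S H).
Qed.

Lemma rsum_le M n k : (forall n, (0 <= M n)%R) -> (rsum M n <= rsum M (n + k))%R.
Proof.
  intros H. induction k. rewrite Nat.add_0_r; lra.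
  rewrite Nat.add_succ_r. simpl. specialize (H (n + k)%nat). lra.
Qed.

Lemma summable_rsum_le M S n : (forall n, (0 <= M n)%R) -> summable M S -> (rsum M n <= S)%R.
Proof.
  intros H HS.
  apply (is_lim_seq_incr_n (rsum M) n) in HS.
  assert (L := is_lim_seq_le (fun _ => rsum M n) (fun k => rsum M (k + n)) (rsum M n) S).
  apply L; auto. intros k. rewrite Nat.add_comm. now apply rsum_le. apply is_lim_seq_const.
Qed.

Lemma csum_bound u M n k : (forall n, (Cmod (u n) <= M n)%R) ->
  (Cmod (csum u (n + k) - csum u n) <= rsum M (n + k) - rsum M n)%R.
Proof.
  intros H. induction k.
  - rewrite Nat.add_0_r. replace (csum u n - csum u n) with (RtoC 0) by ring. rewrite Cmod_0. lra.
  - rewrite Nat.add_succ_r. simpl.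
    replace (csum u (n + k) + u (n + k)%nat - csum u n) with ((csum u (n + k) - csum u n) + u (n + k)%nat) by ring.
    eapply Rle_trans; [apply Cmod_triangle|]. specialize (H (n + k)%nat). lra.
Qed.

Lemma Clim_Cmod_le u l M : Clim u l -> (forall n, (Cmod (u n) <= M)%R) -> (Cmod l <= M)%R.
Proof.
  intros H HM.
  assert (L := is_lim_seq_le (fun _ => Cmod l) (fun n => Cmod (u n - l) + M)%R (Cmod l) (0 + M)%R).
  rewrite <- (Rplus_0_l M). apply L.
  - intros n. replace l with (- (u n - l) + u n) at 1 by ring.
    eapply Rle_trans; [apply Cmod_triangle|]. rewrite Cmod_opp. specialize (HM n). lra.
  - apply is_lim_seq_const.
  - apply is_lim_seq_plus'; auto. apply is_lim_seq_const.
Qed.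

Lemma csum_tail u M S l N : (forall n, (Cmod (u n) <= M n)%R) -> summable M S -> Clim (csum u) l ->
  (Cmod (l - csum u N) <= S - rsum M N)%R.
Proof.
  intros H HS Hl.
  assert (M0 : forall n, (0 <= M n)%R) by (intros n; eapply Rle_trans; [apply Cmod_ge_0|apply H]).
  apply (Clim_Cmod_le (fun k => csum u (k + N) + - csum u N)).
  - apply Clim_plus. now apply Clim_subn. apply Clim_const.
  - intros k. rewrite Nat.add_comm. eapply Rle_trans. apply (csum_bound u M); auto.
    assert (X := summable_rsum_le M S (N + k) M0 HS). lra.
Qed.

(** The Weierstrass test: domination by a summable sequence gives uniform convergence, hence
    termwise integration. *)
Lemma CRInt_series (F : nat -> R -> C) (G : R -> C) M S :
  (forall n, exI (F n) 0 1) -> (forall n x, in01 x -> (Cmod (F n x) <= M n)%R) -> summable M S ->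
  (forall x, in01 x -> Clim (csum (fun n => F n x)) (G x)) ->
  exI G 0 1 /\ Clim (csum (fun n => CRInt (F n) 0 1)) (CRInt G 0 1).
Proof.
  intros HI HM HS HG.
  (* [filterlim_RInt] asks for uniform convergence on the whole line; clamping the argument to [0,1]
     provides it. *)
  set (f := fun n x => csum (fun k => F k (clamp 0 1 x)) n).
  set (g := fun x => G (clamp 0 1 x)).
  assert (If : forall n, isI (f n) 0 1 (csum (fun k => CRInt (F k) 0 1) n)).
  { induction n.
    - apply is_RInt_ext with (fun _ => RtoC 0). reflexivity.
      change (csum (fun k => CRInt (F k) 0 1) 0) with (RtoC 0).
      assert (X := CRInt_correct (fun _ => RtoC 0) 0 1 (exI_cont_all _ 0 1 (continuous_const (RtoC 0)))).
      rewrite CRInt_const in X. replace (RtoC (1 - 0) * 0) with (RtoC 0) in X by ring. exact X.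
    - apply (is_RInt_plus (V := C_R_NormedModule) (f n) (fun x => F n (clamp 0 1 x))); auto.
      apply is_RInt_ext with (F n).
      + intros x Hx. rewrite Rmin_left, Rmax_right in Hx by lra. rewrite clamp_id; auto. lra.
      + apply CRInt_correct, HI. }
  assert (Lim : filterlim (f : nat -> fct_UniformSpace R C_R_NormedModule) eventually (locally (g : fct_UniformSpace R C_R_NormedModule))).
  { apply (filterlim_locally (F := eventually) (U := fct_UniformSpace R C_R_NormedModule)). intros eps.
    apply is_lim_seq_spec in HS as HS'. destruct (HS' eps) as [N HN].
    exists N. intros n Hn x.
    assert (Hx : in01 (clamp 0 1 x)) by (apply clamp_in; lra).
    assert (T := csum_tail (fun k => F k (clamp 0 1 x)) M S (g x) n (fun k => HM k _ Hx) HS (HG _ Hx)).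
    specialize (HN n Hn). apply Rabs_def2 in HN.
    assert (B : (Cmod (f n x - g x) < eps)%R).
    { replace (f n x - g x) with (- (g x - f n x)) by ring. rewrite Cmod_opp. unfold f at 1. lra. }
    split.
    - eapply Rle_lt_trans; [exact (Re_le_Cmod (f n x - g x))|exact B].
    - eapply Rle_lt_trans; [exact (Im_le_Cmod (f n x - g x))|exact B]. }
  destruct (filterlim_RInt (V := C_R_CompleteNormedModule) f 0 1 eventually _ g (fun n => csum (fun k => CRInt (F k) 0 1) n) If Lim) as (l & L1 & L2).
  assert (IG : isI G 0 1 l).
  { apply is_RInt_ext with g; auto. intros x Hx. rewrite Rmin_left, Rmax_right in Hx by lra.
    unfold g. rewrite clamp_id; auto. lra. }
  split. now exists l.
  rewrite (CRInt_unique _ _ _ _ IG).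
  apply parts_Clim.
  - apply (filterlim_comp nat C R (csum (fun k => CRInt (F k) 0 1)) fst eventually (locally (l : C_R_NormedModule)) (locally (Re l))); auto.
    apply (continuous_pfst (U := R_UniformSpace) (V := R_UniformSpace) l).
  - apply (filterlim_comp nat C R (csum (fun k => CRInt (F k) 0 1)) snd eventually (locally (l : C_R_NormedModule)) (locally (Im l))); auto.
    apply (continuous_psnd (U := R_UniformSpace) (V := R_UniformSpace) l).
Qed.

(** The coefficient of y^n in (1 - y)^(-a). *)
Definition bc (a : C) (n : nat) : C := poch a n / RtoC (INR (fact n)).

Lemma bc_S a n : RtoC (INR (S n)) * bc a (S n) = (a + RtoC (INR n)) * bc a n.
Proof.
  unfold bc. rewrite poch_S, fact_simpl, mult_INR, RtoC_mult. field.
  split. apply INR_fact_neq0C. apply RtoC_neq0. apply not_0_INR. lia.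
Qed.

Lemma bc_shift a n : RtoC (INR (S n)) * bc a (S n) = a * bc (a + 1) n.
Proof.
  unfold bc. rewrite poch_shift, fact_simpl, mult_INR, RtoC_mult. field.
  split. apply INR_fact_neq0C. apply RtoC_neq0. apply not_0_INR. lia.
Qed.

Lemma bc_neq0 a n : not_nonpos_int a -> bc a n <> 0.
Proof.
  intros H. apply Cmult_neq_0. now apply poch_neq0.
  intros E. assert (X := Cinv_r _ (INR_fact_neq0C n)). rewrite E in X. apply C1_nz. rewrite <- X. ring.
Qed.

Lemma bc_summable a rho : not_nonpos_int a -> (0 <= rho < 1)%R ->
  exists S, summable (fun n => (Cmod (bc a n) * rho ^ n)%R) S.
Proof.
  intros Ha Hr. set (r := ((1 + rho) / 2)%R).
  assert (X : ex_series (fun n => Rabs (Cmod (bc a n) * r ^ n)%R)).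
  { apply ex_series_DAlembert with r. unfold r; lra.
    - intros n E. apply Rmult_integral in E. destruct E as [E|E].
      + assert (N := bc_neq0 a n Ha). apply Cmod_gt_0 in N. lra.
      + revert E. apply pow_nonzero. unfold r; lra.
    - assert (L : is_lim_seq (fun n => (Cmod ((a + RtoC (INR n)) / (1 + RtoC (INR n))) * r)%R) r).
      { assert (N1 : forall n : nat, 1 + RtoC (INR n) <> 0).
        { intros n. rewrite <- RtoC_plus. apply RtoC_neq0. generalize (pos_INR n); lra. }
        assert (C := Clim_div_shift 1 a N1).
        assert (L1 : is_lim_seq (fun n => Cmod ((a + RtoC (INR n)) / (1 + RtoC (INR n)))) 1%R).
        { set (w := fun n : nat => (a + RtoC (INR n)) / (1 + RtoC (INR n))) in *.
          apply (is_lim_seq_le_le (fun n => 1 - Cmod (w n - 1))%R _ (fun n => 1 + Cmod (w n - 1))%R).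
          - intros n. assert (T1 := Cmod_triangle (w n - 1) 1). assert (T2 := Cmod_triangle (w n) (- (w n - 1))).
            rewrite Cmod_opp in T2. replace (w n + - (w n - 1)) with (RtoC 1) in T2 by ring.
            replace (w n - 1 + 1) with (w n) in T1 by ring. rewrite Cmod_1 in *.
            change (fun n : nat => (a + RtoC (INR n)) / (1 + RtoC (INR n))) with w. unfold w in *. lra.
          - assert (X := is_lim_seq_minus' (fun _ => 1%R) (fun n => Cmod (w n - 1)) 1%R 0%R (is_lim_seq_const 1%R) C).
            rewrite Rminus_0_r in X. exact X.
          - assert (X := is_lim_seq_plus' (fun _ => 1%R) (fun n => Cmod (w n - 1)) 1%R 0%R (is_lim_seq_const 1%R) C).
            rewrite Rplus_0_r in X. exact X. }
        assert (X := is_lim_seq_mult' _ (fun _ => r) 1%R r L1 (is_lim_seq_const r)).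
        rewrite Rmult_1_l in X. exact X. }
      revert L. apply is_lim_seq_ext. intros n.
      assert (N := bc_neq0 a n Ha). assert (N' := N). apply Cmod_gt_0 in N'.
      assert (Np : (r ^ n)%R <> 0%R) by (apply pow_nonzero; unfold r; lra).
      assert (E : (a + RtoC (INR n)) / (1 + RtoC (INR n)) = bc a (S n) / bc a n).
      { assert (B := bc_S a n). rewrite S_INR, RtoC_plus in B.
        assert (N1 : RtoC (INR n) + 1 <> 0).
        { rewrite <- RtoC_plus. apply RtoC_neq0. generalize (pos_INR n); lra. }
        assert (N2 : 1 + RtoC (INR n) <> 0) by (intros Z; apply N1; rewrite <- Z; ring).
        transitivity ((a + RtoC (INR n)) * bc a n / ((1 + RtoC (INR n)) * bc a n)). field; auto.
        rewrite <- B. field; auto. }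
      rewrite E, Cmod_div by auto. simpl pow. rewrite Rabs_pos_eq.
      + field. split; auto; lra.
      + apply Rdiv_le_0_compat. apply Rmult_le_pos. apply Cmod_ge_0. apply Rmult_le_pos. unfold r; lra. apply pow_le; unfold r; lra.
        apply Rmult_lt_0_compat; auto. apply pow_lt; unfold r; lra. }
  apply ex_series_summable.
  apply (ex_series_le (K := R_AbsRing) (V := R_CompleteNormedModule) _ (fun n => Rabs (Cmod (bc a n) * r ^ n)%R)); auto.
  intros n. unfold norm; simpl; unfold abs; simpl.
  rewrite !Rabs_mult. apply Rmult_le_compat_l. apply Rabs_pos.
  rewrite !Rabs_pos_eq by (apply pow_le; unfold r; lra). apply pow_incr. unfold r; lra.
Qed.

(* [(1-ty)^a P_N(t)], [P_N] the truncated series, has derivative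
   [- (1-ty)^(a-1) N c_N y^N t^(N-1)]. *)
Lemma binomial_series a y : not_nonpos_int a -> (Cmod y < 1)%R ->
  Clim (csum (fun n => bc a n * Cpow y n)) (Cexp (- a * Clog (1 - y))).
Proof.
  intros Ha Hy.
  set (E := fun t : R => Cexp (a * Clog (1 - RtoC t * y))).
  set (P := fun N (t : R) => csum (fun n => bc a n * Cpow y n * Cpow (RtoC t) n) N).
  set (P' := fun N (t : R) => csum (fun n => RtoC (INR (S n)) * bc a (S n) * Cpow y (S n) * Cpow (RtoC t) n) (Nat.pred N)).
  assert (O : forall t, in01 t -> offcut (1 - RtoC t * y)).
  { intros t [H0 H1]. apply offcut_Re. assert (B := Re_le_Cmod y). apply Rabs_le_between in B.
    replace (Re (1 - RtoC t * y)) with (1 - t * Re y)%R by (destruct y; cbn; ring). nra. }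
  assert (Dp : forall n t, Cderiv (fun t => Cpow (RtoC t) (S n)) t (RtoC (INR (S n)) * Cpow (RtoC t) n)).
  { intros n t. induction n.
    - apply Cderiv_ext with RtoC. intros h; simpl; ring.
      apply Cderiv_eq with (RtoC 1). apply Cderiv_id. simpl. ring.
    - apply Cderiv_ext with (fun t => RtoC t * Cpow (RtoC t) (S n)). intros; now rewrite <- Cpow_S.
      apply Cderiv_eq with (1 * Cpow (RtoC t) (S n) + RtoC t * (RtoC (INR (S n)) * Cpow (RtoC t) n)).
      apply (Cderiv_mult RtoC (fun t => Cpow (RtoC t) (S n))). apply Cderiv_id. exact IHn.
      rewrite (S_INR (S n)), RtoC_plus, (Cpow_S _ n). ring. }
  assert (DP : forall N t, Cderiv (P N) t (P' N t)).
  { induction N as [|[|N] IH]; intros t.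
    - apply Cderiv_const.
    - apply (Cderiv_ext (fun _ => bc a 0 * 1 * 1)). intros; unfold P; simpl; ring. apply Cderiv_const.
    - specialize (IH t). apply (Cderiv_plus (P (S N)) (fun t => bc a (S N) * Cpow y (S N) * Cpow (RtoC t) (S N))) with (1 := IH).
      apply Cderiv_eq with (bc a (S N) * Cpow y (S N) * (RtoC (INR (S N)) * Cpow (RtoC t) N)).
      apply Cderiv_scal. apply Dp. ring. }
  (* The truncated series satisfies the differential equation of (1-ty)^(-a) up to its last term:
     all others cancel by the recurrence for [bc]. *)
  assert (Alg : forall N t, (1 - RtoC t * y) * P' (S N) t - a * y * P (S N) t = - (RtoC (INR (S N)) * bc a (S N) * Cpow y (S N) * Cpow (RtoC t) N)).
  { intros N t. unfold P, P'. simpl Nat.pred. induction N.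
    - assert (B := bc_shift a 0). simpl csum. change (Cpow (RtoC t) 0) with (RtoC 1). change (Cpow y 0) with (RtoC 1).
      rewrite B. unfold bc. simpl. field.
    - change (csum (fun n => RtoC (INR (S n)) * bc a (S n) * Cpow y (S n) * Cpow (RtoC t) n) (S N))
        with (csum (fun n => RtoC (INR (S n)) * bc a (S n) * Cpow y (S n) * Cpow (RtoC t) n) N + RtoC (INR (S N)) * bc a (S N) * Cpow y (S N) * Cpow (RtoC t) N).
      change (csum (fun n => bc a n * Cpow y n * Cpow (RtoC t) n) (S (S N)))
        with (csum (fun n => bc a n * Cpow y n * Cpow (RtoC t) n) (S N) + bc a (S N) * Cpow y (S N) * Cpow (RtoC t) (S N)).
      set (A1 := csum _ N) in *. set (A2 := csum _ (S N)) in *.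
      transitivity (((1 - RtoC t * y) * A1 - a * y * A2) + ((1 - RtoC t * y) * (RtoC (INR (S N)) * bc a (S N) * Cpow y (S N) * Cpow (RtoC t) N) - a * y * (bc a (S N) * Cpow y (S N) * Cpow (RtoC t) (S N)))).
      ring. rewrite IHN, (bc_S a (S N)), (Cpow_S y (S N)), (Cpow_S (RtoC t) N). ring. }
  assert (DE : forall t, in01 t -> Cderiv E t (E t * (a * (- y / (1 - RtoC t * y))))).
  { intros t Ht. apply (Cderiv_Cexp (fun t => a * Clog (1 - RtoC t * y))). apply Cderiv_scal.
    apply (Cderiv_Clog (fun t => 1 - RtoC t * y)). now apply O.
    apply Cderiv_eq with (0 - (1 * y + RtoC t * 0)); [|ring].
    apply Cderiv_minus. apply Cderiv_const. apply (Cderiv_mult RtoC (fun _ => y)). apply Cderiv_id. apply Cderiv_const. }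
  set (h := fun t => E t / (1 - RtoC t * y)).
  assert (Cl : forall t, ccont (fun t => 1 - RtoC t * y) t).
  { intros t. apply continuous_Cminus. apply continuous_const. apply continuous_Cmult. apply continuous_RtoC, continuous_id. apply continuous_const. }
  assert (Ch : forall t, in01 t -> ccont h t).
  { intros t Ht. apply continuous_Cdiv. now apply offcut_neq0, O. eapply Cderiv_continuous, DE; auto. apply Cl. }
  destruct (cont_rect_bounded (fun t _ => h t) 0 1 0 1 Rle_0_1 Rle_0_1) as (M & HM0 & HM).
  { intros t s Ht _. apply (continuous_comp fst (h : R -> C_UniformSpace)). apply continuous_pfst. now apply Ch. }
  set (b := fun N => RtoC (INR (S N)) * bc a (S N) * Cpow y (S N)).
  assert (Cpw : forall N t, ccont (fun t => Cpow (RtoC t) N) t).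
  { induction N; intros t. apply continuous_const. apply continuous_Cmult. apply continuous_RtoC, continuous_id. apply IHN. }
  assert (Est : forall N, (Cmod (P (S N) 1%R * E 1%R - 1) <= M * Cmod (b N))%R).
  { intros N.
    assert (E0 : P (S N) 0%R * E 0%R = 1).
    { assert (E00 : E 0%R = 1).
      { unfold E. replace (1 - RtoC 0 * y) with (RtoC 1) by ring. rewrite Clog_RtoC, ln_1 by lra.
        replace (a * RtoC 0) with (RtoC 0) by ring. apply Cexp_0. }
      rewrite E00, Cmult_1_r. unfold P. clear. induction N.
      - simpl. unfold bc. simpl. field.
      - change (csum (fun n => bc a n * Cpow y n * Cpow (RtoC 0) n) (S N) + bc a (S N) * Cpow y (S N) * Cpow (RtoC 0) (S N) = 1).
        rewrite IHN, (Cpow_S (RtoC 0)). ring. }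
    replace (P (S N) 1%R * E 1%R - 1) with (P (S N) 1%R * E 1%R - P (S N) 0%R * E 0%R) by now rewrite E0.
    rewrite <- (CRInt_FTC (fun t => P (S N) t * E t) (fun t => - (b N * Cpow (RtoC t) N) * h t) 0 1 Rle_0_1).
    - replace (M * Cmod (b N))%R with ((1 - 0) * (M * Cmod (b N)))%R by ring.
      apply Cmod_CRInt_le_const; [lra| |].
      + intros t Ht. rewrite Cmod_mult, Cmod_opp, Cmod_mult, Cmod_pow, Cmod_R, Rabs_pos_eq by lra.
        assert (T : (t ^ N <= 1)%R) by (rewrite <- (pow1 N); apply pow_incr; lra).
        assert (T0 : (0 <= t ^ N)%R) by (apply pow_le; lra).
        assert (X := HM t 0%R Ht ltac:(lra)). assert (X0 := Cmod_ge_0 (h t)). assert (X1 := Cmod_ge_0 (b N)).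
        rewrite (Rmult_comm M). apply Rmult_le_compat; auto. now apply Rmult_le_pos. nra.
      + apply exI_cont. lra. intros t Ht. apply continuous_Cmult; [|now apply Ch].
        apply continuous_Copp, continuous_Cmult. apply continuous_const. apply Cpw.
    - intros t Ht. apply Cderiv_eq with (P' (S N) t * E t + P (S N) t * (E t * (a * (- y / (1 - RtoC t * y))))).
      + apply (Cderiv_mult (P (S N)) E); auto.
      + assert (Nz := offcut_neq0 _ (O t Ht)). unfold h, b.
        transitivity (((1 - RtoC t * y) * P' (S N) t - a * y * P (S N) t) * (E t / (1 - RtoC t * y))). field; auto.
        rewrite Alg. ring.
    - intros t Ht. apply continuous_Cmult; [|now apply Ch].
      apply continuous_Copp, continuous_Cmult. apply continuous_const. apply Cpw. }
  (* By [bc_shift], [b N] is a y times a term of the series for a + 1, which is summable. *)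
  assert (Lb : is_lim_seq (fun N => (M * Cmod (b N))%R) 0%R).
  { destruct (bc_summable (a + 1) (Cmod y) (nonpos_plus1 _ Ha) (conj (Cmod_ge_0 y) Hy)) as [S HS].
    assert (L0 : is_lim_seq (fun n => (Cmod (bc (a + 1) n) * Cmod y ^ n)%R) 0%R).
    { assert (HS1 := HS). apply (is_lim_seq_incr_1 (rsum _)) in HS1.
      apply is_lim_seq_ext with (fun n => rsum (fun n => (Cmod (bc (a + 1) n) * Cmod y ^ n)%R) (Datatypes.S n) - rsum (fun n => (Cmod (bc (a + 1) n) * Cmod y ^ n)%R) n)%R.
      intros n. simpl. ring.
      replace 0%R with (S - S)%R by ring. now apply is_lim_seq_minus'. }
    apply is_lim_seq_ext with (fun n => ((M * (Cmod a * Cmod y)) * (Cmod (bc (a + 1) n) * Cmod y ^ n))%R).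
    - intros n. unfold b. rewrite bc_shift, !Cmod_mult, Cmod_pow. simpl. ring.
    - replace 0%R with (M * (Cmod a * Cmod y) * 0)%R by ring.
      apply (is_lim_seq_scal_l _ (M * (Cmod a * Cmod y))%R 0%R L0). }
  assert (E1 : Cexp (- a * Clog (1 - y)) * E 1%R = 1).
  { unfold E. rewrite <- Cexp_add. replace (1 - RtoC 1 * y) with (1 - y) by ring.
    replace (- a * Clog (1 - y) + a * Clog (1 - y)) with (RtoC 0) by ring. apply Cexp_0. }
  assert (L1 : Clim (fun N => P (S N) 1%R * E 1%R) 1) by (apply Clim_le0 with (1 := Est); auto).
  apply Clim_incr_1.
  assert (L2 := Clim_mult _ _ _ _ L1 (Clim_const (Cexp (- a * Clog (1 - y))))).
  rewrite Cmult_1_l in L2. revert L2. apply Clim_ext. intros N.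
  transitivity (P (S N) 1%R * (Cexp (- a * Clog (1 - y)) * E 1%R)). ring.
  rewrite E1, Cmult_1_r. unfold P. apply csum_ext. intros k. rewrite Cpow_1_l. ring.
Qed.

(** * Termwise integration over the cube *)

(** Integrability at each stage of the iterated integral, which is what passing to a limit one
    variable at a time consumes and reproduces. *)
Record nested (F : fun4) : Prop := {
  nested_s : forall p q r, in01 p -> in01 q -> in01 r -> exI (F p q r) 0 1;
  nested_r : forall p q, in01 p -> in01 q -> exI (fun r => CRInt (F p q r) 0 1) 0 1;
  nested_q : forall p, in01 p -> exI (fun q => CRInt (fun r => CRInt (F p q r) 0 1) 0 1) 0 1;
  nested_p : exI (fun p => CRInt (fun q => CRInt (fun r => CRInt (F p q r) 0 1) 0 1) 0 1) 0 1 }.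

Lemma CRInt01_bound f M : exI f 0 1 -> (forall x, in01 x -> (Cmod (f x) <= M)%R) -> (Cmod (CRInt f 0 1) <= M)%R.
Proof.
  intros H HM. replace M with ((1 - 0) * M)%R by ring. apply Cmod_CRInt_le_const; auto. lra.
Qed.

(** [CRInt_series] is applied four times from the inside outwards; the bound M n survives each
    integration because the intervals have length 1. *)
Lemma cube_series (F : nat -> fun4) (G : fun4) M S :
  (forall n, nested (F n)) ->
  (forall n p q r s, in01 p -> in01 q -> in01 r -> in01 s -> (Cmod (F n p q r s) <= M n)%R) ->
  summable M S ->
  (forall p q r s, in01 p -> in01 q -> in01 r -> in01 s -> Clim (csum (fun n => F n p q r s)) (G p q r s)) ->
  nested G /\ Clim (csum (fun n => cube_int (F n))) (cube_int G) /\ forall n, (Cmod (cube_int (F n)) <= M n)%R.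
Proof.
  intros HF HM HS HG.
  assert (Bs : forall n p q r, in01 p -> in01 q -> in01 r -> (Cmod (CRInt (F n p q r) 0 1) <= M n)%R).
  { intros. apply CRInt01_bound; [now apply nested_s|]. intros; now apply HM. }
  assert (Br : forall n p q, in01 p -> in01 q -> (Cmod (CRInt (fun r => CRInt (F n p q r) 0 1) 0 1) <= M n)%R).
  { intros. apply CRInt01_bound; [now apply nested_r|]. intros; now apply Bs. }
  assert (Bq : forall n p, in01 p -> (Cmod (CRInt (fun q => CRInt (fun r => CRInt (F n p q r) 0 1) 0 1) 0 1) <= M n)%R).
  { intros. apply CRInt01_bound; [now apply nested_q|]. intros; now apply Br. }
  assert (Ls : forall p q r, in01 p -> in01 q -> in01 r ->
    exI (G p q r) 0 1 /\ Clim (csum (fun n => CRInt (F n p q r) 0 1)) (CRInt (G p q r) 0 1)).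
  { intros p q r Hp Hq Hr. apply (CRInt_series (fun n => F n p q r) (G p q r) M S).
    - intros n. exact (nested_s _ (HF n) p q r Hp Hq Hr).
    - intros n s Hs. exact (HM n p q r s Hp Hq Hr Hs).
    - exact HS.
    - intros s Hs. exact (HG p q r s Hp Hq Hr Hs). }
  assert (Lr : forall p q, in01 p -> in01 q ->
    exI (fun r => CRInt (G p q r) 0 1) 0 1 /\
    Clim (csum (fun n => CRInt (fun r => CRInt (F n p q r) 0 1) 0 1)) (CRInt (fun r => CRInt (G p q r) 0 1) 0 1)).
  { intros p q Hp Hq. apply (CRInt_series (fun n r => CRInt (F n p q r) 0 1) (fun r => CRInt (G p q r) 0 1) M S).
    - intros n. exact (nested_r _ (HF n) p q Hp Hq).
    - intros n r Hr. exact (Bs n p q r Hp Hq Hr).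
    - exact HS.
    - intros r Hr. exact (proj2 (Ls p q r Hp Hq Hr)). }
  assert (Lq : forall p, in01 p ->
    exI (fun q => CRInt (fun r => CRInt (G p q r) 0 1) 0 1) 0 1 /\
    Clim (csum (fun n => CRInt (fun q => CRInt (fun r => CRInt (F n p q r) 0 1) 0 1) 0 1)) (CRInt (fun q => CRInt (fun r => CRInt (G p q r) 0 1) 0 1) 0 1)).
  { intros p Hp. apply (CRInt_series (fun n q => CRInt (fun r => CRInt (F n p q r) 0 1) 0 1) (fun q => CRInt (fun r => CRInt (G p q r) 0 1) 0 1) M S).
    - intros n. exact (nested_q _ (HF n) p Hp).
    - intros n q Hq. exact (Br n p q Hp Hq).
    - exact HS.
    - intros q Hq. exact (proj2 (Lr p q Hp Hq)). }
  assert (Lp := CRInt_series (fun n p => CRInt (fun q => CRInt (fun r => CRInt (F n p q r) 0 1) 0 1) 0 1)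
     (fun p => CRInt (fun q => CRInt (fun r => CRInt (G p q r) 0 1) 0 1) 0 1) M S
     (fun n => nested_p _ (HF n)) (fun n p Hp => Bq n p Hp) HS (fun p Hp => proj2 (Lq p Hp))).
  destruct Lp as [Lp1 Lp2]. split; [|split].
  - split; intros; [now apply Ls|now apply Lr|now apply Lq|exact Lp1].
  - exact Lp2.
  - intros n. apply CRInt01_bound; [apply nested_p, HF|]. intros; now apply Bq.
Qed.

Lemma nested_sep (g h : R -> R -> C) : cont01 g -> cont01 h ->
  nested (fun p q r s => g p q * h r s) /\
  cube_int (fun p q r s => g p q * h r s) = CRInt (fun p => CRInt (g p) 0 1) 0 1 * CRInt (fun r => CRInt (h r) 0 1) 0 1.
Proof.
  intros Hg Hh.
  assert (Ig : forall p, in01 p -> exI (g p) 0 1) by (intros p Hp; exact (cont_rect_exI g 0 1 0 1 p Rle_0_1 Hg Hp)).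
  assert (Ih : forall r, in01 r -> exI (h r) 0 1) by (intros p Hp; exact (cont_rect_exI h 0 1 0 1 p Rle_0_1 Hh Hp)).
  assert (Ig2 := cont_rect_exI2 g 0 1 0 1 Rle_0_1 Rle_0_1 Hg).
  assert (Ih2 := cont_rect_exI2 h 0 1 0 1 Rle_0_1 Rle_0_1 Hh).
  set (Hh2 := CRInt (fun r => CRInt (h r) 0 1) 0 1).
  assert (Es : forall p q r, in01 r -> CRInt (fun s => g p q * h r s) 0 1 = g p q * CRInt (h r) 0 1).
  { intros p q r Hr. apply CRInt_scal. now apply Ih. }
  assert (Er : forall p q, CRInt (fun r => CRInt (fun s => g p q * h r s) 0 1) 0 1 = g p q * Hh2).
  { intros p q. rewrite (CRInt_ext01 _ (fun r => g p q * CRInt (h r) 0 1) 0 1 Rle_0_1) by (intros; now apply Es).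
    now apply CRInt_scal. }
  assert (Eq : forall p, in01 p -> CRInt (fun q => CRInt (fun r => CRInt (fun s => g p q * h r s) 0 1) 0 1) 0 1 = CRInt (g p) 0 1 * Hh2).
  { intros p Hp. rewrite (CRInt_ext01 _ (fun q => g p q * Hh2) 0 1 Rle_0_1) by (intros; apply Er).
    apply CRInt_scalr. now apply Ig. }
  split; [split|].
  - intros p q r _ _ Hr. apply exI_scal. now apply Ih.
  - intros p q _ _. apply (exI_ext01 (fun r => g p q * CRInt (h r) 0 1) _ 0 1 Rle_0_1).
    intros r Hr. symmetry. now apply Es. now apply exI_scal.
  - intros p Hp. apply (exI_ext01 (fun q => g p q * Hh2) _ 0 1 Rle_0_1).
    intros q Hq. symmetry. apply Er. apply exI_scalr. now apply Ig.
  - apply (exI_ext01 (fun p => CRInt (g p) 0 1 * Hh2) _ 0 1 Rle_0_1).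
    intros p Hp. symmetry. now apply Eq. now apply exI_scalr.
  - unfold cube_int. rewrite (CRInt_ext01 _ (fun p => CRInt (g p) 0 1 * Hh2) 0 1 Rle_0_1) by exact Eq.
    now apply CRInt_scalr.
Qed.

Lemma cube_int_ext F G : (forall p q r s, in01 p -> in01 q -> in01 r -> in01 s -> F p q r s = G p q r s) -> cube_int F = cube_int G.
Proof.
  intros H. unfold cube_int. apply CRInt_ext01; [lra|]. intros p Hp. apply CRInt_ext01; [lra|]. intros q Hq.
  apply CRInt_ext01; [lra|]. intros r Hr. apply CRInt_ext01; [lra|]. intros s Hs. now apply H.
Qed.

(** Iterated convergence in the order in which [hypF] sums. The inner sums are existential, so
    finite linear combinations are easy to form. *)
Definition dsum (u : nat -> nat -> C) (l : C) : Prop :=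
  exists S, (forall n, Clim (csum (u n)) (S n)) /\ Clim (csum S) l.

Lemma dsum_CSeries u l : dsum u l -> CSeries (fun n => CSeries (u n)) = l.
Proof.
  intros (S & H1 & H2). apply Clim_CSeries. revert H2. apply Clim_ext. intros n. apply csum_ext.
  intros k. symmetry. apply Clim_CSeries, H1.
Qed.

Lemma dsum_ext u v l : (forall n m, u n m = v n m) -> dsum u l -> dsum v l.
Proof.
  intros E (S & H1 & H2). exists S. split; auto. intros n. generalize (H1 n). apply Clim_ext.
  intros k. now apply csum_ext.
Qed.

Lemma dsum_plus u v l m : dsum u l -> dsum v m -> dsum (fun i j => u i j + v i j) (l + m).
Proof.
  intros (S & H1 & H2) (T & H3 & H4). exists (fun n => S n + T n). split.
  - intros n. generalize (Clim_plus _ _ _ _ (H1 n) (H3 n)). apply Clim_ext. intros k. symmetry. apply csum_plus.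
  - generalize (Clim_plus _ _ _ _ H2 H4). apply Clim_ext. intros k. symmetry. apply csum_plus.
Qed.

Lemma dsum_scal c u l : dsum u l -> dsum (fun i j => c * u i j) (c * l).
Proof.
  intros (S & H1 & H2). exists (fun n => c * S n). split.
  - intros n. generalize (Clim_mult _ _ _ _ (Clim_const c) (H1 n)). apply Clim_ext. intros k. symmetry. apply csum_scal.
  - generalize (Clim_mult _ _ _ _ (Clim_const c) H2). apply Clim_ext. intros k. symmetry. apply csum_scal.
Qed.

Lemma dsum_0 : dsum (fun _ _ => 0) 0.
Proof.
  assert (Z : forall n, csum (fun _ => 0) n = 0) by (induction n; simpl; [|rewrite IHn]; ring).
  exists (fun _ => 0). split; [intros n|]; apply Clim_ext with (fun _ => RtoC 0); try apply Clim_const; intros; symmetry; apply Z.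
Qed.

Lemma dsum_Csum {T : Type} (A : list T) (u : T -> nat -> nat -> C) (l : T -> C) :
  (forall X, In X A -> dsum (u X) (l X)) -> dsum (fun n m => Csum (map (fun X => u X n m) A)) (Csum (map l A)).
Proof.
  induction A as [|X A IH]; intros H; simpl.
  - apply dsum_0.
  - apply dsum_plus. apply H; now left. apply IH. intros; apply H; now right.
Qed.

(** The sum over m is integrated termwise for each n, then the sum over n; the inner sums are
    dominated by al n times the total of be. *)
Lemma cube_dseries (F : nat -> nat -> fun4) (F' : nat -> fun4) (G : fun4) al be Sa Sb :
  (forall n m, nested (F n m)) ->
  (forall n m p q r s, in01 p -> in01 q -> in01 r -> in01 s -> (Cmod (F n m p q r s) <= al n * be m)%R) ->
  summable al Sa -> summable be Sb ->
  (forall n p q r s, in01 p -> in01 q -> in01 r -> in01 s -> Clim (csum (fun m => F n m p q r s)) (F' n p q r s)) ->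
  (forall p q r s, in01 p -> in01 q -> in01 r -> in01 s -> Clim (csum (fun n => F' n p q r s)) (G p q r s)) ->
  dsum (fun n m => cube_int (F n m)) (cube_int G).
Proof.
  intros HF HM HSa HSb HL HG.
  assert (Inner : forall n, nested (F' n) /\ Clim (csum (fun m => cube_int (F n m))) (cube_int (F' n)) /\ forall m, (Cmod (cube_int (F n m)) <= al n * be m)%R).
  { intros n. apply (cube_series (F n) (F' n) (fun m => al n * be m)%R (al n * Sb)%R); auto. now apply summable_scal. }
  assert (Bd : forall n p q r s, in01 p -> in01 q -> in01 r -> in01 s -> (Cmod (F' n p q r s) <= al n * Sb)%R).
  { intros n p q r s Hp Hq Hr Hs.
    assert (X := csum_tail (fun m => F n m p q r s) _ _ (F' n p q r s) 0 (fun m => HM n m p q r s Hp Hq Hr Hs) (summable_scal (al n) _ _ HSb) (HL n p q r s Hp Hq Hr Hs)).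
    simpl in X. replace (F' n p q r s - 0) with (F' n p q r s) in X by ring. lra. }
  assert (HSa' : summable (fun n => al n * Sb)%R (Sb * Sa)%R).
  { apply (is_lim_seq_ext (rsum (fun n => Sb * al n)%R)); [|now apply summable_scal].
    intros n. induction n; simpl; [|rewrite IHn]; ring. }
  destruct (cube_series F' G (fun n => al n * Sb)%R (Sb * Sa)%R (fun n => proj1 (Inner n)) Bd HSa' HG) as (_ & L & _).
  exists (fun n => cube_int (F' n)). split; [|exact L]. intros n. exact (proj1 (proj2 (Inner n))).
Qed.

(** * The integrand on a product cell *)

(** What the cells of all three kinds share, rotated or not; the expansion is then carried out once,
    for an arbitrary product of good cells. The lower bound e also yields an explicit radius for
    x. *)
Record good (N : nat) (e : R) (K : cell) : Prop := {
  good_form : forall i, (i < N)%nat -> exists fp fq, C1pq (form K i) fp fq;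
  good_lg : forall i, (i < N)%nat -> cont01 (lg K i);
  good_exp : forall i p q, (i < N)%nat -> in01 p -> in01 q -> Cexp (lg K i p q) = form K i p q;
  good_low : forall i p q, (i < N)%nat -> in01 p -> in01 q -> (e <= Cmod (form K i p q))%R }.

Definition Jac (K : cell) (p q : R) : C :=
  CDerive (fun h => form K 0 h q) p * CDerive (fun h => form K 1 p h) q
  - CDerive (fun h => form K 0 p h) q * CDerive (fun h => form K 1 h q) p.

Lemma Jac_eq K f0p f0q f1p f1q p q : C1pq (form K 0) f0p f0q -> C1pq (form K 1) f1p f1q -> in01 p -> in01 q ->
  Jac K p q = f0p p q * f1q p q - f0q p q * f1p p q.
Proof.
  intros H0 H1 Hp Hq. unfold Jac.
  rewrite (Cderiv_CDerive _ _ _ (C1_p _ _ _ H0 p q Hp Hq)), (Cderiv_CDerive _ _ _ (C1_q _ _ _ H0 p q Hp Hq)).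
  now rewrite (Cderiv_CDerive _ _ _ (C1_p _ _ _ H1 p q Hp Hq)), (Cderiv_CDerive _ _ _ (C1_q _ _ _ H1 p q Hp Hq)).
Qed.

Lemma Jac_cont N e K : (2 <= N)%nat -> good N e K ->
  exists j, cont01 j /\ forall p q, in01 p -> in01 q -> Jac K p q = j p q.
Proof.
  intros HN HK.
  destruct (good_form _ _ _ HK 0%nat ltac:(lia)) as (f0p & f0q & H0).
  destruct (good_form _ _ _ HK 1%nat ltac:(lia)) as (f1p & f1q & H1).
  exists (fun p q => f0p p q * f1q p q - f0q p q * f1p p q). split.
  - destruct H0, H1. c01.
  - intros p q Hp Hq. now apply Jac_eq.
Qed.

(** Rows t1, t3, t2, t4 against p, q, r, s: t3 depends on p, q only, t2 and t4 on r, s only. Just t1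
    mixes them, so the matrix is block triangular. *)
Lemma Cdet4_block (M : nat -> nat -> C) :
  M 1%nat 2%nat = 0 -> M 1%nat 3%nat = 0 -> M 2%nat 0%nat = 0 -> M 2%nat 1%nat = 0 -> M 3%nat 0%nat = 0 -> M 3%nat 1%nat = 0 ->
  Cdet 4 M = (M 0%nat 0%nat * M 1%nat 1%nat - M 0%nat 1%nat * M 1%nat 0%nat) * (M 2%nat 2%nat * M 3%nat 3%nat - M 2%nat 3%nat * M 3%nat 2%nat).
Proof.
  intros E1 E2 E3 E4 E5 E6. cbn -[Cmult Cplus Copp]. rewrite E1, E2, E3, E4, E5, E6. ring.
Qed.

Lemma CDerive_const c t : CDerive (fun _ => c) t = 0.
Proof. apply Cderiv_CDerive, Cderiv_const. Qed.

Lemma jacobian_iota N1 N2 e lx x1 x2 K1 K2 p q r s : (0 < e)%R -> (2 <= N1)%nat -> (2 <= N2)%nat ->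
  good N1 e K1 -> good N2 e K2 -> in01 p -> in01 q -> in01 r -> in01 s ->
  jacobian (iota_cell lx x1 x2 (K1, K2)) p q r s
  = - x1 / (form K1 0 p q * form K1 0 p q * form K2 0 r s) * Jac K1 p q * Jac K2 r s.
Proof.
  intros he HN1 HN2 H1 H2 Hp Hq Hr Hs.
  destruct (good_form _ _ _ H1 0%nat ltac:(lia)) as (f0p & f0q & F0).
  destruct (good_form _ _ _ H1 1%nat ltac:(lia)) as (f1p & f1q & F1).
  destruct (good_form _ _ _ H2 0%nat ltac:(lia)) as (g0p & g0q & G0).
  destruct (good_form _ _ _ H2 1%nat ltac:(lia)) as (g1p & g1q & G1).
  rewrite (Jac_eq K1 _ _ _ _ p q F0 F1), (Jac_eq K2 _ _ _ _ r s G0 G1) by auto.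
  assert (N0 : form K1 0 p q <> 0).
  { apply Cmod_gt_0. assert (X := good_low _ _ _ H1 0%nat p q ltac:(lia) Hp Hq). lra. }
  assert (M0 : form K2 0 r s <> 0).
  { apply Cmod_gt_0. assert (X := good_low _ _ _ H2 0%nat r s ltac:(lia) Hr Hs). lra. }
  assert (NM : form K1 0 p q * form K2 0 r s <> 0) by now apply Cmult_neq_0.
  unfold jacobian. rewrite Cdet4_block.
  - unfold partial, iota_cell, t1, t2, t3, t4, s1, s2, s3, s4, fst, snd.
    rewrite (Cderiv_CDerive (fun h => form K1 1 h q) p _ (C1_p _ _ _ F1 p q Hp Hq)).
    rewrite (Cderiv_CDerive (fun h => form K1 1 p h) q _ (C1_q _ _ _ F1 p q Hp Hq)).
    rewrite (Cderiv_CDerive (fun h => form K2 0 h s) r _ (C1_p _ _ _ G0 r s Hr Hs)).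
    rewrite (Cderiv_CDerive (fun h => form K2 0 r h) s _ (C1_q _ _ _ G0 r s Hr Hs)).
    rewrite (Cderiv_CDerive (fun h => form K2 1 h s) r _ (C1_p _ _ _ G1 r s Hr Hs)).
    rewrite (Cderiv_CDerive (fun h => form K2 1 r h) s _ (C1_q _ _ _ G1 r s Hr Hs)).
    rewrite (Cderiv_CDerive (fun h => x1 / (form K1 0 h q * form K2 0 r s)) p
      (0 / (form K1 0 p q * form K2 0 r s) - x1 * (f0p p q * form K2 0 r s) / ((form K1 0 p q * form K2 0 r s) * (form K1 0 p q * form K2 0 r s)))).
    rewrite (Cderiv_CDerive (fun h => x1 / (form K1 0 p h * form K2 0 r s)) q
      (0 / (form K1 0 p q * form K2 0 r s) - x1 * (f0q p q * form K2 0 r s) / ((form K1 0 p q * form K2 0 r s) * (form K1 0 p q * form K2 0 r s)))).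
    + field. auto.
    + apply (Cderiv_div (fun _ => x1) (fun h => form K1 0 p h * form K2 0 r s)); auto. apply Cderiv_const.
      apply Cderiv_eq with (f0q p q * form K2 0 r s + form K1 0 p q * 0); [|ring].
      apply (Cderiv_mult (fun h => form K1 0 p h) (fun _ => form K2 0 r s)). exact (C1_q _ _ _ F0 p q Hp Hq). apply Cderiv_const.
    + apply (Cderiv_div (fun _ => x1) (fun h => form K1 0 h q * form K2 0 r s)); auto. apply Cderiv_const.
      apply Cderiv_eq with (f0p p q * form K2 0 r s + form K1 0 p q * 0); [|ring].
      apply (Cderiv_mult (fun h => form K1 0 h q) (fun _ => form K2 0 r s)). exact (C1_p _ _ _ F0 p q Hp Hq). apply Cderiv_const.
  - exact (CDerive_const (form K1 1 p q) r).
  - exact (CDerive_const (form K1 1 p q) s).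
  - exact (CDerive_const (form K2 0 r s) p).
  - exact (CDerive_const (form K2 0 r s) q).
  - exact (CDerive_const (form K2 1 r s) p).
  - exact (CDerive_const (form K2 1 r s) q).
Qed.

Definition pow4 (w0 w1 w2 w3 a b c d : C) : C := Cexp (w0 * a + w1 * b + w2 * c + w3 * d).

Definition cell3 (K : cell) (w0 w1 w2 : C) : C :=
  CRInt (fun p => CRInt (fun q => pow3 w0 w1 w2 (lg K 0 p q) (lg K 1 p q) (lg K 2 p q) * Jac K p q) 0 1) 0 1.

Definition cell4 (K : cell) (w0 w1 w2 w3 : C) : C :=
  CRInt (fun p => CRInt (fun q => pow4 w0 w1 w2 w3 (lg K 0 p q) (lg K 1 p q) (lg K 2 p q) (lg K 3 p q) * Jac K p q) 0 1) 0 1.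

Definition sqrel (K : cell) : Prop := forall p q, form K 2 p q = 1 - form K 0 p q /\ form K 3 p q = 1 - form K 1 p q.

Lemma Cexp_nat_pow z n : Cexp (- RtoC (INR n) * z) = / Cpow (Cexp z) n.
Proof.
  induction n.
  - simpl. replace (- RtoC 0 * z) with (RtoC 0) by ring. rewrite Cexp_0. field.
  - rewrite S_INR, RtoC_plus. replace (- (RtoC (INR n) + 1) * z) with (- RtoC (INR n) * z + - z) by ring.
    rewrite Cexp_add, IHn, Cexp_opp, Cpow_S. field. split. apply Cpow_nz, Cexp_neq0. apply Cexp_neq0.
Qed.

Section CubeCell.
Variables (a1 a2 a3 b1 b2 b3 b4 lx x1 x2 : C) (e : R) (K1 K2 : cell).
Hypotheses (he : (0 < e)%R) (hx : Cexp lx = x1) (good1 : good 4 e K1) (good2 : good 3 e K2) (rel1 : sqrel K1).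
Hypotheses (hg : not_nonpos_int (- (b1 + b3 - a1 - 2))) (ha3 : not_nonpos_int a3).
Hypothesis small1 : forall p q r s, in01 p -> in01 q -> in01 r -> in01 s ->
  (Cmod x1 < Cmod (form K1 3 p q * form K1 0 p q * form K2 0 r s))%R.
Hypothesis small2 : forall p q r s, in01 p -> in01 q -> in01 r -> in01 s ->
  (Cmod x2 < Cmod (form K1 2 p q * form K1 1 p q * form K2 1 r s))%R.

Let g := b1 + b3 - a1 - 2.
Let h := b2 + b4 - a2 - 2.

Lemma form1_neq0 i p q : (i < 4)%nat -> in01 p -> in01 q -> form K1 i p q <> 0.
Proof. intros Hi Hp Hq. apply Cmod_gt_0. assert (X := good_low _ _ _ good1 i p q Hi Hp Hq). lra. Qed.

Lemma form2_neq0 i p q : (i < 3)%nat -> in01 p -> in01 q -> form K2 i p q <> 0.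
Proof. intros Hi Hp Hq. apply Cmod_gt_0. assert (X := good_low _ _ _ good2 i p q Hi Hp Hq). lra. Qed.

Lemma cont_form N K i : good N e K -> (i < N)%nat -> cont01 (form K i).
Proof. intros HK Hi. destruct (good_form _ _ _ HK i Hi) as (fp & fq & F). exact (C1_c _ _ _ F). Qed.

(** Compactness makes the strict inequality uniform. The modulus is a function of (p,q) times a
    function of (r,s), so two maxima in two variables replace one in four. *)
Lemma ratio_bound x i j k : (i < 4)%nat -> (j < 4)%nat -> (k < 3)%nat ->
  (forall p q r s, in01 p -> in01 q -> in01 r -> in01 s -> (Cmod x < Cmod (form K1 i p q * form K1 j p q * form K2 k r s))%R) ->
  exists rho, (0 <= rho < 1)%R /\ forall p q r s, in01 p -> in01 q -> in01 r -> in01 s ->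
    (Cmod (x / (form K1 i p q * form K1 j p q * form K2 k r s)) <= rho)%R.
Proof.
  intros Hi Hj Hk Hs.
  assert (CA : cont01 (fun p q => x / (form K1 i p q * form K1 j p q))).
  { apply cont01_div. intros; apply Cmult_neq_0; now apply form1_neq0.
    apply cont01_const. apply cont01_mult; now apply (cont_form 4). }
  assert (CB : cont01 (fun r s => / form K2 k r s)).
  { apply cont01_inv. intros; now apply form2_neq0. now apply (cont_form 3). }
  destruct (EVT_rect _ 0 1 0 1 Rle_0_1 Rle_0_1 CA) as (p0 & q0 & Hp0 & Hq0 & MA).
  destruct (EVT_rect _ 0 1 0 1 Rle_0_1 Rle_0_1 CB) as (r0 & s0 & Hr0 & Hs0 & MB).
  assert (E : forall p q r s, in01 p -> in01 q -> in01 r -> in01 s ->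
    Cmod (x / (form K1 i p q * form K1 j p q * form K2 k r s)) = (Cmod (x / (form K1 i p q * form K1 j p q)) * Cmod (/ form K2 k r s))%R).
  { intros p q r s Hp Hq Hr Hs'. rewrite <- Cmod_mult. f_equal. field.
    repeat split; first [now apply form1_neq0|now apply form2_neq0]. }
  exists (Cmod (x / (form K1 i p0 q0 * form K1 j p0 q0)) * Cmod (/ form K2 k r0 s0))%R. split.
  - split. apply Rmult_le_pos; apply Cmod_ge_0.
    rewrite <- E by auto. assert (X := Hs p0 q0 r0 s0 Hp0 Hq0 Hr0 Hs0).
    assert (Nz : form K1 i p0 q0 * form K1 j p0 q0 * form K2 k r0 s0 <> 0).
    { apply Cmult_neq_0; [apply Cmult_neq_0; now apply form1_neq0|now apply form2_neq0]. }
    rewrite Cmod_div by auto. apply Cmod_gt_0 in Nz. apply Rmult_lt_reg_r with (1 := Nz).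
    unfold Rdiv. rewrite Rmult_assoc, Rinv_l by lra. lra.
  - intros p q r s Hp Hq Hr Hs'. rewrite E by auto. apply Rmult_le_compat; try apply Cmod_ge_0.
    now apply MA. now apply MB.
Qed.

(** The arguments of the two binomial series. [W1] and [W2] are the weights with exponents lowered
    by n and m, and [kap] collects the factors that are constant on the cell. *)
Let Y1 p q r s := x1 / (form K1 3 p q * form K1 0 p q * form K2 0 r s).
Let Y2 p q r s := x2 / (form K1 2 p q * form K1 1 p q * form K2 1 r s).
Let W1 n m p q := pow4 (b1 - 2 - RtoC (INR n)) (- b3 - RtoC (INR m)) (- a3 - RtoC (INR m)) (g - RtoC (INR n))
   (lg K1 0 p q) (lg K1 1 p q) (lg K1 2 p q) (lg K1 3 p q) * Jac K1 p q.
Let W2 n m r s := pow3 (b1 - b2 - 1 - RtoC (INR n)) (- b4 - RtoC (INR m)) h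
   (lg K2 0 r s) (lg K2 1 r s) (lg K2 2 r s) * Jac K2 r s.
Let kap n m := - Cexp ((1 - b1) * lx) * (bc (- g) n * Cpow x1 n * (bc a3 m * Cpow x2 m)).

Lemma integrand_eq p q r s : in01 p -> in01 q -> in01 r -> in01 s ->
  u_branch a1 a2 a3 b1 b2 b3 b4 (iota_cell lx x1 x2 (K1, K2)) p q r s * jacobian (iota_cell lx x1 x2 (K1, K2)) p q r s
  = - Cexp ((1 - b1) * lx) * (W1 0 0 p q * W2 0 0 r s) * (Cexp (g * Clog (1 - Y1 p q r s)) * Cexp (- a3 * Clog (1 - Y2 p q r s))).
Proof.
  intros Hp Hq Hr Hs. rewrite (jacobian_iota 4 3 e) by (auto; lia).
  destruct (rel1 p q) as [R2 R3].
  unfold u_branch, iota_cell, lg_t1, lg_t2, lg_t3, lg_t4, lg_13, lg_24, lg_Q, s1, s2, s3, s4, fst, snd.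
  rewrite <- R2.
  replace (1 - form K1 1 p q) with (form K1 3 p q).
  unfold W1, W2, pow4, pow3. simpl INR.
  fold (Y1 p q r s). fold (Y2 p q r s).
  (* The Jacobian factor is again an exponential in the logarithms of the load, so that all powers
     merge into one exponent, compared by [ring]. *)
  assert (X0 : - x1 / (form K1 0 p q * form K1 0 p q * form K2 0 r s) = - Cexp (lx - lg K1 0 p q - lg K1 0 p q - lg K2 0 r s)).
  { assert (N0 := form1_neq0 0 p q ltac:(lia) Hp Hq). assert (M0 := form2_neq0 0 r s ltac:(lia) Hr Hs).
    rewrite <- hx. unfold Cminus. rewrite !Cexp_add, !Cexp_opp, (good_exp _ _ _ good1), (good_exp _ _ _ good2) by (auto; lia).
    field. auto. }
  rewrite X0.
  set (A := Clog (1 - Y1 p q r s)). set (B := Clog (1 - Y2 p q r s)).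
  set (J1 := Jac K1 p q). set (J2 := Jac K2 r s).
  transitivity (- (Cexp (- b1 * (lx - lg K1 0 p q - lg K2 0 r s) - b2 * lg K2 0 r s - b3 * lg K1 1 p q - b4 * lg K2 1 r s +
     (b1 + b3 - a1 - 2) * (lg K1 3 p q + A) + (b2 + b4 - a2 - 2) * lg K2 2 r s - a3 * (lg K1 2 p q + B))
      * Cexp (lx - lg K1 0 p q - lg K1 0 p q - lg K2 0 r s)) * (J1 * J2)).
  { ring. }
  transitivity (- (Cexp ((1 - b1) * lx) *
     Cexp ((b1 - 2 - 0) * lg K1 0 p q + (- b3 - 0) * lg K1 1 p q + (- a3 - 0) * lg K1 2 p q + (g - 0) * lg K1 3 p q) *
     Cexp ((b1 - b2 - 1 - 0) * lg K2 0 r s + (- b4 - 0) * lg K2 1 r s + h * lg K2 2 r s) *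
     Cexp (g * A) * Cexp (- a3 * B)) * (J1 * J2)).
  2:{ ring. }
  f_equal. f_equal. rewrite <- !Cexp_add. f_equal. unfold g, h. ring.
Qed.

(** The n-th power of Y1 and the m-th of Y2 contribute negative integral powers of the forms, which
    amount to lowering the exponents, whatever the branch. *)
Lemma term_eq n m p q r s : in01 p -> in01 q -> in01 r -> in01 s ->
  kap n m * W1 n m p q * W2 n m r s
  = - Cexp ((1 - b1) * lx) * (W1 0 0 p q * W2 0 0 r s) * ((bc (- g) n * Cpow (Y1 p q r s) n) * (bc a3 m * Cpow (Y2 p q r s) m)).
Proof.
  intros Hp Hq Hr Hs.
  assert (N0 := form1_neq0 0 p q ltac:(lia) Hp Hq). assert (N1 := form1_neq0 1 p q ltac:(lia) Hp Hq).
  assert (N2 := form1_neq0 2 p q ltac:(lia) Hp Hq). assert (N3 := form1_neq0 3 p q ltac:(lia) Hp Hq).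
  assert (M0 := form2_neq0 0 r s ltac:(lia) Hr Hs). assert (M1 := form2_neq0 1 r s ltac:(lia) Hr Hs).
  assert (E1 : W1 n m p q = W1 0 0 p q * / (Cpow (form K1 0 p q) n * Cpow (form K1 1 p q) m * Cpow (form K1 2 p q) m * Cpow (form K1 3 p q) n)).
  { unfold W1, pow4. simpl (INR 0).
    replace ((b1 - 2 - RtoC (INR n)) * lg K1 0 p q + (- b3 - RtoC (INR m)) * lg K1 1 p q + (- a3 - RtoC (INR m)) * lg K1 2 p q + (g - RtoC (INR n)) * lg K1 3 p q)
    with ((b1 - 2 - 0) * lg K1 0 p q + (- b3 - 0) * lg K1 1 p q + (- a3 - 0) * lg K1 2 p q + (g - 0) * lg K1 3 p q
      + (- RtoC (INR n) * lg K1 0 p q + (- RtoC (INR m) * lg K1 1 p q + (- RtoC (INR m) * lg K1 2 p q + - RtoC (INR n) * lg K1 3 p q)))) by ring.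
    rewrite (Cexp_add (_ + (g - 0) * _)), (Cexp_add (- RtoC (INR n) * lg K1 0 p q)), (Cexp_add (- RtoC (INR m) * lg K1 1 p q)), (Cexp_add (- RtoC (INR m) * lg K1 2 p q)).
    rewrite !Cexp_nat_pow, !(good_exp _ _ _ good1) by (auto; lia). field.
    repeat split; now apply Cpow_nz. }
  assert (E2 : W2 n m r s = W2 0 0 r s * / (Cpow (form K2 0 r s) n * Cpow (form K2 1 r s) m)).
  { unfold W2, pow3. simpl (INR 0).
    replace ((b1 - b2 - 1 - RtoC (INR n)) * lg K2 0 r s + (- b4 - RtoC (INR m)) * lg K2 1 r s + h * lg K2 2 r s)
    with ((b1 - b2 - 1 - 0) * lg K2 0 r s + (- b4 - 0) * lg K2 1 r s + h * lg K2 2 r s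
      + (- RtoC (INR n) * lg K2 0 r s + - RtoC (INR m) * lg K2 1 r s)) by ring.
    rewrite (Cexp_add (_ + h * _)), (Cexp_add (- RtoC (INR n) * lg K2 0 r s)).
    rewrite !Cexp_nat_pow, !(good_exp _ _ _ good2) by (auto; lia). field.
    repeat split; now apply Cpow_nz. }
  rewrite E1, E2. unfold kap, Y1, Y2, Cdiv. rewrite !Cpow_mult_l.
  rewrite !Cpow_inv by (repeat apply Cmult_neq_0; assumption). rewrite !Cpow_mult_l.
  field. repeat split; now apply Cpow_nz.
Qed.

Lemma cube_cell :
  dsum (fun n m => kap n m * (cell4 K1 (b1 - 2 - RtoC (INR n)) (- b3 - RtoC (INR m)) (- a3 - RtoC (INR m)) (g - RtoC (INR n))
                     * cell3 K2 (b1 - b2 - 1 - RtoC (INR n)) (- b4 - RtoC (INR m)) h))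
    (cube_int (fun p q r s => u_branch a1 a2 a3 b1 b2 b3 b4 (iota_cell lx x1 x2 (K1, K2)) p q r s * jacobian (iota_cell lx x1 x2 (K1, K2)) p q r s)).
Proof.
  destruct (Jac_cont 4 e K1 ltac:(lia) good1) as (j1 & Cj1 & Ej1).
  destruct (Jac_cont 3 e K2 ltac:(lia) good2) as (j2 & Cj2 & Ej2).
  assert (L1 : forall i, (i < 4)%nat -> cont01 (lg K1 i)) by (intros; now apply (good_lg _ _ _ good1)).
  assert (L2 : forall i, (i < 3)%nat -> cont01 (lg K2 i)) by (intros; now apply (good_lg _ _ _ good2)).
  assert (l10 := L1 0%nat ltac:(lia)). assert (l11 := L1 1%nat ltac:(lia)). assert (l12 := L1 2%nat ltac:(lia)). assert (l13 := L1 3%nat ltac:(lia)).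
  assert (l20 := L2 0%nat ltac:(lia)). assert (l21 := L2 1%nat ltac:(lia)). assert (l22 := L2 2%nat ltac:(lia)).
  (* [Jac] is controlled on the parameter square only; replacing it by the functions [j1] and [j2]
     gives integrands that are continuous in the sense of [cont01]. *)
  set (V1 := fun n m p q => pow4 (b1 - 2 - RtoC (INR n)) (- b3 - RtoC (INR m)) (- a3 - RtoC (INR m)) (g - RtoC (INR n))
   (lg K1 0 p q) (lg K1 1 p q) (lg K1 2 p q) (lg K1 3 p q) * j1 p q).
  set (V2 := fun n m r s => pow3 (b1 - b2 - 1 - RtoC (INR n)) (- b4 - RtoC (INR m)) h
   (lg K2 0 r s) (lg K2 1 r s) (lg K2 2 r s) * j2 r s).
  assert (EV1 : forall n m p q, in01 p -> in01 q -> W1 n m p q = V1 n m p q) by (intros; unfold W1, V1; now rewrite Ej1).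
  assert (EV2 : forall n m p q, in01 p -> in01 q -> W2 n m p q = V2 n m p q) by (intros; unfold W2, V2; now rewrite Ej2).
  assert (CV1 : forall n m, cont01 (fun p q => kap n m * V1 n m p q)) by (intros; unfold V1, pow4; c01).
  assert (CV2 : forall n m, cont01 (V2 n m)).
  { intros. unfold V2, pow3. c01. }
  destruct (ratio_bound x1 3 0 0 ltac:(lia) ltac:(lia) ltac:(lia) small1) as (rho1 & Hrho1 & B1).
  destruct (ratio_bound x2 2 1 1 ltac:(lia) ltac:(lia) ltac:(lia) small2) as (rho2 & Hrho2 & B2).
  destruct (bc_summable (- g) rho1 hg Hrho1) as (S1 & HS1).
  destruct (bc_summable a3 rho2 ha3 Hrho2) as (S2 & HS2).
  assert (CV10 : cont01 (V1 0%nat 0%nat)) by (unfold V1, pow4; c01).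
  destruct (cont_rect_bounded _ 0 1 0 1 Rle_0_1 Rle_0_1 CV10) as (M1 & HM10 & HM1).
  destruct (cont_rect_bounded _ 0 1 0 1 Rle_0_1 Rle_0_1 (CV2 0%nat 0%nat)) as (M2 & HM20 & HM2).
  set (Q := (Cmod (- Cexp ((1 - b1) * lx)) * (M1 * M2))%R).
  assert (Sep := fun n m => nested_sep (fun p q => kap n m * V1 n m p q) (V2 n m) (CV1 n m) (CV2 n m)).
  assert (TE : forall n m p q r s, in01 p -> in01 q -> in01 r -> in01 s ->
     kap n m * V1 n m p q * V2 n m r s = - Cexp ((1 - b1) * lx) * (V1 0%nat 0%nat p q * V2 0%nat 0%nat r s) * ((bc (- g) n * Cpow (Y1 p q r s) n) * (bc a3 m * Cpow (Y2 p q r s) m))).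
  { intros n m p q r s Hp Hq Hr Hs. rewrite <- !EV1, <- !EV2 by auto. now apply term_eq. }
  assert (MAIN := cube_dseries (fun n m p q r s => kap n m * V1 n m p q * V2 n m r s)
    (fun n p q r s => - Cexp ((1 - b1) * lx) * (V1 0%nat 0%nat p q * V2 0%nat 0%nat r s) * (bc (- g) n * Cpow (Y1 p q r s) n) * Cexp (- a3 * Clog (1 - Y2 p q r s)))
    (fun p q r s => - Cexp ((1 - b1) * lx) * (V1 0%nat 0%nat p q * V2 0%nat 0%nat r s) * (Cexp (g * Clog (1 - Y1 p q r s)) * Cexp (- a3 * Clog (1 - Y2 p q r s))))
    (fun n => (Q * (Cmod (bc (- g) n) * rho1 ^ n))%R) (fun m => (Cmod (bc a3 m) * rho2 ^ m)%R) (Q * S1)%R S2).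
  assert (D : dsum (fun n m => cube_int (fun p q r s => kap n m * V1 n m p q * V2 n m r s))
     (cube_int (fun p q r s => - Cexp ((1 - b1) * lx) * (V1 0%nat 0%nat p q * V2 0%nat 0%nat r s) * (Cexp (g * Clog (1 - Y1 p q r s)) * Cexp (- a3 * Clog (1 - Y2 p q r s)))))).
  { apply MAIN.
    - intros n m. apply Sep.
    - intros n m p q r s Hp Hq Hr Hs. rewrite TE by auto.
      rewrite !Cmod_mult, !Cmod_pow. unfold Q.
      assert (X1 := HM1 p q Hp Hq). assert (X2 := HM2 r s Hr Hs).
      assert (P1 : (Cmod (Y1 p q r s) ^ n <= rho1 ^ n)%R) by (apply pow_incr; split; [apply Cmod_ge_0|now apply B1]).
      assert (P2 : (Cmod (Y2 p q r s) ^ m <= rho2 ^ m)%R) by (apply pow_incr; split; [apply Cmod_ge_0|now apply B2]).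
      assert (Z1 : (0 <= Cmod (Y1 p q r s) ^ n)%R) by (apply pow_le, Cmod_ge_0).
      assert (Z2 : (0 <= Cmod (Y2 p q r s) ^ m)%R) by (apply pow_le, Cmod_ge_0).
      rewrite Rmult_assoc.
      apply Rle_trans with (Cmod (- Cexp ((1 - b1) * lx)) * ((M1 * M2) * ((Cmod (bc (- g) n) * rho1 ^ n) * (Cmod (bc a3 m) * rho2 ^ m))))%R.
      + apply Rmult_le_compat_l; [apply Cmod_ge_0|].
        apply Rmult_le_compat.
        * apply Rmult_le_pos; apply Cmod_ge_0.
        * apply Rmult_le_pos; apply Rmult_le_pos; auto; apply Cmod_ge_0.
        * apply Rmult_le_compat; auto; apply Cmod_ge_0.
        * apply Rmult_le_compat; try (apply Rmult_le_pos; auto; apply Cmod_ge_0); apply Rmult_le_compat_l; auto; apply Cmod_ge_0.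
      + right. ring.
    - now apply summable_scal.
    - exact HS2.
    - intros n p q r s Hp Hq Hr Hs.
      assert (BS := binomial_series a3 (Y2 p q r s) ha3 (Rle_lt_trans _ _ _ (B2 p q r s Hp Hq Hr Hs) (proj2 Hrho2))).
      assert (L := Clim_mult _ _ _ _ (Clim_const (- Cexp ((1 - b1) * lx) * (V1 0%nat 0%nat p q * V2 0%nat 0%nat r s) * (bc (- g) n * Cpow (Y1 p q r s) n))) BS).
      revert L. apply Clim_ext. intros k. rewrite <- csum_scal. apply csum_ext. intros m. rewrite TE by auto. ring.
    - intros p q r s Hp Hq Hr Hs.
      assert (BS := binomial_series (- g) (Y1 p q r s) hg (Rle_lt_trans _ _ _ (B1 p q r s Hp Hq Hr Hs) (proj2 Hrho1))).
      replace (- - g) with g in BS by ring.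
      assert (L := Clim_mult _ _ _ _ (Clim_const (- Cexp ((1 - b1) * lx) * (V1 0%nat 0%nat p q * V2 0%nat 0%nat r s) * Cexp (- a3 * Clog (1 - Y2 p q r s)))) BS).
      replace (- Cexp ((1 - b1) * lx) * (V1 0%nat 0%nat p q * V2 0%nat 0%nat r s) * (Cexp (g * Clog (1 - Y1 p q r s)) * Cexp (- a3 * Clog (1 - Y2 p q r s))))
       with (- Cexp ((1 - b1) * lx) * (V1 0%nat 0%nat p q * V2 0%nat 0%nat r s) * Cexp (- a3 * Clog (1 - Y2 p q r s)) * Cexp (g * Clog (1 - Y1 p q r s))) by ring.
      revert L. apply Clim_ext. intros k. rewrite <- csum_scal. apply csum_ext. intros n. ring. }
  rewrite (cube_int_ext _ _ (fun p q r s Hp Hq Hr Hs => integrand_eq p q r s Hp Hq Hr Hs)).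
  rewrite (cube_int_ext _ (fun p q r s => - Cexp ((1 - b1) * lx) * (V1 0%nat 0%nat p q * V2 0%nat 0%nat r s) * (Cexp (g * Clog (1 - Y1 p q r s)) * Cexp (- a3 * Clog (1 - Y2 p q r s))))).
  2:{ intros p q r s Hp Hq Hr Hs. now rewrite EV1, EV2. }
  revert D. apply dsum_ext. intros n m.
  rewrite (proj2 (Sep n m)).
  assert (I1 : CRInt (fun p => CRInt (fun q => kap n m * V1 n m p q) 0 1) 0 1 = kap n m * cell4 K1 (b1 - 2 - RtoC (INR n)) (- b3 - RtoC (INR m)) (- a3 - RtoC (INR m)) (g - RtoC (INR n))).
  { assert (CV : cont01 (V1 n m)) by (unfold V1, pow4; c01).
    unfold cell4. rewrite <- CRInt_scal.
    - apply CRInt_ext01; [lra|]. intros p Hp.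
      rewrite CRInt_scal by exact (cont_rect_exI _ 0 1 0 1 p Rle_0_1 CV Hp). f_equal.
      apply CRInt_ext01; [lra|]. intros q Hq. symmetry. now apply EV1.
    - apply (exI_ext01 (fun p => CRInt (V1 n m p) 0 1) _ 0 1 Rle_0_1).
      + intros p Hp. apply CRInt_ext01; [lra|]. intros q Hq. symmetry. now apply EV1.
      + exact (cont_rect_exI2 _ 0 1 0 1 Rle_0_1 Rle_0_1 CV). }
  assert (I2 : CRInt (fun r => CRInt (V2 n m r) 0 1) 0 1 = cell3 K2 (b1 - b2 - 1 - RtoC (INR n)) (- b4 - RtoC (INR m)) h).
  { unfold cell3. apply CRInt_ext01; [lra|]. intros p Hp. apply CRInt_ext01; [lra|]. intros q Hq. symmetry. now apply EV2. }
  rewrite I1, I2. ring.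
Qed.
End CubeCell.

(** * The cells of the chain *)

Definition C1 (f : R -> R -> C) : Prop := exists fp fq, C1pq f fp fq.

Lemma Re_ge_Cmod e z : (e <= Re z)%R -> (e <= Cmod z)%R.
Proof. intros H. assert (X := Re_le_Cmod z). apply Rabs_le_between in X. lra. Qed.

Lemma offcut_low e z : (0 < e)%R -> (e <= Re z)%R -> offcut z.
Proof. intros. apply offcut_Re. lra. Qed.

Lemma C1_cont f : C1 f -> cont01 f.
Proof. intros (fp & fq & H). exact (C1_c _ _ _ H). Qed.

Lemma good_none N e f : (0 < e)%R ->
  (forall i, (i < N)%nat -> C1 (f i)) ->
  (forall i p q, (i < N)%nat -> in01 p -> in01 q -> (e <= Re (f i p q))%R) ->
  good N e (load_none f).
Proof.
  intros he HC HR. split; simpl.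
  - exact HC.
  - intros i Hi. apply cont01_log.
    + intros p q Hp Hq. apply (offcut_low e); auto.
    + now apply C1_cont, HC.
  - intros i p q Hi Hp Hq. apply Cexp_Clog, (offcut_low e); auto.
  - intros i p q Hi Hp Hq. now apply Re_ge_Cmod, HR.
Qed.

Lemma good_edge N e f : (0 < e)%R ->
  (forall p q, f 0%nat p q = circ e p) ->
  (forall i, (i < N)%nat -> C1 (f i)) ->
  (forall i p q, (0 < i < N)%nat -> in01 p -> in01 q -> (e <= Re (f i p q))%R) ->
  good N e (load_edge e f).
Proof.
  intros he H0 HC HR. split; simpl.
  - exact HC.
  - intros [|i] Hi.
    + apply (cont01_p (circlog e)). intros; apply ccont_circlog.
    + apply cont01_log.
      * intros p q Hp Hq. apply (offcut_low e); auto. apply HR; auto. lia.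
      * now apply C1_cont, HC.
  - intros [|i] p q Hi Hp Hq.
    + rewrite H0. now apply circ_exp.
    + apply Cexp_Clog, (offcut_low e); auto. apply HR; auto. lia.
  - intros [|i] p q Hi Hp Hq.
    + rewrite H0, Cmod_circ by auto. lra.
    + apply Re_ge_Cmod, HR; auto. lia.
Qed.

Lemma good_vertex N e f : (0 < e)%R ->
  (forall p q, f 0%nat p q = circ e p) -> (forall p q, f 1%nat p q = circ e q) ->
  (forall i, (i < N)%nat -> C1 (f i)) ->
  (forall i p q, (1 < i < N)%nat -> in01 p -> in01 q -> (e <= Re (f i p q))%R) ->
  good N e (load_vertex e f).
Proof.
  intros he H0 H1 HC HR. split; simpl.
  - exact HC.
  - intros [|[|i]] Hi.
    + apply (cont01_p (circlog e)). intros; apply ccont_circlog.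
    + apply (cont01_q (circlog e)). intros; apply ccont_circlog.
    + apply cont01_log.
      * intros p q Hp Hq. apply (offcut_low e); auto. apply HR; auto. lia.
      * now apply C1_cont, HC.
  - intros [|[|i]] p q Hi Hp Hq.
    + rewrite H0. now apply circ_exp.
    + rewrite H1. now apply circ_exp.
    + apply Cexp_Clog, (offcut_low e); auto. apply HR; auto. lia.
  - intros [|[|i]] p q Hi Hp Hq.
    + rewrite H0, Cmod_circ by auto. lra.
    + rewrite H1, Cmod_circ by auto. lra.
    + apply Re_ge_Cmod, HR; auto. lia.
Qed.

Lemma good_rot N e i K : (0 < N)%nat -> good N e K -> good N e (rot N i K).
Proof.
  intros HN [G1 G2 G3 G4].
  assert (M : forall j, ((j + N - i) mod N < N)%nat) by (intros; apply Nat.mod_upper_bound; lia).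
  split; simpl; intros.
  - apply G1, M.
  - apply G2, M.
  - now apply G3.
  - now apply G4.
Qed.

Lemma sqrel_rot1 K : sqrel K -> sqrel (rot 4 1 K).
Proof. intros H p q. destruct (H p q) as [E2 E3]. simpl. rewrite E2, E3. split; ring. Qed.

Lemma sqrel_rot i K : (i < 4)%nat -> sqrel K -> sqrel (rot 4 i K).
Proof.
  intros Hi H p q. destruct (H p q) as [E2 E3].
  destruct i as [|[|[|[|i]]]]; simpl; rewrite ?E2, ?E3; try (split; ring). lia.
Qed.

Definition trirel (K : cell) : Prop := forall p q, form K 2 p q = 1 - form K 0 p q - form K 1 p q.

Lemma trirel_rot1 K : trirel K -> trirel (rot 3 1 K).
Proof. intros H p q. simpl. rewrite (H p q). ring. Qed.

(** The rotated coordinates are (1 - l_1, l_0), a change of determinant 1. *)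
Lemma Jac_square_rot1 e K p q : good 4 e K -> sqrel K -> in01 p -> in01 q -> Jac (rot 4 1 K) p q = Jac K p q.
Proof.
  intros G R Hp Hq.
  destruct (good_form _ _ _ G 0%nat ltac:(lia)) as (f0p & f0q & F0).
  destruct (good_form _ _ _ G 1%nat ltac:(lia)) as (f1p & f1q & F1).
  rewrite (Jac_eq K _ _ _ _ p q F0 F1) by auto.
  rewrite (Jac_eq (rot 4 1 K) (fun p q => 0 - f1p p q) (fun p q => 0 - f1q p q) f0p f0q p q); auto. ring.
  refine (C1pq_ext (fun p q => 1 - form K 1 p q) _ _ _ _ _ _ (fun _ _ => eq_refl) (fun _ _ => eq_refl) (C1pq_minus _ _ _ _ _ _ (C1pq_const 1) F1)).
  intros u v. symmetry. apply R.
Qed.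

(** The rotated coordinates are (1 - l_0 - l_1, l_0), again of determinant 1. *)
Lemma Jac_triangle_rot1 e K p q : good 3 e K -> trirel K -> in01 p -> in01 q -> Jac (rot 3 1 K) p q = Jac K p q.
Proof.
  intros G R Hp Hq.
  destruct (good_form _ _ _ G 0%nat ltac:(lia)) as (f0p & f0q & F0).
  destruct (good_form _ _ _ G 1%nat ltac:(lia)) as (f1p & f1q & F1).
  rewrite (Jac_eq K _ _ _ _ p q F0 F1) by auto.
  rewrite (Jac_eq (rot 3 1 K) (fun p q => 0 - f0p p q - f1p p q) (fun p q => 0 - f0q p q - f1q p q) f0p f0q p q); auto. ring.
  refine (C1pq_ext (fun p q => 1 - form K 0 p q - form K 1 p q) _ _ _ _ _ _ (fun _ _ => eq_refl) (fun _ _ => eq_refl)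
    (C1pq_minus _ _ _ _ _ _ (C1pq_minus _ _ _ _ _ _ (C1pq_const 1) F0) F1)).
  intros u v. symmetry. apply R.
Qed.

Lemma cell4_rot1 e K w0 w1 w2 w3 : good 4 e K -> sqrel K -> cell4 (rot 4 1 K) w0 w1 w2 w3 = cell4 K w1 w2 w3 w0.
Proof.
  intros G R. unfold cell4. apply CRInt_ext01; [lra|]. intros p Hp. apply CRInt_ext01; [lra|]. intros q Hq.
  rewrite (Jac_square_rot1 e) by auto. f_equal. unfold pow4. simpl. f_equal. ring.
Qed.

Lemma cell3_rot1 e K w0 w1 w2 : good 3 e K -> trirel K -> cell3 (rot 3 1 K) w0 w1 w2 = cell3 K w1 w2 w0.
Proof.
  intros G R. unfold cell3. apply CRInt_ext01; [lra|]. intros p Hp. apply CRInt_ext01; [lra|]. intros q Hq.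
  rewrite (Jac_triangle_rot1 e) by auto. f_equal. unfold pow3. simpl. f_equal. ring.
Qed.

Lemma cell4_rot e K w0 w1 w2 w3 : good 4 e K -> sqrel K ->
  cell4 (rot 4 0 K) w0 w1 w2 w3 = cell4 K w0 w1 w2 w3 /\
  cell4 (rot 4 1 K) w0 w1 w2 w3 = cell4 K w1 w2 w3 w0 /\
  cell4 (rot 4 2 K) w0 w1 w2 w3 = cell4 K w2 w3 w0 w1 /\
  cell4 (rot 4 3 K) w0 w1 w2 w3 = cell4 K w3 w0 w1 w2.
Proof.
  intros G R.
  assert (G1 : good 4 e (rot 4 1 K)) by (apply good_rot; auto; lia).
  assert (G2 : good 4 e (rot 4 1 (rot 4 1 K))) by (apply good_rot; auto; lia).
  assert (R1 := sqrel_rot1 _ R). assert (R2 := sqrel_rot1 _ R1).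
  split; [|split; [|split]].
  - reflexivity.
  - now apply (cell4_rot1 e).
  (* [cell4] reads the indices 0 to 3 only, where the residues compute, so the double rotation is
     the same by conversion. *)
  - transitivity (cell4 (rot 4 1 (rot 4 1 K)) w0 w1 w2 w3). reflexivity. now rewrite !(cell4_rot1 e).
  - transitivity (cell4 (rot 4 1 (rot 4 1 (rot 4 1 K))) w0 w1 w2 w3). reflexivity. now rewrite !(cell4_rot1 e).
Qed.

Lemma cell3_rot e K w0 w1 w2 : good 3 e K -> trirel K ->
  cell3 (rot 3 0 K) w0 w1 w2 = cell3 K w0 w1 w2 /\
  cell3 (rot 3 1 K) w0 w1 w2 = cell3 K w1 w2 w0 /\
  cell3 (rot 3 2 K) w0 w1 w2 = cell3 K w2 w0 w1.
Proof.
  intros G R.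
  assert (G1 : good 3 e (rot 3 1 K)) by (apply good_rot; auto; lia).
  assert (R1 := trirel_rot1 _ R).
  split; [|split].
  - reflexivity.
  - now apply (cell3_rot1 e).
  - transitivity (cell3 (rot 3 1 (rot 3 1 K)) w0 w1 w2). reflexivity. now rewrite !(cell3_rot1 e).
Qed.

Lemma CRInt_prod (f g : R -> C) (F : R -> R -> C) : exI f 0 1 -> exI g 0 1 ->
  (forall p q, in01 p -> in01 q -> F p q = f p * g q) ->
  CRInt (fun p => CRInt (F p) 0 1) 0 1 = CRInt f 0 1 * CRInt g 0 1.
Proof.
  intros Hf Hg E. transitivity (CRInt (fun p => f p * CRInt g 0 1) 0 1).
  - apply CRInt_ext01; [lra|]. intros p Hp. transitivity (CRInt (fun q => f p * g q) 0 1).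
    + apply CRInt_ext01; [lra|]. intros q Hq. now apply E.
    + now apply CRInt_scal.
  - now apply CRInt_scalr.
Qed.

Section Cells.
Variable e : R.
Hypothesis he : (0 < e < 1 / 3)%R.

Definition square_sigma : cell := load_none (square_forms (fun p q => sd e p) (fun p q => sd e q)).
Definition square_edge : cell := load_edge e (square_forms (fun p q => circ e p) (fun p q => sd e q)).
Definition square_vertex : cell := load_vertex e (square_forms (fun p q => circ e p) (fun p q => circ e q)).
Definition triangle_sigma : cell := load_none (triangle_forms (sx e) (sy e)).
Definition triangle_edge : cell := load_edge e (triangle_forms (fun p q => circ e p) (ey e)).
Definition triangle_vertex : cell := load_vertex e (triangle_forms (fun p q => circ e p) (fun p q => circ e q)).

Lemma C1pq_sd_p : C1pq (fun p _ => sd e p) (fun _ _ => RtoC (1 - 2 * e)) (fun _ _ => 0).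
Proof. apply (C1pq_p (sd e) (fun _ => RtoC (1 - 2 * e))). apply Cderiv_sd. intros; apply continuous_const. Qed.

Lemma C1pq_sd_q : C1pq (fun _ q => sd e q) (fun _ _ => 0) (fun _ _ => RtoC (1 - 2 * e)).
Proof. apply (C1pq_q (sd e) (fun _ => RtoC (1 - 2 * e))). apply Cderiv_sd. intros; apply continuous_const. Qed.

Lemma C1_intro f fp fq : C1pq f fp fq -> C1 f.
Proof. intros H. now exists fp, fq. Qed.

Lemma C1_minus f g : C1 f -> C1 g -> C1 (fun p q => f p q - g p q).
Proof. intros (fp & fq & F) (gp & gq & G). eexists. eexists. exact (C1pq_minus _ _ _ _ _ _ F G). Qed.

Lemma C1_square z0 z1 i : C1 z0 -> C1 z1 -> (i < 4)%nat -> C1 (square_forms z0 z1 i).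
Proof.
  intros H0 H1 Hi. assert (O1 := C1_intro _ _ _ (C1pq_const 1)).
  destruct i as [|[|[|i]]].
  - exact H0.
  - exact H1.
  - exact (C1_minus _ _ O1 H0).
  - exact (C1_minus _ _ O1 H1).
Qed.

Lemma C1_triangle z0 z1 i : C1 z0 -> C1 z1 -> (i < 3)%nat -> C1 (triangle_forms z0 z1 i).
Proof.
  intros H0 H1 Hi. assert (O1 := C1_intro _ _ _ (C1pq_const 1)).
  destruct i as [|[|i]].
  - exact H0.
  - exact H1.
  - exact (C1_minus _ _ (C1_minus _ _ O1 H0) H1).
Qed.

Lemma sd_Re r : in01 r -> (e <= Re (sd e r))%R.
Proof. intros H. apply (sd_bounds e he) in H. unfold sd. cbn. lra. Qed.

Lemma sd_compl_Re r : in01 r -> (e <= Re (1 - sd e r))%R.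
Proof. intros H. rewrite sd_compl. apply (sd_bounds e he) in H. cbn. lra. Qed.

Lemma circ_compl_Re p : (e <= Re (1 - circ e p)%C)%R.
Proof. assert (B := Re_circ e p ltac:(lra)). revert B. destruct (circ e p). cbn. lra. Qed.

Lemma good_square_sigma : good 4 e square_sigma.
Proof.
  apply good_none; [lra| |].
  - intros i Hi. apply C1_square; auto. exact (C1_intro _ _ _ C1pq_sd_p). exact (C1_intro _ _ _ C1pq_sd_q).
  - intros [|[|[|i]]] p q Hi Hp Hq; cbn [square_forms]; first [now apply sd_Re|now apply sd_compl_Re].
Qed.

Lemma good_square_edge : good 4 e square_edge.
Proof.
  apply good_edge; [lra| | |].
  - reflexivity.
  - intros i Hi. apply C1_square; auto. exact (C1_intro _ _ _ (C1pq_circ_p e)). exact (C1_intro _ _ _ C1pq_sd_q).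
  - intros [|[|[|i]]] p q Hi Hp Hq; cbn [square_forms]; [lia| | |]; first [now apply sd_Re|now apply sd_compl_Re|apply circ_compl_Re].
Qed.

Lemma good_square_vertex : good 4 e square_vertex.
Proof.
  apply good_vertex; [lra| | | |].
  - reflexivity.
  - reflexivity.
  - intros i Hi. apply C1_square; auto. exact (C1_intro _ _ _ (C1pq_circ_p e)). exact (C1_intro _ _ _ (C1pq_circ_q e)).
  - intros [|[|[|i]]] p q Hi Hp Hq; cbn [square_forms]; [lia|lia| |]; apply circ_compl_Re.
Qed.

Lemma good_triangle_sigma : good 3 e triangle_sigma.
Proof.
  apply good_none; [lra| |].
  - intros i Hi. apply C1_triangle; auto. exact (C1_intro _ _ _ (C1_sx e)). exact (C1_intro _ _ _ (C1_sy e)).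
  - intros [|[|i]] p q Hi Hp Hq; cbn [triangle_forms].
    + now apply sx_pos.
    + now apply sy_pos.
    + rewrite sz_RtoC. now apply sz_pos.
Qed.

Lemma good_triangle_edge : good 3 e triangle_edge.
Proof.
  apply good_edge; [lra| | |].
  - reflexivity.
  - intros i Hi. apply C1_triangle; auto. exact (C1_intro _ _ _ (C1pq_circ_p e)). exact (C1_intro _ _ _ (C1_ey e)).
  - intros [|[|i]] p q Hi Hp Hq; cbn [triangle_forms]; [lia| |].
    + now apply ey_Re.
    + rewrite ez_eq. apply ey_Re; auto. now apply in01_sub.
Qed.

Lemma good_triangle_vertex : good 3 e triangle_vertex.
Proof.
  apply good_vertex; [lra| | | |].
  - reflexivity.
  - reflexivity.
  - intros i Hi. apply C1_triangle; auto. exact (C1_intro _ _ _ (C1pq_circ_p e)). exact (C1_intro _ _ _ (C1pq_circ_q e)).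
  - intros [|[|i]] p q Hi Hp Hq; cbn [triangle_forms]; [lia|lia|]; now apply vz_Re.
Qed.

Lemma reg_In N w sigma edge vertex c K : In (c, K) (reg N w sigma edge vertex) ->
  K = sigma \/ (exists i, (i < N)%nat /\ K = rot N i edge) \/ exists i, (i < N)%nat /\ K = rot N i vertex.
Proof.
  unfold reg. cbv zeta. intros [H|H]; [left; congruence|].
  apply in_app_iff in H. destruct H as [H|H]; right; [left|right];
  apply in_map_iff in H; destruct H as (i & H & Hi); exists i; apply in_seq in Hi; (split; [lia|congruence]).
Qed.

Lemma square_good w c K : In (c, K) (reg_square e w) -> good 4 e K /\ sqrel K.
Proof.
  intros H. apply (reg_In 4 w square_sigma square_edge square_vertex) in H.
  destruct H as [->|[(i & Hi & ->)|(i & Hi & ->)]]; (split; [|]).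
  - apply good_square_sigma.
  - intros p q; now split.
  - apply good_rot; [lia|apply good_square_edge].
  - apply sqrel_rot; auto. intros p q; now split.
  - apply good_rot; [lia|apply good_square_vertex].
  - apply sqrel_rot; auto. intros p q; now split.
Qed.

Lemma triangle_good w c K : In (c, K) (reg_triangle e w) -> good 3 e K.
Proof.
  intros H. apply (reg_In 3 w triangle_sigma triangle_edge triangle_vertex) in H.
  destruct H as [->|[(i & Hi & ->)|(i & Hi & ->)]].
  - apply good_triangle_sigma.
  - apply good_rot; [lia|apply good_triangle_edge].
  - apply good_rot; [lia|apply good_triangle_vertex].
Qed.

Lemma side_int_sym u v : side_int e u v = side_int e v u.
Proof.
  unfold side_int. rewrite CRInt_flip by (apply exI_side; exact he).
  apply CRInt_ext. intros r _.
  assert (E : sd e (1 - r) = 1 - sd e r).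
  { rewrite sd_compl. unfold sd. f_equal. ring. }
  rewrite E. replace (1 - (1 - sd e r)) with (sd e r) by ring. f_equal. f_equal. ring.
Qed.

Lemma cell4_sigma w0 w1 w2 w3 : cell4 square_sigma w0 w1 w2 w3 = side_int e w0 w2 * side_int e w1 w3.
Proof.
  unfold cell4, side_int. apply CRInt_prod; [now apply exI_side|now apply exI_side|].
  intros p q Hp Hq. rewrite (Jac_eq square_sigma _ _ _ _ p q C1pq_sd_p C1pq_sd_q Hp Hq).
  unfold pow4. cbn [square_sigma load_none form lg square_forms].
  replace (w0 * Clog (sd e p) + w1 * Clog (sd e q) + w2 * Clog (1 - sd e p) + w3 * Clog (1 - sd e q))
    with ((w0 * Clog (sd e p) + w2 * Clog (1 - sd e p)) + (w1 * Clog (sd e q) + w3 * Clog (1 - sd e q))) by ring.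
  rewrite Cexp_add. ring.
Qed.

Lemma cell4_edge w0 w1 w2 w3 : cell4 square_edge w0 w1 w2 w3 = loop_int e w0 w2 * side_int e w1 w3.
Proof.
  unfold cell4, side_int, loop_int. apply CRInt_prod; [now apply exI_loop1|now apply exI_side|].
  intros p q Hp Hq. rewrite (Jac_eq square_edge _ _ _ _ p q (C1pq_circ_p e) C1pq_sd_q Hp Hq).
  unfold pow4. cbn [square_edge load_edge form lg square_forms].
  replace (w0 * circlog e p + w1 * Clog (sd e q) + w2 * Clog (1 - circ e p) + w3 * Clog (1 - sd e q))
    with ((w0 * circlog e p + w2 * Clog (1 - circ e p)) + (w1 * Clog (sd e q) + w3 * Clog (1 - sd e q))) by ring.
  rewrite Cexp_add. ring.
Qed.

Lemma cell4_vertex w0 w1 w2 w3 : cell4 square_vertex w0 w1 w2 w3 = loop_int e w0 w2 * loop_int e w1 w3.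
Proof.
  unfold cell4, loop_int. apply CRInt_prod; [now apply exI_loop1|now apply exI_loop1|].
  intros p q Hp Hq. rewrite (Jac_eq square_vertex _ _ _ _ p q (C1pq_circ_p e) (C1pq_circ_q e) Hp Hq).
  unfold pow4. cbn [square_vertex load_vertex form lg square_forms].
  replace (w0 * circlog e p + w1 * circlog e q + w2 * Clog (1 - circ e p) + w3 * Clog (1 - circ e q))
    with ((w0 * circlog e p + w2 * Clog (1 - circ e p)) + (w1 * circlog e q + w3 * Clog (1 - circ e q))) by ring.
  rewrite Cexp_add. ring.
Qed.

Lemma cell3_sigma w0 w1 w2 : cell3 triangle_sigma w0 w1 w2 = tri_sigma e w0 w1 w2.
Proof.
  unfold cell3, tri_sigma, cell_int. apply CRInt_ext01; [lra|]. intros p Hp. apply CRInt_ext01; [lra|]. intros q Hq.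
  now rewrite (Jac_eq triangle_sigma _ _ _ _ p q (C1_sx e) (C1_sy e) Hp Hq).
Qed.

Lemma cell3_edge w0 w1 w2 : cell3 triangle_edge w0 w1 w2 = tri_edge e w0 w1 w2.
Proof.
  unfold cell3, tri_edge, cell_int. apply CRInt_ext01; [lra|]. intros p Hp. apply CRInt_ext01; [lra|]. intros q Hq.
  now rewrite (Jac_eq triangle_edge _ _ _ _ p q (C1pq_circ_p e) (C1_ey e) Hp Hq).
Qed.

Lemma cell3_vertex w0 w1 w2 : cell3 triangle_vertex w0 w1 w2 = tri_vertex e w0 w1 w2.
Proof.
  unfold cell3, tri_vertex, cell_int. apply CRInt_ext01; [lra|]. intros p Hp. apply CRInt_ext01; [lra|]. intros q Hq.
  now rewrite (Jac_eq triangle_vertex _ _ _ _ p q (C1pq_circ_p e) (C1pq_circ_q e) Hp Hq).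
Qed.

(** The nine cells expand the product of two three-term regularized intervals. The coefficients see
    [w] only through [per], so the cycle built from the original weights also serves their integral
    shifts w0, ..., w3. *)
Lemma square_sum (w : nat -> C) w0 w1 w2 w3 :
  per (w 0%nat) = per w0 -> per (w 1%nat) = per w1 -> per (w 2%nat) = per w2 -> per (w 3%nat) = per w3 ->
  per w0 - 1 <> 0 -> per w1 - 1 <> 0 -> per w2 - 1 <> 0 -> per w3 - 1 <> 0 ->
  Csum (map (fun X => fst X * cell4 (snd X) w0 w1 w2 w3) (reg_square e w)) = regI e w0 w2 * regI e w1 w3.
Proof.
  intros E0 E1 E2 E3 N0 N1 N2 N3.
  change (reg_square e w) with (reg 4 w square_sigma square_edge square_vertex).
  unfold reg. cbv zeta. cbn [seq map app Csum fold_right fst snd Nat.modulo Nat.divmod Nat.sub].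
  fold tau. change (Cexp (tau * w 0%nat)) with (per (w 0%nat)). change (Cexp (tau * w 1%nat)) with (per (w 1%nat)).
  change (Cexp (tau * w 2%nat)) with (per (w 2%nat)). change (Cexp (tau * w 3%nat)) with (per (w 3%nat)).
  rewrite E0, E1, E2, E3.
  destruct (cell4_rot e square_edge w0 w1 w2 w3 good_square_edge ltac:(intros p q; now split)) as (-> & -> & -> & ->).
  destruct (cell4_rot e square_vertex w0 w1 w2 w3 good_square_vertex ltac:(intros p q; now split)) as (-> & -> & -> & ->).
  rewrite cell4_sigma, !cell4_edge, !cell4_vertex. unfold regI.
  rewrite (side_int_sym w2 w0), (side_int_sym w3 w1). field. auto.
Qed.

Lemma triangle_sum (w : nat -> C) w0 w1 w2 :
  per (w 0%nat) = per w0 -> per (w 1%nat) = per w1 -> per (w 2%nat) = per w2 ->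
  per w0 - 1 <> 0 -> per w1 - 1 <> 0 -> per w2 - 1 <> 0 ->
  Csum (map (fun X => fst X * cell3 (snd X) w0 w1 w2) (reg_triangle e w)) = tri e w0 w1 w2.
Proof.
  intros E0 E1 E2 N0 N1 N2.
  change (reg_triangle e w) with (reg 3 w triangle_sigma triangle_edge triangle_vertex).
  unfold reg. cbv zeta. cbn [seq map app Csum fold_right fst snd Nat.modulo Nat.divmod Nat.sub].
  fold tau. change (Cexp (tau * w 0%nat)) with (per (w 0%nat)). change (Cexp (tau * w 1%nat)) with (per (w 1%nat)).
  change (Cexp (tau * w 2%nat)) with (per (w 2%nat)).
  rewrite E0, E1, E2.
  destruct (cell3_rot e triangle_edge w0 w1 w2 good_triangle_edge ltac:(now intros p q)) as (-> & -> & ->).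
  destruct (cell3_rot e triangle_vertex w0 w1 w2 good_triangle_vertex ltac:(now intros p q)) as (-> & -> & ->).
  rewrite cell3_sigma, !cell3_edge, !cell3_vertex. unfold tri. field. auto.
Qed.
End Cells.

(** * Assembly *)

Lemma poch_add z n m : poch z (n + m) = poch z n * poch (z + RtoC (INR n)) m.
Proof.
  induction m.
  - rewrite Nat.add_0_r. simpl. ring.
  - rewrite Nat.add_succ_r, !poch_S, IHm, plus_INR, RtoC_plus. ring.
Qed.

Lemma poch_1 n : poch 1 n = RtoC (INR (fact n)).
Proof.
  induction n.
  - reflexivity.
  - rewrite poch_S, IHn, fact_simpl, mult_INR, S_INR, RtoC_mult, RtoC_plus. ring.
Qed.

Lemma poch_descent (G : nat -> C) a c :
  (forall n, (a + RtoC (INR n)) * G (S n) = (c + RtoC (INR n)) * G n) ->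
  forall n, poch a n * G n = poch c n * G 0%nat.
Proof.
  intros H n. induction n.
  - reflexivity.
  - rewrite !poch_S. transitivity (poch a n * ((a + RtoC (INR n)) * G (S n))). ring.
    rewrite H. transitivity (poch a n * G n * (c + RtoC (INR n))). ring. rewrite IHn. ring.
Qed.

Lemma not_int_minus w (k : Z) : not_int w -> not_int (w - RtoC (IZR k)).
Proof.
  intros H. replace (w - RtoC (IZR k)) with (w + RtoC (IZR (- k))).
  now apply not_int_plus. rewrite opp_IZR, RtoC_opp. ring.
Qed.

Lemma not_int_minus_nat w n : not_int w -> not_int (w - RtoC (INR n)).
Proof. rewrite INR_IZR_INZ. apply not_int_minus. Qed.

Lemma per_minus_nat w n : per (w - RtoC (INR n)) = per w.
Proof.
  induction n.
  - f_equal. simpl. ring.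
  - rewrite <- IHn, <- (per_minus1 (w - RtoC (INR n))). f_equal. rewrite S_INR, RtoC_plus. ring.
Qed.

(** * Integral shifts of the exponents and Pochhammer symbols *)

Section Shift.
Variable e : R.
Hypothesis he : (0 < e < 1 / 3)%R.

(** The recurrences are run downwards, m steps in v and n in u. Lowering exponents reverses signs,
    hence Pochhammer symbols of negated exponents; each step lowers the sum u + v by 1, so the right
    sides join into one symbol of length n + m. *)
Lemma regI_shift u v n m : not_int u -> not_int v ->
  poch (- u) n * poch (- v) m * regI e (u - RtoC (INR n)) (v - RtoC (INR m)) = poch (- (u + v + 1)) (n + m) * regI e u v.
Proof.
  intros hu hv.
  assert (pu : forall k, per (u - RtoC (INR k)) - 1 <> 0) by (intros; now apply per_neq1, not_int_minus_nat).
  assert (pv : forall k, per (v - RtoC (INR k)) - 1 <> 0) by (intros; now apply per_neq1, not_int_minus_nat).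
  assert (A := poch_descent (fun k => regI e (u - RtoC (INR n)) (v - RtoC (INR k))) (- v) (- (u - RtoC (INR n) + v + 1))).
  assert (B := poch_descent (fun k => regI e (u - RtoC (INR k)) v) (- u) (- (u + v + 1))).
  cbv beta in A, B. simpl (INR 0) in A, B. replace (v - 0) with v in A by ring. replace (u - 0) with u in B by ring.
  rewrite poch_add. replace (- (u + v + 1) + RtoC (INR n)) with (- (u - RtoC (INR n) + v + 1)) by ring.
  rewrite <- Cmult_assoc, A.
  - transitivity (poch (- u) n * regI e (u - RtoC (INR n)) v * poch (- (u - RtoC (INR n) + v + 1)) m). ring.
    rewrite B. ring.
    intros k. destruct (regI_recurrence e he (u - RtoC (INR (S k))) v (pu (S k)) (per_neq1 _ hv)) as [X _].
    replace (u - RtoC (INR (S k)) + 1) with (u - RtoC (INR k)) in X by (rewrite S_INR, RtoC_plus; ring).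
    replace (u - RtoC (INR (S k)) + v + 2) with (u - RtoC (INR k) + v + 1) in X by (rewrite S_INR, RtoC_plus; ring).
    transitivity (- ((u - RtoC (INR k)) * regI e (u - RtoC (INR (S k))) v)). ring. rewrite <- X. ring.
  - intros k. destruct (regI_recurrence e he (u - RtoC (INR n)) (v - RtoC (INR (S k))) (pu n) (pv (S k))) as [_ X].
    replace (v - RtoC (INR (S k)) + 1) with (v - RtoC (INR k)) in X by (rewrite S_INR, RtoC_plus; ring).
    replace (u - RtoC (INR n) + (v - RtoC (INR (S k))) + 2) with (u - RtoC (INR n) + v + 1 - RtoC (INR k)) in X by (rewrite S_INR, RtoC_plus; ring).
    transitivity (- ((v - RtoC (INR k)) * regI e (u - RtoC (INR n)) (v - RtoC (INR (S k))))). ring. rewrite <- X. ring.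
Qed.

Lemma tri_shift w0 w1 w2 n m : not_int w0 -> not_int w1 -> not_int w2 ->
  poch (- w0) n * poch (- w1) m * tri e (w0 - RtoC (INR n)) (w1 - RtoC (INR m)) w2
  = poch (- (w0 + w1 + w2 + 2)) (n + m) * tri e w0 w1 w2.
Proof.
  intros h0 h1 h2.
  assert (p0 : forall k, per (w0 - RtoC (INR k)) - 1 <> 0) by (intros; now apply per_neq1, not_int_minus_nat).
  assert (p1 : forall k, per (w1 - RtoC (INR k)) - 1 <> 0) by (intros; now apply per_neq1, not_int_minus_nat).
  assert (p2 := per_neq1 _ h2).
  assert (A := poch_descent (fun k => tri e (w0 - RtoC (INR n)) (w1 - RtoC (INR k)) w2) (- w1) (- (w0 - RtoC (INR n) + w1 + w2 + 2))).
  assert (B := poch_descent (fun k => tri e (w0 - RtoC (INR k)) w1 w2) (- w0) (- (w0 + w1 + w2 + 2))).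
  cbv beta in A, B. simpl (INR 0) in A, B. replace (w1 - 0) with w1 in A by ring. replace (w0 - 0) with w0 in B by ring.
  rewrite poch_add. replace (- (w0 + w1 + w2 + 2) + RtoC (INR n)) with (- (w0 - RtoC (INR n) + w1 + w2 + 2)) by ring.
  rewrite <- Cmult_assoc, A.
  - transitivity (poch (- w0) n * tri e (w0 - RtoC (INR n)) w1 w2 * poch (- (w0 - RtoC (INR n) + w1 + w2 + 2)) m). ring.
    rewrite B. ring.
    intros k. destruct (tri_recurrence e he (w0 - RtoC (INR (S k))) w1 w2 (p0 (S k)) (per_neq1 _ h1) p2) as [X _].
    replace (w0 - RtoC (INR (S k)) + 1) with (w0 - RtoC (INR k)) in X by (rewrite S_INR, RtoC_plus; ring).
    replace (w0 - RtoC (INR (S k)) + w1 + w2 + 3) with (w0 - RtoC (INR k) + w1 + w2 + 2) in X by (rewrite S_INR, RtoC_plus; ring).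
    transitivity (- ((w0 - RtoC (INR k)) * tri e (w0 - RtoC (INR (S k))) w1 w2)). ring. rewrite <- X. ring.
  - intros k. destruct (tri_recurrence e he (w0 - RtoC (INR n)) (w1 - RtoC (INR (S k))) w2 (p0 n) (p1 (S k)) p2) as [_ [X _]].
    replace (w1 - RtoC (INR (S k)) + 1) with (w1 - RtoC (INR k)) in X by (rewrite S_INR, RtoC_plus; ring).
    replace (w0 - RtoC (INR n) + (w1 - RtoC (INR (S k))) + w2 + 3) with (w0 - RtoC (INR n) + w1 + w2 + 2 - RtoC (INR k)) in X by (rewrite S_INR, RtoC_plus; ring).
    transitivity (- ((w1 - RtoC (INR k)) * tri e (w0 - RtoC (INR n)) (w1 - RtoC (INR (S k))) w2)). ring. rewrite <- X. ring.
Qed.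
End Shift.

Lemma Csum_scal {T} c (f : T -> C) A : Csum (map (fun X => c * f X) A) = c * Csum (map f A).
Proof. induction A; simpl; [|rewrite IHA]; ring. Qed.

Lemma Csum_app A B : Csum (A ++ B) = Csum A + Csum B.
Proof. induction A; simpl; [|rewrite IHA]; ring. Qed.

Lemma Csum_chain_prod (f g : cell -> C) A B :
  Csum (map (fun X => fst X * (f (fst (snd X)) * g (snd (snd X)))) (chain_prod A B))
  = Csum (map (fun X => fst X * f (snd X)) A) * Csum (map (fun X => fst X * g (snd X)) B).
Proof.
  induction A as [|a A IH]; [simpl; ring|].
  change (chain_prod (a :: A) B) with (map (fun Y => (fst a * fst Y, (snd a, snd Y))) B ++ chain_prod A B).
  rewrite map_app, Csum_app, IH, map_map. simpl.
  rewrite Cmult_plus_distr_r, <- (Csum_scal (fst a * f (snd a))). f_equal. f_equal. apply map_ext. intros; ring.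
Qed.

Lemma Csum_chain_opp {T} (f : T -> C) A :
  Csum (map (fun X => fst X * f (snd X)) (chain_opp A)) = - Csum (map (fun X => fst X * f (snd X)) A).
Proof. induction A; simpl; [|rewrite IHA]; ring. Qed.

Lemma chain_prod_In A B c K : In (c, K) (chain_prod A B) -> exists c1 c2, In (c1, fst K) A /\ In (c2, snd K) B.
Proof.
  intros H. apply in_flat_map in H. destruct H as ([c1 K1] & H1 & H). apply in_map_iff in H.
  destruct H as ([c2 K2] & E & H2). injection E as E1 E2. subst K. now exists c1, c2.
Qed.

(** * How small x has to be *)

Section Closeness.
Variables (e : R) (a1 a2 a3 b1 b2 b3 b4 : C).
Hypothesis he : (0 < e < 1 / 3)%R.

Lemma reg_prod_good c K : In (c, K) (reg_prod e a1 a2 a3 b1 b2 b3 b4) -> good 4 e (fst K) /\ sqrel (fst K) /\ good 3 e (snd K).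
Proof.
  intros H. apply chain_prod_In in H. destruct H as (c1 & c2 & H1 & H2).
  apply square_good in H1; auto. apply triangle_good in H2; auto. tauto.
Qed.

Lemma good_neq0 N K i p q : good N e K -> (i < N)%nat -> in01 p -> in01 q -> form K i p q <> 0.
Proof. intros G Hi Hp Hq. apply Cmod_gt_0. assert (X := good_low _ _ _ G i p q Hi Hp Hq). lra. Qed.

Lemma cube_lower K1 K2 i j k p q r s : good 4 e K1 -> good 3 e K2 -> (i < 4)%nat -> (j < 4)%nat -> (k < 3)%nat ->
  in01 p -> in01 q -> in01 r -> in01 s -> (e * e * e <= Cmod (form K1 i p q * form K1 j p q * form K2 k r s))%R.
Proof.
  intros G1 G2 Hi Hj Hk Hp Hq Hr Hs. rewrite !Cmod_mult.
  assert (X1 := good_low _ _ _ G1 i p q Hi Hp Hq). assert (X2 := good_low _ _ _ G1 j p q Hj Hp Hq).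
  assert (X3 := good_low _ _ _ G2 k r s Hk Hr Hs).
  apply Rmult_le_compat; try lra. nra. apply Rmult_le_compat; lra.
Qed.

(** If one of the two expressions vanishes, then y2 or y1 equals a product of three forms, each of
    modulus at least e. *)
Lemma close_near x1 x2 : (Cmod x1 < e * e * e)%R -> (Cmod x2 < e * e * e)%R ->
  close_to_0 (reg_prod e a1 a2 a3 b1 b2 b3 b4) x1 x2.
Proof.
  intros H1 H2 y1 y2 Hy1 L1 L2 c K HK p q r s Hp Hq Hr Hs u1.
  destruct (reg_prod_good c K HK) as (G1 & R1 & G2). destruct K as [K1 K2]. simpl in G1, R1, G2.
  unfold u1, Qpoly, s1, s2, s3, s4, fst, snd.
  destruct (R1 p q) as [R2 R3].
  assert (N0 := good_neq0 _ _ 0 p q G1 ltac:(lia) Hp Hq). assert (M0 := good_neq0 _ _ 0 r s G2 ltac:(lia) Hr Hs).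
  split; intros E.
  - assert (E2 : form K1 2 p q * form K1 1 p q * form K2 1 r s = y2).
    { rewrite R2. apply Ceq_minus.
      match type of E with ?Q = _ => replace (RtoC 0) with (Q * (form K1 0 p q / y1)) by (rewrite E; ring) end.
      field. auto. }
    assert (B := cube_lower K1 K2 2 1 1 p q r s G1 G2 ltac:(lia) ltac:(lia) ltac:(lia) Hp Hq Hr Hs).
    rewrite E2 in B. lra.
  - assert (E2 : form K1 3 p q * form K1 0 p q * form K2 0 r s = y1).
    { rewrite R3. apply Ceq_minus.
      replace (RtoC 0) with ((1 - y1 / (form K1 0 p q * form K2 0 r s) - form K1 1 p q) * (form K1 0 p q * form K2 0 r s)) by (rewrite E; ring).
      field. auto. }
    assert (B := cube_lower K1 K2 3 0 0 p q r s G1 G2 ltac:(lia) ltac:(lia) ltac:(lia) Hp Hq Hr Hs).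
    rewrite E2 in B. lra.
Qed.

(** Otherwise the product (1-s3) s1 s2 would itself be an admissible y1, and 1 - t1 - t3 vanishes
    for it. *)
Lemma close_small1 x1 x2 c K1 K2 p q r s : close_to_0 (reg_prod e a1 a2 a3 b1 b2 b3 b4) x1 x2 ->
  In (c, (K1, K2)) (reg_prod e a1 a2 a3 b1 b2 b3 b4) -> in01 p -> in01 q -> in01 r -> in01 s ->
  (Cmod x1 < Cmod (form K1 3 p q * form K1 0 p q * form K2 0 r s))%R.
Proof.
  intros Hc HK Hp Hq Hr Hs.
  destruct (reg_prod_good c (K1, K2) HK) as (G1 & R1 & G2). simpl in G1, R1, G2.
  destruct (R1 p q) as [R2 R3].
  assert (N0 := good_neq0 _ _ 0 p q G1 ltac:(lia) Hp Hq). assert (M0 := good_neq0 _ _ 0 r s G2 ltac:(lia) Hr Hs).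
  assert (N3 := good_neq0 _ _ 3 p q G1 ltac:(lia) Hp Hq).
  apply Rnot_le_lt. intros L.
  destruct (Hc (form K1 3 p q * form K1 0 p q * form K2 0 r s) 0 ltac:(repeat apply Cmult_neq_0; auto) L
     ltac:(rewrite Cmod_0; apply Cmod_ge_0) c (K1, K2) HK p q r s Hp Hq Hr Hs) as [_ X].
  apply X. unfold s1, s2, s3, fst, snd. rewrite R3. field. auto.
Qed.

(** Otherwise y2 = (1-s1) s3 s4 would be admissible together with y1 = x1, and Q vanishes there. *)
Lemma close_small2 (x1 x2 c : C) K1 K2 p q r s : x1 <> 0 -> close_to_0 (reg_prod e a1 a2 a3 b1 b2 b3 b4) x1 x2 ->
  In (c, (K1, K2)) (reg_prod e a1 a2 a3 b1 b2 b3 b4) -> in01 p -> in01 q -> in01 r -> in01 s ->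
  (Cmod x2 < Cmod (form K1 2 p q * form K1 1 p q * form K2 1 r s))%R.
Proof.
  intros Hx Hc HK Hp Hq Hr Hs.
  destruct (reg_prod_good c (K1, K2) HK) as (G1 & R1 & G2). simpl in G1, R1, G2.
  destruct (R1 p q) as [R2 R3].
  assert (N0 := good_neq0 _ _ 0 p q G1 ltac:(lia) Hp Hq). assert (M0 := good_neq0 _ _ 0 r s G2 ltac:(lia) Hr Hs).
  apply Rnot_le_lt. intros L.
  destruct (Hc x1 (form K1 2 p q * form K1 1 p q * form K2 1 r s) Hx (Rle_refl _) L c (K1, K2) HK p q r s Hp Hq Hr Hs) as [X _].
  apply X. unfold Qpoly, s1, s2, s3, s4, fst, snd. rewrite R2. field. auto.
Qed.
End Closeness.

Theorem corollary3p2 (a1 a2 a3 b1 b2 b3 b4 : C)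
  (hb1 : not_int b1) (hb3 : not_int b3) (hb4 : not_int b4) (ha3 : not_int a3)
  (hb12 : not_int (b1 - b2))
  (hb13 : not_int (b1 + b3 - a1)) (hb24 : not_int (b2 + b4 - a2))
  (hba1 : not_nonpos_int (b1 - a1)) (hba2 : not_nonpos_int (b1 - a2))
  (hba3 : not_nonpos_int (b1 - a3))
  (e : R) (he : (0 < e < 1 / 3)%R) :
  (exists d : R, (0 < d)%R /\
     forall x1 x2 : C, (Cmod x1 < d)%R -> (Cmod x2 < d)%R ->
       close_to_0 (reg_prod e a1 a2 a3 b1 b2 b3 b4) x1 x2)
  /\
  (forall x1 x2 lx : C, Cexp lx = x1 ->
     close_to_0 (reg_prod e a1 a2 a3 b1 b2 b3 b4) x1 x2 ->
     F10 a1 a2 a3 b1 b2 b3 b4 lx x1 x2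
     = C10 a1 a2 a3 b1 b2 b3 b4
       * int_u_dt a1 a2 a3 b1 b2 b3 b4 (Delta10 e a1 a2 a3 b1 b2 b3 b4 lx x1 x2)).
Proof.
  split.
  { exists (e * e * e)%R. split. repeat apply Rmult_lt_0_compat; lra. intros x1 x2 H1 H2. now apply close_near. }
  intros x1 x2 lx Hlx Hc.
  set (g := b1 + b3 - a1 - 2). set (h := b2 + b4 - a2 - 2).
  assert (n0 : not_int (b1 - 2)) by (exact (not_int_minus b1 2 hb1)).
  assert (n1 : not_int (- b3)) by now apply not_int_opp.
  assert (n2 : not_int (- a3)) by now apply not_int_opp.
  assert (n3 : not_int g) by (exact (not_int_minus _ 2 hb13)).
  assert (m0 : not_int (b1 - b2 - 1)) by (exact (not_int_minus _ 1 hb12)).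
  assert (m1 : not_int (- b4)) by now apply not_int_opp.
  assert (m2 : not_int h) by (exact (not_int_minus _ 2 hb24)).
  assert (x1nz : x1 <> 0) by (rewrite <- Hlx; apply Cexp_neq0).
  set (kap := fun n m => - Cexp ((1 - b1) * lx) * (bc (- g) n * Cpow x1 n * (bc a3 m * Cpow x2 m))).
  set (P := reg_prod e a1 a2 a3 b1 b2 b3 b4).
  set (cI := fun K => cube_int (fun p q r s => u_branch a1 a2 a3 b1 b2 b3 b4 (iota_cell lx x1 x2 K) p q r s * jacobian (iota_cell lx x1 x2 K) p q r s)).
  (* The cellwise double series are summed over the chain, where the terms factor into regularized
     integrals. The minus sign is the orientation of [Delta10]; it compensates the one in [kap],
     which comes from the pull-back of dt. *)
  assert (D : dsum (fun n m => kap n m * - (regI e (b1 - 2 - RtoC (INR n)) (- a3 - RtoC (INR m)) * regI e (- b3 - RtoC (INR m)) (g - RtoC (INR n))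
       * tri e (b1 - b2 - 1 - RtoC (INR n)) (- b4 - RtoC (INR m)) h))
     (int_u_dt a1 a2 a3 b1 b2 b3 b4 (Delta10 e a1 a2 a3 b1 b2 b3 b4 lx x1 x2))).
  { replace (int_u_dt a1 a2 a3 b1 b2 b3 b4 (Delta10 e a1 a2 a3 b1 b2 b3 b4 lx x1 x2))
      with (- Csum (map (fun X => fst X * cI (snd X)) P)).
    2:{ rewrite <- Csum_chain_opp. unfold int_u_dt, Delta10, iota_chain. now rewrite map_map. }
    replace (- Csum (map (fun X => fst X * cI (snd X)) P)) with (- (1) * Csum (map (fun X => fst X * cI (snd X)) P)) by ring.
    assert (D1 := dsum_Csum P (fun X n m => fst X * (kap n m * (cell4 (fst (snd X)) (b1 - 2 - RtoC (INR n)) (- b3 - RtoC (INR m)) (- a3 - RtoC (INR m)) (g - RtoC (INR n))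
                     * cell3 (snd (snd X)) (b1 - b2 - 1 - RtoC (INR n)) (- b4 - RtoC (INR m)) h))) (fun X => fst X * cI (snd X))).
    assert (D2 := dsum_scal (- (1)) _ _ (D1 ltac:(idtac;
      intros [c [K1 K2]] HK; destruct (reg_prod_good e a1 a2 a3 b1 b2 b3 b4 he c (K1, K2) HK) as (G1 & R1 & G2);
      exact (dsum_scal c _ _ (cube_cell a1 a2 a3 b1 b2 b3 b4 lx x1 x2 e K1 K2 (proj1 he) Hlx G1 G2 R1
        (not_int_nonpos _ (not_int_opp _ n3)) (not_int_nonpos _ ha3)
        (fun p q r s => close_small1 e a1 a2 a3 b1 b2 b3 b4 he x1 x2 c K1 K2 p q r s Hc HK)
        (fun p q r s => close_small2 e a1 a2 a3 b1 b2 b3 b4 he x1 x2 c K1 K2 p q r s x1nz Hc HK)))))).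
    revert D2. apply dsum_ext. intros n m.
    transitivity (- (1) * (kap n m * Csum (map (fun X => fst X * (cell4 (fst (snd X)) (b1 - 2 - RtoC (INR n)) (- b3 - RtoC (INR m)) (- a3 - RtoC (INR m)) (g - RtoC (INR n))
                     * cell3 (snd (snd X)) (b1 - b2 - 1 - RtoC (INR n)) (- b4 - RtoC (INR m)) h)) P))).
    - f_equal. rewrite <- Csum_scal. f_equal. apply map_ext. intros X. ring.
    - unfold P, reg_prod. rewrite (Csum_chain_prod (fun K => cell4 K _ _ _ _) (fun K => cell3 K _ _ _)).
      rewrite square_sum, triangle_sum; auto; try (now apply per_neq1, not_int_minus_nat); try (now apply per_neq1); try (symmetry; apply per_minus_nat).
      ring. }
  assert (S0 := poch_neq0).
  assert (gB : not_nonpos_int (- g)) by now apply not_int_nonpos, not_int_opp.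
  assert (gA : not_nonpos_int a3) by now apply not_int_nonpos.
  assert (gb1 : not_nonpos_int (2 - b1)).
  { apply not_int_nonpos. replace (2 - b1) with (- (b1 - 2)) by ring. now apply not_int_opp. }
  assert (gb2 : not_nonpos_int (b2 - b1 + 1)).
  { apply not_int_nonpos. replace (b2 - b1 + 1) with (- (b1 - b2 - 1)) by ring. now apply not_int_opp. }
  assert (gb3 : not_nonpos_int b3) by now apply not_int_nonpos.
  assert (gb4 : not_nonpos_int b4) by now apply not_int_nonpos.
  set (T := regI e (b1 - 2) (- a3) * regI e (- b3) g * tri e (b1 - b2 - 1) (- b4) h).
  (* [C10] normalizes the term n = m = 0: the Gamma factors of the three regularized integrals have
     denominators at b1 - a3, b1 - a1 and b1 - a2. *)
  assert (CT : C10 a1 a2 a3 b1 b2 b3 b4 * T = 1).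
  { assert (R1 := regI_Gamma e he (b1 - 2) (- a3) n0 n2).
    assert (R2 := regI_Gamma e he (- b3) g n1 n3).
    assert (R3 := tri_Gamma e he (b1 - b2 - 1) (- b4) h m0 m1 m2).
    replace (b1 - 2 + - a3 + 2) with (b1 - a3) in R1 by ring.
    replace (b1 - 2 + 1) with (b1 - 1) in R1 by ring. replace (- a3 + 1) with (1 - a3) in R1 by ring.
    replace (- b3 + g + 2) with (b1 - a1) in R2 by (unfold g; ring).
    replace (- b3 + 1) with (1 - b3) in R2 by ring. replace (g + 1) with (b1 + b3 - a1 - 1) in R2 by (unfold g; ring).
    replace (b1 - b2 - 1 + - b4 + h + 3) with (b1 - a2) in R3 by (unfold h; ring).
    replace (b1 - b2 - 1 + 1) with (b1 - b2) in R3 by ring. replace (- b4 + 1) with (1 - b4) in R3 by ring.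
    replace (h + 1) with (b2 + b4 - a2 - 1) in R3 by (unfold h; ring).
    specialize (R1 hba3). specialize (R2 hba1). specialize (R3 hba2).
    assert (GN : forall z, not_int z -> CGamma z <> 0) by (intros z Hz; now apply Gauss_converges, not_int_nonpos).
    assert (z1 : CGamma (b1 - 1) <> 0) by (apply GN; exact (not_int_minus _ 1 hb1)).
    assert (z2 : CGamma (1 - a3) <> 0).
    { apply GN. replace (1 - a3) with (- a3 + 1) by ring. now apply not_int_plus1. }
    assert (z3 : CGamma (1 - b3) <> 0).
    { apply GN. replace (1 - b3) with (- b3 + 1) by ring. now apply not_int_plus1. }
    assert (z4 : CGamma (1 - b4) <> 0).
    { apply GN. replace (1 - b4) with (- b4 + 1) by ring. now apply not_int_plus1. }
    assert (z5 : CGamma (b1 - b2) <> 0) by now apply GN.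
    assert (z6 : CGamma (b1 + b3 - a1 - 1) <> 0) by (apply GN; exact (not_int_minus _ 1 hb13)).
    assert (z7 : CGamma (b2 + b4 - a2 - 1) <> 0) by (apply GN; exact (not_int_minus _ 1 hb24)).
    unfold C10, T.
    transitivity ((regI e (b1 - 2) (- a3) * CGamma (b1 - a3)) * (regI e (- b3) g * CGamma (b1 - a1)) * (tri e (b1 - b2 - 1) (- b4) h * CGamma (b1 - a2))
       / (CGamma (b1 + b3 - a1 - 1) * CGamma (b2 + b4 - a2 - 1) * CGamma (1 - a3) * (CGamma (b1 - 1) * CGamma (b1 - b2) * CGamma (1 - b3) * CGamma (1 - b4)))).
    - field. repeat split; assumption.
    - rewrite R1, R2, R3. field. repeat split; assumption. }
  assert (D3 := dsum_scal (C10 a1 a2 a3 b1 b2 b3 b4 / Cexp ((1 - b1) * lx)) _ _ D).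
  assert (E0 := Cexp_neq0 ((1 - b1) * lx)).
  unfold F10, hypF. symmetry.
  transitivity (Cexp ((1 - b1) * lx) * (C10 a1 a2 a3 b1 b2 b3 b4 / Cexp ((1 - b1) * lx) * int_u_dt a1 a2 a3 b1 b2 b3 b4 (Delta10 e a1 a2 a3 b1 b2 b3 b4 lx x1 x2))).
  { field. exact E0. }
  f_equal. symmetry. apply dsum_CSeries. revert D3. apply dsum_ext. intros n m.
  (* Each regularized integral supplies one numerator symbol of length n + m: the s1 interval gives
     a3 - b1 + 1, the s3 interval a1 - b1 + 1, the triangle a2 - b1 + 1. *)
  assert (X1 := regI_shift e he (b1 - 2) (- a3) n m n0 n2).
  assert (X2 := regI_shift e he (- b3) g m n n1 n3).
  assert (X3 := tri_shift e he (b1 - b2 - 1) (- b4) h n m m0 m1 m2).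
  replace (- (b1 - 2)) with (2 - b1) in X1 by ring. replace (- - a3) with a3 in X1 by ring.
  replace (- (b1 - 2 + - a3 + 1)) with (a3 - b1 + 1) in X1 by ring.
  replace (- - b3) with b3 in X2 by ring.
  replace (- (- b3 + g + 1)) with (a1 - b1 + 1) in X2 by (unfold g; ring).
  replace (- (b1 - b2 - 1)) with (b2 - b1 + 1) in X3 by ring. replace (- - b4) with b4 in X3 by ring.
  replace (- (b1 - b2 - 1 + - b4 + h + 2)) with (a2 - b1 + 1) in X3 by (unfold h; ring).
  rewrite (Nat.add_comm m n) in X2.
  rewrite !poch_1. unfold kap, bc.
  assert (P1 := S0 _ n gb1). assert (P2 := S0 _ n gb2). assert (P3 := S0 _ m gb3). assert (P4 := S0 _ m gb4).
  assert (P5 := S0 _ n gB). assert (P6 := S0 _ m gA).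
  assert (Fn := INR_fact_neq0C n). assert (Fm := INR_fact_neq0C m).
  (* The symbols of - g and a3 in the binomial coefficients are exactly those that complete the left
     sides of the shift formulas; only the denominators of the hypergeometric series remain. *)
  transitivity (C10 a1 a2 a3 b1 b2 b3 b4 *
    ((poch (2 - b1) n * poch a3 m * regI e (b1 - 2 - RtoC (INR n)) (- a3 - RtoC (INR m)))
    * (poch b3 m * poch (- g) n * regI e (- b3 - RtoC (INR m)) (g - RtoC (INR n)))
    * (poch (b2 - b1 + 1) n * poch b4 m * tri e (b1 - b2 - 1 - RtoC (INR n)) (- b4 - RtoC (INR m)) h))
    / (poch (2 - b1) n * poch (b2 - b1 + 1) n * RtoC (INR (fact n)) * poch b3 m * poch b4 m * RtoC (INR (fact m)))
    * Cpow x1 n * Cpow x2 m).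
  { field. repeat split; assumption. }
  rewrite X1, X2, X3.
  transitivity (C10 a1 a2 a3 b1 b2 b3 b4 * T * (poch (a1 - b1 + 1) (n + m) * poch (a2 - b1 + 1) (n + m) * poch (a3 - b1 + 1) (n + m))
    / (poch (2 - b1) n * poch (b2 - b1 + 1) n * RtoC (INR (fact n)) * poch b3 m * poch b4 m * RtoC (INR (fact m)))
    * Cpow x1 n * Cpow x2 m).
  { unfold T, Cdiv. ring. }
  rewrite CT. unfold Cdiv. ring.
Qed.
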